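(* Let $k\ge 2$ be an integer. If the unit disk of a normed plane $\mathcal{M}$ is a regular $(2k)$-gon with $k\neq 4,5,7$, then $\mathcal{M}$ satisfies the honeycomb property.
   Context: A normed plane $\mathcal{M}$ is $\mathbb{R}^2$ equipped with the norm whose closed unit disk is an $o$-symmetric convex disk $M$ (compact, convex, with nonempty interior, $M=-M$); it also carries its underlying Euclidean structure, with respect to which the unit disk is a regular polygon centered at $o$. $\mathrm{area}(\cdot)$ is Lebesgue measure. The $M$-perimeter $\mathrm{perim}_M(K)$ of a convex disk $K$ is the supremum of the sums of the $M$-lengths of the sides of the convex polygons inscribed in $K$. $\mathbf{B}^2$ is the Euclidean closed unit disk centered at the origin $o$. A tiling is a countable family of compact sets (cells) with nonempty interiors, whose union is $\mathbb{R}^2$ and such that the interiors of any two distinct cells are disjoint. It is convex if every cell is convex. A convex tiling is normal if there are constants $0<\hat r<\hat R$ such that every cell contains a Euclidean disk of radius $\hat r$ and is contained in a Euclidean disk of radius $\hat R$. A hexagonal tiling is a tiling whose cells are translates of a given centrally symmetric convex hexagon; angles of cells are permitted to be straight angles, so the hexagon may be degenerate (e.g. a parallelogram). For a convex, normal tiling $\mathcal{T}$ let $\mathcal{T}(R)$ be the family of cells contained in $R\mathbf{B}^2$, and let \[ \underline{P}_{1}(\mathcal{T})=\liminf_{R\to\infty}\frac{\sum_{C\in\mathcal{T}(R)}\mathrm{perim}_M(C)}{\mathrm{card}(\mathcal{T}(R))}; \] $\overline{P}_1(\mathcal{T})$ is the same with $\limsup$, and if the two are equal the common value is $P_1(\mathcal{T})$.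 $\mathcal{M}$ satisfies the honeycomb property (i.e. the $1$-honeycomb property) if there is a hexagonal tiling $\mathcal{T}_{hex}$ of $\mathcal{M}$ with unit area cells such that $\underline{P}_{1}(\mathcal{T})\ge P_{1}(\mathcal{T}_{hex})$ for every convex, normal tiling $\mathcal{T}$ of $\mathcal{M}$ with unit area cells. *)

(* Defs.v *)
From mathcomp Require Import all_boot all_order all_algebra.
From mathcomp Require Import all_classical all_reals all_analysis.
From mathcomp Require Import finmap.

Set Implicit Arguments.
Unset Strict Implicit.
Unset Printing Implicit Defensive.

Import Order.TTheory GRing.Theory Num.Theory.
Import numFieldNormedType.Exports.

Local Open Scope classical_set_scope.
Local Open Scope ring_scope.

(* The plane is [R * R]. Its library norm is the sup norm, which serves only
   for the topology; Euclidean disks are therefore written out. *)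

Definition euclidean_disk (R : realType) (c : R * R) (r : R) : set (R * R) :=
  [set x | (x.1 - c.1) ^+ 2 + (x.2 - c.2) ^+ 2 <= r ^+ 2].

Definition area (R : realType) (K : set (R * R)) : \bar R :=
  (@lebesgue_measure R \x @lebesgue_measure R)%E K.

Definition convex_disk (R : realType) (K : set (R * R)) : Prop :=
  [/\ compact K, convex_set K & K° !=set0].

Definition o_symmetric (R : realType) (K : set (R * R)) : Prop :=
  forall x, K x -> K (- x).

(* The norm whose closed unit disk is the o-symmetric convex disk [M]. *)
Definition M_norm (R : realType) (M : set (R * R)) (x : R * R) : R :=
  inf [set l : R | 0 <= l /\ exists2 y, M y & x = l *: y].

Definition convex_hull (R : realType) (n : nat) (v : 'I_n -> R * R) :
    set (R * R) :=
  [set x | exists w : 'I_n -> R,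
     [/\ forall i, 0 <= w i, \sum_i w i = 1 & x = \sum_i w i *: v i]].

(* Twice the signed area of the triangle [a b c]. *)
Definition orient (R : realType) (a b c : R * R) : R :=
  (b.1 - a.1) * (c.2 - a.2) - (b.2 - a.2) * (c.1 - a.1).

(* [v] lists distinct vertices of a nondegenerate convex polygon in
   counterclockwise order. Straight angles are permitted, so the extreme points
   of [convex_hull v] may form a proper subset of the vertices. *)
Definition convex_polygon (R : realType) (n : nat) (v : 'I_n -> R * R) : Prop :=
  [/\ injective v,
      forall i j l : 'I_n, (i < j)%N -> (j < l)%N ->
        0 <= orient (v i) (v j) (v l)
    & exists i j l : 'I_n, orient (v i) (v j) (v l) != 0].

Definition boundary (R : realType) (K : set (R * R)) : set (R * R) :=
  closure K `\` K°.

(* [ordS i] is the cyclic successor of [i]. *)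
Definition M_length (R : realType) (M : set (R * R)) (n : nat)
    (v : 'I_n -> R * R) : R :=
  \sum_(i < n) M_norm M (v (ordS i) - v i).

Definition perim (R : realType) (M K : set (R * R)) : \bar R :=
  ereal_sup [set s | exists (n : nat) (v : 'I_n -> R * R),
    [/\ convex_polygon v, forall i, boundary K (v i)
      & s = (M_length M v)%:E]].

Definition regular_polygon (R : realType) (m : nat) (K : set (R * R)) : Prop :=
  exists r theta : R, 0 < r /\
    K = convex_hull (fun j : 'I_m =>
          (r * cos (theta + 2 * pi * j%:R / m%:R),
           r * sin (theta + 2 * pi * j%:R / m%:R))).

(* Cells have nonempty, pairwise disjoint interiors, so no two members of a
   family can be equal and a tiling is just a set of cells. *)
Definition tiling (R : realType) (T : set (set (R * R))) : Prop :=
  [/\ countable T,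
      forall C, T C -> compact C /\ C° !=set0,
      \bigcup_(C in T) C = setT
    & trivIset T (fun C => C°)].

Definition convex_tiling (R : realType) (T : set (set (R * R))) : Prop :=
  tiling T /\ forall C, T C -> convex_set C.

Definition normal_tiling (R : realType) (T : set (set (R * R))) : Prop :=
  exists r1 r2 : R, [/\ 0 < r1, r1 < r2
    & forall C, T C ->
        (exists c, euclidean_disk c r1 `<=` C) /\
        (exists c, C `<=` euclidean_disk c r2)].

Definition unit_area_cells (R : realType) (T : set (set (R * R))) : Prop :=
  forall C, T C -> area C = 1%E.

Definition centrally_symmetric (R : realType) (K : set (R * R)) : Prop :=
  exists c : R * R, forall x, K x -> K (c + c - x).

Definition hexagonal_tiling (R : realType) (T : set (set (R * R))) : Prop :=
  tiling T /\
  exists v : 'I_6 -> R * R,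
    [/\ convex_polygon v, centrally_symmetric (convex_hull v)
      & forall C, T C -> exists t, C = [set t + x | x in convex_hull v]].

Definition cells_in (R : realType) (T : set (set (R * R))) (r : R) :
    set (set (R * R)) :=
  [set C | T C /\ C `<=` euclidean_disk 0 r].

(* For a normal tiling [cells_in T r] is finite, and it is nonempty for all
   large [r]; only then are the finite sum and [fset_set] meaningful. *)
Definition mean_perim (R : realType) (M : set (R * R))
    (T : set (set (R * R))) (r : R) : \bar R :=
  ((\sum_(C \in cells_in T r) perim M C) /
     (#|` fset_set (cells_in T r)|%fset%:R)%:E)%E.

Definition lower_P1 (R : realType) (M : set (R * R))
    (T : set (set (R * R))) : \bar R :=
  limf_einf (mean_perim M T) (pinfty_nbhs R).

Definition upper_P1 (R : realType) (M : set (R * R))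
    (T : set (set (R * R))) : \bar R :=
  limf_esup (mean_perim M T) (pinfty_nbhs R).

Definition is_P1 (R : realType) (M : set (R * R))
    (T : set (set (R * R))) (p : \bar R) : Prop :=
  lower_P1 M T = p /\ upper_P1 M T = p.

Definition honeycomb_property (R : realType) (M : set (R * R)) : Prop :=
  exists (Thex : set (set (R * R))) (p : \bar R),
    [/\ hexagonal_tiling Thex, unit_area_cells Thex, is_P1 M Thex p
      & forall T : set (set (R * R)), convex_tiling T -> normal_tiling T ->
          unit_area_cells T -> (p <= lower_P1 M T)%E].

(* Main.v *)
(** Minkowski's inequality, applied to a cell and to its edge normals weighted by
    the norm, bounds the squared M-perimeter of a polygonal cell of unit area from
    below by an area sum over the gaps between consecutive edge directions. Among
    all polygons with [n] edges this sum is least, up to an error controlled by a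
    tangent line in [n], for a hexagon circumscribed about a regular [2k]-gon: in
    the gap between two edge directions it is bounded by a chord of [tan], unless
    a gap is so unbalanced that the inscribed circle alone gives enough. Hence
    every cell with [n] extreme points has M-perimeter at least
    [2 / r * (c6 + sl * (n - 6))] with [sl <= 0], and a Morse-theoretic form of
    Euler's formula, counting extreme points by the cells on which a generic linear
    function is extremal there, shows that [n] is at most [6 + o(1)] on average.

    Equality is attained by a centrally symmetric hexagon whose three edges [a],
    [b], [c] point towards vertices of M. It tiles by the lattice spanned by
    [a + b] and [b + c], and its perimeter is bounded above by comparing the norm
    with a multiple of [x |-> |a * x| + |b * x| + |c * x|] ([*] the cross product),
    whose total variation along a convex polygon is twice the sum of the widths. *)

(* The 2k-gon of the kite estimates is [r] times the polar of M, which has inradius 1; its support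
   function in a direction is [r] times the M-norm of the unit vector there. By Minkowski's
   inequality the M-perimeter of a cell of unit area is at least [2 / r] times the square root of
   the area of the polygon circumscribed about this 2k-gon, or about its incircle, with the normals
   given by the edge directions of the cell. Let c_n be the square root of the area of the n-gon
   whose sides are flush with sides of the 2k-gon and as equally spaced as possible. Averaging over
   cells needs a line through (6, c_6) that lies below these values. For k = 4, 5, 7 there is none,
   because c_5 + c_7 falls slightly short of 2 c_6. For the other k > 2 the circle settles most n.
   Hexagons have to be compared with the 2k-gon itself unless 3 divides k, and for k = 8 pentagons
   as well, since there the margin is too small for the circle. The square, k = 2, is treated
   through the widths of a cell instead. *)
Require Import Defs.
From mathcomp Require Import all_boot all_order all_algebra.
From mathcomp Require Import all_classical all_reals all_analysis.
From mathcomp Require Import finmap measurable_realfun ring lra zify.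

Set Implicit Arguments.
Unset Strict Implicit.
Unset Printing Implicit Defensive.

Import Order.TTheory GRing.Theory Num.Theory.
Import numFieldNormedType.Exports.

Local Open Scope convex_scope.
Local Open Scope classical_set_scope.
Local Open Scope ring_scope.

(** * Minkowski's inequality for convex polygons *)

(* Area of the quadrilateral cut out of a sector of angle [d] by the two lines
   orthogonal to its sides at distances [h] and [h'] from its apex. *)
Definition kite {R : realType} (h h' d : R) : R :=
  (2 * h * h' - (h ^+ 2 + h' ^+ 2) * cos d) / (2 * sin d).

(** The middle line, at distance [hm], cuts a triangle off the corner of the large kite. Its area is
    quadratic in the distance from the corner to that line, and the squared expression is this
    distance times [sin (A + B)]. *)
Lemma kite_split (R : realType) (ha hb hm A B : R) :
  sin A != 0 -> sin B != 0 -> sin (A + B) != 0 ->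
  kite ha hb (A + B) - kite ha hm A - kite hm hb B =
  (sin B * ha + sin A * hb - sin (A + B) * hm) ^+ 2 /
    (2 * (sin A * sin B * sin (A + B))).
Proof.
move=> a0 c0 S0.
have E1 : cos A * sin (A + B) - sin A * cos (A + B) = sin B.
  rewrite -[in RHS](addrK A B) [B + A]addrC sinB; ring.
have E2 : cos B * sin (A + B) - sin B * cos (A + B) = sin A.
  rewrite -[in RHS](addrK B A) sinB; ring.
have E3 : sin B * cos A + sin A * cos B = sin (A + B) by rewrite sinD; ring.
rewrite /kite; move: (sin A) (sin B) (cos A) (cos B) (sin (A + B))
  (cos (A + B)) a0 c0 S0 E1 E2 E3 => a c b d S C a0 c0 S0 E1 E2 E3.
have -> : (c * ha + a * hb - S * hm) ^+ 2 =
   c * ha ^+ 2 * (b * S - a * C) + a * hb ^+ 2 * (d * S - c * C)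
   + S * hm ^+ 2 * (c * b + a * d)
   + 2 * (a * c * ha * hb - S * c * ha * hm - S * a * hb * hm).
  by rewrite E1 E2 E3; ring.
by field; rewrite a0 c0 S0.
Qed.

Lemma mulr_sqr_le (R : realFieldType) (a b c d x y : R) :
  0 <= a -> 0 <= b -> 0 <= c -> 0 <= d ->
  x ^+ 2 <= a * b -> y ^+ 2 <= c * d -> (x + y) ^+ 2 <= (a + c) * (b + d).
Proof.
move=> a0 b0 c0 d0 hx hy.
have h : (2 * (x * y)) ^+ 2 <= (a * d + b * c) ^+ 2.
  have : x ^+ 2 * y ^+ 2 <= (a * b) * (c * d) by rewrite ler_pM ?sqr_ge0.
  have : 0 <= (a * d - b * c) ^+ 2 by rewrite sqr_ge0.
  nra.
have : 2 * (x * y) <= a * d + b * c.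
  rewrite leNgt; apply/negP => lt.
  have h0 : 0 <= a * d + b * c by rewrite addr_ge0 ?mulr_ge0.
  have : (a * d + b * c) ^+ 2 < (2 * (x * y)) ^+ 2.
    by rewrite ltr_pXn2r // nnegrE (le_trans h0 (ltW lt)).
  by rewrite ltNge h.
nra.
Qed.

(* Reversed Cauchy-Schwarz for the Lorentzian form [(A, F, V) |-> V^2 - A F]. *)
Lemma lorentz_sub (R : realFieldType) (A F V a f v : R) :
  0 <= a -> 0 <= f -> v ^+ 2 <= a * f -> A * F <= V ^+ 2 ->
  0 < A - a -> (A - a) * (F - f) <= (V - v) ^+ 2.
Proof.
move=> a0 f0 hv hV Aa.
have [Ff|Ff] := leP (F - f) 0.
  by apply: le_trans (sqr_ge0 _); rewrite pmulr_rle0.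
rewrite leNgt; apply/negP => lt.
have := @mulr_sqr_le _ (A - a) (F - f) a f (V - v) v (ltW Aa) (ltW Ff) a0 f0
  (ltW lt) hv.
rewrite !subrK => h.
suff : V ^+ 2 < A * F by rewrite ltNge hV.
(* equality is excluded because the first bound is strict *)
have [e e0 he] : exists2 e, 0 < e & (V - v) ^+ 2 <= (A - a) * (F - f - e).
  exists (((A - a) * (F - f) - (V - v) ^+ 2) / (A - a)).
      by rewrite divr_gt0 // subr_gt0.
  by rewrite mulrBr [(A - a) * (_ / _)]mulrC divfK ?gt_eqF //; lra.
have Fe : 0 <= F - f - e.
  by rewrite -(pmulr_rge0 _ Aa); apply: le_trans he; rewrite sqr_ge0.
have := @mulr_sqr_le _ (A - a) (F - f - e) a f (V - v) v (ltW Aa) Fe a0 f0 he hv.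
rewrite !subrK => h'; apply: (le_lt_trans h').
have A0 : 0 < A by lra.
by rewrite ltr_pM2l //; lra.
Qed.

Section Wedge.
Variables (R : realType) (X Y th l h : nat -> R).
Hypothesis XE : forall i, X i.+1 = X i + l i * cos (th i).
Hypothesis YE : forall i, Y i.+1 = Y i + l i * sin (th i).

Let S2 a b := \sum_(a <= i < b) (X i * Y i.+1 - Y i * X i.+1)
              - (X a * Y b - Y a * X b).

Let G i j := kite (h i) (h j) (th j - th i).

(** The inner edges are removed one at a time by prolonging their neighbours. Each removal adds a
    square to the area gained by the polygon, a square to the area gained by the polygon with
    support numbers [h], and the product of the roots, up to a constant, to the mixed term; the
    Cauchy-Schwarz step [mulr_sqr_le] adds the removals up. *)
Lemma wedge_polygon m a :
  (forall i, (a <= i < a + m.+1)%N -> th i < th i.+1) ->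
  th (a + m.+1)%N < th a + pi ->
  exists x y, [/\ X (a + m.+1)%N - X a.+1 = x * cos (th a) + y * cos (th (a + m.+1)%N),
   Y (a + m.+1)%N - Y a.+1 = x * sin (th a) + y * sin (th (a + m.+1)%N) &
   [/\ 0 <= x * y * sin (th (a + m.+1)%N - th a) - S2 a.+1 (a + m.+1),
       0 <= G a (a + m.+1)%N - \sum_(a <= i < a + m.+1) G i i.+1 &
   (x * h a + y * h (a + m.+1)%N - \sum_(a.+1 <= i < a + m.+1) l i * h i) ^+ 2
    <= 2 * ((x * y * sin (th (a + m.+1)%N - th a) - S2 a.+1 (a + m.+1))
      * (G a (a + m.+1)%N - \sum_(a <= i < a + m.+1) G i i.+1))]].
Proof.
elim: m a => [|m IH] a inc lt.
  have S0 : S2 a.+1 a.+1 = 0 by rewrite /S2 big_geq // [Y _ * _]mulrC !subrr.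
  exists 0, 0; rewrite addn1 !subrr S0 big_nat1 big_geq // subrr !mul0r addr0.
  by rewrite !subrr expr0n !mulr0.
have ab : (a + m.+2 = a.+1 + m.+1)%N by lia.
have ab1 : (a.+1 < a.+1 + m.+1)%N by rewrite addnS ltnS leq_addr.
rewrite ab in lt *; set b := (a.+1 + m.+1)%N in lt ab1 *.
have inc' i : (a.+1 <= i < b)%N -> th i < th i.+1.
  by move=> hi; apply: inc; move: hi; rewrite /b; lia.
have thab : th a < th a.+1 by apply: inc; lia.
have thbb : th a.+1 < th b.
  rewrite /b; have : forall j, th a.+1 < th (a.+1 + j.+1)%N \/ (m < j)%N.
    elim=> [|j [jl|jl]]; [left; rewrite addn1; apply: inc; lia| |right; lia].
    have [mj|mj] := ltnP m j.+1; first by right.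
    left; apply: (lt_trans jl); rewrite [(a.+1 + j.+2)%N]addnS.
    by apply: inc; lia.
  by move/(_ m) => [//|]; rewrite ltnn.
have [|x' [y' [EX EY [Q0 T0 CS]]]] := IH a.+1 inc'.
  by rewrite -/b (lt_trans lt) // ltrD2r.
rewrite -/b in EX EY Q0 T0 CS.
set A := th a.+1 - th a; set B := th b - th a.+1.
have AB : th b - th a = A + B by rewrite /A /B; ring.
have sA : 0 < sin A by apply: sin_gt0_pi; rewrite /A; apply/andP; split; lra.
have sB : 0 < sin B by apply: sin_gt0_pi; rewrite /B; apply/andP; split; lra.
have sAB : 0 < sin (A + B).
  by apply: sin_gt0_pi; rewrite -AB; apply/andP; split; lra.
(* Once the edges between [a.+1] and [b] are gone, edge [a.+1] has length [z]. It is the one removed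
   now, by resolving it along the directions [th a] and [th b]. *)
set z := l a.+1 + x'.
exists (z * (sin B / sin (A + B))), (y' + z * (sin A / sin (A + B))).
have UX : sin (A + B) * cos (th a.+1) = sin B * cos (th a) + sin A * cos (th b).
  rewrite -AB /A /B !sinB.
  ring.
have UY : sin (A + B) * sin (th a.+1) = sin B * sin (th a) + sin A * sin (th b).
  by rewrite -AB /A /B !sinB; ring.
have UX' : cos (th a.+1) = sin B / sin (A + B) * cos (th a) + sin A / sin (A + B) * cos (th b).
  by rewrite -[LHS](mulKf (lt0r_neq0 sAB)) UX; field; rewrite gt_eqF.
have UY' : sin (th a.+1) = sin B / sin (A + B) * sin (th a) + sin A / sin (A + B) * sin (th b).
  by rewrite -[LHS](mulKf (lt0r_neq0 sAB)) UY; field; rewrite gt_eqF.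
rewrite AB.
have EX1 : X b - X a.+1 = z * cos (th a.+1) + y' * cos (th b).
  move: EX; rewrite XE /z => EX.
  by rewrite mulrDl -addrA -EX; ring.
have EY1 : Y b - Y a.+1 = z * sin (th a.+1) + y' * sin (th b).
  move: EY; rewrite YE /z => EX'.
  by rewrite mulrDl -addrA -EX'; ring.
have SS : S2 a.+1 b = S2 a.+2 b + l a.+1 * y' * sin B.
  rewrite /S2 big_ltn //.
  rewrite (XE a.+1) (YE a.+1).
  have -> : X b = X a.+1 + z * cos (th a.+1) + y' * cos (th b) by rewrite -addrA -EX1; ring.
  have -> : Y b = Y a.+1 + z * sin (th a.+1) + y' * sin (th b) by rewrite -addrA -EY1; ring.
  by rewrite /B sinB; ring.
have QE : z * (sin B / sin (A + B)) * (y' + z * (sin A / sin (A + B))) * sin (A + B) -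
       S2 a.+1 b = (x' * y' * sin B - S2 a.+2 b) + z ^+ 2 * (sin A * sin B / sin (A + B)).
  by rewrite SS /z; field; rewrite gt_eqF.
have TE : G a b - \sum_(a <= i < b) G i i.+1 = (G a.+1 b - \sum_(a.+1 <= i < b) G i i.+1)
   + (sin B * h a + sin A * h b - sin (A + B) * h a.+1) ^+ 2 / (2 * (sin A * sin B * sin (A + B))).
  rewrite -kite_split ?gt_eqF // big_ltn ?(ltnW ab1) //.
  by rewrite /G AB -/A -/B; ring.
have VE : z * (sin B / sin (A + B)) * h a + (y' + z * (sin A / sin (A + B))) * h b
   - \sum_(a.+1 <= i < b) l i * h i = 
   (x' * h a.+1 + y' * h b - \sum_(a.+2 <= i < b) l i * h i) +
   z * ((sin B * h a + sin A * h b - sin (A + B) * h a.+1) / sin (A + B)).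
  rewrite big_ltn //.
  by rewrite /z; field; rewrite gt_eqF.
split.
- rewrite EX1 [X in z * X]UX'; ring.
- rewrite EY1 [X in z * X]UY'; ring.
have q0 : 0 <= z ^+ 2 * (sin A * sin B / sin (A + B)).
  by rewrite mulr_ge0 ?sqr_ge0 // divr_ge0 ?mulr_ge0 ?ltW.
have t0 : 0 <= (sin B * h a + sin A * h b - sin (A + B) * h a.+1) ^+ 2 / (2 * (sin A * sin B * sin (A + B))).
  by rewrite divr_ge0 ?sqr_ge0 // ltW // !mulr_gt0.
split.
- by rewrite QE addr_ge0.
- by rewrite TE addr_ge0.
rewrite QE VE TE.
rewrite [leRHS]mulrCA [2 * (_ + _)]mulrDr; apply: mulr_sqr_le => //.
- by rewrite mulr_ge0.
- by rewrite mulr_ge0.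
- by rewrite mulrCA.
- rewrite le_eqVlt; apply/orP; left; apply/eqP.
  by field; rewrite !gt_eqF.
Qed.

Lemma wedge_between a b : (a < b)%N ->
  (forall i, (a <= i < b)%N -> th i < th i.+1) -> th b < th a + pi ->
  exists x y q t, [/\ 0 <= q, 0 <= t,
    X b = X a.+1 + x * cos (th a) + y * cos (th b),
    Y b = Y a.+1 + x * sin (th a) + y * sin (th b) &
    [/\ \sum_(a.+1 <= i < b) (X i * Y i.+1 - Y i * X i.+1) =
         X a.+1 * Y b - Y a.+1 * X b + x * y * sin (th b - th a) - q,
       \sum_(a <= i < b) kite (h i) (h i.+1) (th i.+1 - th i) =
         kite (h a) (h b) (th b - th a) - t &
       (x * h a + y * h b - \sum_(a.+1 <= i < b) l i * h i) ^+ 2 <= 2 * (q * t)]].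
Proof.
move=> ab; have -> : b = (a + (b - a.+1).+1)%N by lia.
move: (b - a.+1)%N => m inc lt.
have [x [y [EX EY [Q0 T0 CS]]]] := wedge_polygon inc lt.
exists x, y, (x * y * sin (th (a + m.+1)%N - th a) - S2 a.+1 (a + m.+1)),
  (G a (a + m.+1)%N - \sum_(a <= i < a + m.+1) G i i.+1).
split=> //; [by rewrite -addrA -EX; ring|by rewrite -addrA -EY; ring|].
by split=> //; rewrite /S2 /G; ring.
Qed.

End Wedge.

Lemma kiteC (R : realType) (h h' d : R) : kite h h' d = kite h' h d.
Proof. by rewrite /kite [X in X * cos d]addrC -!mulrA [h * h']mulrC. Qed.

Lemma sin2piB (R : realType) (x : R) : sin (2 * pi - x) = - sin x.
Proof.
have -> : 2 * pi - x = - x + pi *+ 2 by rewrite -mulr_natl; ring.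
by rewrite sinD2pi sinN.
Qed.

Lemma cos2piB (R : realType) (x : R) : cos (2 * pi - x) = cos x.
Proof.
have -> : 2 * pi - x = - x + pi *+ 2 by rewrite -mulr_natl; ring.
by rewrite cosD2pi cosN.
Qed.

Lemma kite_2piB (R : realType) (h h' d : R) : kite h h' (2 * pi - d) = - kite h h' d.
Proof. by rewrite /kite sin2piB cos2piB mulrN invrN mulrN. Qed.

Section Closed.
Variables (R : realType) (X Y th l h : nat -> R) (n p : nat).
Hypothesis XE : forall i, X i.+1 = X i + l i * cos (th i).
Hypothesis YE : forall i, Y i.+1 = Y i + l i * sin (th i).
Hypothesis p1 : (0 < p)%N.
Hypothesis pn : (p.+1 < n)%N.
Hypothesis thE : forall i, (i < n)%N -> th i < th i.+1 < th i + pi.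
Hypothesis thn : th n = th 0%N + 2 * pi.
Hypothesis hn : h n = h 0%N.
Hypothesis Xn : X n = X 0%N.
Hypothesis Yn : Y n = Y 0%N.
Hypothesis thp : th p < th 0%N + pi.
Hypothesis thq : th 0%N + pi <= th p.+1.

Let A2 := \sum_(0 <= i < n) (X i * Y i.+1 - Y i * X i.+1).
Let F := \sum_(0 <= i < n) kite (h i) (h i.+1) (th i.+1 - th i).
Let V := \sum_(0 <= i < n) l i * h i.

Let th_lt i j : (i < j)%N -> (j <= n)%N -> th i < th j.
Proof.
elim: j => [//|j IH]; rewrite ltnS leq_eqVlt => /orP[/eqP->|ij] jn.
  by have /andP[] := thE jn.
by apply: lt_trans (IH ij (ltnW jn)) _; have /andP[] := thE jn.
Qed.

Let pn' : (p < n)%N := ltnW pn.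

Let big_split2 (f : nat -> R) : \sum_(0 <= i < n) f i =
  \sum_(0 <= i < p) f i + f p + \sum_(p.+1 <= i < n) f i.
Proof.
by rewrite (big_cat_nat _ (n := p)) ?(ltnW pn') //= (big_ltn (m := p)) // addrA.
Qed.

Let big_split3 (f : nat -> R) : \sum_(0 <= i < n) f i =
  f 0%N + \sum_(1 <= i < p) f i + f p + f p.+1 + \sum_(p.+2 <= i < n) f i.
Proof.
rewrite big_ltn ?(leq_trans _ pn) // (big_cat_nat _ (n := p)) //=; last first.
  exact: ltnW (ltnW pn).
rewrite (big_ltn (m := p)) ?(ltnW pn) // (big_ltn (m := p.+1)) //.
by rewrite !addrA.
Qed.

(** All gaps between the directions [0], [p], [p.+1] are below a half turn, so removing the other
    edges leaves a triangle. Triangles with the same normals are homothetic, hence Minkowski's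
    inequality is an equality for them, and [lorentz_sub] carries it back to the given polygon. *)
Lemma closed_polygon_triangle :
  th 0%N + pi < th p.+1 -> 0 < A2 -> 2 * A2 * F <= V ^+ 2.
Proof.
move=> thq' A20.
have incr i : (i < n)%N -> th i < th i.+1 by move=> /thE/andP[].
have [|x1 [y1 [q1 [t1 [q10 t10 EX1 EY1 [S1 T1 C1]]]]]] :=
    wedge_between h XE YE p1 _ thp.
  by move=> i /andP[_ ip]; apply: incr; apply: (ltn_trans ip).
have [||x2 [y2 [q2 [t2 [q20 t20 EX2 EY2 [S2 T2 C2]]]]]] :=
    wedge_between h XE YE pn.
- by move=> i /andP[_ ip]; apply: incr.
- by rewrite thn; lra.
have c2 : cos (th n) = cos (th 0%N).
  by rewrite thn [2 * pi]mulr_natl cosD2pi.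
have s2 : sin (th n) = sin (th 0%N).
  by rewrite thn [2 * pi]mulr_natl sinD2pi.
set A := th p - th 0%N; set B := th p.+1 - th p.
have CE : th n - th p.+1 = 2 * pi - (A + B) by rewrite thn /A /B; ring.
rewrite CE sin2piB c2 s2 hn in EX2 EY2 S2 T2 C2.
rewrite Xn in EX2 S2; rewrite Yn in EY2 S2.
have AE : A + B = th p.+1 - th 0%N by rewrite /A /B; ring.
have sA : 0 < sin A.
  apply: sin_gt0_pi; rewrite /A subr_gt0 th_lt ?(ltnW pn') //=.
  by rewrite ltrBlDl.
have sB : 0 < sin B.
  apply: sin_gt0_pi; rewrite /B subr_gt0; have /andP[-> /=] : th p < th p.+1 < th p + pi by apply: thE.
  by rewrite ltrBlDl.
have sC : sin (A + B) < 0.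
  have -> : A + B = 2 * pi - (2 * pi - (A + B)) by ring.
  rewrite sin2piB oppr_lt0; apply: sin_gt0_pi; rewrite -CE subr_gt0 th_lt //=.
  by rewrite thn; lra.
set L0 := l 0%N + x1 + y2; set Lp := l p + y1; set Lq := l p.+1 + x2.
have sAE : sin A = sin (th p) * cos (th 0%N) - cos (th p) * sin (th 0%N) by rewrite /A sinB.
have sBE : sin B = sin (th p.+1) * cos (th p) - cos (th p.+1) * sin (th p) by rewrite /B sinB.
have sCE : sin (A + B) = sin (th p.+1) * cos (th 0%N) - cos (th p.+1) * sin (th 0%N).
  by rewrite AE sinB.
have hx : L0 * cos (th 0%N) + Lp * cos (th p) + Lq * cos (th p.+1) = 0.
  by move: EX2; rewrite (XE p.+1) (XE p) EX1 (XE 0) /L0 /Lp /Lq; lra.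
have hy : L0 * sin (th 0%N) + Lp * sin (th p) + Lq * sin (th p.+1) = 0.
  by move: EY2; rewrite (YE p.+1) (YE p) EY1 (YE 0) /L0 /Lp /Lq; lra.
(* Projecting the closing relation orthogonally to each side gives the law of sines for the
   remaining triangle. *)
have closed t : L0 * sin (t - th 0%N) + Lp * sin (t - th p) + Lq * sin (t - th p.+1) = 0.
  have -> : 0 = sin t * 0 - cos t * 0 :> R by ring.
  by rewrite -{1}hx -hy !sinB; ring.
have E1 : Lp * sin A = - (Lq * sin (A + B)).
  by have := closed (th 0%N); rewrite subrr sin0 -opprB -[th 0%N - th p.+1]opprB
    !sinN -/A -AE; lra.
have E2 : L0 * sin A = Lq * sin B.
  by have := closed (th p); rewrite subrr sin0 -[th p - th p.+1]opprB sinN -/A -/B; lra.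
have E3 : L0 * sin (A + B) + Lp * sin B = 0.
  by have := closed (th p.+1); rewrite subrr sin0 -AE -/B; lra.
have AA : A2 = L0 * Lp * sin A - (q1 + q2).
  have -> : A2 = (l 0%N + x1) * Lp * sin A - (q1 + q2) - x2 * y2 * sin (A + B)
      + l p.+1 * ((l 0%N + x1) * sin (A + B) + Lp * sin B).
    rewrite /A2 big_split3 S1 S2 (XE p.+1) (YE p.+1) (XE p) (YE p) EX1 EY1.
    by rewrite (XE 0) (YE 0) sAE sBE sCE /Lp; ring.
  have -> : (l 0%N + x1) * sin (A + B) + Lp * sin B = - y2 * sin (A + B).
    by move: E3; rewrite /L0; lra.
  have -> : L0 * Lp * sin A = (l 0%N + x1) * Lp * sin A - y2 * (Lq * sin (A + B)).
    by rewrite -mulrA E1 /L0 -mulrA E1; ring.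
  by rewrite /Lq; ring.
have VV : V = L0 * h 0%N + Lp * h p + Lq * h p.+1 -
   ((x1 * h 0%N + y1 * h p - \sum_(1 <= i < p) l i * h i) +
    (x2 * h p.+1 + y2 * h 0%N - \sum_(p.+2 <= i < n) l i * h i)).
  by rewrite /V big_split3 /L0 /Lp /Lq; ring.
have FF : F = - (sin B * h 0%N + sin A * h p.+1 - sin (A + B) * h p) ^+ 2 /
    (2 * (sin A * sin B * sin (A + B))) - (t1 + t2).
  rewrite /F big_split2 T1 T2 kite_2piB -/A -/B mulNr -kite_split ?(lt0r_neq0 sA) ?(lt0r_neq0 sB) ?(ltr0_neq0 sC) //.
  by rewrite [kite (h p.+1) (h 0%N) _]kiteC; ring.
rewrite -mulrA mulrCA VV AA FF [2 * (_ - _)]mulrBr; apply: lorentz_sub.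
- exact: addr_ge0.
- by rewrite mulr_ge0 // addr_ge0.
- have -> : (q1 + q2) * (2 * (t1 + t2)) = (q1 + q2) * (2 * t1 + 2 * t2) by ring.
  by apply: mulr_sqr_le; rewrite ?mulr_ge0 // [leRHS]mulrCA.
- rewrite le_eqVlt; apply/orP; left; apply/eqP.
  have -> : L0 = Lq * sin B / sin A by rewrite -E2 mulfK ?gt_eqF.
  have -> : Lp = - (Lq * sin (A + B)) / sin A by rewrite -E1 mulfK ?gt_eqF.
  by field; rewrite ?(lt0r_neq0 sA) ?(lt0r_neq0 sB) ?(ltr0_neq0 sC).
- by rewrite -AA.
Qed.

(** Edges [0] and [p.+1] are antiparallel, so the three directions of the previous case bound no
    triangle; keeping the last edge [b] as well leaves a trapezoid. With height [H] and sum [m] of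
    the parallel sides, twice its area is [H * m], the other polygon has area [w * K], and the mixed
    term is [m * w / 2 + H * K]. The inequality is then the one between arithmetic and geometric
    mean. *)
Lemma closed_polygon_trapezoid :
  th p.+1 = th 0%N + pi -> 0 < A2 -> 2 * A2 * F <= V ^+ 2.
Proof.
move=> thq' A20.
have incr i : (i < n)%N -> th i < th i.+1 by move=> /thE/andP[].
have [b bn] : exists b, n = b.+1 by exists n.-1; rewrite prednK ?(ltn_trans _ pn).
have bn' : (b < n)%N by rewrite bn.
(* If [p.+1] were the last edge, the closing gap would be a full half turn. *)
have qb : (p.+1 < b)%N.
  have : (p.+1 <= b)%N by rewrite -ltnS -bn.
  rewrite leq_eqVlt => /orP[/eqP pb|//].
  have /andP[_] : th b < th b.+1 < th b + pi by apply: thE.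
  by rewrite -bn thn -pb thq'; lra.
have [|x1 [y1 [q1 [t1 [q10 t10 EX1 EY1 [S1 T1 C1]]]]]] :=
    wedge_between h XE YE p1 _ thp.
  by move=> i /andP[_ ip]; apply: incr; apply: (ltn_trans ip).
have thb : th b < th 0%N + 2 * pi by rewrite -thn bn; apply: incr.
have [||x2 [y2 [q2 [t2 [q20 t20 EX2 EY2 [S2 T2 C2]]]]]] :=
    wedge_between h XE YE qb.
- by move=> i /andP[_ ip]; apply: incr; apply: (ltn_trans ip).
- by rewrite thq'; lra.
set A := th p - th 0%N; set D := th b - th p.+1.
have sA : 0 < sin A.
  apply: sin_gt0_pi; rewrite /A subr_gt0 th_lt ?(ltnW pn') //=.
  by rewrite ltrBlDl.
have sD : 0 < sin D.
  apply: sin_gt0_pi; rewrite /D subr_gt0 th_lt ?(ltnW bn') //=.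
  by rewrite thq'; lra.
have BE : th p.+1 - th p = pi - A by rewrite thq' /A; ring.
have EE : th n - th b = pi - D by rewrite thn /D thq'; ring.
have spB (z : R) : sin (pi - z) = sin z by rewrite addrC sinDpi sinN opprK.
have cpB (z : R) : cos (pi - z) = - cos z by rewrite addrC cosDpi cosN.
have cq : cos (th p.+1) = - cos (th 0%N) by rewrite thq' cosDpi.
have sq : sin (th p.+1) = - sin (th 0%N) by rewrite thq' sinDpi.
have sAE : sin A = sin (th p) * cos (th 0%N) - cos (th p) * sin (th 0%N) by rewrite /A sinB.
have sDE : sin D = cos (th b) * sin (th 0%N) - sin (th b) * cos (th 0%N).
  by rewrite /D sinB cq sq; ring.
have cAE : cos A = cos (th p) * cos (th 0%N) + sin (th p) * sin (th 0%N) by rewrite /A cosB.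
have cDE : cos D = - (cos (th b) * cos (th 0%N) + sin (th b) * sin (th 0%N)).
  by rewrite /D cosB cq sq; ring.
set L0 := l 0%N + x1; set Lp := l p + y1; set Lq := l p.+1 + x2; set Lb := l b + y2.
have hx : L0 * cos (th 0%N) + Lp * cos (th p) - Lq * cos (th 0%N) + Lb * cos (th b) = 0.
  have := Xn; rewrite bn XE EX2 (XE p.+1) (XE p) EX1 (XE 0) cq /L0 /Lp /Lq /Lb; lra.
have hy : L0 * sin (th 0%N) + Lp * sin (th p) - Lq * sin (th 0%N) + Lb * sin (th b) = 0.
  have := Yn; rewrite bn YE EY2 (YE p.+1) (YE p) EY1 (YE 0) sq /L0 /Lp /Lq /Lb; lra.
have E1 : Lp * sin A = Lb * sin D.
  apply/eqP; rewrite -subr_eq0; apply/eqP.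
  have -> : 0 = cos (th 0%N) * 0 - sin (th 0%N) * 0 :> R by ring.
  by rewrite -{1}hy -hx sAE sDE; ring.
have E2 : L0 - Lq = Lb * cos D - Lp * cos A.
  apply/eqP; rewrite -subr_eq0; apply/eqP.
  have -> : 0 = cos (th 0%N) * 0 + sin (th 0%N) * 0 :> R by ring.
  rewrite -{1}hx -hy cAE cDE -[L0 - Lq]mulr1 -(cos2Dsin2 (th 0%N)); ring.
have AA : A2 = Lp * sin A * (L0 + Lq) - (q1 + q2).
  rewrite /A2 big_split3 {1}bn big_nat_recr ?(ltnW qb) //= S1 S2 -bn Xn Yn.
  have wx : L0 * cos (th 0%N) + Lp * cos (th p) = Lq * cos (th 0%N) - Lb * cos (th b) by lra.
  have wy : L0 * sin (th 0%N) + Lp * sin (th p) = Lq * sin (th 0%N) - Lb * sin (th b) by lra.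
  transitivity (L0 * Lp * sin A - q1 - q2 + Lq * y2 * sin D +
    ((L0 * cos (th 0%N) + Lp * cos (th p)) * (y2 * sin (th b) - Lq * sin (th 0%N))
     - (L0 * sin (th 0%N) + Lp * sin (th p)) * (y2 * cos (th b) - Lq * cos (th 0%N)))).
    rewrite EX2 EY2 (XE p.+1) (YE p.+1) (XE p) (YE p) EX1 EY1 (XE 0) (YE 0) cq sq.
    by rewrite sAE sDE /L0 /Lp /Lq; ring.
  rewrite wx wy.
  have -> : L0 * Lp * sin A = L0 * (Lp * sin A) by rewrite mulrA.
  have -> : Lp * sin A * (L0 + Lq) = L0 * (Lp * sin A) + Lq * (Lb * sin D) by rewrite -E1; ring.
  by rewrite sDE; ring.
have VV : V = L0 * h 0%N + Lp * h p + Lq * h p.+1 + Lb * h b -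
   ((x1 * h 0%N + y1 * h p - \sum_(1 <= i < p) l i * h i) +
    (x2 * h p.+1 + y2 * h b - \sum_(p.+2 <= i < b) l i * h i)).
  rewrite /V big_split3 {1}bn big_nat_recr //=.
  by rewrite /L0 /Lp /Lq /Lb; ring.
set K := (2 * h p + (h p.+1 - h 0%N) * cos A) / (2 * sin A) +
         (2 * h b + (h 0%N - h p.+1) * cos D) / (2 * sin D).
have FF : F = (h 0%N + h p.+1) * K - (t1 + t2).
  rewrite /F big_split2 T1 {1}bn big_nat_recr ?(ltnW qb) //=.
  rewrite T2 -bn hn BE EE -/A -/D /K /kite spB cpB spB cpB.
  by field; rewrite !gt_eqF.
rewrite -mulrA mulrCA VV AA FF [2 * (_ - _)]mulrBr; apply: lorentz_sub.
- exact: addr_ge0.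
- by rewrite mulr_ge0 // addr_ge0.
- have -> : (q1 + q2) * (2 * (t1 + t2)) = (q1 + q2) * (2 * t1 + 2 * t2) by ring.
  by apply: mulr_sqr_le; rewrite ?mulr_ge0 // [leRHS]mulrCA.
- set w := h 0%N + h p.+1; set m := L0 + Lq; set H := Lp * sin A.
  have -> : L0 * h 0%N + Lp * h p + Lq * h p.+1 + Lb * h b = m * w / 2 + H * K.
    have -> : L0 * h 0%N + Lp * h p + Lq * h p.+1 + Lb * h b =
       m * w / 2 + (L0 - Lq) * (h 0%N - h p.+1) / 2 + Lp * h p + Lb * h b.
      by rewrite /m /w; field.
    rewrite E2 mulrDr /K; have -> : Lp = H / sin A by rewrite /H mulfK ?gt_eqF.
    have -> : Lb = H / sin D by rewrite /H E1 mulfK ?gt_eqF.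
    by field; rewrite !gt_eqF.
  have : 0 <= (m * w / 2 - H * K) ^+ 2 by apply: sqr_ge0.
  lra.
- by rewrite -AA.
Qed.

(* Minkowski's inequality V(C,Q)^2 >= area(C) area(Q): C is the given polygon and
   Q has the same normals with support numbers [h]. *)
Theorem closed_polygon_minkowski : 0 < A2 -> 2 * A2 * F <= V ^+ 2.
Proof.
move: thq; rewrite le_eqVlt => /orP[/eqP/esym|].
- exact: closed_polygon_trapezoid.
- exact: closed_polygon_triangle.
Qed.

End Closed.

(** * Edge directions of a convex polygon *)

Lemma polar_coordinates (R : realType) (a x y : R) :
  exists l t, [/\ 0 <= l, a <= t < a + 2 * pi, x = l * cos t & y = l * sin t].
Proof.
have base (u w : R) : exists l t, [/\ 0 <= l, 0 <= t < 2 * pi, u = l * cos t & w = l * sin t].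
  have pi0 := pi_gt0 R.
  set l := Num.sqrt (u ^+ 2 + w ^+ 2).
  have l0 : 0 <= l by rewrite sqrtr_ge0.
  have l2 : l ^+ 2 = u ^+ 2 + w ^+ 2 by rewrite sqr_sqrtr // addr_ge0 ?sqr_ge0.
  have [lE|lN] := eqVneq l 0.
    exists 0, 0; rewrite !mul0r; move: l2; rewrite lE expr0n /= => /esym/eqP.
    rewrite paddr_eq0 ?sqr_ge0 // !sqrf_eq0 => /andP[/eqP-> /eqP->].
    by split=> //; rewrite lexx /= mulr_gt0.
  have lp : 0 < l by rewrite lt_def lN.
  have cb : -1 <= u / l <= 1.
    rewrite ler_pdivlMr // ler_pdivrMr // mulN1r mul1r -ler_norml.
    by rewrite -(ler_pXn2r (n := 2)) ?nnegrE // real_normK ?num_real // l2 lerDl sqr_ge0.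
  have s2 : sin (acos (u / l)) = `|w| / l.
    rewrite sin_acos //; have -> : 1 - (u / l) ^+ 2 = (`|w| / l) ^+ 2.
      rewrite !expr_div_n real_normK ?num_real // -[1](divff (lt0r_neq0 (exprn_gt0 2 lp))).
      by rewrite -mulrBl l2; congr (_ / _); ring.
    by rewrite sqrtr_sqr ger0_norm // divr_ge0.
  have c2 : cos (acos (u / l)) = u / l by rewrite acosK // in_itv.
  have a0 := acos_ge0 cb; have a1 := acos_lepi cb.
  have [w0|w0] := leP 0 w.
    exists l, (acos (u / l)); split=> //; first by rewrite a0 /=; lra.
      by rewrite c2 mulrC divfK.
    by rewrite s2 mulrC divfK // ger0_norm.
  exists l, (2 * pi - acos (u / l)); split=> //.
  - rewrite subr_ge0; apply/andP; split; first by lra.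
    rewrite ltrBlDr ltrDl lt_def a0 andbT; apply/eqP => E.
    by move: s2; rewrite E sin0 => /esym/eqP; rewrite mulf_eq0 normr_eq0 invr_eq0 (negbTE lN) lt_eqF.
  - by rewrite cos2piB c2 mulrC divfK.
  - by rewrite sin2piB s2 mulrN mulrC divfK // ltr0_norm // opprK.
have [l [t [l0 tb uE wE]]] := base (x * cos a + y * sin a) (y * cos a - x * sin a).
exists l, (a + t); split=> //; first by move: tb; lra.
- rewrite cosD mulrBr ![l * (_ * _)]mulrCA -uE -wE.
  rewrite -[LHS]mulr1 -(cos2Dsin2 a); ring.
- rewrite sinD mulrDr ![l * (_ * _)]mulrCA -uE -wE.
  rewrite -[LHS]mulr1 -(cos2Dsin2 a); ring.
Qed.

Lemma sin_gt0P (R : realType) (x : R) : - pi <= x < 2 * pi -> 0 < sin x -> 0 < x < pi.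
Proof.
move=> /andP[x1 x2] s0; apply/andP; split; rewrite ltNge; apply/negP => xb.
- have : 0 <= sin (- x) by apply: sin_ge0_pi; lra.
  by rewrite sinN; lra.
- have : 0 <= sin (x - pi) by apply: sin_ge0_pi; lra.
  by rewrite -(opprK (x - pi)) sinN opprB addrC sinDpi sinN; lra.
Qed.

Lemma sin_le0P (R : realType) (x : R) : 0 <= x < 2 * pi -> sin x <= 0 -> x = 0 \/ pi <= x.
Proof.
move=> /andP[x1 x2] s0; have [->|xN] := eqVneq x 0; [by left|right].
rewrite leNgt; apply/negP => xpi.
have : 0 < sin x by apply: sin_gt0_pi; rewrite xpi andbT lt_def xN.
by lra.
Qed.

(* Heights over the line [v 0, v 1] are unimodal along a convex polygon. *)
Lemma convex_polygon_descent (R : realDomainType) (y : nat -> R) (x : nat -> R) j n :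
  (forall i j l, (i < j < l)%N -> (l < n)%N ->
     0 < (x j - x i) * (y l - y i) - (y j - y i) * (x l - x i)) ->
  (1 < j)%N -> (j < n)%N -> x n = x 0%N -> y n = y 0%N ->
  (x 1%N - x 0%N) * (y j - y j.-1) - (y 1%N - y 0%N) * (x j - x j.-1) <= 0 ->
  (x 1%N - x 0%N) * (y j.+1 - y j) - (y 1%N - y 0%N) * (x j.+1 - x j) < 0.
Proof.
move=> cvx j1 jn xn yn dec.
have H0 := cvx 0%N 1%N j; rewrite j1 jn in H0; have {}H0 := H0 isT isT.
have [jE|jn'] : j.+1 = n \/ (j.+1 < n)%N by lia.
  by rewrite jE xn yn; move: H0; lra.
have H1 : 0 < (x j - x j.-1) * (y j.+1 - y j.-1) - (y j - y j.-1) * (x j.+1 - x j.-1).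
  by apply: cvx; lia.
have H2 : 0 < (x j.-1 - x 0%N) * (y j - y 0%N) - (y j.-1 - y 0%N) * (x j - x 0%N).
  have [jE|jE] : j = 2%N \/ (2 < j)%N by lia.
    by move: H0; rewrite jE.
  by apply: cvx; lia.
have H3 : 0 < (x j - x 0%N) * (y j.+1 - y 0%N) - (y j - y 0%N) * (x j.+1 - x 0%N).
  by apply: cvx; lia.
rewrite ltNge; apply/negP => up.
set ay := (x 1%N - x 0%N) * (y j - y j.-1) - (y 1%N - y 0%N) * (x j - x j.-1) in dec.
set b := (x 1%N - x 0%N) * (y j.+1 - y j) - (y 1%N - y 0%N) * (x j.+1 - x j) in up.
set c := _ - _ in H0.
have := mulr_gt0 H0 H1; have := mulr_ge0 up (ltW H2).
have : 0 <= - ay * _ := mulr_ge0 _ (ltW H3); rewrite oppr_ge0 => /(_ dec).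
rewrite /ay /b /c; lra.
Qed.

(* [ordered_polygon n x y]: the points [(x i, y i)], [i < n], are the vertices of a
   strictly convex polygon in counterclockwise order, and index [n] closes it up. *)
Definition ordered_polygon (R : realType) n (x y : nat -> R) : Prop :=
  [/\ (2 < n)%N, x n = x 0%N, y n = y 0%N &
   forall i j l, (i < j < l)%N -> (l < n)%N ->
     0 < (x j - x i) * (y l - y i) - (y j - y i) * (x l - x i)].

(** The point is that the edge directions, all chosen in the turn that starts at the first edge,
    increase. Heights over the first edge rise up to some vertex [q] and fall afterwards, which puts
    the earlier directions into the first half turn and the later ones into the second. The sign of
    the sine of consecutive differences then decides. *)
Lemma ordered_polygon_minkowski (R : realType) n (x y : nat -> R) :
  ordered_polygon n x y ->
  0 < \sum_(0 <= i < n) (x i * y i.+1 - y i * x i.+1) ->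
  exists l th : nat -> R,
  [/\ forall i, (i < n)%N -> [/\ 0 <= l i, x i.+1 - x i = l i * cos (th i)
        & y i.+1 - y i = l i * sin (th i)],
      th n = th 0%N + 2 * pi,
      forall i, (i < n)%N -> 0 < th i.+1 - th i < pi &
      forall h : nat -> R, h n = h 0%N ->
        2 * (\sum_(0 <= i < n) (x i * y i.+1 - y i * x i.+1)) *
        (\sum_(0 <= i < n) kite (h i) (h i.+1) (th i.+1 - th i))
        <= (\sum_(0 <= i < n) l i * h i) ^+ 2].
Proof.
move=> [n2 xn yn cvx] A20.
have n0 : (0 < n)%N by lia.
have [l0 [t0 [l00 _ ex0 ey0]]] := polar_coordinates 0 (x 1%N - x 0%N) (y 1%N - y 0%N).
have /choice[lt ltP] : forall i, exists lt : R * R, [/\ 0 <= lt.1, t0 <= lt.2 < t0 + 2 * pi,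
    x i.+1 - x i = lt.1 * cos lt.2 & y i.+1 - y i = lt.1 * sin lt.2].
  move=> i; have [l [t [? ? ? ?]]] := polar_coordinates t0 (x i.+1 - x i) (y i.+1 - y i).
  by exists (l, t).
pose l i := if i == 0%N then l0 else if (i < n)%N then (lt i).1 else 0.
pose th i := if i == 0%N then t0 else if (i < n)%N then (lt i).2 else t0 + 2 * pi.
have lth i : (i < n)%N -> [/\ 0 <= l i, x i.+1 - x i = l i * cos (th i)
        & y i.+1 - y i = l i * sin (th i)].
  move=> iN; rewrite /l /th; case: eqP => [->//|_]; rewrite iN.
  by have [? _ ? ?] := ltP i.
have th0 : th 0%N = t0 by [].
have thn : th n = th 0%N + 2 * pi by rewrite th0 /th (gtn_eqF n0) ltnn.
have thb i : (0 < i < n)%N -> th 0%N <= th i < th 0%N + 2 * pi.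
  move=> /andP[i0 iN]; rewrite th0 /th (gtn_eqF i0) iN.
  by have [] := ltP i.
have lpos i s : 0 < l i * s -> 0 <= l i -> 0 < s.
  move=> ls li; have l0' : 0 < l i.
    by rewrite lt_def li andbT; apply: contraTneq ls => ->; rewrite mul0r ltxx.
  by rewrite pmulr_rgt0 in ls.
have crE i j : (i < n)%N -> (j < n)%N ->
    (x i.+1 - x i) * (y j.+1 - y j) - (y i.+1 - y i) * (x j.+1 - x j) =
    l i * (l j * sin (th j - th i)).
  by move=> /lth[_ -> ->] /lth[_ -> ->]; rewrite sinB; ring.
have sin_pos i j : (i < n)%N -> (j < n)%N ->
   0 < (x i.+1 - x i) * (y j.+1 - y j) - (y i.+1 - y i) * (x j.+1 - x j) ->
   0 < sin (th j - th i).
  move=> iN jN; rewrite crE // => h; have [li _ _] := lth i iN; have [lj _ _] := lth j jN.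
  exact: lpos (lpos _ _ h li) lj.
have sin_neg i j : (i < n)%N -> (j < n)%N ->
   (x i.+1 - x i) * (y j.+1 - y j) - (y i.+1 - y i) * (x j.+1 - x j) < 0 ->
   sin (th j - th i) < 0.
  move=> iN jN; rewrite -opprB oppr_lt0 => h.
  by rewrite -opprB sinN oppr_lt0; apply: sin_pos => //; move: h; lra.
have ncr i : (i.+1 < n)%N -> 0 < (x i.+1 - x i) * (y i.+2 - y i.+1) - (y i.+1 - y i) * (x i.+2 - x i.+1).
  move=> iN.
  have [iE|iN'] : i.+2 = n \/ (i.+2 < n)%N by lia.
    have i0 : (0 < i)%N by lia.
    have := cvx 0%N i i.+1; rewrite i0 ltnSn iN => /(_ isT isT).
    by rewrite iE xn yn; lra.
  have := cvx i i.+1 i.+2; rewrite !ltnSn iN' => /(_ isT isT); lra.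
have [m nE] : exists m, n = m.+1 by exists n.-1; rewrite prednK.
have mn : (m < n)%N by rewrite nE.
have m1 : (0 < 1 < m)%N by lia.
have lcr : 0 < (x m.+1 - x m) * (y 1%N - y 0%N) - (y m.+1 - y m) * (x 1%N - x 0%N).
  by rewrite -nE xn yn; have := cvx 0%N 1%N m m1 mn; lra.
have next i : (i.+1 < n)%N -> 0 < sin (th i.+1 - th i).
  by move=> iN; apply: sin_pos (ncr i iN) => //; exact: ltnW.
have last : 0 < sin (th 0%N - th m) by apply: sin_pos lcr.
have lgt0 i : (i < n)%N -> 0 < l i.
  move=> iN; rewrite lt_def; have [-> _ _] := lth i iN; rewrite andbT.
  have [iE|iN'] := eqVneq i m.
    by apply: contraTneq lcr; rewrite -iE crE // => ->; rewrite mul0r ltxx.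
  have iN2 : (i.+1 < n)%N by rewrite nE ltnS ltn_neqAle iN' -ltnS -nE.
  by apply: contraTneq (ncr i iN2); rewrite crE // => ->; rewrite mul0r ltxx.
have dec_m : (x 1%N - x 0%N) * (y m.+1 - y m) - (y 1%N - y 0%N) * (x m.+1 - x m) < 0.
  by rewrite -nE xn yn; have := cvx 0%N 1%N m m1 mn; lra.
(* [q] will be the first edge along which the height over edge [0] does not rise. *)
have exq : exists q, (0 < q < n)%N && ((x 1%N - x 0%N) * (y q.+1 - y q) - (y 1%N - y 0%N) * (x q.+1 - x q) <= 0).
  by exists m; rewrite (ltW dec_m) mn !andbT; lia.
have [q /andP[/andP[q0 qn] qle] qmin] := ex_minnP exq.
have up i : (0 < i < q)%N -> 0 < th i - th 0%N < pi.
  move=> /andP[i0 iq]; have iN := ltn_trans iq qn.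
  have /thb : (0 < i < n)%N by rewrite i0.
  move=> tb; apply: sin_gt0P; first by have := pi_gt0 R; lra.
  apply: sin_pos => //; rewrite ltNge; apply/negP => le.
  by have := qmin i; rewrite i0 iN le leqNgt iq => /(_ isT).
have q1 : (1 < q)%N.
  rewrite ltn_neqAle q0 andbT; apply/eqP => qE; move: qle; rewrite -qE leNgt.
  have := cvx 0%N 1%N 2%N isT n2; move=> h /negP; apply; lra.
have [p qE] : exists p, q = p.+1 by exists q.-1; rewrite prednK.
have p0 : (0 < p)%N by lia.
have up_p := up p; rewrite p0 qE ltnSn in up_p; have {}up_p := up_p isT.
have pn : (p < n)%N by rewrite ltnW // -qE.
have pi0 := pi_gt0 R.
have down_q : pi <= th q - th 0%N.
  have [qz|//] : th q - th 0%N = 0 \/ pi <= th q - th 0%N.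
    apply: sin_le0P; first by have := thb q; rewrite q0 qn => /(_ isT); lra.
    by move: qle; rewrite crE // !pmulr_rle0 ?lgt0.
  have := next p; rewrite -qE => /(_ qn).
  have -> : th q - th p = - (th p - th 0%N) by move: qz; lra.
  by rewrite sinN oppr_gt0 ltNge ltW // sin_gt0_pi.
have down i : (q <= i < n)%N -> pi <= th i - th 0%N < 2 * pi.
  move=> /andP[qi iN].
  have tb : th 0%N <= th i < th 0%N + 2 * pi by apply: thb; rewrite iN andbT (leq_trans q0).
  apply/andP; split; last by lra.
  have [->//|iq] := eqVneq i q.
  have dn j : (q < j)%N -> (j < n)%N -> (x 1%N - x 0%N) * (y j.+1 - y j) - (y 1%N - y 0%N) * (x j.+1 - x j) < 0.
    elim: j => [//|j IH]; rewrite ltnS => qj jn.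
    apply: (@convex_polygon_descent _ _ _ _ n) => //.
      by rewrite ltnS (leq_trans q0).
    move: qj; rewrite leq_eqVlt => /orP[/eqP <-//|qj]; apply/ltW/IH => //; exact: ltnW.
  have qi' : (q < i)%N by rewrite ltn_neqAle eq_sym iq.
  have s := sin_neg 0%N i n0 iN (dn i qi' iN).
  have tb' : 0 <= th i - th 0%N < 2 * pi by move: tb; lra.
  have [e|//] := sin_le0P tb' (ltW s).
  by move: s; rewrite e sin0 ltxx.
have thE i : (i < n)%N -> th i < th i.+1 < th i + pi.
  move=> iN.
  suff : 0 < th i.+1 - th i < pi by lra.
  have [iE|iNm] := eqVneq i m.
    have qm : (q <= m)%N by rewrite -ltnS -nE.
    rewrite iE -nE thn; apply: sin_gt0P.
      by have := down m; rewrite qm mn => /(_ isT); lra.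
    have -> : th 0%N + 2 * pi - th m = th 0%N - th m + pi *+ 2 by rewrite -mulr_natl; ring.
    by rewrite sinD2pi.
  have iN' : (i.+1 < n)%N by rewrite nE ltnS ltn_neqAle iNm -ltnS -nE.
  apply: sin_gt0P (next _ iN').
  have [iq|iq] := ltnP i.+1 q.
    have := up i.+1; rewrite iq => /(_ isT).
    have [->|i0] := posnP i; first by lra.
    by have := up i; rewrite i0 (ltnW iq) => /(_ isT); lra.
  have := down i.+1; rewrite iq iN' => /(_ isT).
  have [iq'|iq'] := ltnP i q.
    have [->|i0] := posnP i; first by lra.
    by have := up i; rewrite i0 iq' => /(_ isT); lra.
  by have := down i; rewrite iq' iN => /(_ isT); lra.
exists l, th; split=> //; first by move=> i /thE; lra.
move=> h hn.
have E i : (i < n)%N -> minn i n = i /\ minn i.+1 n = i.+1.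
  by move=> iN; rewrite !(minn_idPl _) // ltnW.
have lge i : (n <= i)%N -> l i = 0.
  by move=> ni; rewrite /l gtn_eqF ?(leq_trans n0) // ltnNge ni.
(* The section wants the edge relations at every index, so the vertices are frozen from [n] on,
   where [l] is zero. *)
have := @closed_polygon_minkowski R (fun i => x (minn i n)) (fun i => y (minn i n)) th l h n p.
have -> : \sum_(0 <= i < n) (x (minn i n) * y (minn i.+1 n) - y (minn i n) * x (minn i.+1 n))
   = \sum_(0 <= i < n) (x i * y i.+1 - y i * x i.+1).
  by apply: eq_big_nat => i /andP[_ /E[-> ->]].
rewrite minnn min0n; apply=> //.
- move=> i; have [iN|ni] := ltnP i n.
    by have [_ ->] := E i iN; have [_ <- _] := lth i iN; rewrite addrC subrK.
  by rewrite lge // mul0r addr0 (minn_idPr _) // leqW.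
- move=> i; have [iN|ni] := ltnP i n.
    by have [_ ->] := E i iN; have [_ _ <-] := lth i iN; rewrite addrC subrK.
  by rewrite lge // mul0r addr0 (minn_idPr _) // leqW.
- by rewrite -qE.
- by lra.
- by rewrite -qE; lra.
Qed.

(** * Kites between consecutive edge directions *)

Lemma cos_gt0_itv (R : realType) (x : R) : 0 <= x < pi / 2 -> 0 < cos x.
Proof.
move=> /andP[x0 x1]; apply: cos_gt0_pihalf; rewrite x1 andbT.
by apply: lt_le_trans x0; rewrite oppr_lt0 divr_gt0 ?pi_gt0.
Qed.

Lemma tan_MVT (R : realType) (x y : R) : 0 <= x -> x <= y -> y < pi / 2 ->
  exists2 c, x <= c <= y & tan y - tan x = (1 + tan c ^+ 2) * (y - x).
Proof.
move=> x0 xy y1.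
have cz z : x <= z <= y -> cos z != 0.
  by move=> /andP[z0 z1]; rewrite gt_eqF // cos_gt0_itv //; lra.
have [||c] := @MVT_segment R tan (fun z => (cos z) ^-2) x y xy.
- move=> z; rewrite in_itv /= => /andP[z0 z1].
  by apply: is_derive_tan; apply: cz; rewrite !ltW.
- apply: continuous_in_subspaceT => z /set_mem /=; rewrite in_itv /= => zb.
  exact/continuous_tan/cz.
- rewrite in_itv /= => cb ->; exists c => //.
  by rewrite cos2_tan2 // cz.
Qed.

Lemma tan_ge0 (R : realType) (x : R) : 0 <= x < pi / 2 -> 0 <= tan x.
Proof.
move=> /andP[x0 x1]; have [c _ E] := tan_MVT (lexx 0) x0 x1.
rewrite tan0 !subr0 in E; rewrite E mulr_ge0 // addr_ge0 ?sqr_ge0 //.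
Qed.

Lemma tan_le (R : realType) (x y : R) : 0 <= x -> x <= y -> y < pi / 2 -> tan x <= tan y.
Proof.
move=> x0 xy y1; have [c _ E] := tan_MVT x0 xy y1.
rewrite -subr_ge0 E mulr_ge0 ?subr_ge0 // addr_ge0 ?sqr_ge0 //.
Qed.

Lemma tan_tangent (R : realType) (a x : R) : 0 <= a < pi / 2 -> 0 <= x < pi / 2 ->
  tan a + (1 + tan a ^+ 2) * (x - a) <= tan x.
Proof.
move=> /andP[a0 a1] /andP[x0 x1].
have sq u v : 0 <= u -> u <= v -> v < pi / 2 -> tan u ^+ 2 <= tan v ^+ 2.
  move=> u0 uv v1; rewrite ler_pXn2r ?nnegrE ?tan_le ?tan_ge0 //; first by lra.
  by lra.
have [ax|xa] := leP a x.
  have [c /andP[c0 c1] E] := tan_MVT a0 ax x1.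
  have /(ler_wpM2r (_ : 0 <= x - a)) h : 1 + tan a ^+ 2 <= 1 + tan c ^+ 2.
    by rewrite lerD2l sq //; lra.
  by have := h; rewrite subr_ge0 => /(_ ax); move: E; lra.
have [c /andP[c0 c1] E] := tan_MVT x0 (ltW xa) a1.
have /(ler_wpM2r (_ : 0 <= a - x)) h : 1 + tan c ^+ 2 <= 1 + tan a ^+ 2.
  by rewrite lerD2l sq //; lra.
by have := h; rewrite subr_ge0 => /(_ (ltW xa)); move: E; lra.
Qed.

Lemma tan_chord (R : realType) (x y z : R) : 0 <= x -> x <= y -> y <= z -> z < pi / 2 ->
  (z - x) * tan y <= (z - y) * tan x + (y - x) * tan z.
Proof.
move=> x0 xy yz z1.
have hx : tan y + (1 + tan y ^+ 2) * (x - y) <= tan x by apply: tan_tangent; lra.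
have hz : tan y + (1 + tan y ^+ 2) * (z - y) <= tan z by apply: tan_tangent; lra.
have zy : 0 <= z - y by lra.
have yx : 0 <= y - x by lra.
have := ler_wpM2l zy hx; have := ler_wpM2l yx hz; lra.
Qed.

Lemma cot_chord (R : realType) (x y z : R) : 0 < x -> x <= y -> y <= z -> z <= pi / 2 ->
  (z - x) * (cos y / sin y) <= (z - y) * (cos x / sin x) + (y - x) * (cos z / sin z).
Proof.
have E (t : R) : cos t / sin t = tan (pi / 2 - t).
  by rewrite /tan -opprB sinN cosN cosBpihalf sinBpihalf opprK.
move=> x0 xy yz z1; rewrite !E.
have h1 : 0 <= pi / 2 - z by lra.
have h2 : pi / 2 - z <= pi / 2 - y by lra.
have h3 : pi / 2 - y <= pi / 2 - x by lra.
have h4 : pi / 2 - x < pi / 2 by lra.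
by have := tan_chord h1 h2 h3 h4; lra.
Qed.

Lemma sin_half (R : realType) (d : R) : sin d = 2 * (sin (d / 2) * cos (d / 2)).
Proof. by rewrite {1}(splitr d) sinD; ring. Qed.

Lemma cos_half (R : realType) (d : R) : cos d = 1 - 2 * sin (d / 2) ^+ 2.
Proof. by rewrite {1}(splitr d) cosD -!expr2 cos2sin2; ring. Qed.

Lemma kite_same (R : realType) (h d : R) : 0 < d < pi -> kite h h d = h ^+ 2 * tan (d / 2).
Proof.
move=> /andP[d0 d1].
have s0 : sin (d / 2) != 0 by rewrite gt_eqF // sin_gt0_pi //; lra.
have c0 : cos (d / 2) != 0 by rewrite gt_eqF // cos_gt0_itv //; lra.
rewrite /kite /tan sin_half cos_half; field.
by rewrite s0 c0.
Qed.

(* The kite over a gap whose sides pivot about two vertices at angular distance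
   [w]: up to a term depending only on the second side, it is affine in the
   cotangent of the gap. *)
Lemma kite_pivot (R : realType) (rho w a d : R) : sin d != 0 ->
  kite (rho * cos a) (rho * cos (a + d - w)) d - rho ^+ 2 * sin (2 * (a + d - w)) / 4 =
  rho ^+ 2 * (cos a * sin (w - a) - sin (2 * (w - a)) / 4)
  - (rho * (cos a - cos (w - a))) ^+ 2 / 2 * (cos d / sin d).
Proof.
move=> sd; have -> : a + d - w = d - (w - a) by ring.
move: (w - a) => b.
have -> : sin (2 * (d - b)) = 2 * (sin (d - b) * cos (d - b)) by rewrite sin_half mulrAC divff // mul1r.
have -> : sin (2 * b) = 2 * (sin b * cos b) by rewrite sin_half mulrAC divff // mul1r.
have cd := cos2Dsin2 d; apply/eqP; rewrite -subr_eq0 /kite sinB cosB.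
move: (sin d) (cos d) (sin b) (cos b) (cos a) sd cd => S C s c A S0 cd.
apply/eqP; transitivity (- rho ^+ 2 * c * (C * c + S * s) * (C ^+ 2 + S ^+ 2 - 1) / (2 * S)).
  by field.
by rewrite cd subrr mulr0 mul0r.
Qed.

Section Pivot.
Variables (R : realType) (s : R).
Hypothesis s0 : 0 < s.
Hypothesis spi : s < pi.

(* Support function of the polygon circumscribed about the unit circle with turning
   angle [s], at the angle [a] from one of its vertices. *)
Definition vertex_support (a : R) : R := cos a / cos (s / 2).

(** The first term is the signed area of the triangle formed by the centre, the vertex, and the foot
    of the perpendicular to a side through that vertex at angle [a]. The linear term makes the
    potential vanish at [a = s / 2] and [a = - (s / 2)], where the side is flush. *)
Definition vertex_potential (a : R) : R :=
  sin (2 * a) / (4 * cos (s / 2) ^+ 2) - tan (s / 2) / s * a.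

Let cs : 0 < cos (s / 2).
Proof. by apply: cos_gt0_itv; rewrite divr_ge0 ?(ltW s0) //= ltr_pM2r. Qed.

Let psi (a : R) : R := sin (2 * a) / (4 * cos (s / 2) ^+ 2).

(** The kite trimmed to the sector between the two vertices about which its sides pivot: [psi] is
    the area of the triangle between a vertex and a foot. *)
Let E (w a a' : R) : R :=
  kite (vertex_support a) (vertex_support a') (w + a' - a) - psi a' + psi a.

Let E_refl w a a' : E w (- a') (- a) = E w a a'.
Proof.
rewrite /E /vertex_support /psi !cosN !mulrN !sinN !mulNr kiteC opprK.
have -> : w - a + a' = w + a' - a by ring.
ring.
Qed.

(** By [kite_pivot], [a'] enters only through the cotangent of the gap, with a coefficient that is
    not positive. The cotangent is convex up to a right angle, so [E] is concave in [a'], and by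
    [E_refl] also in [a]. *)
Let E_chord w a x y z : x <= y -> y <= z -> 0 < w + x - a -> w + z - a <= pi / 2 ->
  (z - x) * E w a y >= (z - y) * E w a x + (y - x) * E w a z.
Proof.
move=> xy yz wx wz; have pi0 := pi_gt0 R; have s0' := s0; have spi' := spi.
set rho := (cos (s / 2))^-1.
set K := rho ^+ 2 * (cos a * sin (w - a) - sin (2 * (w - a)) / 4) + psi a.
set B := (rho * (cos a - cos (w - a))) ^+ 2 / 2.
have EE t : x <= t <= z -> E w a t = K - B * (cos (w + t - a) / sin (w + t - a)).
  move=> tb; have sd : sin (w + t - a) != 0 by rewrite gt_eqF // sin_gt0_pi //; lra.
  have := kite_pivot rho w a sd; have -> : a + (w + t - a) - w = t by ring.
  rewrite /E /vertex_support -/rho ![_ / cos _]mulrC -/rho => h.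
  have -> : psi t = rho ^+ 2 * sin (2 * t) / 4.
    by rewrite /psi /rho; field; rewrite gt_eqF.
  by rewrite h /K /B; ring.
rewrite !EE ?xy ?yz ?lexx ?(le_trans xy) //.
have B0 : 0 <= B by rewrite divr_ge0 ?sqr_ge0.
have h1 : w + x - a <= w + y - a by lra.
have h2 : w + y - a <= w + z - a by lra.
have := ler_wpM2l B0 (cot_chord wx h1 h2 wz); lra.
Qed.

Lemma vertex_support_ge1 a : - (s / 2) <= a <= s / 2 -> 1 <= vertex_support a.
Proof.
move=> ab; rewrite /vertex_support ler_pdivlMr // mul1r -[cos a]cos_norm.
have pi0 := pi_gt0 R; have s0' := s0; have spi' := spi; have sp : s / 2 <= pi by lra.
have na : `|a| <= s / 2 by rewrite ler_norml.
have [->//|ne] := eqVneq `|a| (s / 2).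
have m1 : `|a| \in `[0, pi]%R by rewrite in_itv /= normr_ge0 /= (le_trans na).
have m2 : s / 2 \in `[0, pi]%R by rewrite in_itv /= sp andbT divr_ge0 // ltW.
by apply/ltW; rewrite ltr_cos // lt_neqAle ne.
Qed.

Let E_diag w a : 0 < w < pi -> - (s / 2) <= a <= s / 2 -> tan (w / 2) <= E w a a.
Proof.
move=> wb ab; have pi0 := pi_gt0 R; have s0' := s0; have spi' := spi.
have -> : E w a a = vertex_support a ^+ 2 * tan (w / 2).
  by rewrite /E addrK subrK kite_same.
have tw : 0 <= tan (w / 2) by apply: tan_ge0; lra.
rewrite ler_peMl //.
by rewrite -[leLHS](expr1n _ 2) ler_pXn2r ?nnegrE ?vertex_support_ge1 //
  (le_trans ler01) // vertex_support_ge1.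
Qed.

Let psi_half : psi (s / 2) = tan (s / 2) / 2.
Proof.
rewrite /psi [2 * _]mulrC divfK // sin_half /tan; field.
by rewrite gt_eqF.
Qed.

Let psi_halfN : psi (- (s / 2)) = - (tan (s / 2) / 2).
Proof. by rewrite -psi_half /psi mulrN sinN mulNr. Qed.

Let E_corner w : 0 < w + s < pi -> E w (- (s / 2)) (s / 2) = tan ((w + s) / 2) - tan (s / 2).
Proof.
move=> wb; rewrite /E /vertex_support cosN divff ?gt_eqF //.
rewrite (_ : w + s / 2 - - (s / 2) = w + s); last by field.
by rewrite kite_same // expr1n mul1r psi_half psi_halfN; field.
Qed.

Let E_corner' w : 0 < w - s < pi -> E w (s / 2) (- (s / 2)) = tan ((w - s) / 2) + tan (s / 2).
Proof.
move=> wb; rewrite /E /vertex_support cosN divff ?gt_eqF //.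
rewrite (_ : w + - (s / 2) - s / 2 = w - s); last by field.
by rewrite kite_same // expr1n mul1r psi_half psi_halfN; field.
Qed.

Let E_interp w a x y z c0 c1 : x <= y -> y <= z -> 0 < w + x - a -> w + z - a <= pi / 2 ->
  c0 + c1 * x <= E w a x -> c0 + c1 * z <= E w a z -> c0 + c1 * y <= E w a y.
Proof.
move=> xy yz wx wz hx hz.
have [xz|xz] := eqVneq x z.
  by have -> : y = x by apply/eqP; rewrite eq_le xy xz yz.
have zx : 0 < z - x by rewrite subr_gt0 lt_neqAle xz (le_trans xy).
have h := E_chord xy yz wx wz.
have h1 : 0 <= z - y by lra.
have h2 : 0 <= y - x by lra.
rewrite -(ler_pM2l zx); apply: le_trans h.
have -> : (z - x) * (c0 + c1 * y) = (z - y) * (c0 + c1 * x) + (y - x) * (c0 + c1 * z) by ring.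
by apply: lerD; apply: ler_wpM2l.
Qed.

(** The pairs [(a, a')] fill a triangle with one side on the diagonal and a corner at
    [(- s / 2, s / 2)]. Concavity in [a] gives the bound on the side [a' = s / 2]; concavity in [a']
    extends it from there to the diagonal. *)
Let E_upper w a a' c0 c1 : 0 < w -> w + s <= pi / 2 -> - (s / 2) <= a -> a <= a' -> a' <= s / 2 ->
  c0 <= tan (w / 2) -> c0 + c1 * s <= tan ((w + s) / 2) - tan (s / 2) ->
  c0 + c1 * (a' - a) <= E w a a'.
Proof.
move=> w0 w1 a0 aa a1 T0 T1; have pi0 := pi_gt0 R; have s0' := s0; have spi' := spi.
have top : c0 + c1 * (s / 2 - a) <= E w a (s / 2).
  rewrite -(E_refl w a); have -> : c0 + c1 * (s / 2 - a) = (c0 + c1 * (s / 2)) + c1 * - a by ring.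
  apply: (@E_interp w _ (- (s / 2)) (- a) (s / 2)); try lra.
  - have -> : c0 + c1 * (s / 2) + c1 * - (s / 2) = c0 by ring.
    by apply: le_trans T0 _; apply: E_diag; lra.
  - by rewrite E_corner; lra.
have -> : c0 + c1 * (a' - a) = (c0 - c1 * a) + c1 * a' by ring.
apply: (@E_interp w a a a' (s / 2)) => //; try lra.
have -> : c0 - c1 * a + c1 * a = c0 by ring.
by apply: le_trans T0 _; apply: E_diag; lra.
Qed.

(** The same argument below the diagonal, with the corner [(s / 2, - s / 2)], where the gap shrinks
    to [w - s]. *)
Let E_lower w a a' c0 c1 : 0 < w - s -> w <= pi / 2 -> - (s / 2) <= a' -> a' <= a -> a <= s / 2 ->
  c0 <= tan (w / 2) -> c0 - c1 * s <= tan ((w - s) / 2) + tan (s / 2) ->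
  c0 + c1 * (a' - a) <= E w a a'.
Proof.
move=> w0 w1 a0 aa a1 T0 T1; have pi0 := pi_gt0 R; have s0' := s0; have spi' := spi.
have bot : c0 + c1 * (a' - s / 2) <= E w (s / 2) a'.
  have -> : c0 + c1 * (a' - s / 2) = (c0 - c1 * (s / 2)) + c1 * a' by ring.
  apply: (@E_interp w _ (- (s / 2)) a' (s / 2)); try lra.
  - by rewrite E_corner'; lra.
  - have -> : c0 - c1 * (s / 2) + c1 * (s / 2) = c0 by ring.
    by apply: le_trans T0 _; apply: E_diag; lra.
rewrite -(E_refl w a); have -> : c0 + c1 * (a' - a) = (c0 + c1 * a') + c1 * - a by ring.
apply: (@E_interp w _ (- (s / 2)) (- a) (- a')); try lra.
- by rewrite E_refl; lra.
- have -> : c0 + c1 * a' + c1 * - a' = c0 by ring.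
  by apply: le_trans T0 _; apply: E_diag; lra.
Qed.

(* [w] is the angular distance between the two vertices and [c0 + c1 d] a line below
   the graph of [d |-> tan (d / 2)] at the multiples of [s]; the last two terms
   cancel when summed along a closed polygon. *)
Lemma kite_vertex_support (w a a' c0 c1 : R) :
  s <= w + a' - a -> - (s / 2) <= a <= s / 2 -> - (s / 2) <= a' <= s / 2 ->
  (a <= a' -> w + s <= pi / 2) -> (a' < a -> 0 < w - s /\ w <= pi / 2) -> 0 < w ->
  c0 + c1 * w <= tan (w / 2) ->
  (w + s <= pi / 2 -> c0 + c1 * (w + s) <= tan ((w + s) / 2)) ->
  (0 < w - s -> c0 + c1 * (w - s) <= tan ((w - s) / 2)) ->
  c0 + c1 * (w + a' - a) + (vertex_potential a' - vertex_potential a)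
    <= kite (vertex_support a) (vertex_support a') (w + a' - a).
Proof.
move=> wl /andP[a0 a1] /andP[a'0 a'1] hu hl w0 T0 Tu Tl.
have s0' := s0; have spi' := spi.
have sl : tan (s / 2) / s * s = tan (s / 2) by rewrite divfK // gt_eqF.
suff : (c0 + c1 * w) + (c1 - tan (s / 2) / s) * (a' - a) <= E w a a'.
  by rewrite /E /vertex_potential -/(psi a) -/(psi a'); lra.
have [aa|aa] := leP a a'.
  have h := hu aa; have := Tu h => T1.
  by apply: E_upper => //; lra.
have [h1 h2] := hl aa; have := Tl h1 => T1.
by apply: E_lower => //; lra.
Qed.

End Pivot.

(** The residue of [x - t0] modulo [s]. When [t0] is a vertex direction of M, subtracting [s / 2]
    gives the angle from the nearest vertex of the polar polygon, the argument that [vertex_support]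
    expects. *)
Definition vertex_offset (R : realType) (s t0 x : R) : R :=
  x - t0 - s * (Num.floor ((x - t0) / s))%:~R.

Lemma vertex_offset_itv (R : realType) (s t0 x : R) : 0 < s ->
  0 <= vertex_offset s t0 x < s.
Proof.
move=> s0; have /andP[f0 f1] := floor_itv ((x - t0) / s).
rewrite ler_pdivlMr // in f0; rewrite ltr_pdivrMr // intrD mulrDl mul1r in f1.
by rewrite /vertex_offset [s * _]mulrC subr_ge0 f0 ltrBlDl.
Qed.

Lemma vertex_offset_period (R : realType) (s t0 x : R) m : 0 < s ->
  vertex_offset s t0 (x + s * m%:R) = vertex_offset s t0 x.
Proof.
move=> s0; rewrite /vertex_offset.
have -> : (x + s * m%:R - t0) / s = (x - t0) / s + m%:R by field; rewrite gt_eqF.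
rewrite floorDrz ?natr_int // intrD (_ : m%:R = m%:Z%:~R) // intrKfloor; ring.
Qed.

(** A secant of a convex function lies below it outside the interval of its two nodes, and no grid
    point lies strictly between [j] and [j.+1]. *)
Lemma line_le_tan (R : realType) (s : R) (j g : nat) :
  0 < s -> s * j.+1%:R < pi -> s * g%:R < pi ->
  tan (s * j%:R / 2) + (g%:R - j%:R) * (tan (s * j.+1%:R / 2) - tan (s * j%:R / 2))
    <= tan (s * g%:R / 2).
Proof.
move=> s0 sj sg; have s20 : 0 < s / 2 by rewrite divr_gt0.
have E (u : R) : s * u / 2 = s / 2 * u by rewrite mulrAC.
have J : j.+1%:R = j%:R + 1 :> R by rewrite -natr1.
have j0 : 0 <= j%:R :> R by rewrite ler0n.
have g0 : 0 <= g%:R :> R by rewrite ler0n.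
have pos (u : R) : 0 <= u -> 0 <= s / 2 * u by move=> u0; rewrite mulr_ge0 // ltW.
have le (u v : R) : u <= v -> s / 2 * u <= s / 2 * v by move=> uv; rewrite ler_pM2l.
have lt (u : R) : s * u < pi -> s / 2 * u < pi / 2 by rewrite -E ltr_pM2r.
rewrite !E.
have [gj|jg] := leqP g j.
  have gj' : g%:R <= j%:R :> R by rewrite ler_nat.
  have := @tan_chord R (s / 2 * g%:R) (s / 2 * j%:R) (s / 2 * j.+1%:R).
  rewrite pos // !le //; last by rewrite J lerDl.
  by move=> /(_ isT isT isT (lt _ sj)) H; rewrite -(ler_pM2l s20); move: H; rewrite J; lra.
have gj' : j.+1%:R <= g%:R :> R by rewrite ler_nat.
have := @tan_chord R (s / 2 * j%:R) (s / 2 * j.+1%:R) (s / 2 * g%:R).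
rewrite pos // !le //; last by rewrite J lerDl.
by move=> /(_ isT isT isT (lt _ sg)) H; rewrite -(ler_pM2l s20); move: H; rewrite J; lra.
Qed.

(** Each [j] gives a bound, the secant through [j] and [j.+1] summed over gaps of total [2 * pi].
    When [j] is the integer part of [2 k / n], it is the area of the n-gon with flush sides and gaps
    [s * j] and [s * j.+1]. *)
Lemma kite_sum_flush (R : realType) (n k m j : nat) (th : nat -> R) (t0 : R)
    (s := pi / k%:R)
    (h := fun i => vertex_support s (vertex_offset s t0 (th i) - s / 2)) :
  (1 < k)%N -> th n = th 0%N + 2 * pi ->
  (forall i, (i < n)%N -> s <= th i.+1 - th i < s * m%:R) ->
  s * m%:R <= pi / 2 -> s * j.+1%:R < pi ->
  n%:R * tan (s * j%:R / 2) +
    (2 * k%:R - n%:R * j%:R) * (tan (s * j.+1%:R / 2) - tan (s * j%:R / 2))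
  <= \sum_(0 <= i < n) kite (h i) (h i.+1) (th i.+1 - th i).
Proof.
move=> k1 thn gap mpi jpi; have pi0 := pi_gt0 R.
have k0 : 0 < k%:R :> R by rewrite ltr0n ltnW.
have s0 : 0 < s by rewrite divr_gt0.
have sk : s * k%:R = pi by rewrite /s divfK // gt_eqF.
have spi : s < pi by rewrite -sk ltr_pMr // ltr1n.
pose T i : R := tan (s * i%:R / 2).
pose c1 := (T j.+1 - T j) / s; pose c0 := T j - c1 * (s * j%:R).
have c1s : c1 * s = T j.+1 - T j by rewrite /c1 divfK // gt_eqF.
pose a i := vertex_offset s t0 (th i) - s / 2.
have ab i : - (s / 2) <= a i < s / 2.
  by have := vertex_offset_itv t0 (th i) s0; rewrite /a; lra.
have line (g : nat) : s * g%:R < pi -> c0 + c1 * (s * g%:R) <= T g.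
  move=> /(line_le_tan s0 jpi).
  have -> : c0 + c1 * (s * g%:R) = T j + (g%:R - j%:R) * (c1 * s) by rewrite /c0; ring.
  by rewrite c1s.
have term i : (i < n)%N -> c0 + c1 * (th i.+1 - th i) +
    (vertex_potential s (a i.+1) - vertex_potential s (a i)) <=
    kite (h i) (h i.+1) (th i.+1 - th i).
  move=> iN; have /andP[g0 g1] := gap i iN.
  (* [s * z] is the angle between the two vertices about which the sides pivot. It is positive
     because the gap is at least [s] while the offsets differ by less than [s]. *)
  pose z : int := Num.floor ((th i.+1 - t0) / s) - Num.floor ((th i - t0) / s).
  have wE : th i.+1 - th i = s * z%:~R + a i.+1 - a i.
    by rewrite /a /vertex_offset /z intrB; ring.
  have abi := ab i; have abi1 := ab i.+1.
  have z0 : 0 < z.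
    rewrite -(ltr0z R) -(pmulr_rgt0 _ s0); move: g0; rewrite wE; lra.
  have [g zE] : exists g : nat, z = g.+1%:Z by case: (z) z0 => // -[|g] // _; exists g.
  have wE' : th i.+1 - th i = s * g.+1%:R + a i.+1 - a i by rewrite wE zE.
  rewrite /h wE' -!/(a _).
  have G : g.+1%:R = g%:R + 1 :> R by rewrite -natr1.
  have up : a i <= a i.+1 -> s * g.+1%:R + s <= pi / 2.
    move=> aa; apply: le_trans mpi.
    have : (g.+1 < m)%N.
      by rewrite -(ltr_nat R) -(ltr_pM2l s0); move: g1; rewrite wE'; lra.
    rewrite -(ler_nat R) -(ler_pM2l s0) => h1; apply: le_trans h1.
    by rewrite -[in leRHS]natr1 mulrDr mulr1.
  have down : a i.+1 < a i -> (0 < g)%N /\ s * g.+1%:R <= pi / 2.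
    move=> aa; split.
      rewrite -(ltr0n R) -(pmulr_rgt0 _ s0); move: g0; rewrite wE' G mulrDr mulr1; lra.
    apply: le_trans mpi; rewrite ler_pM2l // ler_nat -(ltr_nat R) -(ltr_pM2l s0).
    by move: g1; rewrite wE' G mulrDr; lra.
  have wle : s * g.+1%:R <= pi / 2.
    by have [/up|/down[_ //]] := leP (a i) (a i.+1); lra.
  apply: (@kite_vertex_support R s s0 spi (s * g.+1%:R) (a i) (a i.+1) c0 c1) => //.
  - by rewrite -wE'.
  - by lra.
  - by lra.
  - move=> /down[g2 w2]; split=> //.
    by rewrite G mulrDr mulr1 addrK mulr_gt0 ?ltr0n.
  - by rewrite mulr_gt0.
  - by apply: line; lra.
  - move=> w1; have E : s * g.+1%:R + s = s * g.+2%:R by rewrite -[in RHS]natr1; ring.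
    by rewrite E; apply: line; rewrite -E; lra.
  - rewrite G mulrDr mulr1 addrK => _; apply: line.
    by move: wle; rewrite G mulrDr; lra.
have sum_le : \sum_(0 <= i < n) (c0 + c1 * (th i.+1 - th i) +
    (vertex_potential s (a i.+1) - vertex_potential s (a i))) <=
    \sum_(0 <= i < n) kite (h i) (h i.+1) (th i.+1 - th i).
  by apply: ler_sum_nat => i /andP[_ iN]; exact: term.
apply: le_trans sum_le; rewrite big_split big_split /= -mulr_sumr telescope_sumr //.
rewrite (telescope_sumr (fun i => vertex_potential s (a i))) // thn.
(* A full turn is [2 * k] periods, so the potentials cancel around the polygon. *)
have an : a n = a 0%N.
  rewrite /a thn; congr (_ - _).
  have -> : 2 * pi = s * (2 * k)%:R by rewrite natrM mulrCA sk.
  exact: vertex_offset_period.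
rewrite an subrr addr0 sumr_const_nat subn0 addrAC subrr add0r -sk -[c0 *+ n]mulr_natl.
rewrite le_eqVlt; apply/orP; left; apply/eqP.
have -> : tan (s * j.+1%:R / 2) - tan (s * j%:R / 2) = c1 * s by rewrite c1s.
rewrite /c0 /T; ring.
Qed.

(** * Numerical estimates *)

Lemma cos3x (R : realType) (x : R) : cos (3 * x) = cos x * (4 * cos x ^+ 2 - 3).
Proof.
have -> : 3 * x = x + x + x by ring.
rewrite !cosD !sinD; have := sin2cos2 x; move: (sin x) (cos x) => s c h.
have -> : (c * c - s * s) * c - (s * c + c * s) * s = c * (c ^+ 2 - 3 * s ^+ 2) by ring.
by rewrite h; ring.
Qed.

Lemma sin3x (R : realType) (x : R) : sin (3 * x) = sin x * (4 * cos x ^+ 2 - 1).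
Proof.
have -> : 3 * x = x + x + x by ring.
rewrite !sinD !cosD; have := sin2cos2 x; move: (sin x) (cos x) => s c h.
have -> : (s * c + c * s) * c + (c * c - s * s) * s = s * (3 * c ^+ 2 - s ^+ 2) by ring.
by rewrite h; ring.
Qed.

Lemma tan2_sqr (R : realType) (x : R) : 0 <= x < pi / 2 ->
  (1 + tan x ^+ 2) * cos x ^+ 2 = 1.
Proof.
move=> xb; have c0 := lt0r_neq0 (cos_gt0_itv xb).
by rewrite -cos2_tan2 // mulVf // expf_neq0.
Qed.

Lemma tan_double (R : realType) (x : R) : 0 <= x < pi / 4 ->
  tan x < 1 /\ tan (2 * x) * (1 - tan x ^+ 2) = 2 * tan x.
Proof.
move=> /andP[x0 x1]; have pi0 := pi_gt0 R.
have t1 : tan x < 1.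
  rewrite -(@tan_piquarter R) ltr_tan ?in_itv //=; lra.
split=> //; have t0 : 0 <= tan x by apply: tan_ge0; lra.
rewrite mulr_natl tan_mulr2n ?gt_eqF ?cos_gt0_itv //; last by lra.
rewrite divfK ?mulr_natl // gt_eqF // subr_gt0 -(expr1n _ 2).
by rewrite ltr_pXn2r ?nnegrE.
Qed.

Lemma tan_pi6 (R : realType) : tan (pi / 6 : R) ^+ 2 = 1 / 3.
Proof.
have pi0 := pi_gt0 R.
have xb : 0 <= (pi : R) / 6 < pi / 2 by lra.
have c0 := cos_gt0_itv xb.
have : cos (3 * (pi / 6 : R)) = 0.
  by rewrite -(@cos_pihalf R); congr cos; field.
rewrite cos3x => /eqP; rewrite mulf_eq0 gt_eqF //= => /eqP c2.
by have := tan2_sqr xb; nra.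
Qed.

Lemma tan_pi6_itv (R : realType) : (577 + 35 / 100) / 1000 <= tan (pi / 6 : R) <= (577 + 36 / 100) / 1000.
Proof.
have pi0 := pi_gt0 R.
have t0 : 0 <= tan (pi / 6 : R) by apply: tan_ge0; lra.
have t2 := tan_pi6 R; apply/andP; split; nra.
Qed.

(** Three halvings from [pi / 6]. The angle is [pi / (6 * k)] at [k = 8], the largest one met by the
    hexagon estimates, and it also yields the bounds on [pi]. *)
Lemma tan_pi48_itv (R : realType) : (65 + 5 / 10) / 1000 <= tan (pi / 48 : R) <= (65 + 6 / 10) / 1000.
Proof.
have pi0 := pi_gt0 R.
have [a1 a2] : tan (pi / 12 : R) < 1 /\ tan (pi / 6 : R) * (1 - tan (pi / 12) ^+ 2) = 2 * tan (pi / 12).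
  have := @tan_double R (pi / 12); have -> : 2 * (pi / 12) = pi / 6 :> R by field.
  by apply; lra.
have [b1 b2] : tan (pi / 24 : R) < 1 /\ tan (pi / 12 : R) * (1 - tan (pi / 24) ^+ 2) = 2 * tan (pi / 24).
  have := @tan_double R (pi / 24); have -> : 2 * (pi / 24) = pi / 12 :> R by field.
  by apply; lra.
have [c1 c2] : tan (pi / 48 : R) < 1 /\ tan (pi / 24 : R) * (1 - tan (pi / 48) ^+ 2) = 2 * tan (pi / 48).
  have := @tan_double R (pi / 48); have -> : 2 * (pi / 48) = pi / 24 :> R by field.
  by apply; lra.
have a0 : 0 <= tan (pi / 12 : R) by apply: tan_ge0; lra.
have b0 : 0 <= tan (pi / 24 : R) by apply: tan_ge0; lra.
have c0 : 0 <= tan (pi / 48 : R) by apply: tan_ge0; lra.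
have /andP[t1 t2] := tan_pi6_itv R.
move: (tan (pi / 6 : R)) (tan (pi / 12 : R)) (tan (pi / 24 : R)) (tan (pi / 48 : R)) t1 t2 a0 a1 a2 b0 b1 b2 c0 c1 c2.
move=> t a b c t1 t2 a0 a1 a2 b0 b1 b2 c0 c1 c2.
have {}t1 : (267 + 94 / 100) / 1000 <= a <= (267 + 97 / 100) / 1000 by apply/andP; split; nra.
have /andP[a3 a4] := t1.
have /andP[b3 b4] : (131 + 64 / 100) / 1000 <= b <= (131 + 67 / 100) / 1000 by apply/andP; split; nra.
apply/andP; split; nra.
Qed.

(** The tangents of [tan] at [0] and at [pi / 48] bound [pi / 48] above by [tan] and below by
    [tan / (1 + tan ^ 2)]. *)
Lemma pi_itv (R : realType) : 3 + 13 / 100 <= (pi : R) <= 3 + 149 / 1000.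
Proof.
have pi0 := pi_gt0 R; have /andP[t1 t2] := tan_pi48_itv R.
have h0 := @tan_tangent R (pi / 48) 0; have h1 := @tan_tangent R 0 (pi / 48).
rewrite tan0 in h0 h1.
have {}h0 : tan (pi / 48 : R) + (1 + tan (pi / 48) ^+ 2) * (0 - pi / 48) <= 0 by apply: h0; lra.
have {}h1 : 0 + (1 + 0 ^+ 2) * (pi / 48 - 0) <= tan (pi / 48) :> R by apply: h1; lra.
apply/andP; split; nra.
Qed.

(** For [x = pi / 5] the angles [3 x] and [2 x] are supplementary, which makes [cos x] the positive
    root of a quadratic. The seventh of [pi] below works alike with [3 x] and [4 x] and leads to a
    cubic. *)
Lemma tan_pi5_ge (R : realType) : 726 / 1000 <= tan (pi / 5 : R).
Proof.
have pi0 := pi_gt0 R.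
have xb : 0 <= (pi : R) / 5 < pi / 2 by lra.
have c0 := cos_gt0_itv xb.
have s0 : 0 < sin (pi / 5 : R) by apply: sin_gt0_pi; lra.
have E : sin (3 * (pi / 5)) = sin (pi / 5 + pi / 5) :> R.
  have -> : 3 * (pi / 5) = - (pi / 5 + pi / 5) + pi :> R by field.
  by rewrite sinDpi sinN opprK.
have {}E : 4 * cos (pi / 5 : R) ^+ 2 - 1 = 2 * cos (pi / 5 : R).
  apply: (mulfI (lt0r_neq0 s0)); rewrite -sin3x E sinD; ring.
have := tan2_sqr xb; have t0 := tan_ge0 xb.
move: (tan (pi / 5 : R)) (cos (pi / 5 : R)) c0 E t0 => t c c0 E t0 tc.
rewrite leNgt; apply/negP => lt.
have [a aE] : exists a : R, a = (809 + 2 / 10) / 1000 by eexists.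
have [b bE] : exists b : R, b = 726 / 1000 by eexists.
rewrite -bE in lt.
have b0 : 0 <= b by lra.
have a0 : 0 <= a by lra.
have cl : c <= a.
  rewrite leNgt; apply/negP => cl.
  have h : 0 < (c - a) * c by rewrite mulr_gt0 // subr_gt0.
  nra.
have c2 : c ^+ 2 <= a ^+ 2 by rewrite ler_pXn2r ?nnegrE // ltW.
have t2 : t ^+ 2 < b ^+ 2 by rewrite ltr_pXn2r ?nnegrE.
have ab : (1 + b ^+ 2) * a ^+ 2 < 1 by rewrite aE bE; lra.
suff : (1 + t ^+ 2) * c ^+ 2 < 1 by rewrite tc ltxx.
apply: le_lt_trans ab; apply: ler_pM => //; first by rewrite addr_ge0 ?sqr_ge0.
  by rewrite sqr_ge0.
by rewrite lerD2l ltW.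
Qed.

Lemma tan_pi7_ge (R : realType) : 48 / 100 <= tan (pi / 7 : R).
Proof.
have pi0 := pi_gt0 R.
have xb : 0 <= (pi : R) / 7 < pi / 2 by lra.
have c0 := cos_gt0_itv xb.
have s0 : 0 < sin (pi / 7 : R) by apply: sin_gt0_pi; lra.
have E : sin (3 * (pi / 7)) = sin ((pi / 7 + pi / 7) + (pi / 7 + pi / 7)) :> R.
  have -> : 3 * (pi / 7) = - ((pi / 7 + pi / 7) + (pi / 7 + pi / 7)) + pi :> R by field.
  by rewrite sinDpi sinN opprK.
have {}E : 4 * cos (pi / 7 : R) ^+ 2 - 1 = 4 * cos (pi / 7 : R) * (2 * cos (pi / 7) ^+ 2 - 1).
  apply: (mulfI (lt0r_neq0 s0)); rewrite -sin3x E !sinD !cosD.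
  have := sin2cos2 (pi / 7 : R); move: (sin _) (cos _) => s c h.
  have -> : (s * c + c * s) * (c * c - s * s) + (c * c - s * s) * (s * c + c * s) =
     s * (4 * c * (c ^+ 2 - s ^+ 2)) by ring.
  by rewrite h; ring.
have t6 : tan (pi / 7 : R) <= tan (pi / 6) by apply: tan_le; lra.
have := tan2_sqr xb; have t0 := tan_ge0 xb; have t2 := tan_pi6 R.
have /andP[t3 t4] := tan_pi6_itv R.
move: (tan (pi / 7 : R)) (cos (pi / 7 : R)) c0 E t6 t0 => t c c0 E t6 t0 tc.
rewrite leNgt; apply/negP => lt.
have [a aE] : exists a : R, a = (901 + 5 / 10) / 1000 by eexists.
have [b bE] : exists b : R, b = 48 / 100 by eexists.
rewrite -bE in lt.
have b0 : 0 <= b by lra.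
have a0 : 0 <= a by lra.
have c1 : a < c.
  rewrite ltNge; apply/negP => cl.
  have c2 : c ^+ 2 <= a ^+ 2 by rewrite ler_pXn2r ?nnegrE // ltW.
  have tb : t ^+ 2 < b ^+ 2 by rewrite ltr_pXn2r ?nnegrE.
  have ab : (1 + b ^+ 2) * a ^+ 2 < 1 by rewrite aE bE; lra.
  suff : (1 + t ^+ 2) * c ^+ 2 < 1 by rewrite tc ltxx.
  apply: le_lt_trans ab; apply: ler_pM => //; first by rewrite addr_ge0 ?sqr_ge0.
    by rewrite sqr_ge0.
  by rewrite lerD2l ltW.
(* Expanded in powers of [c - a], the cubic satisfied by [cos (pi / 7)] has only positive
   coefficients, so it has no root beyond [a]. *)
have [d dE] : exists d, d = c - a by eexists.
have d0 : 0 < d by rewrite dE subr_gt0.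
have h1 : 0 < d ^+ 2 by rewrite exprn_gt0.
have h2 : 0 < d ^+ 3 by rewrite exprn_gt0.
have {dE} cE : c = a + d by rewrite dE; ring.
by move: E; rewrite cE aE; lra.
Qed.

Lemma tan_sum_ge (R : realType) n (x a : nat -> R) :
  (forall i, (i < n)%N -> 0 <= x i < pi / 2) ->
  (forall i, (i < n)%N -> 0 <= a i < pi / 2) ->
  \sum_(0 <= i < n) (tan (a i) + (1 + tan (a i) ^+ 2) * (x i - a i)) <=
  \sum_(0 <= i < n) tan (x i).
Proof.
by move=> xb ab; apply: ler_sum_nat => i /andP[_ iN]; apply: tan_tangent; auto.
Qed.

Lemma sum_tangent (R : realType) n (x : nat -> R) (a t c : R) :
  \sum_(0 <= i < n) (t + c * (x i - a)) =
  n%:R * t + c * (\sum_(0 <= i < n) x i - n%:R * a).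
Proof.
elim: n => [|n IH]; first by rewrite !big_geq //; ring.
by rewrite !big_nat_recr //= IH -natr1; ring.
Qed.

Lemma tan_sum_ge_cst (R : realType) n (x : nat -> R) a :
  (forall i, (i < n)%N -> 0 <= x i < pi / 2) -> \sum_(0 <= i < n) x i = pi ->
  0 <= a < pi / 2 ->
  n%:R * tan a + (1 + tan a ^+ 2) * (pi - n%:R * a) <= \sum_(0 <= i < n) tan (x i).
Proof.
move=> xb xs ab; have := @tan_sum_ge R n x (fun=> a) xb (fun _ _ => ab).
by rewrite sum_tangent xs.
Qed.

(** The gap [i0] gets its own tangent point [b], so that the bound registers how far this gap is
    from the mean. *)
Lemma tan_sum_ge_but1 (R : realType) n (x : nat -> R) i0 a b :
  (forall i, (i < n)%N -> 0 <= x i < pi / 2) -> \sum_(0 <= i < n) x i = pi ->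
  0 <= a < pi / 2 -> 0 <= b < pi / 2 -> (i0 < n)%N ->
  tan b + (1 + tan b ^+ 2) * (x i0 - b) +
    ((n%:R - 1) * tan a + (1 + tan a ^+ 2) * (pi - x i0 - (n%:R - 1) * a))
  <= \sum_(0 <= i < n) tan (x i).
Proof.
move=> xb xs ab bb i0n.
have := @tan_sum_ge R n x (fun i => if i == i0 then b else a) xb.
have ab' i : (i < n)%N -> 0 <= (if i == i0 then b else a) < pi / 2 by case: eqP.
move=> /(_ ab'); apply: le_trans.
pose g i := tan a + (1 + tan a ^+ 2) * (x i - a).
pose f i := tan b + (1 + tan b ^+ 2) * (x i - b).
have -> : \sum_(0 <= i < n) (tan (if i == i0 then b else a) +
     (1 + tan (if i == i0 then b else a) ^+ 2) * (x i - (if i == i0 then b else a))) =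
   \sum_(0 <= i < n) g i + \sum_(0 <= i < n | i == i0) (f i - g i).
  rewrite [X in _ + X]big_mkcond /= -big_split /=; apply: eq_bigr => i _.
  by rewrite /f /g; case: eqP => _; [rewrite addrC subrK|rewrite addr0].
rewrite big_nat1_eq i0n /= /g sum_tangent xs.
rewrite le_eqVlt; apply/orP; left; apply/eqP; rewrite /f; ring.
Qed.

(* Area of the least hexagon circumscribed about the regular 2k-gon of inradius 1:
   its sides are flush with sides of the 2k-gon, as equally spaced as possible. *)
Definition hexagon_area (R : realType) (k : nat) : R :=
  (6 - 2 * (k %% 3)%N%:R) * tan (pi / k%:R * (k %/ 3)%N%:R / 2) +
  2 * (k %% 3)%N%:R * tan (pi / k%:R * (k %/ 3)%N.+1%:R / 2).

Lemma hexagon_area_mod0 (R : realType) k : (0 < k)%N -> (k %% 3 = 0)%N ->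
  hexagon_area R k = 6 * tan (pi / 6).
Proof.
move=> k0 m0; rewrite /hexagon_area m0 mulr0 subr0 mul0r addr0; congr (_ * tan _).
have kE : k%:R = 3 * (k %/ 3)%N%:R :> R by rewrite {1}(divn_eq k 3) m0 addn0 natrM mulrC.
have j0 : (k %/ 3)%N%:R != 0 :> R.
  by apply: contraTneq k0 => j0; rewrite -(ltr0n R) kE j0 mulr0 ltxx.
by rewrite kE; field.
Qed.

Lemma tan_pi6D (R : realType) (x : R) : 0 <= x < pi / 6 ->
  tan (pi / 6 + x) = (tan (pi / 6) + tan x) / (1 - tan (pi / 6) * tan x) /\
  tan (pi / 6 - x) = (tan (pi / 6) - tan x) / (1 + tan (pi / 6) * tan x).
Proof.
move=> xb; have pi0 := pi_gt0 R.
have c0 : cos (pi / 6 : R) != 0 by rewrite gt_eqF // cos_gt0_itv //; lra.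
have c1 : cos x != 0 by rewrite gt_eqF // cos_gt0_itv //; lra.
split; first by rewrite tanD.
by rewrite tanD ?cosN // tanN mulrN opprK.
Qed.

Lemma mod3_cases k : (k %% 3 != 0)%N ->
  (k = 3 * (k %/ 3) + 1 /\ k %% 3 = 1)%N \/ (k = 3 * (k %/ 3) + 2 /\ k %% 3 = 2)%N.
Proof. by lia. Qed.

(* With u = tan (pi / 6k) the angles are pi/6 - u, pi/6 + 2u or pi/6 - 2u, pi/6 + u. *)
Lemma hexagon_area_le (R : realType) k (U : R) : (8 <= k)%N -> (k %% 3 != 0)%N ->
  tan (pi / (6 * k%:R)) <= U -> U <= 525 / 10 / 1000 ->
  hexagon_area R k <= 6 * tan (pi / 6) + 16 / 3 * U ^+ 2 * (3 * tan (pi / 6) + U) / (96 / 100).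
Proof.
move=> k8 k3; have pi0 := pi_gt0 R.
set x := pi / _ => uU U1; set u := tan x in uU.
set j := (k %/ 3)%N.
have k8' : 8 <= k%:R :> R by rewrite (ler_nat R 8).
have k0 : k%:R != 0 :> R by rewrite gt_eqF //; lra.
have xE : x * (6 * k%:R) = pi by rewrite /x divfK // mulf_neq0.
have x0 : 0 < x by rewrite /x divr_gt0 // mulr_gt0 //; lra.
have x1 : 2 * x < pi / 6 by rewrite -xE; nra.
have xb : 0 <= x < pi / 6 by lra.
have x2b : 0 <= 2 * x < pi / 6 by lra.
have [ep em] := tan_pi6D xb; have [ep2 em2] := tan_pi6D x2b.
have [u1 v1] : tan x < 1 /\ tan (2 * x) * (1 - tan x ^+ 2) = 2 * tan x by apply: tan_double; lra.
have u0 : 0 <= u by apply: tan_ge0; lra.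
have t2 := tan_pi6 R; have /andP[t3 t4] := tan_pi6_itv R.
have v2 : tan (2 * x) = 2 * u / (1 - u ^+ 2).
  by rewrite -v1 mulfK // gt_eqF // -/u; nra.
rewrite -/u in ep em; rewrite v2 in ep2 em2.
set t := tan (pi / 6) in t2 t3 t4 ep em ep2 em2 *.
have U0 : 0 <= U by apply: le_trans uU.
have uu : u ^+ 2 <= U ^+ 2 by rewrite ler_pXn2r ?nnegrE.
have fin D (w : R) : 96 / 100 <= D -> w <= 3 * t + U -> 0 <= w ->
    6 * t + 16 / 3 * u ^+ 2 * w / D <=
    6 * t + 16 / 3 * U ^+ 2 * (3 * t + U) / (96 / 100).
  move=> D1 w1 w0; rewrite lerD2l; apply: ler_pM.
  - by rewrite mulr_ge0 // mulr_ge0 // ?sqr_ge0.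
  - by rewrite invr_ge0; clear -D1; lra.
  - apply: ler_pM => //; first by rewrite mulr_ge0 ?sqr_ge0.
    by rewrite ler_wpM2l.
  - by rewrite lef_pV2 ?posrE //; clear -D1; lra.
have du : 0 < 1 - u ^+ 2 by clear -u0 uU U1; nra.
have tu0 : 0 <= t * u by rewrite mulr_ge0 //; clear -t3; lra.
have tu1 : t * u <= 31 / 1000 by clear -t3 t4 u0 uU U1; nra.
have uu1 : u ^+ 2 <= 28 / 10 / 1000 by clear -u0 uU U1; nra.
have pk : pi / k%:R = 6 * x by rewrite /x; field.
have p6 : pi / 6 = k%:R * x by rewrite /x; field.
have e1 w : 1 + t * w != 0 -> (t - w) / (1 + t * w) = t - 4 / 3 * w / (1 + t * w).
  move=> w0; have -> : t - w = t * (1 + t * w) - (1 + t ^+ 2) * w by ring.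
  by rewrite t2; field.
have e2 w : 1 - t * w != 0 -> (t + w) / (1 - t * w) = t + 4 / 3 * w / (1 - t * w).
  move=> w0; have -> : t + w = t * (1 - t * w) + (1 + t ^+ 2) * w by ring.
  by rewrite t2; field.
have p1 : 0 < 1 + t * u by clear -tu0; lra.
have p2 : 0 < 1 - t * u by clear -tu1; lra.
have p3 : 0 < 1 - u ^+ 2 - 2 * t * u by clear -tu1 uu1; lra.
have p4 : 0 < 1 - u ^+ 2 + 2 * t * u by clear -du tu0; lra.
have p5 : 0 < 1 - t * (2 * u / (1 - u ^+ 2)).
  have -> : 1 - t * (2 * u / (1 - u ^+ 2)) = (1 - u ^+ 2 - 2 * t * u) / (1 - u ^+ 2).
    by field; rewrite gt_eqF.
  by rewrite divr_gt0.
have p7 : 0 < 1 + t * (2 * u / (1 - u ^+ 2)).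
  have -> : 1 + t * (2 * u / (1 - u ^+ 2)) = (1 - u ^+ 2 + 2 * t * u) / (1 - u ^+ 2).
    by field; rewrite gt_eqF.
  by rewrite divr_gt0.
have D1 : 96 / 100 <= (1 - u ^+ 2 - 2 * t * u) * (1 + t * u).
  have -> : (1 - u ^+ 2 - 2 * t * u) * (1 + t * u) = (1 - u ^+ 2 - 2 * (t * u)) * (1 + t * u) by ring.
  move: (t * u) (u ^+ 2) tu0 tu1 uu1 (sqr_ge0 u) => m q m0 m1 q1 q0; clear -m0 m1 q1 q0; nra.
have D2 : 96 / 100 <= (1 - t * u) * (1 - u ^+ 2 + 2 * t * u).
  have -> : (1 - t * u) * (1 - u ^+ 2 + 2 * t * u) = (1 - t * u) * (1 - u ^+ 2 + 2 * (t * u)) by ring.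
  move: (t * u) (u ^+ 2) tu0 tu1 uu1 (sqr_ge0 u) => m q m0 m1 q1 q0; clear -m0 m1 q1 q0; nra.
have [[k1 m1]|[k2 m2]] := mod3_cases k3; [rewrite -/j in k1|rewrite -/j in k2].
- have kE : k%:R = 3 * j%:R + 1 :> R by rewrite {1}k1 natrD natrM.
  rewrite /hexagon_area m1 -/j pk.
  have -> : 6 * x * j%:R / 2 = pi / 6 - x by rewrite p6 kE; field.
  have -> : 6 * x * j.+1%:R / 2 = pi / 6 + 2 * x by rewrite p6 kE -natr1; field.
  rewrite em ep2 e1 ?e2 //; try by rewrite gt_eqF.
  (* The half-gaps average to [pi / 6], so the terms of first order in [u] cancel and the excess
     over the regular hexagon is quadratic in [u]. *)
  have -> : (6 - 2 * 1) * (t - 4 / 3 * u / (1 + t * u)) +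
     2 * 1 * (t + 4 / 3 * (2 * u / (1 - u ^+ 2)) / (1 - t * (2 * u / (1 - u ^+ 2)))) =
     6 * t + 16 / 3 * u ^+ 2 * (3 * t + u) / ((1 - u ^+ 2 - 2 * t * u) * (1 + t * u)).
    by field; rewrite ?gt_eqF.
  by apply: fin; rewrite ?D1 // ?lerD2l //; clear -t3 u0; lra.
- have kE : k%:R = 3 * j%:R + 2 :> R by rewrite {1}k2 natrD natrM.
  rewrite /hexagon_area m2 -/j pk.
  have -> : 6 * x * j%:R / 2 = pi / 6 - 2 * x by rewrite p6 kE; field.
  have -> : 6 * x * j.+1%:R / 2 = pi / 6 + x by rewrite p6 kE -natr1; field.
  rewrite em2 ep e1 ?e2 //; try by rewrite gt_eqF.
  have -> : (6 - 2 * 2) * (t - 4 / 3 * (2 * u / (1 - u ^+ 2)) / (1 + t * (2 * u / (1 - u ^+ 2)))) +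
     2 * 2 * (t + 4 / 3 * u / (1 - t * u)) =
     6 * t + 16 / 3 * u ^+ 2 * (3 * t - u) / ((1 - t * u) * (1 - u ^+ 2 + 2 * t * u)).
    by field; rewrite ?gt_eqF.
  by apply: fin; rewrite ?D2 //; clear -u0 U0 uU U1 t3; lra.
Qed.

(** The sum is the area of an n-gon circumscribed about the unit circle. The tangent of [tan] at
    [pi / n] gives the regular n-gon; the tangent at [pi / 4] is enough for triangles, the one at
    [pi / 7] for octagons, and the area of the disk from [n = 9] on. *)
Lemma circle_bound (R : realType) n (x : nat -> R) : (2 < n)%N ->
  (forall i, (i < n)%N -> 0 <= x i < pi / 2) -> \sum_(0 <= i < n) x i = pi ->
  (if n == 3 then 4 else if n == 4 then 4 else if n == 5 then 363 / 100
   else if n == 6 then 6 * tan (pi / 6)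
   else if n == 7 then 336 / 100 else if n == 8 then 325 / 100 else 313 / 100)
  <= \sum_(0 <= i < n) tan (x i).
Proof.
move=> n2 xb xs; have pi0 := pi_gt0 R.
have /andP[p1 p2] := pi_itv R.
have C m : (0 < m)%N -> (2 < m)%N ->
   n%:R * tan (pi / m%:R) + (1 + tan (pi / m%:R) ^+ 2) * (pi - n%:R * (pi / m%:R)) <= \sum_(0 <= i < n) tan (x i).
  move=> m0 m2; apply: tan_sum_ge_cst => //.
  rewrite divr_ge0 ?ler0n ?(ltW pi0) //= ltr_pM2l // ltf_pV2 ?posrE ?ltr0n //.
  by rewrite (ltr_nat R 2).
have [n3|_] := eqVneq n 3.
  have := C 4 isT isT; rewrite n3 tan_piquarter; lra.
have [n4|_] := eqVneq n 4.
  have := C 4 isT isT; rewrite n4 tan_piquarter; lra.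
have [n5|_] := eqVneq n 5.
  have := C 5 isT isT; have := tan_pi5_ge R; rewrite n5.
  have -> : pi - 5 * (pi / 5) = 0 :> R by field.
  by rewrite mulr0; lra.
have [n6|_] := eqVneq n 6.
  have := C 6 isT isT; rewrite n6; have -> : pi - 6 * (pi / 6) = 0 :> R by field.
  by rewrite mulr0 addr0.
have [n7|_] := eqVneq n 7.
  have := C 7 isT isT; have := tan_pi7_ge R; rewrite n7.
  have -> : pi - 7 * (pi / 7) = 0 :> R by field.
  by rewrite mulr0; lra.
have [n8|_] := eqVneq n 8.
  have := C 7 isT isT; have := tan_pi7_ge R; rewrite n8.
  have h : tan (pi / 7 : R) < 1.
    by rewrite -[ltRHS](@tan_piquarter R) ltr_tan ?in_itv //=; lra.
  move: (tan _) h => t t1 t0; apply: le_trans.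
  have : 0 <= (t - 48 / 100) * (8 - 2 * pi / 7) by apply: mulr_ge0; lra.
  have : 0 <= (1 - t) ^+ 2 by rewrite sqr_ge0.
  nra.
have ab : 0 <= (0 : R) < pi / 2 by lra.
have := tan_sum_ge_cst xb xs ab; rewrite tan0; lra.
Qed.

Lemma sqr_bound (R : realDomainType) (b B F : R) : b <= B -> B ^+ 2 <= F -> b <= 0 \/ b ^+ 2 <= F.
Proof.
move=> bB BF; have [b0|b0] := leP b 0; [by left|right].
apply: le_trans BF; rewrite ler_pXn2r // nnegrE ?(ltW b0) //.
exact: le_trans (ltW b0) bB.
Qed.

Lemma sqrtr_le (R : rcfType) (a c : R) : 0 <= c -> a <= c ^+ 2 -> Num.sqrt a <= c.
Proof. by move=> c0 ac; rewrite -(ger0_norm c0) -sqrtr_sqr ler_wsqrtr. Qed.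

(** The two alternatives are the pairs of hexagon value and slope chosen in [dowker_bound]. The
    constants given to [S] are the values of the lines rounded up, and since the lines decrease, the
    value at [n = 9] serves all larger [n]. *)
Lemma circle_dowker (R : realType) n (x : nat -> R) (c sl : R) : (2 < n)%N -> (n != 5)%N -> (n != 6)%N ->
  (forall i, (i < n)%N -> 0 <= x i < pi / 2) -> \sum_(0 <= i < n) x i = pi ->
  (c <= 1869 / 1000 /\ sl = - (36 / 1000)) \/ (c <= 1 + 871 / 1000 + 2 / 10 / 1000 /\ sl = - (4 / 100)) ->
  c + sl * (n%:R - 6) <= 0 \/ (c + sl * (n%:R - 6)) ^+ 2 <= \sum_(0 <= i < n) tan (x i).
Proof.
move=> n2 n5 n6 xb xs csl; have := circle_bound n2 xb xs.
rewrite (negbTE n5) (negbTE n6).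
have S (B C : R) : c + sl * (n%:R - 6) <= B -> B ^+ 2 <= C -> C <= \sum_(0 <= i < n) tan (x i) ->
   c + sl * (n%:R - 6) <= 0 \/ (c + sl * (n%:R - 6)) ^+ 2 <= \sum_(0 <= i < n) tan (x i).
  by move=> cB BC CF; apply: sqr_bound cB (le_trans BC CF).
have [n3|n3] /= := eqVneq n 3.
  by move=> H; case: csl S => -[cl ->] S; apply: (S (1995 / 1000) _ _ _ H); rewrite ?n3; lra.
have [n4|n4] /= := eqVneq n 4.
  by move=> H; case: csl S => -[cl ->] S; apply: (S (1995 / 1000) _ _ _ H); rewrite ?n4; lra.
have [n7|n7] /= := eqVneq n 7.
  by move=> H; case: csl S => -[cl ->] S; apply: (S (1 + 833 / 1000) _ _ _ H); rewrite ?n7; lra.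
have [n8|n8] /= := eqVneq n 8.
  by move=> H; case: csl S => -[cl ->] S; apply: (S (1 + 797 / 1000) _ _ _ H); rewrite ?n8; lra.
have n9 : (9 <= n)%N.
  by move: n2 n3 n4 n5 n6 n7 n8; clear; case: n => [|[|[|[|[|[|[|[|[|n]]]]]]]]].
have n9' : 9 <= n%:R :> R by rewrite (ler_nat R 9).
by move=> H; case: csl S => -[cl ->] S; apply: (S (1 + 761 / 1000) _ _ _ H); lra.
Qed.

(** [tan x / x] increases, so the product is largest at [k = 8], where it is at most 8 * 0.0656. *)
Lemma tan_small (R : realType) k : (8 <= k)%N -> tan (pi / (6 * k%:R)) * k%:R <= 5248 / 10 / 1000 :> R.
Proof.
move=> k8; have pi0 := pi_gt0 R.
have k8' : 8 <= k%:R :> R by rewrite (ler_nat R 8).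
have k0 : 0 < k%:R :> R by lra.
have /andP[_ t2] := tan_pi48_itv R.
have e0 : 0 <= pi / (6 * k%:R) :> R by rewrite divr_ge0 ?mulr_ge0 // ltW.
have e1 : pi / (6 * k%:R) <= pi / 48 :> R.
  have h48 : 48 <= 6 * k%:R :> R by lra.
  by rewrite ler_pM2l // lef_pV2 // posrE; lra.
have := tan_chord (lexx 0) e0 e1; rewrite tan0 mulr0 add0r !subr0 => h.
have {}h : pi / 48 * tan (pi / (6 * k%:R)) <= pi / (6 * k%:R) * tan (pi / 48) :> R by apply: h; lra.
have {}h : (pi * 6 * k%:R / pi) * (pi / 48 * tan (pi / (6 * k%:R))) <= (pi * 6 * k%:R / pi) * (pi / (6 * k%:R) * tan (pi / 48)) :> R.
  by rewrite ler_wpM2l // divr_ge0 ?mulr_ge0 // ltW.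
have piN : pi != 0 :> R by rewrite gt_eqF.
have kN : k%:R != 0 :> R by rewrite gt_eqF.
have E1 : (pi * 6 * k%:R / pi) * (pi / 48 * tan (pi / (6 * k%:R))) = pi * (tan (pi / (6 * k%:R)) * k%:R / 8) :> R.
  by move: (tan _) => tt; move: (pi : R) piN => p pN; field; rewrite ?pN ?kN.
have E2 : (pi * 6 * k%:R / pi) * (pi / (6 * k%:R) * tan (pi / 48)) = pi * tan (pi / 48) :> R.
  by move: (tan _) => tt; move: (pi : R) piN => p pN; field; rewrite ?pN ?kN.
rewrite E1 E2 ler_pM2l // in h.
lra.
Qed.

Lemma hexagon_area_le_tan (R : realType) k (U : R) : (8 <= k)%N -> (k %% 3 != 0)%N ->
  0 <= U -> 5248 / 10 / 1000 <= U * k%:R -> U <= 525 / 10 / 1000 ->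
  hexagon_area R k <= 6 * tan (pi / 6) + 16 / 3 * U ^+ 2 * (3 * tan (pi / 6) + U) / (96 / 100).
Proof.
move=> k8 k3 U0 Uk U1; apply: hexagon_area_le => //.
have k0 : 0 < k%:R :> R by rewrite ltr0n (leq_trans _ k8).
by rewrite -(ler_pM2r k0); apply: le_trans Uk; apply: tan_small.
Qed.

(** The constant 0.0525 is 0.5248 / 10 rounded up, with 0.5248 from [tan_small]; [hexagon_area_le11]
    rounds 0.5248 / 11 in the same way. *)
Lemma hexagon_area_le10 (R : realType) k : (10 <= k)%N -> (k %% 3 != 0)%N ->
  hexagon_area R k <= 3 + 493 / 1000.
Proof.
move=> k10 k3; have k10' : 10 <= k%:R :> R by rewrite (ler_nat R 10).
have k8 : (8 <= k)%N by apply: leq_trans k10.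
have /andP[t1 t2] := tan_pi6_itv R.
have [U UE] : exists U : R, U = 525 / 10 / 1000 by eexists.
have := @hexagon_area_le_tan R k U k8 k3; rewrite {1 2 3}UE => h.
apply: le_trans (h _ _ _) _; [clear; lra|clear -k10'; lra|exact: lexx|]; move: (tan (pi / 6)) t1 t2 => t t1 t2.
rewrite UE; clear -t1 t2; lra.
Qed.

Lemma hexagon_area_le11 (R : realType) k : (11 <= k)%N -> (k %% 3 != 0)%N ->
  hexagon_area R k <= 3 + 489 / 1000.
Proof.
move=> k11 k3; have k11' : 11 <= k%:R :> R by rewrite (ler_nat R 11).
have k8 : (8 <= k)%N by apply: leq_trans k11.
have /andP[t1 t2] := tan_pi6_itv R.
have [U UE] : exists U : R, U = 478 / 10 / 1000 by eexists.
have := @hexagon_area_le_tan R k U k8 k3; rewrite {1 2 3}UE => h.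
apply: le_trans (h _ _ _) _; [clear; lra|clear -k11'; lra|clear; lra|]; move: (tan (pi / 6)) t1 t2 => t t1 t2.
rewrite UE; clear -t1 t2; lra.
Qed.

(** The case [k = 8] lies outside the general hexagon estimate. Its two tangents come from doubling
    [pi / 8] and [3 * pi / 16], the double of the latter being [pi / 4 + pi / 8]. *)
Lemma tan_3pi16 (R : realType) : 664 / 1000 <= tan (pi / 8 * 3 / 2 : R) /\
  hexagon_area R 8 <= 3 + (501 + 38 / 100) / 1000.
Proof.
have pi0 := pi_gt0 R.
have [y1 y2] : tan (pi / 8 : R) < 1 /\ tan (2 * (pi / 8)) * (1 - tan (pi / 8 : R) ^+ 2) = 2 * tan (pi / 8).
  by apply: tan_double; lra.
have [z1 z2] : tan (pi / 8 * 3 / 2 : R) < 1 /\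
    tan (2 * (pi / 8 * 3 / 2)) * (1 - tan (pi / 8 * 3 / 2 : R) ^+ 2) = 2 * tan (pi / 8 * 3 / 2).
  by apply: tan_double; lra.
have e1 : 2 * (pi / 8) = pi / 4 :> R by field.
have e2 : 2 * (pi / 8 * 3 / 2) = pi / 4 + pi / 8 :> R by field.
have y0 : 0 <= tan (pi / 8 : R) by apply: tan_ge0; lra.
have z0 : 0 <= tan (pi / 8 * 3 / 2 : R) by apply: tan_ge0; lra.
rewrite e1 tan_piquarter in y2.
have c4 : cos (pi / 4 : R) != 0 by rewrite gt_eqF // cos_gt0_itv //; lra.
have c8 : cos (pi / 8 : R) != 0 by rewrite gt_eqF // cos_gt0_itv //; lra.
rewrite e2 tanD // tan_piquarter mul1r in z2.
have hE : hexagon_area R 8 = 2 * tan (pi / 8) + 4 * tan (pi / 8 * 3 / 2).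
  rewrite /hexagon_area (_ : 8 %% 3 = 2)%N // (_ : 8 %/ 3 = 2)%N //.
  have -> : pi / 8 * 2 / 2 = pi / 8 :> R by field.
  ring.
rewrite hE; move: (tan (pi / 8)) (tan (pi / 8 * 3 / 2)) y0 y1 y2 z0 z1 z2 => y z y0 y1 y2 z0 z1 z2.
have {}z2 : (1 + y) * (1 - z ^+ 2) = 2 * z * (1 - y).
  by rewrite -z2; field; rewrite gt_eqF // subr_gt0.
have y3 : (414 + 21 / 100) / 1000 <= y by nra.
have y4 : y <= (414 + 22 / 100) / 1000 by nra.
have z3 : (668 + 1 / 10) / 1000 <= z by nra.
have z4 : z <= (668 + 19 / 100) / 1000 by nra.
by split; lra.
Qed.

(* The circle bound alone is enough when some gap is at most [s] or close to a right
   angle: such a hexagon is too far from being equiangular. *)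
Lemma hexagon_bad_gap (R : realType) k (x : nat -> R) i : (8 <= k)%N -> (k %% 3 != 0)%N ->
  (forall i, (i < 6)%N -> 0 <= x i < pi / 2) -> \sum_(0 <= i < 6) x i = pi -> (i < 6)%N ->
  (x i <= pi / 16) \/ pi / k%:R * (k./2)%:R / 2 <= x i ->
  hexagon_area R k <= \sum_(0 <= i < 6) tan (x i).
Proof.
move=> k8 k3 xb xs i6; have pi0 := pi_gt0 R.
have /andP[p1 p2] := pi_itv R; have /andP[t1 t2] := tan_pi6_itv R; have tt := tan_pi6 R.
have ab : 0 <= (pi : R) / 6 < pi / 2 by lra.
have H8 : hexagon_area R k <= 3 + (501 + 38 / 100) / 1000.
  have [k10|k10] := leqP 10 k; first by have := hexagon_area_le10 R k10 k3; lra.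
  have [->|k9] : k = 8 \/ k = 9 by move: k8 k10; clear; lia.
    by have [] := tan_3pi16 R.
  by rewrite k9 in k3.
case=> [lo|hi].
  have b0 : 0 <= (0 : R) < pi / 2 by lra.
  have := tan_sum_ge_but1 xb xs ab b0 i6; rewrite tan0 tt; apply: le_trans.
  move: t1 t2 H8 lo p1 p2; move: (x i) (tan (pi / 6)) (hexagon_area R k) => y t H; move: (pi : R) => p; clear.
  by move=> *; lra.
have b4 : 0 <= (pi : R) / 4 < pi / 2 by lra.
have := tan_sum_ge_but1 xb xs ab b4 i6; rewrite tan_piquarter tt; apply: le_trans.
have k0 : 0 < k%:R :> R by rewrite ltr0n (leq_trans _ k8).
(* For even [k] the threshold is [pi / 4], for odd [k] it is [(pi - pi / k) / 4]. An odd [k >= 8]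
   prime to 3 is at least 11, which gives [5 * pi / 22] and leaves the smaller hexagon area of
   [hexagon_area_le11] to beat. *)
have [ev|od] := boolP (odd k); last first.
  have kE : k%:R = 2 * (k./2)%:R :> R.
    by rewrite -natrM -{1}(odd_double_half k) (negbTE od) add0n -mul2n.
  have {}hi : pi / 4 <= x i.
    apply: le_trans hi; rewrite kE le_eqVlt; apply/orP; left; apply/eqP.
    have h0 : (k./2)%:R != 0 :> R by apply: contraTneq k0; rewrite kE => ->; rewrite mulr0 ltxx.
    by move: (pi : R) => p; field.
  move: t1 t2 H8 hi p1 p2; move: (x i) (tan (pi / 6)) (hexagon_area R k) => y t H; move: (pi : R) => p; clear.
  by move=> *; lra.
have k11 : (11 <= k)%N.
  by move: k8 k3 ev; clear; case: k => [|[|[|[|[|[|[|[|[|[|[|k]]]]]]]]]]].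
have H11 := hexagon_area_le11 R k11 k3.
have kE : (k./2)%:R = (k%:R - 1) / 2 :> R.
  have e : k = (2 * k./2 + 1)%N by rewrite -{1}(odd_double_half k) ev addnC mul2n.
  by rewrite {2}e natrD natrM; field.
have {}hi : 5 * pi / 22 <= x i.
  apply: le_trans hi; rewrite kE.
  have k11' : 11 <= k%:R :> R by rewrite (ler_nat R 11).
  have -> : pi / k%:R * ((k%:R - 1) / 2) / 2 = (pi - pi / k%:R) / 4 :> R.
    by have := lt0r_neq0 k0; move: (pi : R) => p kN; field.
  suff : pi / k%:R <= pi / 11 :> R by lra.
  by rewrite ler_pM2l // lef_pV2 // posrE; lra.
move: t1 t2 H11 hi p1 p2; move: (x i) (tan (pi / 6)) (hexagon_area R k) => y t H; move: (pi : R) => p; clear.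
by move=> *; lra.
Qed.

(** This serves [k = 8], where the thresholds are half of [s = pi / 8] and half of a right angle.
    The pentagon value of the line there is at most 1.9112, whose square is below 3.655. *)
Lemma pentagon_bad_gap (R : realType) (x : nat -> R) i :
  (forall i, (i < 5)%N -> 0 <= x i < pi / 2) -> \sum_(0 <= i < 5) x i = pi -> (i < 5)%N ->
  (x i <= pi / 16) \/ pi / 4 <= x i ->
  3 + 655 / 1000 <= \sum_(0 <= i < 5) tan (x i).
Proof.
move=> xb xs i5; have pi0 := pi_gt0 R.
have /andP[p1 p2] := pi_itv R; have t1 := tan_pi5_ge R.
have ab : 0 <= (pi : R) / 5 < pi / 2 by lra.
have t2 : tan (pi / 5 : R) <= 1.
  by rewrite -[leRHS](@tan_piquarter R); apply: tan_le; lra.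
have /andP[x0 _] := xb i i5.
case=> [lo|hi].
  have b0 : 0 <= (0 : R) < pi / 2 by lra.
  have := tan_sum_ge_but1 xb xs ab b0 i5; rewrite tan0; apply: le_trans.
  move: t1 t2 x0 lo p1 p2; move: (x i) (tan (pi / 5)) => y t; move: (pi : R) => p; clear.
  move=> t1 t2 x0 lo p1 p2.
  have h2 : 0 <= t ^+ 2 - 527 / 1000 by nra.
  have h3 : 0 <= (t ^+ 2 - 527 / 1000) * (p / 5 - y) by rewrite mulr_ge0 //; lra.
  lra.
have b4 : 0 <= (pi : R) / 4 < pi / 2 by lra.
have := tan_sum_ge_but1 xb xs ab b4 i5; rewrite tan_piquarter; apply: le_trans.
move: t1 t2 x0 hi p1 p2; move: (x i) (tan (pi / 5)) => y t; move: (pi : R) => p; clear.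
move=> t1 t2 x0 hi p1 p2.
have h : 0 <= (1 - t ^+ 2) * (y - p / 4).
  by rewrite mulr_ge0 // ?subr_ge0 // exprn_ile1 //; lra.
have h3 : 0 <= (t - 726 / 1000) * (4 - (t + 726 / 1000) * p / 20).
  apply: mulr_ge0; first by lra.
  have : 0 <= (1 - t) * p by rewrite mulr_ge0; lra.
  lra.
lra.
Qed.

(** In the spirit of Dowker's theorem on the convexity in [n] of least circumscribed areas, but only
    a line touching at [n = 6] is established. The incircle and the polygon are alternatives because
    either one bounds the perimeter, and the line drops below zero for large [n]. *)
Theorem dowker_bound (R : realType) (k : nat) : (3 <= k)%N -> k <> 4 -> k <> 5 -> k <> 7 ->
  exists2 sl : R, sl <= 0 &
  forall n (th : nat -> R) (t0 : R) (s := pi / k%:R)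
    (h := fun i => vertex_support s (vertex_offset s t0 (th i) - s / 2))
    (b := Num.sqrt (hexagon_area R k) + sl * (n%:R - 6)),
  (2 < n)%N -> th n = th 0%N + 2 * pi ->
  (forall i, (i < n)%N -> 0 < th i.+1 - th i < pi) ->
  [\/ b <= 0, b ^+ 2 <= \sum_(0 <= i < n) kite 1 1 (th i.+1 - th i) |
     b ^+ 2 <= \sum_(0 <= i < n) kite (h i) (h i.+1) (th i.+1 - th i)].
Proof.
move=> k3 k4 k5 k7; have pi0 := pi_gt0 R.
have k0 : 0 < k%:R :> R by rewrite ltr0n ltnW // ltnW.
(* The slope is squeezed between heptagons and pentagons: 1.869 - 0.036 = 1.833 has square below
   3.36, and 1.869 + 0.036 = 1.905 has square below 3.63. For [k = 8] heptagons force a drop of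
   about 0.038, and the pentagon value then exceeds what the circle yields, so pentagons need the
   flush bound. *)
have [sl slP] : exists sl : R,
   (Num.sqrt (hexagon_area R k) <= 1869 / 1000 /\ sl = - (36 / 1000) /\ k != 8) \/
   (Num.sqrt (hexagon_area R k) <= 1 + 871 / 1000 + 2 / 10 / 1000 /\ sl = - (4 / 100) /\ k = 8).
  have [k8|k8] := eqVneq k 8.
    exists (- (4 / 100)); right; split=> //; rewrite k8.
    by have [_ h] := tan_3pi16 R; apply: sqrtr_le; lra.
  exists (- (36 / 1000)); left; split=> //; apply: sqrtr_le; first by lra.
  have /andP[t1 t2] := tan_pi6_itv R.
  have [m0|m0] := eqVneq (k %% 3)%N 0%N.
    by rewrite hexagon_area_mod0 //; [lra|exact: ltnW (ltnW k3)].
  have k10 : (10 <= k)%N.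
    by move: k3 k4 k5 k7 k8 m0; clear; case: k => [|[|[|[|[|[|[|[|[|[|k]]]]]]]]]].
  by have := hexagon_area_le10 R k10 m0; lra.
have sl0 : sl <= 0 by case: slP => -[_ [-> _]]; lra.
exists sl => // n th t0 s h b n2 thn gap.
pose x i := (th i.+1 - th i) / 2.
have xb i : (i < n)%N -> 0 <= x i < pi / 2 by move=> /gap; rewrite /x; lra.
have xs : \sum_(0 <= i < n) x i = pi.
  by rewrite /x -mulr_suml telescope_sumr // thn addrC addKr; move: (pi : R) => p; field.
have k1E : \sum_(0 <= i < n) kite 1 1 (th i.+1 - th i) = \sum_(0 <= i < n) tan (x i).
  apply: eq_big_nat => i /andP[_ iN]; by rewrite (kite_same _ (gap i iN)) expr1n mul1r.
have flush m j : s * m%:R <= pi / 2 -> s * j.+1%:R < pi ->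
    (forall i, (i < n)%N -> s <= th i.+1 - th i < s * m%:R) ->
    n%:R * tan (s * j%:R / 2) +
    (2 * k%:R - n%:R * j%:R) * (tan (s * j.+1%:R / 2) - tan (s * j%:R / 2))
  <= \sum_(0 <= i < n) kite (h i) (h i.+1) (th i.+1 - th i).
  by move=> mpi jpi g; apply: (@kite_sum_flush R n k m j) => //; exact: ltnW.
have bad m : ~ (forall i, (i < n)%N -> s <= th i.+1 - th i < s * m%:R) ->
   exists2 i, (i < n)%N & x i <= s / 2 \/ s * m%:R / 2 <= x i.
  move=> nf; apply: contrapT => H; apply: nf => i iN.
  apply: contrapT => G; apply: H; exists i => //.
  apply: contrapT => G'; apply: G; move: G'.
  move=> /not_orP[/negP g1 /negP g2]; rewrite -!ltNge /x in g1 g2.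
  by apply/andP; split; lra.
have [n6|n6] := eqVneq n 6.
  have [hex0|] := boolP (hexagon_area R k <= 0); last rewrite -ltNge => hex0.
    by apply: Or31; rewrite /b n6 subrr mulr0 addr0 ler0_sqrtr.
  have -> : b ^+ 2 = hexagon_area R k by rewrite /b n6 subrr mulr0 addr0 sqr_sqrtr // ltW.
  have [m0|m0] := eqVneq (k %% 3)%N 0%N.
    apply: Or32; rewrite hexagon_area_mod0 ?(ltnW (ltnW k3)) // [leRHS]k1E.
    by have := circle_bound n2 xb xs; move: (\sum_(0 <= i < n) tan (x i)) => S; rewrite n6.
  have k8 : (8 <= k)%N.
    by move: k3 k4 k5 k7 m0; clear; case: k => [|[|[|[|[|[|[|[|k]]]]]]]].
  have [g|/bad[i iN xi]] := pselect (forall i, (i < n)%N -> s <= th i.+1 - th i < s * (k./2)%:R).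
    apply: Or33; have mpi : s * (k./2)%:R <= pi / 2.
      have : (k./2 * 2 <= k)%N by rewrite muln2 -{2}(odd_double_half k) leq_addl.
      rewrite -(ler_nat R) natrM => h2; rewrite ler_pdivlMr // -mulrA /s -mulrA.
      by rewrite ger_pMr // mulrC ler_pdivrMr // mul1r.
    have jpi : s * (k %/ 3)%N.+1%:R < pi.
      have : ((k %/ 3).+1 < k)%N by move: k8; clear; lia.
      rewrite -(ltr_nat R) => h2; rewrite /s -mulrA gtr_pMr // mulrC ltr_pdivrMr //.
      by rewrite mul1r.
    apply: le_trans (flush _ _ mpi jpi g); rewrite n6 /hexagon_area -/s.
    have kE : k%:R = (k %/ 3)%N%:R * 3 + (k %% 3)%N%:R :> R.
      by rewrite -natrM -natrD -divn_eq.
    rewrite {1}kE le_eqVlt; apply/orP; left; apply/eqP.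
    move: (tan _) => T1; move: (tan _) => T2; ring.
  apply: Or32; rewrite [leRHS]k1E.
  move: xb xs iN; rewrite n6 => xb xs iN; apply: (hexagon_bad_gap k8 m0 xb xs iN).
  case: xi => xi; [left|right] => //; apply: le_trans xi _.
  rewrite /s; have k8' : 8 <= k%:R :> R by rewrite (ler_nat R 8).
  suff : pi / k%:R <= pi / 8 :> R by lra.
  by rewrite ler_pM2l // lef_pV2 // posrE; lra.
have [n5|n5] := eqVneq n 5.
  case: slP => [[h1 [h2 _]]|[h1 [h2 k8]]].
    have cb : 363 / 100 <= \sum_(0 <= i < n) tan (x i).
      by have := circle_bound n2 xb xs; move: (\sum_(0 <= i < n) tan (x i)) => S; rewrite n5.
    have bB : b <= 1 + 905 / 1000 by rewrite /b h2 n5; lra.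
    have [|?|?] := @sqr_bound R b (1 + 905 / 1000) (363 / 100) bB; first by lra.
      exact: Or31.
    by apply: Or32; rewrite [leRHS]k1E; apply: le_trans cb.
  have bB : b <= 1 + 911 / 1000 + 2 / 10 / 1000 by rewrite /b h2 n5; lra.
  have [|?|hb] := @sqr_bound R b (1 + 911 / 1000 + 2 / 10 / 1000) (3 + 655 / 1000) bB; first by lra.
    exact: Or31.
  have [g|/bad[i iN xi]] := pselect (forall i, (i < n)%N -> s <= th i.+1 - th i < s * 4%:R).
    have sE : s = pi / 8 by rewrite /s k8.
    (* A pentagon flush with the 16-gon has gaps of 3, 3, 3, 3 and 4 steps, so its area is
       [4 * tan (3 * pi / 16) + 1]. *)
    apply: Or33; apply: le_trans hb _; apply: le_trans (flush 4 3 _ _ g).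
    - rewrite n5 sE; have -> : pi / 8 * 4 / 2 = pi / 4 :> R by field.
      by rewrite tan_piquarter k8; have [h3 _] := tan_3pi16 R; lra.
    - by rewrite sE; lra.
    - by rewrite sE; lra.
  apply: Or32; rewrite [leRHS]k1E; apply: le_trans hb _.
  move: xb xs iN; rewrite n5 => xb xs iN; apply: (pentagon_bad_gap xb xs iN).
  by move: xi; rewrite /s k8 => -[xi|xi]; [left|right]; lra.
case: (circle_dowker n2 n5 n6 xb xs (c := Num.sqrt (hexagon_area R k)) (sl := sl)).
- by case: slP => [[h1 [h2 _]]|[h1 [h2 _]]]; [left|right].
- by move=> ?; apply: Or31.
- by move=> ?; apply: Or32; rewrite [leRHS]k1E.
Qed.

(** * Areas *)

Notation plane R := (measurableTypeR R * measurableTypeR R)%type.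

(** The rescaled push-forward measure agrees with Lebesgue measure on half-open intervals, and these
    determine it. *)
Lemma lebesgue_affine (R : realType) (s c : R) (A : set (measurableTypeR R)) : s != 0 ->
  measurable A ->
  (lebesgue_measure ((fun y : R => s * y + c)%R @^-1` A) * `|s|%:E)%E = lebesgue_measure A.
Proof.
move=> s0 mA.
have mf : measurable_fun [set: measurableTypeR R] (fun y : R => s * y + c : measurableTypeR R).
  by apply: measurable_funD => //; apply: measurable_funM.
pose nn : {nonneg R} := NngNum (normr_ge0 s).
pose m := mscale nn (measure_function_pushforward__canonical__measure_function_Measure
  (@lebesgue_measure R) mf).
rewrite [RHS](@lebesgue_measure_unique R m) //; first by rewrite muleC.
move=> _ [[a b] _ <-] /=.
rewrite -[RHS]/(`|s|%:E * lebesgue_measure ((fun y : R => (s * y + c)%R) @^-1` `]a, b]%classic))%E.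
rewrite (_ : _ @^-1` _ =
   [set` if 0 < s then `](a - c) / s, (b - c) / s] else `[(b - c) / s, (a - c) / s[]); last first.
  apply/seteqP; split=> y /=; rewrite in_itv /=; case: ifPn => [sp|];
    rewrite ?in_itv /= ?ltr_pdivrMr ?ler_pdivlMr // => H.
  - by rewrite mulrC; lra.
  - have sn : s < 0 by rewrite lt_neqAle s0 leNgt.
    by rewrite ler_ndivrMr ?ltr_ndivlMr // mulrC; lra.
  - by move: H; rewrite mulrC; lra.
  - have sn : s < 0 by rewrite lt_neqAle s0 leNgt.
    by move: H; rewrite ler_ndivrMr ?ltr_ndivlMr // mulrC; lra.
case: ifPn => sp; rewrite !lebesgue_measure_itv /= !lte_fin.
- rewrite ltr_pM2r ?invr_gt0 // ltrD2r; case: ifPn => _; last by rewrite mule0.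
  by rewrite -!EFinB -EFinM gtr0_norm // -mulrBl mulrC divfK //; congr _%:E; ring.
- have sn : s < 0 by rewrite lt_neqAle s0 leNgt.
  rewrite ltr_nM2r ?invr_lt0 // ltrD2r; case: ifPn => _; last by rewrite mule0.
  by rewrite -!EFinB -EFinM ltr0_norm // -mulrBl mulNr mulrC divfK //; congr _%:E; ring.
Qed.

(* [f] multiplies areas by [d], in the form stable under composition. *)
Definition scales_area (R : realType) (f : plane R -> plane R) (d : R) : Prop :=
  measurable_fun setT f /\
  forall A : set (plane R), measurable A -> (area (f @^-1` A) * d%:E)%E = area A.

Lemma scales_area_comp (R : realType) (f g : plane R -> plane R) d e :
  scales_area f d -> scales_area g e -> scales_area (f \o g) (d * e).
Proof.
move=> [mf fd] [mg ge]; split; first exact: measurableT_comp.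
move=> A mA; rewrite comp_preimage EFinM [X in (_ * X)%E]muleC muleA ge ?fd //.
by rewrite -[X in measurable X]setTI; apply: mf.
Qed.

Lemma scales_area_diag (R : realType) (s t c e : R) : s != 0 -> t != 0 ->
  scales_area (fun z : plane R => (s * z.1 + c, t * z.2 + e) : plane R) (`|s| * `|t|).
Proof.
move=> s0 t0.
have mf1 (u c' : R) : measurable_fun [set: measurableTypeR R] (fun y : R => u * y + c' : measurableTypeR R).
  by apply: measurable_funD => //; apply: measurable_funM.
have mf : measurable_fun [set: plane R] (fun z : plane R => (s * z.1 + c, t * z.2 + e) : plane R).
  by apply: measurable_fun_pair; apply: measurable_funD => //; apply: measurable_funM.
split=> // A mA.
pose nn : {nonneg R} := NngNum (mulr_ge0 (normr_ge0 s) (normr_ge0 t)).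
pose m := mscale nn (measure_function_pushforward__canonical__measure_function_Measure
  (product_measure1 (@lebesgue_measure R) (@lebesgue_measure R)) mf).
rewrite /area [RHS](@product_measure_unique _ _ _ _ _ (@lebesgue_measure R) (@lebesgue_measure R) m) //.
  by rewrite muleC.
move=> B C mB mC.
rewrite -[LHS]/((`|s| * `|t|)%:E * (lebesgue_measure \x lebesgue_measure)
  ((fun z : plane R => ((s * z.1 + c)%R, (t * z.2 + e)%R)) @^-1` (B `*` C)))%E.
have -> : (fun z : plane R => (s * z.1 + c, t * z.2 + e)) @^-1` (B `*` C) =
   ((fun y : R => s * y + c) @^-1` B) `*` ((fun y : R => t * y + e) @^-1` C).
  by apply/seteqP; split=> z.
have mp (u c' : R) D : measurable D -> measurable ((fun y : measurableTypeR R => u * y + c' : measurableTypeR R) @^-1` D).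
  by move=> mD; rewrite -[X in measurable X]setTI; apply: mf1.
rewrite product_measure1E; try exact: mp.
rewrite -[RHS]/(lebesgue_measure B * lebesgue_measure C)%E.
by rewrite -(lebesgue_affine c s0 mB) -(lebesgue_affine e t0 mC) EFinM muleC muleACA.
Qed.

Lemma scales_area_swap (R : realType) :
  scales_area (fun z : plane R => (z.2, z.1) : plane R) 1.
Proof.
have mf : measurable_fun [set: plane R] (fun z : plane R => (z.2, z.1) : plane R).
  by apply: measurable_fun_pair.
split=> // A mA.
pose m := measure_function_pushforward__canonical__measure_function_Measure
  (product_measure1 (@lebesgue_measure R) (@lebesgue_measure R)) mf.
rewrite mule1 /area [RHS](@product_measure_unique _ _ _ _ _ (@lebesgue_measure R) (@lebesgue_measure R) m) //.
move=> B C mB mC.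
rewrite -[LHS]/((lebesgue_measure \x lebesgue_measure)
  ((fun z : plane R => (z.2, z.1)) @^-1` (B `*` C)))%E.
have -> : (fun z : plane R => (z.2, z.1)) @^-1` (B `*` C) = C `*` B.
  by apply/seteqP; split=> z [].
by rewrite product_measure1E // muleC.
Qed.

(** Sections over the first coordinate are only translated, so the inner integral does not
    change. *)
Lemma scales_area_shear (R : realType) (c : R) :
  scales_area (fun z : plane R => (z.1, z.2 + c * z.1) : plane R) 1.
Proof.
have mf : measurable_fun [set: plane R] (fun z : plane R => (z.1, z.2 + c * z.1) : plane R).
  by apply: measurable_fun_pair => //; apply: measurable_funD => //; apply: measurable_funM.
split=> // A mA; rewrite mule1 /area /product_measure1.
apply: eq_integral => x _ /=.
have -> : xsection ((fun z : plane R => (z.1, z.2 + c * z.1)) @^-1` A) x =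
   (fun y : R => 1 * y + c * x) @^-1` xsection A x.
  by apply/seteqP; split=> y; rewrite /xsection /= mul1r => /set_mem h; apply/mem_set.
have := @lebesgue_affine R 1 (c * x) (xsection A x) (oner_neq0 _) (measurable_xsection x mA).
by rewrite normr1 mule1.
Qed.

(** When the upper left entry is nonzero, the matrix factors into a lower shear, a diagonal matrix
    and an upper shear, the last being a lower shear conjugated by the swap. Otherwise the rows are
    exchanged first. *)
Lemma scales_area_affine (R : realType) (a b c d e f : R) : a * d - b * c != 0 ->
  scales_area (fun z : plane R => (a * z.1 + b * z.2 + e, c * z.1 + d * z.2 + f) : plane R)
    `|a * d - b * c|.
Proof.
have main a' b' c' d' e' f' : a' != 0 -> a' * d' - b' * c' != 0 ->
  scales_area (fun z : plane R => (a' * z.1 + b' * z.2 + e', c' * z.1 + d' * z.2 + f') : plane R)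
    `|a' * d' - b' * c'|.
  move=> a0 D0.
  have h1 := scales_area_comp (scales_area_swap R)
     (scales_area_comp (scales_area_shear (b' / a')) (scales_area_swap R)).
  have t0 : (a' * d' - b' * c') / a' != 0 by rewrite mulf_neq0 ?invr_neq0.
  have h2 := scales_area_diag 0 0 a0 t0.
  have h3 := scales_area_shear (c' / a').
  have h4 := scales_area_diag e' f' (oner_neq0 R) (oner_neq0 R).
  have := scales_area_comp h4 (scales_area_comp h3 (scales_area_comp h2 h1)).
  have E : `|a'| * `|(a' * d' - b' * c') / a'| = `|a' * d' - b' * c'|.
    by rewrite -normrM mulrCA divff // mulr1.
  rewrite !normr1 !mulr1 !mul1r E.
  congr (scales_area _ _); apply/funext => z /=; congr (_, _); field => //.
have [->|a0] := eqVneq a 0; last exact: main.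
rewrite mul0r sub0r oppr_eq0 normrN => bc0.
have c0 : c != 0 by apply: contraNneq bc0 => ->; rewrite mulr0.
have := @main c d 0 b f e c0; rewrite mulr0 subr0 mulrC => /(_ bc0) h.
have := scales_area_comp (scales_area_swap R) h; rewrite mul1r.
by congr (scales_area _ _); apply/funext => z /=; rewrite !mul0r !add0r.
Qed.

Lemma measurable_le_fun (R : realType) (f : plane R -> R) : measurable_fun setT f ->
  measurable [set z : plane R | 0 <= f z].
Proof.
move=> mf; have -> : [set z : plane R | 0 <= f z] = f @^-1` `[0, +oo[.
  by apply/seteqP; split=> z /=; rewrite in_itv /= andbT.
by rewrite -[X in measurable X]setTI; apply: mf.
Qed.

Lemma measurable_lt_fun (R : realType) (f : plane R -> R) : measurable_fun setT f ->
  measurable [set z : plane R | 0 < f z].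
Proof.
move=> mf; have -> : [set z : plane R | 0 < f z] = f @^-1` `]0, +oo[.
  by apply/seteqP; split=> z /=; rewrite in_itv /= andbT.
by rewrite -[X in measurable X]setTI; apply: mf.
Qed.

Lemma measurable_affine (R : realType) (a b c : R) :
  measurable_fun [set: plane R] (fun z : plane R => a * z.1 + b * z.2 + c).
Proof.
by apply: measurable_funD => //; apply: measurable_funD; apply: measurable_funM.
Qed.

Lemma le_area (R : realType) (A B : set (plane R)) : measurable A -> measurable B ->
  A `<=` B -> (area A <= area B)%E.
Proof. by move=> mA mB AB; apply: le_measure => //; apply/mem_set. Qed.

Lemma area_affine (R : realType) (a b c d e f : R) (A : set (plane R)) :
  a * d - b * c != 0 -> measurable A ->
  (area [set z : plane R | A (a * z.1 + b * z.2 + e, c * z.1 + d * z.2 + f)%R]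
    * `|a * d - b * c|%R%:E)%E = area A.
Proof. by move=> D0 mA; have [_] := scales_area_affine e f D0; apply. Qed.

Lemma area_rect (R : realType) (A B : set (measurableTypeR R)) : measurable A -> measurable B ->
  area (A `*` B) = (lebesgue_measure A * lebesgue_measure B)%E.
Proof. by move=> mA mB; rewrite /area product_measure1E. Qed.

Lemma area_line (R : realType) (a b c : R) : (a != 0) || (b != 0) ->
  area [set z : plane R | a * z.1 + b * z.2 + c = 0] = 0%E.
Proof.
have main (u v : R) (mk : plane R -> plane R) (d : R) : scales_area mk d -> 0 < d ->
   area (mk @^-1` ([set 0] `*` setT)) = 0%E.
  move=> [mf sc] d0.
  have mz : measurable ([set 0] : set (measurableTypeR R)) by exact: measurable_set1.
  have /sc : measurable ([set 0] `*` setT : set (plane R)) by exact: measurableX.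
  rewrite (area_rect mz measurableT) lebesgue_measure_set1 mul0e.
  by move/eqP; rewrite mule_eq0 => /orP[/eqP//|]; rewrite eqe gt_eqF.
move=> /orP[a0|b0].
  have D0 : a * 1 - b * 0 != 0 by rewrite mulr1 mulr0 subr0.
  have := main 0 0 _ _ (scales_area_affine c 0 D0); rewrite normr_gt0 => /(_ D0) <-.
  by congr (area _); apply/seteqP; split=> z /=; [move=> -> |case].
have D0 : a * 0 - b * 1 != 0 by rewrite mulr1 mulr0 sub0r oppr_eq0.
have := main 0 0 _ _ (scales_area_affine c 0 D0); rewrite normr_gt0 => /(_ D0) <-.
by congr (area _); apply/seteqP; split=> z /=; [move=> -> |case].
Qed.

(** A half turn about the centre of the unit square takes the simplex without its hypotenuse to a
    disjoint set inside the square, and the hypotenuse is null. *)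
Lemma area_simplex_le (R : realType) :
  (area [set z : plane R | [/\ 0 <= z.1, 0 <= z.2 & z.1 + z.2 <= 1]%R] <= (1 / 2)%:E)%E.
Proof.
set A := [set _ | _].
have m1 : measurable_fun [set: plane R] (fun z : plane R => z.1) by exact: measurable_fst.
have m2 : measurable_fun [set: plane R] (fun z : plane R => z.2) by exact: measurable_snd.
have m3 : measurable_fun [set: plane R] (fun z : plane R => -1 * z.1 + -1 * z.2 + 1) by exact: measurable_affine.
have m4 : measurable_fun [set: plane R] (fun z : plane R => 1 * z.1 + 1 * z.2 + -1) by exact: measurable_affine.
pose A' := [set z : plane R | 0 <= z.1] `&` [set z : plane R | 0 <= z.2] `&` [set z : plane R | 0 < -1 * z.1 + -1 * z.2 + 1].
pose L := A `&` [set z : plane R | 1 * z.1 + 1 * z.2 + -1 = 0].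
have mA : measurable A.
  have -> : A = [set z : plane R | 0 <= z.1] `&` [set z : plane R | 0 <= z.2] `&` [set z : plane R | 0 <= -1 * z.1 + -1 * z.2 + 1].
    by apply/seteqP; split=> z /= => [[? ? ?]|[[? ?] ?]]; [split; [split|]|split] => //; lra.
  exact: (measurableI _ _ (measurableI _ _ (measurable_le_fun m1) (measurable_le_fun m2)) (measurable_le_fun m3)).
have mA' : measurable A'.
  exact: (measurableI _ _ (measurableI _ _ (measurable_le_fun m1) (measurable_le_fun m2)) (measurable_lt_fun m3)).
pose line := [set z : plane R | 1 * z.1 + 1 * z.2 + -1 = 0].
have mline : measurable line.
  have -> : line = [set z : plane R | 0 <= 1 * z.1 + 1 * z.2 + -1] `&` [set z : plane R | 0 <= -1 * z.1 + -1 * z.2 + 1].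
    by apply/seteqP; split=> z; rewrite /line /=; [move=> ?; split; lra|move=> [? ?]; lra].
  exact: (measurableI _ _ (measurable_le_fun m4) (measurable_le_fun m3)).
have l0 : area line = 0%E by apply: area_line; rewrite oner_neq0.
pose C := [set z : plane R | A' (-1 * z.1 + 0 * z.2 + 1, 0 * z.1 + -1 * z.2 + 1)].
have D0 : -1 * -1 - 0 * 0 != 0 :> R by rewrite mul0r subr0 mulrNN mulr1 oner_neq0.
have CE : area C = area A'.
  by rewrite -(area_affine 1 1 D0 mA') mul0r subr0 mulrNN mulr1 normr1 mule1.
have mC : measurable C.
  have [mf _] := scales_area_affine 1 1 D0.
  by rewrite -[X in measurable X]setTI; apply: mf.
have h1 : (area A <= area A')%E.
  rewrite -[leRHS]adde0 -l0; apply: le_trans (measureU2 _ _ _) => //.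
  apply: le_area => //; first exact: measurableU.
  move=> z [z1 z2 z3] /=; have [e|e] := eqVneq (z.1 + z.2) 1; [right|left].
    by rewrite /line /=; lra.
  by split=> //=; move: z3; rewrite le_eqVlt (negbTE e) /=; lra.
have h2 : (area A + area C <= 1)%E.
  rewrite -measureU //; last first.
    apply/seteqP; split=> z //= [[z1 z2 z3]] [[z4 z5] z6]; move: z6 => /=; lra.
  have -> : 1%E = area (`[0, 1]%classic `*` `[0, 1]%classic : set (plane R)).
    rewrite area_rect //; rewrite lebesgue_measure_itv /= lte_fin ltr01.
    by rewrite -EFinB subr0 mule1.
  apply: le_area; [exact: measurableU|exact: measurableX|].
  move=> z [[z1 z2 z3]|[[z1 z2] z3]]; split=> /=; rewrite in_itv /=; [lra|lra| |];
    by move: z1 z2 z3 => /=; lra.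
have fA : area A \is a fin_num.
  rewrite ge0_fin_numE ?measure_ge0 //; apply: le_lt_trans (ltry 1); apply: le_trans h2.
  by rewrite leeDl // measure_ge0.
rewrite CE in h2; have : (area A + area A <= 1)%E by apply: le_trans h2; rewrite leeD2lE.
by rewrite -(fineK fA) -EFinD !lee_fin; lra.
Qed.

Definition triangle (R : realType) (p q r : R * R) : set (R * R) :=
  [set z | [/\ 0 <= orient p q z, 0 <= orient q r z & 0 <= orient r p z]].

Lemma orientE (R : realType) (p q : R * R) (z : R * R) :
  orient p q z = - (q.2 - p.2) * z.1 + (q.1 - p.1) * z.2 + (p.1 * q.2 - p.2 * q.1).
Proof. by rewrite /orient; ring. Qed.

Lemma measurable_orient_ge0 (R : realType) (p q : R * R) :
  measurable ([set z | 0 <= orient p q z] : set (plane R)).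
Proof.
have -> : [set z | 0 <= orient p q z] = [set z : plane R |
    0 <= - (q.2 - p.2) * z.1 + (q.1 - p.1) * z.2 + (p.1 * q.2 - p.2 * q.1)].
  by apply/seteqP; split=> z /=; rewrite orientE.
exact: (measurable_le_fun (measurable_affine _ _ _)).
Qed.

Lemma measurable_triangle (R : realType) (p q r : R * R) :
  measurable (triangle p q r : set (plane R)).
Proof.
have -> : (triangle p q r : set (plane R)) =
   [set z | 0 <= orient p q z] `&` [set z | 0 <= orient q r z] `&` [set z | 0 <= orient r p z].
  by apply/seteqP; split=> z; [case|case=> [[]]].
exact: (measurableI _ _ (measurableI _ _ (measurable_orient_ge0 _ _) (measurable_orient_ge0 _ _))
  (measurable_orient_ge0 _ _)).
Qed.

(** Two barycentric coordinates form an affine map of determinant [D^-1] under which the triangle is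
    the preimage of the standard simplex. *)
Lemma area_triangle_le (R : realType) (p q r : R * R) : 0 < orient p q r ->
  (area (triangle p q r) <= (orient p q r / 2)%:E)%E.
Proof.
set D := orient p q r => D0.
set A := [set z : plane R | [/\ 0 <= z.1, 0 <= z.2 & z.1 + z.2 <= 1]].
have mA : measurable A.
  have m1 : measurable_fun [set: plane R] (fun z : plane R => z.1) by exact: measurable_fst.
  have m2 : measurable_fun [set: plane R] (fun z : plane R => z.2) by exact: measurable_snd.
  have m3 : measurable_fun [set: plane R] (fun z : plane R => -1 * z.1 + -1 * z.2 + 1) by exact: measurable_affine.
  have -> : A = [set z : plane R | 0 <= z.1] `&` [set z : plane R | 0 <= z.2] `&` [set z : plane R | 0 <= -1 * z.1 + -1 * z.2 + 1].
    by apply/seteqP; split=> z /= => [[? ? ?]|[[? ?] ?]]; [split; [split|]|split] => //; lra.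
  exact: (measurableI _ _ (measurableI _ _ (measurable_le_fun m1) (measurable_le_fun m2)) (measurable_le_fun m3)).
pose a := - (p.2 - r.2) / D; pose b := (p.1 - r.1) / D; pose e := (r.1 * p.2 - r.2 * p.1) / D.
pose c := - (q.2 - p.2) / D; pose d := (q.1 - p.1) / D; pose f := (p.1 * q.2 - p.2 * q.1) / D.
have detE : a * d - b * c = D^-1.
  rewrite /a /b /c /d; have -> : - (p.2 - r.2) / D * ((q.1 - p.1) / D) - (p.1 - r.1) / D * (- (q.2 - p.2) / D) =
    (- (p.2 - r.2) * (q.1 - p.1) + (p.1 - r.1) * (q.2 - p.2)) / D ^+ 2 by field; rewrite gt_eqF.
  have -> : - (p.2 - r.2) * (q.1 - p.1) + (p.1 - r.1) * (q.2 - p.2) = D by rewrite /D /orient; ring.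
  by field; rewrite gt_eqF.
have det0 : a * d - b * c != 0 by rewrite detE invr_neq0 // gt_eqF.
have := area_affine e f det0 mA; rewrite detE gtr0_norm ?invr_gt0 //.
have -> : [set z : plane R | A (a * z.1 + b * z.2 + e, c * z.1 + d * z.2 + f)] = triangle p q r.
  have e1 z : a * z.1 + b * z.2 + e = orient r p z / D by rewrite orientE /a /b /e; field; rewrite gt_eqF.
  have e2 z : c * z.1 + d * z.2 + f = orient p q z / D by rewrite orientE /c /d /f; field; rewrite gt_eqF.
  have e3 z : orient r p z / D + orient p q z / D = 1 - orient q r z / D.
    have -> : orient q r z = D - orient r p z - orient p q z by rewrite /D /orient; ring.
    by field; rewrite gt_eqF.
  have pos (x : R) : (0 <= x / D) = (0 <= x) by rewrite pmulr_lge0 // invr_gt0.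
  apply/seteqP; split=> z; rewrite /A /triangle /= e1 e2 e3 !pos.
    by move=> [h1 h2]; rewrite gerBl pos.
  by move=> [h1 h2 h3]; rewrite gerBl pos.
move=> h; have := area_simplex_le R; rewrite -/A -h => h2.
have := lee_wpmul2r (_ : 0%E <= D%:E)%E h2; rewrite lee_fin (ltW D0) => /(_ isT).
by rewrite -muleA -!EFinM mulVf ?gt_eqF // mule1 mulrC mul1r.
Qed.

Definition cross (R : realType) (a b : R * R) : R := a.1 * b.2 - a.2 * b.1.

Definition parallelogram (R : realType) (p a b : R * R) : set (R * R) :=
  [set z | exists s t : R, [/\ 0 <= s <= 1, 0 <= t <= 1 &
    z = (p.1 + s * a.1 + t * b.1, p.2 + s * a.2 + t * b.2)]].

Definition open_parallelogram (R : realType) (p a b : R * R) : set (R * R) :=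
  [set z | exists s t : R, [/\ 0 < s < 1, 0 < t < 1 &
    z = (p.1 + s * a.1 + t * b.1, p.2 + s * a.2 + t * b.2)]].

Lemma parallelogramE (R : realType) (p a b : R * R) (I J : set R) : 0 < cross a b ->
  [set z | exists s t : R, [/\ I s, J t & z = (p.1 + s * a.1 + t * b.1, p.2 + s * a.2 + t * b.2)]] =
  [set z : plane R | (I `*` J) (b.2 / cross a b * z.1 + - b.1 / cross a b * z.2 + (b.1 * p.2 - b.2 * p.1) / cross a b,
     - a.2 / cross a b * z.1 + a.1 / cross a b * z.2 + (a.2 * p.1 - a.1 * p.2) / cross a b)].
Proof.
set D := cross a b => D0; have DN : D != 0 by rewrite gt_eqF.
apply/seteqP; split=> [z [s [t [Is Jt ->]]]|[x y] /= [Is Jt]].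
  split=> /=.
    have -> : b.2 / D * (p.1 + s * a.1 + t * b.1) + - b.1 / D * (p.2 + s * a.2 + t * b.2) +
      (b.1 * p.2 - b.2 * p.1) / D = s * (a.1 * b.2 - a.2 * b.1) / D by field.
    by rewrite -/(cross a b) -/D mulfK.
  have -> : - a.2 / D * (p.1 + s * a.1 + t * b.1) + a.1 / D * (p.2 + s * a.2 + t * b.2) +
    (a.2 * p.1 - a.1 * p.2) / D = t * (a.1 * b.2 - a.2 * b.1) / D by field.
  by rewrite -/(cross a b) -/D mulfK.
exists (b.2 / D * x + - b.1 / D * y + (b.1 * p.2 - b.2 * p.1) / D),
  (- a.2 / D * x + a.1 / D * y + (a.2 * p.1 - a.1 * p.2) / D); split=> //.
congr (_, _).
  transitivity (p.1 + (x - p.1) * (a.1 * b.2 - a.2 * b.1) / D); last by field.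
  by rewrite -/(cross a b) -/D mulfK //; ring.
transitivity (p.2 + (y - p.2) * (a.1 * b.2 - a.2 * b.1) / D); last by field.
by rewrite -/(cross a b) -/D mulfK //; ring.
Qed.

Lemma area_box (R : realType) (p a b : R * R) (i j : interval R) : 0 < cross a b ->
  lebesgue_measure ([set` i] : set R) = 1%E -> lebesgue_measure ([set` j] : set R) = 1%E ->
  let K := [set z | exists s t : R, [/\ s \in i, t \in j &
     z = (p.1 + s * a.1 + t * b.1, p.2 + s * a.2 + t * b.2)]] : set (plane R) in
  measurable K /\ area K = (cross a b)%:E.
Proof.
move=> D0 hi hj /=.
set D := cross a b in D0 *; have DN : D != 0 by rewrite gt_eqF.
have mIJ : measurable ([set` i] `*` [set` j] : set (plane R)) by apply: measurableX.
have detE : b.2 / D * (a.1 / D) - - b.1 / D * (- a.2 / D) = D^-1.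
  have -> : b.2 / D * (a.1 / D) - - b.1 / D * (- a.2 / D) = (a.1 * b.2 - a.2 * b.1) / D ^+ 2 by field.
  by rewrite -/(cross a b) -/D; field.
have det0 : b.2 / D * (a.1 / D) - - b.1 / D * (- a.2 / D) != 0 by rewrite detE invr_neq0.
rewrite (parallelogramE p [set` i] [set` j] D0) -/D; split.
  have [mf _] := scales_area_affine ((b.1 * p.2 - b.2 * p.1) / D) ((a.2 * p.1 - a.1 * p.2) / D) det0.
  by rewrite -[X in measurable X]setTI; apply: mf.
have := area_affine ((b.1 * p.2 - b.2 * p.1) / D) ((a.2 * p.1 - a.1 * p.2) / D) det0 mIJ.
have nD : `|D^-1| = D^-1 by rewrite gtr0_norm ?invr_gt0.
rewrite detE nD (area_rect (measurable_itv i) (measurable_itv j)) hi hj mule1 => h.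
by rewrite -[LHS]mule1 -(mulVf DN) EFinM muleA h mul1e.
Qed.

Lemma area_parallelogram (R : realType) (p a b : R * R) : 0 < cross a b ->
  measurable (parallelogram p a b : set (plane R)) /\ area (parallelogram p a b) = (cross a b)%:E.
Proof.
move=> D0; have l1 : lebesgue_measure (`[0, 1]%classic : set R) = 1%E.
  by rewrite lebesgue_measure_itv /= lte_fin ltr01 -EFinB subr0.
by have := area_box p D0 l1 l1; congr (measurable _ /\ area _ = _);
  apply/seteqP; split=> z [s [t]]; rewrite !in_itv /=; exists s, t.
Qed.

Lemma area_open_parallelogram (R : realType) (p a b : R * R) : 0 < cross a b ->
  measurable (open_parallelogram p a b : set (plane R)) /\
  area (open_parallelogram p a b) = (cross a b)%:E.
Proof.
move=> D0; have l1 : lebesgue_measure (`]0, 1[%classic : set R) = 1%E.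
  by rewrite lebesgue_measure_itv /= lte_fin ltr01 -EFinB subr0.
by have := area_box p D0 l1 l1; congr (measurable _ /\ area _ = _);
  apply/seteqP; split=> z [s [t]]; rewrite !in_itv /=; exists s, t.
Qed.

Lemma measurable_disk (R : realType) (c : R * R) (r : R) :
  measurable (euclidean_disk c r : set (plane R)).
Proof.
have -> : (euclidean_disk c r : set (plane R)) =
  [set z | 0 <= r ^+ 2 - ((z.1 - c.1) ^+ 2 + (z.2 - c.2) ^+ 2)].
  by apply/seteqP; split=> z /=; rewrite /euclidean_disk /= subr_ge0.
apply: measurable_le_fun; apply: measurable_funB => //; apply: measurable_funD;
  by apply: measurable_funX; apply: measurable_funB.
Qed.

(** The constant is [pi], but only quadratic growth matters for counting cells. Scaling reduces to
    the unit disk, and an inner and an outer square make its area positive and finite. *)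
Lemma area_disk (R : realType) : exists2 kappa : R, 0 < kappa &
  forall r : R, 0 < r -> area (euclidean_disk 0 r) = (kappa * r ^+ 2)%:E.
Proof.
have scale (r : R) : 0 < r -> (area (euclidean_disk (0%R : R * R) r) * (r ^- 2)%:E)%E = area (euclidean_disk (0%R : R * R) 1).
  move=> r0; have D0 : r^-1 * r^-1 - 0 * 0 != 0 :> R by rewrite mul0r subr0 mulf_neq0 // invr_neq0 // gt_eqF.
  rewrite -(area_affine 0 0 D0 (measurable_disk 0 1)).
  have -> : `|r^-1 * r^-1 - 0 * 0| = r ^- 2.
    by rewrite mul0r subr0 -expr2 exprVn ger0_norm // invr_ge0 sqr_ge0.
  congr (area _ * _)%E; apply/seteqP; split=> z; rewrite /euclidean_disk /= !subr0 !addr0 !mul0r addr0 add0r !exprMn exprVn -mulrDr expr1n.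
    by rewrite ler_pdivrMl ?exprn_gt0 // mulr1.
  by rewrite ler_pdivrMl ?exprn_gt0 // mulr1.
have box (c : R) : 0 < c -> measurable (parallelogram (- c, - c) (2 * c, 0) (0, 2 * c) : set (plane R)) /\
  area (parallelogram (- c, - c) (2 * c, 0) (0, 2 * c)) = (4 * c ^+ 2)%:E.
  move=> c0; have D0 : 0 < cross (2 * c, 0) (0, 2 * c) by rewrite /cross /= mulr0 subr0 mulr_gt0 ?mulr_gt0.
  have [m ->] := area_parallelogram (- c, - c) D0; split=> //.
  by rewrite /cross /=; congr _%:E; ring.
have up : (area (euclidean_disk (0%R : R * R) 1) <= 4%:E)%E.
  have [m e] := box 1 ltr01.
  rewrite (_ : 4%:E = (4 * 1 ^+ 2)%R%:E)%E; last by rewrite expr1n mulr1.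
  rewrite -e.
  apply: le_area => //; first exact: measurable_disk.
  move=> [x y]; rewrite /euclidean_disk /= !subr0 expr1n => h.
  exists ((x + 1) / 2), ((y + 1) / 2); split; [nra|nra|].
  by congr (_, _) => /=; field.
have lo : (1%:E <= area (euclidean_disk (0%R : R * R) 1))%E.
  have h0 : 0 < 1 / 2 :> R by lra.
  have [m e] := box _ h0; have e' : 4 * (1 / 2) ^+ 2 = 1 :> R by field.
  rewrite e' in e; rewrite -e; apply: le_area => //; first exact: measurable_disk.
  move=> z [s [t [s1 t1 ->]]]; rewrite /euclidean_disk /= !subr0 expr1n.
  nra.
have fin : area (euclidean_disk (0%R : R * R) 1) \is a fin_num.
  by rewrite ge0_fin_numE ?measure_ge0 //; apply: le_lt_trans up _; rewrite ltry.
exists (fine (area (euclidean_disk (0%R : R * R) 1))).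
  by rewrite -lte_fin fineK //; apply: lt_le_trans lo; rewrite lte_fin.
move=> r r0; rewrite EFinM fineK // -(scale r r0) -muleA -EFinM mulVf ?mule1 //.
by rewrite expf_neq0 // gt_eqF.
Qed.

(** * Extreme points of convex sets *)

Lemma conv_coord (R : realType) (x y : convex_lmodType (R * R)%type) (t : {i01 R}) :
  x <| t |> y = (y.1 + t%:num * (x.1 - y.1), y.2 + t%:num * (x.2 - y.2)) :> R * R.
Proof.
transitivity (t%:num * x.1 + (1 - t%:num) * y.1, t%:num * x.2 + (1 - t%:num) * y.2) => //.
by congr (_, _); ring.
Qed.

Lemma convexP (R : realType) (K : set (R * R)) : convex_set K ->
  forall x y t, K x -> K y -> 0 <= t <= 1 ->
  K (x.1 + t * (y.1 - x.1), x.2 + t * (y.2 - x.2)).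
Proof.
move=> cK x y t Kx Ky /andP[t0 t1].
by have := cK y x (Itv01 t0 t1) (mem_set Ky) (mem_set Kx) => /set_mem; rewrite conv_coord.
Qed.

Lemma convex_setP (R : realType) (K : set (R * R)) :
  (forall x y t, K x -> K y -> 0 <= t <= 1 ->
  K (x.1 + t * (y.1 - x.1), x.2 + t * (y.2 - x.2))) -> convex_set K.
Proof.
move=> cK x y t /set_mem Kx /set_mem Ky; apply/mem_set; rewrite conv_coord.
by apply: cK => //; rewrite ge0 le1.
Qed.

Lemma interior_box (R : realType) (K : set (R * R)) (x : R * R) :
  K° x <-> exists2 e, 0 < e & forall y, `|y.1 - x.1| < e -> `|y.2 - x.2| < e -> K y.
Proof.
split=> [|[e e0 H]].
  rewrite /interior /= => /nbhs_ballP[e /= e0 H]; exists e => // y h1 h2; apply: H.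
  by split; rewrite /ball /= distrC.
apply/nbhs_ballP; exists e => //= y [h1 h2]; apply: H; rewrite distrC.
  exact: h1.
exact: h2.
Qed.

Lemma interior_convex (R : realType) (K : set (R * R)) : convex_set K ->
  forall x y t, K° x -> K y -> 0 <= t < 1 ->
  K° (x.1 + t * (y.1 - x.1), x.2 + t * (y.2 - x.2)).
Proof.
move=> cK x y t /interior_box[e e0 H] Ky /andP[t0 t1].
apply/interior_box; exists (e * (1 - t)); first by rewrite mulr_gt0 // subr_gt0.
have u0 : 0 < 1 - t by rewrite subr_gt0.
move=> z /= h1 h2.
pose x' := ((z.1 - t * y.1) / (1 - t), (z.2 - t * y.2) / (1 - t)).
have Kx' : K x'.
  apply: H => /=.
    have -> : (z.1 - t * y.1) / (1 - t) - x.1 = (z.1 - (x.1 + t * (y.1 - x.1))) / (1 - t).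
      by field; rewrite gt_eqF.
    by rewrite normrM normfV (gtr0_norm u0) ltr_pdivrMr.
  have -> : (z.2 - t * y.2) / (1 - t) - x.2 = (z.2 - (x.2 + t * (y.2 - x.2))) / (1 - t).
    by field; rewrite gt_eqF.
  by rewrite normrM normfV (gtr0_norm u0) ltr_pdivrMr.
have := convexP cK Kx' Ky (_ : 0 <= t <= 1); rewrite t0 ltW // => /(_ isT).
by congr K; rewrite [RHS]surjective_pairing /=; congr (_, _); field; rewrite gt_eqF.
Qed.

Lemma convex_simplex (R : realType) (K : set (R * R)) : convex_set K ->
  forall p q r s t, K p -> K q -> K r -> 0 <= s -> 0 <= t -> s + t <= 1 ->
  K (p.1 + s * (q.1 - p.1) + t * (r.1 - p.1), p.2 + s * (q.2 - p.2) + t * (r.2 - p.2)).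
Proof.
move=> cK p q r s t Kp Kq Kr s0 t0 st.
have [st0|st0] := eqVneq (s + t) 0.
  have -> : s = 0 by lra.
  have -> : t = 0 by lra.
  by rewrite !mul0r !addr0 -surjective_pairing.
have st1 : 0 < s + t by rewrite lt_neqAle eq_sym st0 addr_ge0.
have h1 : 0 <= t / (s + t) <= 1 by rewrite (divr_ge0 t0 (ltW st1)) ler_pdivrMr // mul1r lerDr.
have h2 : 0 <= s + t <= 1 by rewrite ltW.
have := convexP cK Kp (convexP cK Kq Kr h1) h2.
by congr K; congr (_, _) => /=; field.
Qed.

Lemma orient_convex_comb (R : realType) (p q r z : R * R) : orient p q r != 0 ->
  z = (p.1 + orient r p z / orient p q r * (q.1 - p.1) + orient p q z / orient p q r * (r.1 - p.1),
       p.2 + orient r p z / orient p q r * (q.2 - p.2) + orient p q z / orient p q r * (r.2 - p.2)).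
Proof.
by move=> D0; rewrite [LHS]surjective_pairing; congr (_, _); rewrite /orient;
  field; rewrite /orient in D0.
Qed.

Lemma triangle_sub (R : realType) (K : set (R * R)) : convex_set K ->
  forall p q r, K p -> K q -> K r -> 0 < orient p q r -> triangle p q r `<=` K.
Proof.
move=> cK p q r Kp Kq Kr D0 z [h1 h2 h3].
rewrite (orient_convex_comb z (lt0r_neq0 D0)); apply: convex_simplex => //.
- by rewrite divr_ge0 // ltW.
- by rewrite divr_ge0 // ltW.
rewrite -mulrDl ler_pdivrMr // mul1r.
suff -> : orient p q r = orient r p z + orient p q z + orient q r z by rewrite lerDl.
by rewrite /orient; ring.
Qed.

Definition extreme (R : realType) (K : set (R * R)) (x : R * R) : Prop :=
  K x /\ forall d : R * R, K (x.1 + d.1, x.2 + d.2) -> K (x.1 - d.1, x.2 - d.2) -> d = 0.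

Lemma extreme_boundary (R : realType) (K : set (R * R)) x : extreme K x -> boundary K x.
Proof.
move=> [Kx H]; split; first exact: subset_closure.
move=> /interior_box[e e0 h].
have e2 : `|e / 2| < e by rewrite gtr0_norm ?divr_gt0 //; lra.
have c1 (u : R) : `|u + e / 2 - u| < e by rewrite addrAC addrN add0r.
have c2 (u : R) : `|u - e / 2 - u| < e by rewrite addrAC addrN add0r normrN.
have [] := H (e / 2, e / 2) (h (_, _) (c1 _) (c1 _)) (h (_, _) (c2 _) (c2 _)).
by move=> /eqP; rewrite mulf_eq0 invr_eq0 pnatr_eq0 gt_eqF.
Qed.

Lemma continuous_linear2 (R : realType) (a b : R) :
  continuous (fun z : R * R => a * z.1 + b * z.2).
Proof.
move=> z; apply: (@cvgD _ R^o); apply: (@cvgM R); (try exact: cvg_cst); [exact: cvg_fst|exact: cvg_snd].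
Qed.

Lemma lex_max (R : realType) (K : set (R * R)) (a b c d : R) : compact K -> K !=set0 ->
  exists2 v, K v & forall z, K z -> a * z.1 + b * z.2 < a * v.1 + b * v.2 \/
    (a * z.1 + b * z.2 = a * v.1 + b * v.2 /\ c * z.1 + d * z.2 <= c * v.1 + d * v.2).
Proof.
move=> cK K0.
have [w /set_mem Kw wm] := compact_EVT_max K0 cK (continuous_subspaceT (@continuous_linear2 R a b)).
pose F := K `&` [set z | a * z.1 + b * z.2 = a * w.1 + b * w.2].
have clF : closed [set z : R * R | a * z.1 + b * z.2 = a * w.1 + b * w.2].
  have -> : [set z : R * R | a * z.1 + b * z.2 = a * w.1 + b * w.2] =
     (fun z : R * R => a * z.1 + b * z.2) @^-1` [set a * w.1 + b * w.2] by [].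
  by apply: closed_comp => [z _|]; [exact: continuous_linear2|exact: closed_eq].
have cF : compact F by exact: compact_closedI.
have F0 : F !=set0 by exists w.
have [v /set_mem [Kv ve] vm] := compact_EVT_max F0 cF (continuous_subspaceT (@continuous_linear2 R c d)).
exists v => // z Kz; have := wm z (mem_set Kz); rewrite le_eqVlt => /orP[/eqP e|]; last first.
  by left; rewrite ve.
by right; rewrite ve; split=> //; apply: vm; apply/mem_set.
Qed.

Lemma lex_max_extreme (R : realType) (K : set (R * R)) (a b c d : R) v :
  a * d - b * c != 0 -> K v ->
  (forall z, K z -> a * z.1 + b * z.2 < a * v.1 + b * v.2 \/
    (a * z.1 + b * z.2 = a * v.1 + b * v.2 /\ c * z.1 + d * z.2 <= c * v.1 + d * v.2)) ->
  extreme K v.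
Proof.
move=> D0 Kv H; split=> // x /H h1 /H h2; rewrite /= in h1 h2.
have e1 : a * x.1 + b * x.2 = 0 by lra.
have e2 : c * x.1 + d * x.2 = 0 by lra.
rewrite [x]surjective_pairing; congr (_, _); apply: (mulfI D0); rewrite mulr0.
  have -> : (a * d - b * c) * x.1 = d * (a * x.1 + b * x.2) - b * (c * x.1 + d * x.2) by ring.
  by rewrite e1 e2 !mulr0 subr0.
have -> : (a * d - b * c) * x.2 = a * (c * x.1 + d * x.2) - c * (a * x.1 + b * x.2) by ring.
by rewrite e1 e2 !mulr0 subr0.
Qed.

Lemma extreme_max (R : realType) (K : set (R * R)) (a b : R) : compact K -> K !=set0 ->
  (a != 0) || (b != 0) ->
  exists2 v, extreme K v & forall z, K z -> a * z.1 + b * z.2 <= a * v.1 + b * v.2.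
Proof.
move=> cK K0 ab0; have [v Kv H] := lex_max a b (- b) a cK K0.
exists v; last by move=> z /H [/ltW|[-> _]].
apply: lex_max_extreme H => //; rewrite mulrN opprK.
by case/orP: ab0 => h; rewrite gt_eqF //; rewrite -!expr2;
 [apply: ltr_pwDl|apply: ltr_pwDr]; rewrite ?sqr_ge0 // lt_neqAle eq_sym expf_neq0 ?sqr_ge0.
Qed.

(** Shifting a little weight from [q] to [r], or back, moves [z] by opposite multiples of [q - r]
    inside [K]. *)
Lemma extreme_simplex (R : realType) (K : set (R * R)) : convex_set K ->
  forall z p q r s t, extreme K z -> K p -> K q -> K r -> 0 < s -> 0 < t -> s + t <= 1 ->
  z = (p.1 + s * (q.1 - p.1) + t * (r.1 - p.1), p.2 + s * (q.2 - p.2) + t * (r.2 - p.2)) ->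
  q = r.
Proof.
move=> cK z p q r s t [_ H] Kp Kq Kr s0 t0 st zE; rewrite {}zE /= in H.
pose e := Num.min s t.
have e0 : 0 < e by rewrite lt_min s0.
have [es et] : e <= s /\ e <= t by rewrite !ge_min !lexx orbT.
have := H (e * (q.1 - r.1), e * (q.2 - r.2)).
have p1 : 0 <= s + e by lra.
have p2 : 0 <= t - e by lra.
have p3 : s + e + (t - e) <= 1 by lra.
have p4 : 0 <= s - e by lra.
have p5 : 0 <= t + e by lra.
have p6 : s - e + (t + e) <= 1 by lra.
have h1 := convex_simplex cK Kp Kq Kr p1 p2 p3.
have h2 := convex_simplex cK Kp Kq Kr p4 p5 p6.
move=> h; have [] : (e * (q.1 - r.1), e * (q.2 - r.2)) = 0.
  by apply: h; [move: h1|move: h2]; congr K; congr (_, _) => /=; ring.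
move=> /eqP; rewrite mulf_eq0 gt_eqF // subr_eq0 => /eqP e1.
move=> /eqP; rewrite mulf_eq0 gt_eqF // subr_eq0 => /eqP e2.
by rewrite [q]surjective_pairing [r]surjective_pairing e1 e2.
Qed.

Lemma extreme_segment (R : realType) (K : set (R * R)) : convex_set K ->
  forall z p q t, extreme K z -> K p -> K q -> 0 < t < 1 ->
  z = (p.1 + t * (q.1 - p.1), p.2 + t * (q.2 - p.2)) -> q = p.
Proof.
move=> cK z p q t ez Kp Kq /andP[t0 t1] zE.
apply: (extreme_simplex cK (t := 1 - t) ez Kp Kq Kp t0).
- by rewrite subr_gt0.
- by rewrite addrC subrK.
by rewrite !subrr !mulr0 !addr0.
Qed.

(** Otherwise a linear function equal at [p] and [q] would attain both its maximum and its minimum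
    over [K] there and be constant on [K], against the interior point. *)
Lemma extreme_two_points (R : realType) (K : set (R * R)) (p q : R * R) :
  compact K -> K° !=set0 -> exists v, [/\ extreme K v, v <> p & v <> q].
Proof.
move=> cK [z0 z0K].
have K0 : K !=set0 by exists z0; apply: interior_subset.
apply: contrapT => H.
have ext v : extreme K v -> v = p \/ v = q.
  move=> ev; have [->|/eqP vp] := eqVneq v p; first by left.
  have [->|/eqP vq] := eqVneq v q; first by right.
  by exfalso; apply: H; exists v.
have [a [b [ab0 abE]]] : exists a b : R, (a != 0) || (b != 0) /\ a * p.1 + b * p.2 = a * q.1 + b * q.2.
  have [h|h] := boolP ((p.2 - q.2 != 0) || (q.1 - p.1 != 0)).
    by exists (p.2 - q.2), (q.1 - p.1); split=> //; ring.
  exists 1, 0; rewrite oner_neq0 !mul0r !addr0 !mul1r; split=> //.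
  by move: h; rewrite negb_or !negbK => /andP[_ /eqP]; lra.
have nab0 : (- a != 0) || (- b != 0) by rewrite !oppr_eq0.
have [v1 /ext e1 m1] := extreme_max cK K0 ab0.
have [v2 /ext e2 m2] := extreme_max cK K0 nab0.
have f1 : a * v1.1 + b * v1.2 = a * p.1 + b * p.2 by case: e1 => ->.
have f2 : a * v2.1 + b * v2.2 = a * p.1 + b * p.2 by case: e2 => ->.
have const z : K z -> a * z.1 + b * z.2 = a * p.1 + b * p.2.
  by move=> Kz; have := m1 z Kz; have := m2 z Kz; lra.
move/interior_box: z0K => [e e0 he].
have [eps [ep0 ea eb]] : exists eps, [/\ 0 < eps, `|eps * a| < e & `|eps * b| < e].
  pose d := `|a| + `|b| + 1.
  have d0 : 0 < d by rewrite ltr_wpDl // addr_ge0.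
  exists (e / d); rewrite divr_gt0 //; split=> //; rewrite normrM (gtr0_norm (divr_gt0 e0 d0));
   rewrite -mulrA gtr_pMr // mulrC ltr_pdivrMr // mul1r /d; have := normr_ge0 a; have := normr_ge0 b; lra.
have Kz1 : K (z0.1 + eps * a, z0.2 + eps * b) by apply: he; rewrite /= addrAC addrN add0r.
have Kz0 : K z0 by apply: he; rewrite addrN normr0.
have := const _ Kz1; rewrite -(const _ Kz0) /= => h.
have {}h : eps * (a ^+ 2 + b ^+ 2) = 0 by move: h; rewrite !expr2; lra.
move/eqP: h; rewrite mulf_eq0 (gt_eqF ep0) /= paddr_eq0 ?sqr_ge0 // !sqrf_eq0.
by case/orP: ab0 => /negbTE ->; rewrite ?andbF.
Qed.

(** * Cyclic order of the extreme points and the area of a polygonal cell *)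

Definition lex_pos (R : realType) (w : R * R) : bool := (0 < w.1) || (w.1 == 0) && (0 < w.2).

(** The lexicographically positive vectors form an open half-plane with one of its boundary rays. On
    such a set comparison by angle is transitive, as the expansion of [b1 * (a1 * c2 - a2 * c1)]
    shows. *)
Lemma lex_pos_trans (R : realType) (p a b c : R * R) :
  lex_pos (a.1 - p.1, a.2 - p.2) -> lex_pos (b.1 - p.1, b.2 - p.2) -> lex_pos (c.1 - p.1, c.2 - p.2) ->
  0 <= orient p a b -> 0 <= orient p b c -> 0 <= orient p a c.
Proof.
rewrite /lex_pos /orient /=.
move: (a.1 - p.1) (a.2 - p.2) (b.1 - p.1) (b.2 - p.2) (c.1 - p.1) (c.2 - p.2) => a1 a2 b1 b2 c1 c2.
move=> ha hb hc h1 h2.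
have a0 : 0 <= a1 by case/orP: ha => [/ltW//|/andP[/eqP->]].
have c0 : 0 <= c1 by case/orP: hc => [/ltW//|/andP[/eqP->]].
case/orP: hb => [b0|/andP[/eqP b0 b20]].
  rewrite -(pmulr_rge0 _ b0).
  have -> : b1 * (a1 * c2 - a2 * c1) = a1 * (b1 * c2 - b2 * c1) + c1 * (a1 * b2 - a2 * b1) by ring.
  by rewrite addr_ge0 // mulr_ge0.
rewrite b0 in h1 h2; have c10 : c1 = 0 by nra.
rewrite c10 mulr0 subr0; case/orP: hc => [|/andP[_ c2p]]; first by rewrite c10 ltxx.
by rewrite mulr_ge0 // ltW.
Qed.

Lemma lex_pos_parallel (R : realType) (a b : R * R) : lex_pos a -> lex_pos b ->
  a.1 * b.2 - a.2 * b.1 = 0 -> exists2 t, 0 < t & a.1 = t * b.1 /\ a.2 = t * b.2.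
Proof.
rewrite /lex_pos => ha /orP[b0|/andP[/eqP b0 b2]] h.
  have a0 : 0 < a.1.
    case/orP: ha => // /andP[/eqP a0 a2]; move: h; rewrite a0 mul0r sub0r => h; exfalso; nra.
  exists (a.1 / b.1); rewrite ?divr_gt0 // divfK ?gt_eqF //; split=> //.
  apply: (mulIf (lt0r_neq0 b0)); rewrite mulrAC divfK ?gt_eqF //; lra.
have a0 : a.1 = 0 by rewrite b0 in h; nra.
case/orP: ha => [|/andP[_ a2]]; first by rewrite a0 ltxx.
by exists (a.2 / b.2); rewrite ?divr_gt0 // divfK ?gt_eqF // b0 a0 mulr0.
Qed.

Lemma extreme_orient_neq0 (R : realType) (K : set (R * R)) (p a b : R * R) : convex_set K -> K p ->
  extreme K a -> extreme K b -> a <> b ->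
  lex_pos (a.1 - p.1, a.2 - p.2) -> lex_pos (b.1 - p.1, b.2 - p.2) -> orient p a b != 0.
Proof.
move=> cK Kp ea eb ab la lb; apply/eqP => h.
have [t t0 [/= e1 e2]] := lex_pos_parallel la lb h.
have [Ka Kb] := (ea.1, eb.1).
have [t1|t1|t1] := ltgtP t 1.
- have := extreme_segment cK (t := t) ea Kp Kb; rewrite t0 t1 => /(_ isT).
  move=> h1; have bp : b = p by apply: h1; rewrite -e1 -e2 [LHS]surjective_pairing; congr (_, _); ring.
  by move: lb; rewrite bp !subrr /lex_pos /= ltxx andbF.
- have := extreme_segment cK (t := t^-1) eb Kp Ka; rewrite invr_gt0 t0 invf_lt1 // t1 => /(_ isT).
  move=> h1; have ap : a = p by apply: h1; rewrite e1 e2 !mulKf ?gt_eqF // [LHS]surjective_pairing; congr (_, _); ring.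
  by move: la; rewrite ap !subrr /lex_pos /= ltxx andbF.
apply: ab; rewrite [a]surjective_pairing [b]surjective_pairing; congr (_, _).
  by move: e1; rewrite t1; lra.
by move: e2; rewrite t1; lra.
Qed.

Lemma orient_cyclic (R : realType) (p q r : R * R) : orient q r p = orient p q r.
Proof. by rewrite /orient; ring. Qed.

Lemma orient_anti (R : realType) (p q r : R * R) : orient p r q = - orient p q r.
Proof. by rewrite /orient; ring. Qed.

(** The points are sorted by angle about the lexicographically least one, [p]. For a triple [a],
    [b], [c] without [p], a wrong turn at [b] would place [b] in the triangle [p a c] with positive
    weights at [a] and [c], which [extreme_simplex] forbids. *)
Lemma extreme_order (R : realType) (K : set (R * R)) (s : seq (R * R)) :
  compact K -> convex_set K -> K° !=set0 -> uniq s -> (forall x, extreme K x <-> x \in s) ->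
  exists v : nat -> R * R, [/\ (2 < size s)%N, v (size s) = v 0%N,
    forall i j l, (i < j)%N -> (j < l)%N -> (l < size s)%N -> 0 < orient (v i) (v j) (v l),
    forall i, (i < size s)%N -> extreme K (v i) &
    forall x, extreme K x -> exists2 i, (i < size s)%N & v i = x].
Proof.
move=> cpK cK K0 us es.
have Kn0 : K !=set0 by case: K0 => z /interior_subset ?; exists z.
have [p Kp pm] := lex_max (-1) 0 0 (-1) cpK Kn0.
have ep : extreme K p.
  by apply: lex_max_extreme pm => //; rewrite mulr0 subr0 mulrNN mulr1 oner_neq0.
have lp z : K z -> z != p -> lex_pos (z.1 - p.1, z.2 - p.2).
  move=> Kz zp; rewrite /lex_pos /= !subr_gt0 subr_eq0; case: (pm z Kz) => [|[e1 e2]].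
    by rewrite !mul0r !addr0 !mulN1r ltrN2 => ->.
  have e1' : z.1 = p.1 by lra.
  rewrite e1' eqxx ltxx /= lt_neqAle; apply/andP; split; last by lra.
  by apply: contraNneq zp => e; rewrite [z]surjective_pairing [p]surjective_pairing e1' e.
have ps : p \in s by apply/es.
pose e (a b : R * R) := 0 <= orient p a b.
pose s' := sort e (rem p s).
have pl : perm_eq s (p :: s').
  by apply: perm_trans (perm_to_rem ps) _; rewrite perm_cons perm_sym perm_sort.
have sz : size s = (size s').+1 by rewrite (perm_size pl).
have ul : uniq (p :: s') by rewrite -(perm_uniq pl).
have el x : extreme K x <-> x \in p :: s' by rewrite -(perm_mem pl).
have tot : total e.
  by move=> a b; rewrite /e (orient_anti p b a) oppr_ge0; case: (leP 0 (orient p b a)) => [_|/ltW ->]; rewrite ?orbT.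
have all_lp : all [pred x | lex_pos (x.1 - p.1, x.2 - p.2)] s'.
  apply/allP => x xs /=; apply: lp; first by apply: (proj2 (el x) _).1; rewrite inE xs orbT.
  by apply: contraTneq xs => ->; move: ul; rewrite cons_uniq => /andP[].
have pw : pairwise e s'.
  rewrite -(sorted_pairwise_in (P := [pred x | lex_pos (x.1 - p.1, x.2 - p.2)])) ?sort_sorted //.
  by move=> b a c /= lb la lc; exact: lex_pos_trans.
have strict i j : (i < j)%N -> (j < size s')%N -> 0 < orient p (nth p s' i) (nth p s' j).
  move=> ij js; have iS := ltn_trans ij js.
  have ms k : (k < size s')%N -> nth p s' k \in s' by exact: mem_nth.
  have := (pairwiseP p pw) i j iS js ij; rewrite /e le_eqVlt => /orP[/eqP h|//].
  have := extreme_orient_neq0 cK Kp (a := nth p s' i) (b := nth p s' j); rewrite -h eqxx => C.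
  suff: false by [].
  apply: C.
  - by apply/el; rewrite inE ms ?orbT.
  - by apply/el; rewrite inE ms ?orbT.
  - move/eqP; rewrite nth_uniq //; last by move: ul; rewrite cons_uniq => /andP[].
    by rewrite ltn_eqF.
  - exact: (allP all_lp _ (ms _ iS)).
  - exact: (allP all_lp _ (ms _ js)).
have s2 : (2 < size s)%N.
  have [v [v1 v2 v3]] := extreme_two_points p (nth p s' 0) cpK K0.
  have [w [w1 w2 w3]] := extreme_two_points p v cpK K0.
  move: v1 w1 => /el; rewrite inE => /orP[/eqP//|v1] /el; rewrite inE => /orP[/eqP//|w1].
  rewrite sz; case: s' v1 w1 v3 {pl sz ul el all_lp pw strict} => [|x [|y l]] //=.
  by rewrite !inE => /eqP-> /eqP.
(* The default value of [nth] is [p], the first vertex, so index [size s] closes the polygon. *)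
pose v i := nth p (p :: s') i.
have vext i : (i < size s)%N -> extreme K (v i).
  by rewrite sz => h; apply/el; exact: mem_nth.
exists v; split=> //.
- by rewrite /v sz nth_default.
- move=> [|i] [|j] [|l] // ij jl ls; rewrite sz ltnS in ls.
    by rewrite /v /=; apply: strict.
  have jl' : (j < l)%N by []. have ij' : (i < j)%N by [].
  have h1 := strict _ _ ij' (ltn_trans jl' ls).
  have h2 := strict _ _ jl' ls.
  have h3 := strict _ _ (ltn_trans ij' jl') ls.
  have := vext j.+1; rewrite sz ltnS => /(_ (ltn_trans jl' ls)).
  have := vext i.+1; rewrite sz ltnS => /(_ (ltn_trans ij' (ltn_trans jl' ls)))[Ki _].
  have := vext l.+1; rewrite sz ltnS => /(_ ls) [Kl _].
  rewrite /v /= in Ki Kl *; move: (nth p s' i) (nth p s' j) (nth p s' l) Ki Kl h1 h2 h3 => a b c Ka Kc h1 h2 h3 eb.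
  rewrite ltNge; apply/negP => h.
  have e1 : orient a b c = orient p a b + orient p b c - orient p a c by rewrite /orient; ring.
  rewrite e1 in h.
  have ac : a = c.
    apply: (extreme_simplex cK (s := orient p b c / orient p a c) (t := orient p a b / orient p a c) eb Kp Ka Kc).
    - exact: divr_gt0.
    - exact: divr_gt0.
    - by rewrite -mulrDl ler_pdivrMr // mul1r; lra.
    by rewrite [LHS](orient_convex_comb b (lt0r_neq0 h3)) -(orient_cyclic c p b).
  by move: h3; rewrite ac /orient; lra.
move=> x /el xl; exists (index x (p :: s')); first by rewrite sz ltnS -ltnS index_mem.
by rewrite /v nth_index.
Qed.

Definition ccw_polygon (R : realType) (n : nat) (v : nat -> R * R) : Prop :=
  [/\ (2 < n)%N, v n = v 0%N &
    forall i j l, (i < j)%N -> (j < l)%N -> (l < n)%N -> 0 < orient (v i) (v j) (v l)].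

Lemma orient_id (R : realType) (p q : R * R) : orient p p q = 0.
Proof. by rewrite /orient; ring. Qed.

Lemma orient_id2 (R : realType) (p q : R * R) : orient p q p = 0.
Proof. by rewrite /orient; ring. Qed.

Lemma orient_id3 (R : realType) (p q : R * R) : orient p q q = 0.
Proof. by rewrite /orient; ring. Qed.

Lemma ccw_edge (R : realType) n (v : nat -> R * R) i m : ccw_polygon n v ->
  (i < n)%N -> (m < n)%N -> 0 <= orient (v i) (v i.+1) (v m).
Proof.
move=> [n2 vn H] iN mN; have [iN'|] := ltnP i.+1 n; last first.
  rewrite leq_eqVlt ltnS [X in _ || X]leqNgt iN orbF => /eqP en; rewrite -en vn -orient_cyclic.
  have [->|m0] := posnP m; first by rewrite orient_id.
  have [->|mi] := eqVneq m i; first by rewrite orient_id3.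
  by apply: ltW; apply: H => //; rewrite ltn_neqAle mi -ltnS -en.
have [lt_mi|im|->] := ltngtP m i; last by rewrite orient_id2.
  by rewrite orient_cyclic; apply/ltW/H.
have [->|mi] := eqVneq m i.+1; first by rewrite orient_id3.
by apply/ltW/H => //; rewrite ltn_neqAle eq_sym mi.
Qed.

Lemma ccw_edge_neq (R : realType) n (v : nat -> R * R) i : ccw_polygon n v ->
  (i < n)%N -> v i.+1 <> v i.
Proof.
move=> [n2 vn H] iN e; have [iN'|] := ltnP i.+1 n; last first.
  rewrite leq_eqVlt ltnS [X in _ || X]leqNgt iN orbF => /eqP en.
  have i1 : (1 < i)%N by rewrite -ltnS -en.
  by have := H 0%N 1%N i isT i1 iN; rewrite -e -en vn orient_id2 ltxx.
case: i iN iN' e => [|i] iN iN' e.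
  by have := H 0%N 1%N 2 isT isT n2; rewrite e orient_id ltxx.
by have := H 0%N i.+1 i.+2 isT (leqnn _) iN'; rewrite e orient_id3 ltxx.
Qed.

Lemma sum_orient_fan (R : realType) n (v : nat -> R * R) : v n = v 0%N ->
  \sum_(0 <= i < n) orient (v 0%N) (v i) (v i.+1) = \sum_(0 <= i < n) cross (v i) (v i.+1).
Proof.
move=> vn; have -> : \sum_(0 <= i < n) orient (v 0%N) (v i) (v i.+1) =
  \sum_(0 <= i < n) (cross (v i) (v i.+1) - (cross (v 0%N) (v i.+1) - cross (v 0%N) (v i))).
  by apply: eq_bigr => i _; rewrite /orient /cross; ring.
by rewrite big_split /= sumrN telescope_sumr // vn subrr subr0.
Qed.

(** The triangle is found at the first diagonal from [v 0] that does not have [z] strictly on its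
    left. *)
Lemma ccw_fan (R : realType) n (v : nat -> R * R) (z : R * R) : ccw_polygon n v ->
  (forall i, (i < n)%N -> 0 <= orient (v i) (v i.+1) z) ->
  exists2 j, (0 < j < n.-1)%N & triangle (v 0%N) (v j) (v j.+1) z.
Proof.
move=> [n2 vn H] zi.
have n0 : (0 < n)%N by exact: ltn_trans n2.
have ex : exists j, (0 < j < n.-1)%N && (orient (v 0%N) (v j.+1) z <= 0).
  exists n.-2; have := zi n.-1; rewrite (ltn_predK n2) vn => /(_ (leqnn _)) h.
  have n1 : (1 < n.-1)%N by rewrite -ltnS (ltn_predK n2).
  rewrite (ltn_predK n1) leqnn andbT -ltnS (ltn_predK n1) n1 /=.
  by rewrite -oppr_ge0 -orient_anti orient_cyclic.
have [j0 /andP[/andP[j1 j2] j3] jm] := ex_minnP ex.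
have jn : (j0.+1 < n)%N by rewrite -(ltn_predK n2) ltnS.
exists j0; rewrite ?j1 //; split.
- case: j0 j1 j2 j3 jm jn => // -[|j] _ j2 j3 jm jn; first exact: zi.
  rewrite leNgt; apply/negP => h.
  by have := jm j.+1; rewrite (ltW h) (ltn_trans _ j2) // => /(_ isT); rewrite ltnn.
- exact/zi/ltnW.
by rewrite -orient_cyclic orient_anti oppr_ge0.
Qed.

(** The linear function that increases to the right of an edge has its maximum over [K] at an
    extreme point, hence at a vertex, and [ccw_edge] keeps the vertices on the left. So [K] lies to
    the left of every edge. *)
Lemma extreme_fan (R : realType) (K : set (R * R)) n (v : nat -> R * R) :
  compact K -> convex_set K -> K° !=set0 -> ccw_polygon n v ->
  (forall i, (i < n)%N -> extreme K (v i)) ->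
  (forall x, extreme K x -> exists2 i, (i < n)%N & v i = x) ->
  K = \big[setU/set0]_(j < n.-2) triangle (v 0%N) (v j.+1) (v j.+2).
Proof.
move=> cpK cK K0 cv ve ev; have [n2 vn H] := cv.
have Kn0 : K !=set0 by case: K0 => z /interior_subset ?; exists z.
have lt3 j : (j < n.-2)%N -> (j.+2 < n)%N by case: n n2 {cv ve ev vn H} => [|[|n]].
rewrite -(bigcup_mkord _ (fun j => triangle (v 0%N) (v j.+1) (v j.+2))); apply/seteqP; split=> z.
  move=> Kz; have [i iN|[|j] /andP[j1 j2] tz] := @ccw_fan _ n v z cv => //.
    have ab0 : ((v i.+1).2 - (v i).2 != 0) || (- ((v i.+1).1 - (v i).1) != 0).
      apply/negP => /negP; rewrite negb_or !negbK oppr_eq0 !subr_eq0 => /andP[/eqP e2 /eqP e1].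
      by apply: (ccw_edge_neq cv iN); rewrite [LHS]surjective_pairing e1 e2 -surjective_pairing.
    have [w /ev[m mN <-] /(_ z Kz)] := extreme_max cpK Kn0 ab0.
    by have := ccw_edge cv iN mN; rewrite /orient; lra.
  by exists j => //=; rewrite -ltnS (ltn_predK j2).
move=> [j /= /lt3 jn]; apply: triangle_sub => //.
- by apply: (ve _ _).1; exact: ltn_trans n2.
- by apply: (ve _ _).1; exact: ltnW.
- by apply: (ve _ _).1.
- exact: H.
Qed.

(** Subadditivity over the fan points in the right direction: it turns unit area into a lower bound
    for the shoelace sum. *)
Lemma extreme_area (R : realType) (K : set (R * R)) n (v : nat -> R * R) :
  compact K -> convex_set K -> K° !=set0 -> ccw_polygon n v ->
  (forall i, (i < n)%N -> extreme K (v i)) ->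
  (forall x, extreme K x -> exists2 i, (i < n)%N & v i = x) ->
  measurable (K : set (plane R)) /\
  (area K <= ((\sum_(0 <= i < n) cross (v i) (v i.+1)) / 2)%:E)%E.
Proof.
move=> cpK cK K0 cv ve ev; have [n2 vn H] := cv.
have KE := extreme_fan cpK cK K0 cv ve ev.
have mK : measurable (K : set (plane R)).
  by rewrite KE; apply: bigsetU_measurable => j _; exact: measurable_triangle.
split=> //; rewrite -sum_orient_fan //.
have -> : \sum_(0 <= i < n) orient (v 0%N) (v i) (v i.+1) =
    \sum_(j < n.-2) orient (v 0%N) (v j.+1) (v j.+2).
  case: n n2 vn {cv ve ev H KE} => [|[|[|n]]] // _ vn.
  by rewrite big_nat_recl // orient_id add0r big_nat_recr //= vn orient_id2 addr0 big_mkord.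
rewrite mulr_suml -sumEFin.
have := @content_subadditive _ _ _ (product_measure1 (@lebesgue_measure R) (@lebesgue_measure R))
  K (fun j => triangle (v 0%N) (v j.+1) (v j.+2)) n.-2.
move=> /(_ (fun k _ => measurable_triangle _ _ _) mK) /(_ (eq_ind _ (fun z => K `<=` z) (@subset_refl _ K) _ KE)) h.
apply: le_trans h _; apply: lee_sum => j _; apply: area_triangle_le; apply: H => //.
by case: n n2 j {cv ve ev vn KE} => [|[|n]] // _ j; rewrite !ltnS.
Qed.

Lemma convex_polygon_ccw (R : realType) n (v : nat -> R * R) : ccw_polygon n v ->
  convex_polygon (fun i : 'I_n => v i).
Proof.
move=> [n2 vn H].
have neq i j : (i < j)%N -> (j < n)%N -> v i <> v j.
  move=> ij jn e; have [j1|j1] := ltnP j.+1 n.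
    by have := H i j j.+1 ij (leqnn _) j1; rewrite e orient_id ltxx.
  have [i0|i0] := posnP i; last by have := H 0%N i j i0 ij jn; rewrite e orient_id3 ltxx.
  have j2 : (1 < j)%N by rewrite -ltnS; exact: leq_trans n2 j1.
  by have := H 0%N 1%N j isT j2 jn; rewrite -e i0 orient_id2 ltxx.
split=> [i j e|i j l ij jl|].
- apply/val_inj => /=; have [ij|ij|//] := ltngtP i j.
    by case: (neq i j ij (ltn_ord j)).
  by case: (neq j i ij (ltn_ord i)).
- exact/ltW/H.
have l0 := ltn_trans (isT : (0 < 2)%N) n2; have l1 := ltn_trans (isT : (1 < 2)%N) n2.
exists (Ordinal l0), (Ordinal l1), (Ordinal n2) => /=.
by rewrite gt_eqF // H.
Qed.

Lemma ccw_length (R : realType) (M : set (R * R)) n (v : nat -> R * R) : v n = v 0%N ->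
  M_length M (fun i : 'I_n => v i) = \sum_(0 <= i < n) M_norm M (v i.+1 - v i).
Proof.
move=> vn; rewrite /M_length big_mkord; apply: eq_bigr => i _; congr (M_norm M (_ - _)) => /=.
have [iN|] := ltnP i.+1 n; first by rewrite modn_small.
rewrite leq_eqVlt ltnS leqNgt ltn_ord orbF => /eqP <-.
by rewrite modnn vn.
Qed.

(** * The perimeter of a cell *)

Lemma M_norm_le (R : realType) (M : set (R * R)) (x y : R * R) (l : R) : 0 <= l -> M y ->
  x = l *: y -> M_norm M x <= l.
Proof.
move=> l0 My xy; apply: ge_inf; first by exists 0 => z [].
by split=> //; exists y.
Qed.

Lemma M_norm_exists (R : realType) (M : set (R * R)) (x : R * R) : M° 0 ->
  [set l : R | 0 <= l /\ exists2 y, M y & x = l *: y] !=set0.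
Proof.
move=> /interior_box[e e0 he]; pose d := `|x.1| + `|x.2| + 1.
have d0 : 0 < d by rewrite ltr_wpDl // addr_ge0.
exists (d / e); split; first by rewrite ltW // divr_gt0.
exists ((e / d) *: x); last by rewrite scalerA mulrA divfK ?gt_eqF // divff ?gt_eqF // scale1r.
have [n1 n2] := (normr_ge0 x.1, normr_ge0 x.2).
by apply: he => /=; rewrite subr0 /GRing.scale /= normrM (gtr0_norm (divr_gt0 e0 d0)) -mulrA gtr_pMr //
  mulrC ltr_pdivrMr // mul1r /d; lra.
Qed.

Lemma M_norm_ge (R : realType) (M : set (R * R)) (x : R * R) (a b c : R) : M° 0 -> 0 < c ->
  (forall y, M y -> a * y.1 + b * y.2 <= c) -> (a * x.1 + b * x.2) / c <= M_norm M x.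
Proof.
move=> M0 c0 H; apply: lb_le_inf; first exact: M_norm_exists.
move=> l [l0 [y My ->]]; rewrite ler_pdivrMr //=.
have -> : a * (l * y.1) + b * (l * y.2) = l * (a * y.1 + b * y.2) by ring.
by apply: ler_wpM2l => //; exact: H.
Qed.

Lemma M_norm_ge0 (R : realType) (M : set (R * R)) (x : R * R) : M° 0 -> 0 <= M_norm M x.
Proof. by move=> M0; apply: lb_le_inf; [exact: M_norm_exists|move=> l []]. Qed.

Lemma o_symmetric_interior (R : realType) (M : set (R * R)) : convex_disk M -> o_symmetric M -> M° 0.
Proof.
move=> [_ cM [z zM]] sM; have Mz := sM _ (interior_subset zM).
have h : 0 <= (1 / 2 : R) < 1 by apply/andP; split; lra.
have := interior_convex cM zM Mz h; congr (M° _).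
by congr (_, _) => /=; field.
Qed.

Lemma convex_hull_le (R : realType) n (v : 'I_n -> R * R) (a b c : R) :
  (forall i, a * (v i).1 + b * (v i).2 <= c) ->
  forall y, convex_hull v y -> a * y.1 + b * y.2 <= c.
Proof.
move=> H y [w [w0 w1 ->]].
have -> : (\sum_i w i *: v i).1 = \sum_i w i * (v i).1 by rewrite (big_morph (fun z : R * R => z.1) (id1 := 0) (op1 := +%R)).
have -> : (\sum_i w i *: v i).2 = \sum_i w i * (v i).2 by rewrite (big_morph (fun z : R * R => z.2) (id1 := 0) (op1 := +%R)).
rewrite !mulr_sumr -big_split /= -[c]mul1r -w1 mulr_suml; apply: ler_sum => i _.
have -> : a * (w i * (v i).1) + b * (w i * (v i).2) = w i * (a * (v i).1 + b * (v i).2) by ring.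
exact: ler_wpM2l.
Qed.

Lemma cosD2piz (R : realType) (x : R) (z : int) : cos (x + 2 * pi * z%:~R) = cos x.
Proof.
have P n y : cos (y + 2 * pi * n%:R) = cos y :> R.
  by rewrite -[RHS](periodicn (@cosD2pi R) n) -[(pi *+ 2) *+ n]mulr_natr -[pi *+ 2 in RHS]mulr_natl.
case: z => n; first exact: P.
rewrite NegzE -[LHS](P n.+1); congr cos.
by rewrite mulrNz mulrN subrK.
Qed.

Lemma le_cos (R : realType) (a b : R) : 0 <= a -> a <= b -> b <= pi -> cos b <= cos a.
Proof.
move=> a0 ab bp; rewrite leNgt ltr_cos ?in_itv /= ?a0 ?bp ?(le_trans a0 ab) ?(le_trans ab bp) //.
by rewrite -leNgt.
Qed.

(** An odd multiple of [s / 2] is at distance at least [s / 2] from every multiple of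
    [2 * pi = 2 * k * s]. Reducing [z] modulo [2 * k] brings the angle into one turn. *)
Lemma cos_odd_le (R : realType) (k : nat) (z : int) (s := pi / k%:R : R) : (0 < k)%N ->
  cos (s * z%:~R - s / 2) <= cos (s / 2).
Proof.
move=> k0; have kR : 0 < k%:R :> R by rewrite ltr0n.
have s0 : 0 < s by rewrite divr_gt0 // pi_gt0.
have sk : s * k%:R = pi by rewrite divfK // gt_eqF.
have sp : s <= pi by rewrite -sk -[X in X <= _]mulr1 ler_pM2l // ler1n.
pose m := `|(z %% (2 * k)%:Z)%Z|%N.
have k2 : (2 * k)%:Z != 0 by rewrite eqz_nat muln_eq0 negb_or /= -lt0n.
have mE : (z %% (2 * k)%:Z)%Z = m by rewrite gez0_abs // modz_ge0.
have mk : (m < 2 * k)%N by rewrite -ltz_nat -mE; apply: ltz_pmod; rewrite ltz_nat muln_gt0.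
have -> : s * z%:~R - s / 2 = s * m%:R - s / 2 + 2 * pi * ((z %/ (2 * k)%:Z)%Z)%:~R.
  rewrite [in LHS](divz_eq z (2 * k)%:Z) mE intrD intrM -!pmulrn natrM -sk; ring.
rewrite cosD2piz; case: m mk {mE} => [|m] mk.
  by rewrite mulr0 sub0r cosN.
have m0 : 0 <= m%:R :> R by [].
have m1 : m.+1%:R <= 2 * k%:R - 1 :> R.
  by rewrite -natrM lerBrDr natr1 ler_nat.
have h1 : s * m.+1%:R <= 2 * pi - s.
  apply: le_trans (ler_wpM2l (ltW s0) m1) _; rewrite mulrBr mulrCA sk mulr1; lra.
have h2 : s <= s * m.+1%:R by rewrite -[X in X <= _]mulr1 ler_pM2l // ler1n.
move: h1 h2; move: (s * m.+1%:R) => t h1 h2.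
have [tp|tp] := leP (t - s / 2) pi; first by apply: le_cos => //; lra.
have -> : cos (t - s / 2) = cos (2 * pi - (t - s / 2)) by rewrite cos2piB.
by apply: le_cos; lra.
Qed.

Definition regular_hull (R : realType) (k : nat) (r theta : R) : set (R * R) :=
  convex_hull (fun j : 'I_(2 * k) =>
    (r * cos (theta + 2 * pi * j%:R / (2 * k)%:R),
     r * sin (theta + 2 * pi * j%:R / (2 * k)%:R))).

Lemma regular_hull_le (R : realType) (k : nat) (r theta psi c : R) : (0 < k)%N ->
  (forall j : nat, r * cos (theta + pi / k%:R * j%:R - psi) <= c) ->
  forall y, regular_hull k r theta y -> cos psi * y.1 + sin psi * y.2 <= c.
Proof.
move=> k0 H; apply: convex_hull_le => i /=.
apply: le_trans (H i); rewrite cosB.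
have -> : 2 * pi * i%:R / (2 * k)%:R = pi / k%:R * i%:R :> R.
  by rewrite natrM; move: (pi : R) => p; field; rewrite pnatr_eq0 -lt0n.
by rewrite le_eqVlt; apply/orP; left; apply/eqP; ring.
Qed.

Lemma M_norm_polar_ge (R : realType) (k : nat) (r theta l ph : R)
   (M := regular_hull k r theta) : (0 < k)%N -> 0 < r -> M° 0 ->
  l / r <= M_norm M (l * cos ph, l * sin ph).
Proof.
move=> k0 r0 M0.
have H : forall y, M y -> cos ph * y.1 + sin ph * y.2 <= r.
  by apply: regular_hull_le => // j; rewrite ger_pMr // cos_le1.
have := M_norm_ge (l * cos ph, l * sin ph) M0 r0 H => /=.
have -> // : cos ph * (l * cos ph) + sin ph * (l * sin ph) = l.
by transitivity (l * (cos ph ^+ 2 + sin ph ^+ 2)); [ring|rewrite cos2Dsin2 mulr1].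
Qed.

(** [psi] is the normal direction of the side of M met by the ray at angle [ph], and
    [r * cos (s / 2)] is the distance of that side from the centre. *)
Lemma M_norm_support_ge (R : realType) (k : nat) (r theta l ph : R) (s := pi / k%:R)
   (M := regular_hull k r theta) : (1 < k)%N -> 0 < r -> M° 0 ->
  l * vertex_support s (vertex_offset s theta ph - s / 2) / r
    <= M_norm M (l * cos ph, l * sin ph).
Proof.
move=> k1 r0 M0; have k0 := ltnW k1.
have kR : 1 < k%:R :> R by rewrite ltr1n.
have pi0 := pi_gt0 R.
have s0 : 0 < s by rewrite divr_gt0 // (lt_trans _ kR).
have sp : s < pi by rewrite ltr_pdivrMr ?(lt_trans _ kR) // ltr_pMr.
have c0 : 0 < cos (s / 2) by apply: cos_gt0_itv; rewrite divr_ge0 ?(ltW s0) //= ltr_pM2r.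
pose z := Num.floor ((ph - theta) / s).
pose psi := theta + s * z%:~R + s / 2.
have H : forall y, M y -> cos psi * y.1 + sin psi * y.2 <= r * cos (s / 2).
  apply: regular_hull_le => // j; rewrite ler_pM2l //.
  have := cos_odd_le R (j%:Z - z) k0; rewrite -/s; congr (cos _ <= _).
  by rewrite /psi intrD mulrNz; ring.
have rc0 : 0 < r * cos (s / 2) by rewrite mulr_gt0.
have := M_norm_ge (l * cos ph, l * sin ph) M0 rc0 H; congr (_ <= _).
rewrite /vertex_support /vertex_offset -/z.
have -> : ph - theta - s * z%:~R - s / 2 = ph - psi by rewrite /psi; ring.
rewrite cosB /=; field; rewrite !gt_eqF //.
Qed.

Lemma perim_ge (R : realType) (M C : set (R * R)) n (v : nat -> R * R) :
  ccw_polygon n v -> (forall i, (i < n)%N -> extreme C (v i)) ->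
  ((\sum_(0 <= i < n) M_norm M (v i.+1 - v i))%:E <= perim M C)%E.
Proof.
move=> cv ve; apply: ereal_sup_ubound; exists n, (fun i : 'I_n => v i); split.
- exact: convex_polygon_ccw.
- by move=> i; apply/extreme_boundary/ve.
by rewrite ccw_length //; case: cv.
Qed.

Lemma le_of_sqr (R : realType) (a b : R) : 0 <= b -> a ^+ 2 <= b ^+ 2 -> a <= b.
Proof.
move=> b0 h; have [a0|/ltW a0] := leP 0 a; last exact: le_trans b0.
by move: h; rewrite ler_sqr // nnegrE.
Qed.

(** The weights [1] and [h] both bound the M-norm of the edges from below. Whichever alternative of
    [dowker_bound] holds, Minkowski's inequality with area sum at least [b ^ 2] and shoelace sum at
    least 2 makes the weighted length at least [2 * b]. *)
Lemma cell_perim (R : realType) (k : nat) : (3 <= k)%N -> k <> 4 -> k <> 5 -> k <> 7 ->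
  exists2 sl : R, sl <= 0 &
  forall (r theta : R) (M := regular_hull k r theta) (C : set (R * R)) (s : seq (R * R)),
  0 < r -> M° 0 -> compact C -> convex_set C -> C° !=set0 -> area C = 1%E ->
  uniq s -> (forall x, extreme C x <-> x \in s) ->
  ((2 / r * (Num.sqrt (hexagon_area R k) + sl * ((size s)%:R - 6)))%:E <= perim M C)%E.
Proof.
move=> k3 k4 k5 k7; have [sl sl0 H] := @dowker_bound R k k3 k4 k5 k7.
have k1 : (1 < k)%N by exact: ltn_trans k3.
have k0 := ltnW k1.
exists sl => // r theta M C s r0 M0 cpC cC C0 aC us es.
have [v [n2 vn vo ve ev]] := extreme_order cpC cC C0 us es.
have cv : ccw_polygon (size s) v by [].
have [mC] := extreme_area cpC cC C0 cv ve ev; rewrite aC lee_fin => S1.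
set n := size s in n2 vn vo ve ev cv S1 *; set S := \sum_(0 <= i < n) _ in S1.
have op : ordered_polygon n (fun i => (v i).1) (fun i => (v i).2).
  split=> //; [by rewrite vn|by rewrite vn|].
  by move=> i j l /andP[ij jl] ln; exact: vo.
have S0 : 0 < S by lra.
have [l [th [lth thn gap mink]]] := ordered_polygon_minkowski op S0.
apply: le_trans (perim_ge M cv ve); rewrite lee_fin.
have pi0 := pi_gt0 R.
pose sg : R := pi / k%:R.
have sg0 : 0 < sg by rewrite divr_gt0 // ltr0n.
pose h i := vertex_support sg (vertex_offset sg theta (th i) - sg / 2).
set b := Num.sqrt _ + _.
have edge i : (i < n)%N -> v i.+1 - v i = (l i * cos (th i), l i * sin (th i)).
  by move=> /lth[_ e1 e2]; rewrite -e1 -e2.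
have bound (g : nat -> R) : g n = g 0%N -> (forall i, (i < n)%N -> 0 <= g i) ->
    (forall i, (i < n)%N -> l i * g i / r <= M_norm M (v i.+1 - v i)) ->
    b ^+ 2 <= \sum_(0 <= i < n) kite (g i) (g i.+1) (th i.+1 - th i) ->
    2 / r * b <= \sum_(0 <= i < n) M_norm M (v i.+1 - v i).
  move=> gn g0 gM gb; apply: (@le_trans _ _ (\sum_(0 <= i < n) (l i * g i / r))); last first.
    by rewrite !big_nat; apply: ler_sum => i /andP[_ iN]; exact: gM.
  rewrite -mulr_suml mulrAC ler_pM2r ?invr_gt0 //; apply: le_of_sqr.
    by rewrite big_nat; apply: sumr_ge0 => i /andP[_ iN]; rewrite mulr_ge0 ?g0 //; case: (lth i iN).
  apply: le_trans (mink g gn); rewrite exprMn -/S.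
  have K0 : 0 <= \sum_(0 <= i < n) kite (g i) (g i.+1) (th i.+1 - th i) by apply: le_trans gb; exact: sqr_ge0.
  move: gb K0; move: (\sum_(0 <= i < n) kite _ _ _) (b ^+ 2) => K B BK K0.
  have -> : 2 ^+ 2 = 4 :> R by ring.
  by nra.
case: (H n th theta n2 thn gap) => hb.
- apply: (@le_trans _ _ 0); first by rewrite pmulr_rle0 // divr_gt0.
  by apply: sumr_ge0 => i _; exact: M_norm_ge0.
- apply: (bound (fun=> 1)) => // i iN; rewrite edge // mulr1; exact: M_norm_polar_ge.
apply: (bound h) => //.
- by rewrite /h thn -[2 * pi](_ : sg * (2 * k)%:R = _) ?vertex_offset_period //
    natrM mulrCA divfK // pnatr_eq0 -lt0n.
- move=> i iN; have sgp : sg < pi by rewrite ltr_pdivrMr ?ltr0n // ltr_pMr // ltr1n.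
  apply: le_trans ler01 _; apply: vertex_support_ge1 => //.
  by have /andP[] := vertex_offset_itv theta (th i) sg0; lra.
by move=> i iN; rewrite edge //; exact: M_norm_support_ge.
Qed.

Lemma le_sum_norm (R : realType) (g : nat -> R) m n : (m <= n)%N ->
  `|g n - g m| <= \sum_(m <= i < n) `|g i.+1 - g i|.
Proof. by move=> mn; rewrite -telescope_sumr //; exact: ler_norm_sum. Qed.

Lemma closed_variation (R : realType) (g : nat -> R) n a b : g n = g 0%N ->
  (a <= n)%N -> (b <= n)%N -> 2 * (g a - g b) <= \sum_(0 <= i < n) `|g i.+1 - g i|.
Proof.
move=> gn an bn.
suff H c d : (c <= d)%N -> (d <= n)%N -> 2 * `|g d - g c| <= \sum_(0 <= i < n) `|g i.+1 - g i|.
  have [ab|/ltnW ba] := leqP a b.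
    by apply: le_trans (H a b ab bn); rewrite ler_pM2l // distrC ler_norm.
  by apply: le_trans (H b a ba an); rewrite ler_pM2l // ler_norm.
move=> cd dn; rewrite (big_cat_nat (n := d)) //= (big_cat_nat (n := c) _ cd) //=.
have h1 := le_sum_norm g (leq0n c); have h2 := le_sum_norm g cd; have h3 := le_sum_norm g dn.
rewrite -gn in h1; have h4 := ler_normD (g n - g d) (g c - g n).
have -> : 2 * `|g d - g c| = `|g d - g c| + `|g n - g d + (g c - g n)|.
  by rewrite (_ : g n - g d + (g c - g n) = - (g d - g c)) ?normrN; ring.
lra.
Qed.

(** In the frame turned by [theta] the square M is the ball of radius [r] of the sum norm. *)
Lemma square_norm_ge (R : realType) (r theta : R) (x : R * R) (M := regular_hull 2 r theta) :
  0 < r -> M° 0 ->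
  (`|cos theta * x.1 + sin theta * x.2| + `|- sin theta * x.1 + cos theta * x.2|) / r <= M_norm M x.
Proof.
move=> r0 M0.
have H (e0 e1 : R) : `|e0| = 1 -> `|e1| = 1 ->
   (e0 * (cos theta * x.1 + sin theta * x.2) + e1 * (- sin theta * x.1 + cos theta * x.2)) / r <= M_norm M x.
  move=> n0 n1.
  have := @M_norm_ge R M x (e0 * cos theta - e1 * sin theta) (e0 * sin theta + e1 * cos theta) r M0 r0.
  have -> : (e0 * cos theta - e1 * sin theta) * x.1 + (e0 * sin theta + e1 * cos theta) * x.2 =
    e0 * (cos theta * x.1 + sin theta * x.2) + e1 * (- sin theta * x.1 + cos theta * x.2) by ring.
  apply; apply: convex_hull_le => i /=.
  set ph := 2 * pi * i%:R / _.
  have -> : (e0 * cos theta - e1 * sin theta) * (r * cos (theta + ph)) + (e0 * sin theta + e1 * cos theta) * (r * sin (theta + ph))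
     = r * (e0 * cos ph + e1 * sin ph) * (cos theta ^+ 2 + sin theta ^+ 2) by rewrite cosD sinD; ring.
  rewrite cos2Dsin2 mulr1 ger_pMr //.
  suff h : `|cos ph| + `|sin ph| = 1.
    apply: le_trans (ler_norm _) _; apply: le_trans (ler_normD _ _) _.
    by rewrite !normrM n0 n1 !mul1r h.
  rewrite /ph; case: i {ph} => [[|[|[|[|//]]]] /= _].
  - by rewrite mulr0 mul0r cos0 sin0 normr0 normr1 addr0.
  - have -> : 2 * pi * 1 / (2 * 2)%:R = pi / 2 :> R by move: (pi : R) => p; field.
    by rewrite cos_pihalf sin_pihalf normr0 normr1 add0r.
  - have -> : 2 * pi * 2 / (2 * 2)%:R = pi :> R by move: (pi : R) => p; field.
    by rewrite cospi sinpi normrN normr0 normr1 addr0.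
  have -> : 2 * pi * 3 / (2 * 2)%:R = pi / 2 + pi :> R by move: (pi : R) => p; field.
  by rewrite cosDpi sinDpi !normrN cos_pihalf sin_pihalf normr0 normr1 add0r.
move: (_ + _) (_ + _) H => f0 f1 H.
have n1 : `|1| = 1 :> R by exact: normr1.
have n2 : `|-1| = 1 :> R by rewrite normrN.
have := H 1 1 n1 n1; have := H 1 (-1) n1 n2; have := H (-1) 1 n2 n1; have := H (-1) (-1) n2 n2.
rewrite !mul1r !mulN1r.
by case: (ltrP 0 f0) => h0; case: (ltrP 0 f1) => h1;
  rewrite ?(gtr0_norm h0) ?(gtr0_norm h1) ?(ler0_norm h0) ?(ler0_norm h1).
Qed.

(** The sum norm makes the perimeter at least twice the sum of the two widths, divided by [r]. The
    cell fits into a box with these widths, so their product is at least 1 and their sum at least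
    2. *)
Lemma square_cell_perim (R : realType) (r theta : R) (M := regular_hull 2 r theta)
    (C : set (R * R)) (s : seq (R * R)) :
  0 < r -> M° 0 -> compact C -> convex_set C -> C° !=set0 -> area C = 1%E ->
  uniq s -> (forall x, extreme C x <-> x \in s) ->
  ((2 / r * 2)%:E <= perim M C)%E.
Proof.
move=> r0 M0 cpC cC C0 aC us es.
have [v [n2 vn vo ve ev]] := extreme_order cpC cC C0 us es.
have cv : ccw_polygon (size s) v by [].
have [mC _] := extreme_area cpC cC C0 cv ve ev.
set n := size s in n2 vn vo ve ev cv *.
apply: le_trans (perim_ge M cv ve); rewrite lee_fin.
have Cn0 : C !=set0 by case: C0 => z /interior_subset ?; exists z.
have width (a b : R) : (a != 0) || (b != 0) -> exists m W,
    [/\ 0 <= W, forall z, C z -> m <= a * z.1 + b * z.2 <= m + W &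
    2 * W <= \sum_(0 <= i < n) `|a * (v i.+1 - v i).1 + b * (v i.+1 - v i).2|].
  move=> ab0; have nab0 : (- a != 0) || (- b != 0) by rewrite !oppr_eq0.
  have [v1 /ev[i1 i1n <-] m1] := extreme_max cpC Cn0 ab0.
  have [v2 /ev[i2 i2n <-] m2] := extreme_max cpC Cn0 nab0.
  pose g i := a * (v i).1 + b * (v i).2.
  exists (g i2), (g i1 - g i2); split.
  - by have := m2 (v i1) (ve _ i1n).1; rewrite /g; lra.
  - by move=> z Cz; have := m1 z Cz; have := m2 z Cz; rewrite /g; lra.
  have := @closed_variation R g n i1 i2; rewrite /g vn => /(_ erefl (ltnW i1n) (ltnW i2n)) h.
  apply: le_trans h _; rewrite le_eqVlt; apply/orP; left; apply/eqP.
  by apply: eq_bigr => i _; congr `|_| => /=; ring.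
have cs := cos2Dsin2 theta.
have nz : (cos theta != 0) || (sin theta != 0).
  rewrite -negb_and; apply/negP => /andP[/eqP c /eqP s0].
  by move: cs; rewrite c s0 expr0n addr0 => /eqP; rewrite eq_sym oner_eq0.
have nz' : (- sin theta != 0) || (cos theta != 0) by rewrite oppr_eq0 orbC.
have [m0 [W0 [W00 b0 v0]]] := width _ _ nz.
have [m1 [W1 [W10 b1 v1]]] := width _ _ nz'.
have W2 : 2 <= W0 + W1.
  (* Enlarging both widths by [e] makes the box nondegenerate and still leaves their sum below 2. *)
  rewrite leNgt; apply/negP => W2; pose e := (2 - W0 - W1) / 4.
  have e0 : 0 < e by rewrite divr_gt0 //; lra.
  pose p := (m0 * cos theta - m1 * sin theta, m0 * sin theta + m1 * cos theta).
  pose a := ((W0 + e) * cos theta, (W0 + e) * sin theta).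
  pose b := (- (W1 + e) * sin theta, (W1 + e) * cos theta).
  have crE : cross a b = (W0 + e) * (W1 + e).
    by rewrite /cross /=; transitivity ((W0 + e) * (W1 + e) * (cos theta ^+ 2 + sin theta ^+ 2)); [ring|rewrite cs mulr1].
  have w0 : 0 < W0 + e by lra. have w1 : 0 < W1 + e by lra.
  have cr0 : 0 < cross a b by rewrite crE mulr_gt0.
  have [mP aP] := area_parallelogram p cr0.
  have : (area C <= area (parallelogram p a b))%E.
    apply: le_area => // z Cz.
    exists ((cos theta * z.1 + sin theta * z.2 - m0) / (W0 + e)), ((- sin theta * z.1 + cos theta * z.2 - m1) / (W1 + e)).
    have /andP[l0 l1] := b0 z Cz; have /andP[l2 l3] := b1 z Cz.
    split.
    - by rewrite ler_pdivrMr // mul1r divr_ge0 ?(ltW w0) ?subr_ge0 //=; lra.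
    - by rewrite ler_pdivrMr // mul1r divr_ge0 ?(ltW w1) ?subr_ge0 //=; lra.
    have f1 : z.1 = z.1 * (cos theta ^+ 2 + sin theta ^+ 2) by rewrite cs mulr1.
    have f2 : z.2 = z.2 * (cos theta ^+ 2 + sin theta ^+ 2) by rewrite cs mulr1.
    rewrite [LHS]surjective_pairing; congr (_, _) => /=; [rewrite [LHS]f1|rewrite [LHS]f2];
     by field; rewrite !gt_eqF.
  rewrite aC aP crE lee_fin => h1.
  have sum2 : W0 + e + (W1 + e) < 2 by rewrite /e; lra.
  move: (W0 + e) (W1 + e) w0 w1 h1 sum2 => x y x0 y0 h1 sum2.
  have := sqr_ge0 (x - y); have : 0 < (2 - (x + y)) * (2 + (x + y)) by rewrite mulr_gt0; lra.
  nra.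
apply: (@le_trans _ _ ((2 * W0 + 2 * W1) / r)); first by rewrite mulrAC ler_pM2r ?invr_gt0 //; lra.
apply: (@le_trans _ _ (\sum_(0 <= i < n) ((`|cos theta * (v i.+1 - v i).1 + sin theta * (v i.+1 - v i).2| +
   `|- sin theta * (v i.+1 - v i).1 + cos theta * (v i.+1 - v i).2|) / r))).
  by rewrite -mulr_suml ler_pM2r ?invr_gt0 // big_split; exact: lerD.
by apply: ler_sum => i _; exact: square_norm_ge.
Qed.

(** * Extreme points in a normal tiling *)

(** The radii of [normal_tiling] without their comparison, so that the hexagonal tiling fits with
    whatever inner and outer disks are at hand. *)
Definition bounded_cells (R : realType) (T : set (set (R * R))) (r1 r2 : R) : Prop :=
  [/\ 0 < r1, 0 < r2 & forall C, T C ->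
        (exists c, euclidean_disk c r1 `<=` C) /\ (exists c, C `<=` euclidean_disk c r2)].

Lemma disk_trans (R : realType) (a b : R) (x y z : R * R) : 0 <= a -> 0 <= b ->
  euclidean_disk x a y -> euclidean_disk y b z -> euclidean_disk x (a + b) z.
Proof.
rewrite /euclidean_disk /= => a0 b0.
have e1 : z.1 - x.1 = (y.1 - x.1) + (z.1 - y.1) by ring.
have e2 : z.2 - x.2 = (y.2 - x.2) + (z.2 - y.2) by ring.
rewrite e1 e2; move: (y.1 - x.1) (z.1 - y.1) (y.2 - x.2) (z.2 - y.2) => p q u v h1 h2.
have h3 : p * q + u * v <= a * b.
  apply: le_of_sqr; first exact: mulr_ge0.
  rewrite exprMn; apply: le_trans (ler_pM (addr_ge0 (sqr_ge0 p) (sqr_ge0 u)) (addr_ge0 (sqr_ge0 q) (sqr_ge0 v)) h1 h2).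
  by have := sqr_ge0 (p * v - u * q); lra.
by lra.
Qed.

Lemma diskC (R : realType) (x y : R * R) (a : R) : euclidean_disk x a y -> euclidean_disk y a x.
Proof. by rewrite /euclidean_disk /= -[y.1 - _]opprB -[y.2 - _]opprB !sqrrN. Qed.

Lemma disk_coord (R : realType) (x y : R * R) (a : R) : 0 <= a -> euclidean_disk x a y ->
  `|y.1 - x.1| <= a /\ `|y.2 - x.2| <= a.
Proof.
move=> a0; rewrite /euclidean_disk /= => h.
by split; apply: le_of_sqr => //; rewrite real_normK ?num_real //; apply: le_trans h;
  rewrite ?lerDl ?lerDr sqr_ge0.
Qed.

Lemma cell_diam (R : realType) (T : set (set (R * R))) r1 r2 : bounded_cells T r1 r2 ->
  forall C x y, T C -> C x -> C y -> euclidean_disk x (r2 + r2) y.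
Proof.
move=> [_ r20 H] C x y TC Cx Cy; have [_ [c hc]] := H C TC.
by apply: disk_trans (hc _ Cy); rewrite ?ltW //; apply/diskC/hc.
Qed.

Lemma tiling_eq (R : realType) (T : set (set (R * R))) : tiling T ->
  forall C D z, T C -> T D -> C° z -> D° z -> C = D.
Proof. by move=> [_ _ _ tT] C D z TC TD Cz Dz; apply: tT => //; exists z. Qed.

Lemma finite_inj (T U : Type) (A : set T) (B : set U) (f : T -> U) : finite_set B ->
  (forall x, A x -> B (f x)) -> (forall x y, A x -> A y -> f x = f y -> x = y) -> finite_set A.
Proof.
move=> fB AB inj; apply: (@sub_finite_set _ _ (\bigcup_(b in B) (A `&` f @^-1` [set b]))).
  by move=> x Ax; exists (f x); [exact: AB|].
apply: bigcup_finite => // b Bb.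
have [[x [Ax xb]]|nx] := pselect (exists x, A x /\ f x = b); last first.
  by apply: (sub_finite_set _ (finite_set0 T)) => x [Ax xb]; apply: nx; exists x.
by apply: (sub_finite_set _ (finite_set1 x)) => y [Ay yb]; apply: inj => //; rewrite xb.
Qed.

(** A cell is coded by the grid square of side [r1 / 2] that contains the centre of one of its
    inscribed disks. Two cells with the same code have overlapping disks and coincide. *)
Lemma locally_finite (R : realType) (T : set (set (R * R))) r1 r2 rho :
  tiling T -> bounded_cells T r1 r2 -> 0 <= rho ->
  finite_set [set C | T C /\ exists2 z, C z & euclidean_disk 0 rho z].
Proof.
move=> tT [r10 r20 H] rho0; set A := [set _ | _].
have /choice[c cP] : forall C : set (R * R), exists c, T C -> euclidean_disk c r1 `<=` C.
  by move=> C; have [TC|nTC] := pselect (T C); [have [[c hc] _] := H C TC; exists c|exists 0].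
pose L := rho + (r2 + r2).
have L0 : 0 <= L by rewrite !addr_ge0 // ltW.
have cA C : A C -> `|(c C).1| <= L /\ `|(c C).2| <= L.
  move=> [TC [z Cz zr]].
  have Cc : C (c C) by apply: cP => //; rewrite /euclidean_disk /= !subrr expr0n addr0 sqr_ge0.
  have := disk_trans rho0 (addr_ge0 (ltW r20) (ltW r20)) zr (cell_diam (And3 r10 r20 H) TC Cz Cc).
  by move=> /disk_coord => /(_ L0) /=; rewrite !subr0.
pose d := r1 / 2; have d0 : 0 < d by rewrite divr_gt0.
pose f C := (Num.trunc (((c C).1 + L) / d), Num.trunc (((c C).2 + L) / d)).
pose m := (Num.trunc (2 * L / d)).+1.
have near (x y : R) : `|x| <= L -> `|y| <= L -> Num.trunc ((x + L) / d) = Num.trunc ((y + L) / d) -> `|x - y| <= d.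
  rewrite !ler_norml => /andP[x1 x2] /andP[y1 y2] e.
  have x0 : 0 <= (x + L) / d by apply: divr_ge0; [lra|exact: ltW].
  have y0 : 0 <= (y + L) / d by apply: divr_ge0; [lra|exact: ltW].
  have /andP[] := truncn_itv x0; have /andP[] := truncn_itv y0; rewrite e -natr1 => h1 h2 h3 h4.
  have xE : x = d * ((x + L) / d) - L by field; rewrite gt_eqF.
  have yE : y = d * ((y + L) / d) - L by field; rewrite gt_eqF.
  rewrite xE yE; move: ((x + L) / d) ((y + L) / d) h1 h2 h3 h4 => p q h1 h2 h3 h4.
  by apply/andP; split; nra.
have box (x : R) : `|x| <= L -> (Num.trunc ((x + L) / d) < m)%N.
  rewrite ler_norml => /andP[x1 x2].
  by rewrite ltnS; apply: le_truncn; rewrite ler_pM2r ?invr_gt0 //; lra.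
apply: (@finite_inj _ _ A (`I_m `*` `I_m) f).
- by apply: finite_setX; exact: finite_II.
- by move=> C AC; have [h1 h2] := cA C AC; split=> /=; exact: box.
move=> C D AC AD [e1 e2].
  have [[c1 c2] [d1 d2]] := (cA C AC, cA D AD); have [[TC _] [TD _]] := (AC, AD).
  have n1 := near _ _ c1 d1 e1; have n2 := near _ _ c2 d2 e2.
  (* A box of half-side [r1 / 5] about one centre, seen from the other at most [r1 / 2] away in each
     coordinate, stays within [7 / 10] of [r1] there, and twice the square of [7 / 10] is below
     1. *)
  apply: (tiling_eq tT (z := c C)) => //; apply/interior_box; exists (r1 / 5); rewrite ?divr_gt0 // => y.
    move=> h1 h2; apply: cP => //; rewrite /euclidean_disk /=.
    move: h1 h2; move: (y.1 - _) (y.2 - _) => u v; rewrite !ltr_norml => /andP[a1 a2] /andP[b1 b2]; nra.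
  move=> h1 h2; apply: cP => //; rewrite /euclidean_disk /=.
  have -> : y.1 - (c D).1 = (y.1 - (c C).1) + ((c C).1 - (c D).1) by ring.
  have -> : y.2 - (c D).2 = (y.2 - (c C).2) + ((c C).2 - (c D).2) by ring.
  move: n1 n2 h1 h2; move: (y.1 - _) (y.2 - _) ((c C).1 - _) ((c C).2 - _) => u v p q.
  rewrite !ler_norml !ltr_norml /d => /andP[p1 p2] /andP[q1 q2] /andP[a1 a2] /andP[b1 b2].
  have s1 : (u + p) ^+ 2 <= (r1 * 7 / 10) ^+ 2.
    by rewrite -real_normK ?num_real // ler_sqr ?nnegrE ?divr_ge0 ?mulr_ge0 ?(ltW r10) // ler_norml; lra.
  have s2 : (v + q) ^+ 2 <= (r1 * 7 / 10) ^+ 2.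
    by rewrite -real_normK ?num_real // ler_sqr ?nnegrE ?divr_ge0 ?mulr_ge0 ?(ltW r10) // ler_norml; lra.
  by have := sqr_ge0 r1; move: s1 s2; rewrite !expr2; lra.
Qed.

Lemma compact_closed2 (R : realType) (C : set (R * R)) : compact C -> closed C.
Proof. by apply: compact_closed; exact: norm_hausdorff. Qed.

Lemma closed_compl_box (R : realType) (C : set (R * R)) (x : R * R) : closed C -> ~ C x ->
  exists2 e, 0 < e & forall y, `|y.1 - x.1| < e -> `|y.2 - x.2| < e -> ~ C y.
Proof.
move=> /closed_openC oC nCx.
have /interior_box[e e0 h] : (~` C)° x by apply: open_nbhs_nbhs; split.
by exists e.
Qed.

(** The nearby cells that miss [v] are finitely many, so their union is closed and stays away from
    [v]. *)
Lemma near_cells (R : realType) (T : set (set (R * R))) r1 r2 (v : R * R) :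
  tiling T -> bounded_cells T r1 r2 ->
  exists2 e, 0 < e & forall y, `|y.1 - v.1| < e -> `|y.2 - v.2| < e ->
    exists C, [/\ T C, C v & C y].
Proof.
move=> tT bT; have [_ cpT cov _] := tT.
pose rho := `|v.1| + `|v.2| + 2.
have rho0 : 0 <= rho by rewrite !addr_ge0.
pose F := [set C | T C /\ exists2 z, C z & euclidean_disk 0 rho z] `&` [set C | ~ C v].
have fF : finite_set F by exact: finite_setIl (locally_finite tT bT rho0).
have clF : closed (\bigcup_(C in F) C).
  by apply: closed_bigcup => // C [[TC _] _]; apply: compact_closed2; exact: (cpT C TC).1.
have nF : ~ (\bigcup_(C in F) C) v by case=> C [_ nv] Cv; exact: (nv Cv).
have [e e0 he] := closed_compl_box clF nF.
exists (Num.min e 1); first by rewrite lt_min e0 ltr01.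
move=> y; rewrite !lt_min => /andP[y1 y11] /andP[y2 y21].
have [C TC Cy] : (\bigcup_(C in T) C) y by rewrite cov.
exists C; split=> //; apply: contrapT => nCv; apply: (he y y1 y2); exists C => //; split=> //.
split=> //; exists y => //; rewrite /euclidean_disk /= !subr0.
have h1 : `|y.1| <= `|v.1| + 1.
  by rewrite -[y.1](subrK v.1) addrC; apply: le_trans (ler_normD _ _) _; rewrite lerD2l ltW.
have h2 : `|y.2| <= `|v.2| + 1.
  by rewrite -[y.2](subrK v.2) addrC; apply: le_trans (ler_normD _ _) _; rewrite lerD2l ltW.
rewrite -[y.1 ^+ 2]real_normK ?num_real // -[y.2 ^+ 2]real_normK ?num_real // /rho.
have := normr_ge0 y.1; have := normr_ge0 y.2; have := normr_ge0 v.1; have := normr_ge0 v.2.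
move: h1 h2; move: `|y.1| `|y.2| `|v.1| `|v.2| => p q a b; nra.
Qed.

Lemma interior_dense (R : realType) (C : set (R * R)) x e : convex_set C -> C° !=set0 -> C x ->
  0 < e -> exists z, [/\ C° z, `|z.1 - x.1| < e & `|z.2 - x.2| < e].
Proof.
move=> cC [z0 Cz0] Cx e0.
pose d := `|x.1 - z0.1| + `|x.2 - z0.2| + e.
have d0 : 0 < d by rewrite ltr_wpDl // addr_ge0.
have ed : 0 <= 1 - e / d < 1.
  have h1 : 0 < e / d by rewrite divr_gt0.
  have h2 : e / d <= 1 by rewrite ler_pdivrMr // mul1r lerDr addr_ge0.
  by rewrite subr_ge0 h2 /=; lra.
have := interior_convex cC Cz0 Cx ed; set z := (_, _) => Cz; exists z; split=> // {Cz}.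
  have -> : z.1 - x.1 = (z0.1 - x.1) * (e / d) by rewrite /z /=; ring.
  rewrite normrM (gtr0_norm (divr_gt0 e0 d0)) mulrCA gtr_pMr // ltr_pdivrMr // mul1r distrC /d.
  by rewrite -addrA ltrDl ltr_wpDl.
have -> : z.2 - x.2 = (z0.2 - x.2) * (e / d) by rewrite /z /=; ring.
rewrite normrM (gtr0_norm (divr_gt0 e0 d0)) mulrCA gtr_pMr // ltr_pdivrMr // mul1r distrC /d.
by rewrite -addrA addrCA ltrDl ltr_wpDl.
Qed.

Lemma cell_interior_eq (R : realType) (T : set (set (R * R))) C D x : convex_tiling T ->
  T C -> T D -> C x -> D° x -> C = D.
Proof.
move=> [tT cT] TC TD Cx /interior_box[e e0 he].
have [_ cpT _ _] := tT.
have e2 : 0 < e / 2 by rewrite divr_gt0.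
have [z [Cz z1 z2]] := interior_dense (cT C TC) (cpT C TC).2 Cx e2.
apply: (tiling_eq tT TC TD Cz); apply/interior_box; exists (e / 2) => // y y1 y2; apply: he.
  rewrite -[y.1](subrK z.1) -addrA; apply: le_lt_trans (ler_normD _ _) _; lra.
rewrite -[y.2](subrK z.2) -addrA; apply: le_lt_trans (ler_normD _ _) _; lra.
Qed.

Lemma extreme_other_cell (R : realType) (T : set (set (R * R))) r1 r2 C v :
  convex_tiling T -> bounded_cells T r1 r2 -> T C -> extreme C v ->
  exists D, [/\ T D, D <> C & D v].
Proof.
move=> [tT cT] bT TC ev; have [e e0 he] := near_cells v tT bT.
apply: contrapT => H; case: (extreme_boundary ev) => _ nC; apply: nC; apply/interior_box.
exists e => // y y1 y2; have [D [TD Dv Dy]] := he y y1 y2.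
by have [<-//|nDC] := pselect (D = C); exfalso; apply: H; exists D.
Qed.

Lemma extreme_orient (R : realType) (C : set (R * R)) p q r : convex_set C ->
  extreme C p -> extreme C q -> extreme C r -> p <> q -> p <> r -> q <> r -> orient p q r != 0.
Proof.
move=> cC ep ef er pq pr qr; apply/eqP => h.
have [[Cp Cq] Cr] := (ep.1, ef.1, er.1).
have [t [t1 t2]] : exists t, r.1 - p.1 = t * (q.1 - p.1) /\ r.2 - p.2 = t * (q.2 - p.2).
  have [a0|a0] := eqVneq (q.1 - p.1) 0.
    have b0 : q.2 - p.2 != 0.
      apply/eqP => b0; apply: pq; rewrite [p]surjective_pairing [q]surjective_pairing.
      by congr (_, _); lra.
    exists ((r.2 - p.2) / (q.2 - p.2)); rewrite divfK //; split=> //.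
    apply: (mulfI b0); move: h; rewrite /orient a0 mul0r sub0r mulr0 mulr0 => /eqP.
    by rewrite oppr_eq0 => /eqP.
  exists ((r.1 - p.1) / (q.1 - p.1)); rewrite divfK //; split=> //.
  by apply: (mulfI a0); move: h; rewrite /orient mulrA mulrCA divff // mulr1; lra.
have rE : r = (p.1 + t * (q.1 - p.1), p.2 + t * (q.2 - p.2)).
  by rewrite -t1 -t2 [LHS]surjective_pairing; congr (_, _); ring.
have [tn|tn|t0] := ltgtP t 0.
- have u : 0 < 1 - t by lra.
  apply: qr; apply: (extreme_segment cC (t := - t / (1 - t)) ep Cr Cq).
    by rewrite divr_gt0 ?oppr_gt0 // ltr_pdivrMr // mul1r; lra.
  by rewrite rE /= [LHS]surjective_pairing; congr (_, _); field; rewrite gt_eqF.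
- have [tl|tl|te] := ltgtP t 1.
  + by apply/pq/esym; apply: (extreme_segment cC (t := t) er Cp Cq) => //; rewrite tn.
  + apply/pr/esym; apply: (extreme_segment cC (t := t^-1) ef Cp Cr).
      by rewrite invr_gt0 tn invf_lt1.
    by rewrite rE /= [LHS]surjective_pairing; congr (_, _); field; rewrite gt_eqF.
  by apply: qr; rewrite rE te [LHS]surjective_pairing; congr (_, _); ring.
by apply: pr; rewrite rE t0 [LHS]surjective_pairing; congr (_, _); ring.
Qed.

Lemma nbhs_halfplane (R : realType) (a b c : R) (z : R * R) : 0 < a * z.1 + b * z.2 + c ->
  nbhs z [set y : R * R | 0 < a * y.1 + b * y.2 + c].
Proof.
move=> h; have := @continuous_linear2 R a b z => /(cvgr_gt (a * z.1 + b * z.2))/(_ (- c)).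
rewrite -subr_gt0 opprK => /(_ h); apply: filterS => y /=.
by rewrite -subr_gt0 opprK.
Qed.

Lemma triangle_interior (R : realType) (p q r : R * R) : 0 < orient p q r ->
  (triangle p q r)° ((p.1 + q.1 + r.1) / 3, (p.2 + q.2 + r.2) / 3).
Proof.
move=> D0; set g := (_, _).
have pos (x y : R * R) : 0 < orient x y g -> nbhs g [set z | 0 < orient x y z].
  rewrite orientE => /nbhs_halfplane; apply: filterS => z /=; by rewrite orientE.
have h1 : 0 < orient p q g.
  by rewrite (_ : orient p q g = orient p q r / 3) ?divr_gt0 // /orient /g /=; field.
have h2 : 0 < orient q r g.
  by rewrite (_ : orient q r g = orient p q r / 3) ?divr_gt0 // /orient /g /=; field.
have h3 : 0 < orient r p g.
  by rewrite (_ : orient r p g = orient p q r / 3) ?divr_gt0 // /orient /g /=; field.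
rewrite /interior; apply: filterS (filterI (pos _ _ h1) (filterI (pos _ _ h2) (pos _ _ h3))).
by move=> z /= [/ltW ? [/ltW ? /ltW ?]].
Qed.

(** Three extreme points of [C] are not collinear, so they would span a triangle whose centroid is
    interior to both cells. *)
Lemma common_extreme (R : realType) (T : set (set (R * R))) C D p q r : convex_tiling T ->
  T C -> T D -> C <> D -> extreme C p -> extreme C q -> extreme C r -> D p -> D q -> D r ->
  p <> q -> p <> r -> q <> r -> False.
Proof.
move=> [tT cT] TC TD CD ep ef er Dp Dq Dr pq pr qr; apply: CD.
have key q' r' : extreme C q' -> extreme C r' -> D q' -> D r' -> 0 < orient p q' r' -> C = D.
  move=> [Cq _] [Cr _] Dq' Dr' o0; have Cp := ep.1.
  have h := triangle_interior o0.
  apply: (tiling_eq tT TC TD).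
    by apply: interiorS h; apply: triangle_sub => //; exact: cT.
  by apply: interiorS h; apply: triangle_sub => //; exact: cT.
have := extreme_orient (cT C TC) ep ef er pq pr qr.
rewrite neq_lt => /orP[lt0|lt0]; last exact: (key q r ef er Dq Dr lt0).
by apply: (key r q) => //; rewrite orient_anti oppr_gt0.
Qed.

(** This is why cells are polygons: every extreme point lies in another cell, finitely many cells
    come near, and each of them contains at most two. *)
Lemma finite_extreme (R : realType) (T : set (set (R * R))) r1 r2 C :
  convex_tiling T -> bounded_cells T r1 r2 -> T C -> finite_set (extreme C).
Proof.
move=> ctT bT TC; have [tT cT] := ctT; have [_ r20 bd] := bT.
have [_ [c hc]] := bd C TC.
pose rho := `|c.1| + `|c.2| + r2.
have rho0 : 0 <= rho by rewrite !addr_ge0 // ltW.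
have cd : euclidean_disk 0 (`|c.1| + `|c.2|) c.
  rewrite /euclidean_disk /= !subr0 -[c.1 ^+ 2]real_normK ?num_real // -[c.2 ^+ 2]real_normK ?num_real //.
  have := normr_ge0 c.1; have := normr_ge0 c.2; nra.
have Cd x : C x -> euclidean_disk 0 rho x.
  by move=> /hc; apply: disk_trans cd; rewrite ?addr_ge0 // ltW.
pose F := [set D | T D /\ exists2 z, D z & euclidean_disk 0 rho z] `&` [set D | D <> C].
have fF : finite_set F by exact: finite_setIl (locally_finite tT bT rho0).
apply: (@sub_finite_set _ _ (\bigcup_(D in F) (extreme C `&` D))).
  move=> v ev; have [D [TD DC Dv]] := extreme_other_cell ctT bT TC ev.
  by exists D => //; split=> //; split=> //; exists v => //; exact: Cd ev.1.
apply: bigcup_finite => // D [[TD _] DC].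
have [[p [ep Dp]]|np] := pselect (exists p, extreme C p /\ D p); last first.
  by apply: (sub_finite_set _ (finite_set0 _)) => x [ex Dx]; apply: np; exists x.
have [[q [ef Dq qp]]|nq] := pselect (exists q, [/\ extreme C q, D q & p <> q]); last first.
  apply: (sub_finite_set _ (finite_set1 p)) => x [ex Dx] /=; apply: contrapT => xp; apply: nq.
  by exists x; split=> // /esym.
apply: (sub_finite_set _ (finite_set2 p q)) => x [ex Dx] /=; apply: contrapT => H.
apply: (common_extreme ctT TC TD (fun h => DC (esym h)) ep ef ex) => //.
  by move=> h; apply: H; left.
by move=> h; apply: H; right.
Qed.

Lemma continuous_segment (R : realType) (x d : R * R) :
  continuous (fun t : R => (x.1 + t * d.1, x.2 + t * d.2) : R * R).
Proof.
have aff (a b t : R) : (a + u * b) @[u --> t] --> (a + t * b).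
  by apply: (@cvgD _ R^o); [exact: cvg_cst|apply: (@cvgM R); [exact: cvg_id|exact: cvg_cst]].
by move=> t; exact: (cvg_pair (aff x.1 d.1 t) (aff x.2 d.2 t)).
Qed.

Lemma closed_segment_preimage (R : realType) (A : set (R * R)) (x d : R * R) (a b : R) : closed A ->
  compact ([set t : R | a <= t <= b] `&` [set t : R | A (x.1 + t * d.1, x.2 + t * d.2)]).
Proof.
move=> cA; apply: compact_closedI.
  rewrite (_ : [set t : R | a <= t <= b] = `[a, b]%classic); first exact: segment_compact.
  by apply/seteqP; split=> t /=; rewrite in_itv.
have -> : [set t : R | A (x.1 + t * d.1, x.2 + t * d.2)] =
   (fun t : R => (x.1 + t * d.1, x.2 + t * d.2) : R * R) @^-1` A by [].
by apply: closed_comp => // t _; exact: continuous_segment.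
Qed.

Lemma segment_crossing (R : realType) (A B : set (R * R)) (x d : R * R) : closed A -> closed B ->
  A x -> B (x.1 + d.1, x.2 + d.2) ->
  (forall t, 0 <= t <= 1 -> A (x.1 + t * d.1, x.2 + t * d.2) \/ B (x.1 + t * d.1, x.2 + t * d.2)) ->
  exists t, [/\ 0 <= t <= 1, A (x.1 + t * d.1, x.2 + t * d.2) & B (x.1 + t * d.1, x.2 + t * d.2)].
Proof.
move=> cA cB Ax By AB.
have id_cont (S : set R) : {within S, continuous (fun t : R => t)}.
  by apply: continuous_subspaceT => t; exact: cvg_id.
have [|s /set_mem[/= /andP[s0 s1] As] sm] := compact_EVT_max _ (closed_segment_preimage (x := x) (d := d) (a := 0) (b := 1) cA) (id_cont _).
  by exists 0; split; rewrite /= ?lexx ?ler01 // !mul0r !addr0 -surjective_pairing.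
have [|t /set_mem[/= /andP[t0 t1] Bt] tm] := compact_EVT_min _ (closed_segment_preimage (x := x) (d := d) (a := s) (b := 1) cB) (id_cont _).
  by exists 1; split; rewrite /= ?s1 ?lexx // !mul1r.
have [ts|ts] := eqVneq t s; first by exists t; rewrite t1 (le_trans s0 t0); split=> //; rewrite ts.
have lst : s < t by rewrite lt_neqAle eq_sym ts.
exfalso; pose m := (s + t) / 2; have [ms mt] : s < m /\ m < t by rewrite /m; split; lra.
have m01 : 0 <= m <= 1 by apply/andP; split; lra.
case: (AB m m01) => h.
  by have := sm m (mem_set (conj m01 h)); lra.
have ms1 : s <= m <= 1 by rewrite (ltW ms); case/andP: m01.
by have := tm m (mem_set (conj ms1 h)); lra.
Qed.

(* If only two cells meet at [v] then [v] is not extreme: cut across from one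
   cell to the other on one side of [v], find a common point [v + f] of the two
   cells, and reflect it in [v]. *)
Lemma extreme_third_cell (R : realType) (T : set (set (R * R))) r1 r2 C C' v :
  convex_tiling T -> bounded_cells T r1 r2 -> T C -> T C' -> extreme C v ->
  (forall D, T D -> D v -> D = C \/ D = C') -> C' v -> False.
Proof.
move=> ctT bT TC TC' ev H C'v; have [tT cT] := ctT; have [_ cpT _ _] := tT.
have Cv := ev.1; have [_ exv] := ev.
have [e e0 he] := near_cells v tT bT.
have nb y : `|y.1 - v.1| < e -> `|y.2 - v.2| < e -> C y \/ C' y.
  by move=> y1 y2; have [D [TD Dv Dy]] := he y y1 y2; case: (H D TD Dv) => <-; [left|right].
have [vb nvi] := extreme_boundary ev.
have CC' : C <> C'.
  by move=> e1; apply: nvi; apply/interior_box; exists e => // y y1 y2; case: (nb y y1 y2) => //; rewrite -e1.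
apply: CC'; have e4 : 0 < e / 4 by rewrite divr_gt0.
have [x0 [Cx0 x01 x02]] := interior_dense (cT C TC) (cpT C TC).2 Cv e4.
pose d := (x0.1 - v.1, x0.2 - v.2).
have dn0 : 0 < d.1 ^+ 2 + d.2 ^+ 2.
  rewrite lt_neqAle eq_sym addr_ge0 ?sqr_ge0 // andbT paddr_eq0 ?sqr_ge0 // !sqrf_eq0 !subr_eq0.
  apply/negP => /andP[/eqP h1 /eqP h2]; apply: nvi.
  by rewrite [v]surjective_pairing -h1 -h2 -surjective_pairing.
have /interior_box[e1 e10 he1] := Cx0.
pose m := Num.min (e1 / e) 1.
have m0 : 0 < m by rewrite lt_min divr_gt0 // ltr01.
have me : m * e <= e1 by rewrite -ler_pdivlMr // ge_min lexx.
have m1 : m <= 1 by rewrite ge_min lexx orbT.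
(* [w] is a short vector orthogonal to [d], so the segment from [x0 = v + d] to [v - d + w] passes
   beside [v]. It is short enough that [x0 - w], the reflection of the end point in [v], still lies
   in [C]; hence the end point lies in [C']. *)
pose w := (- m * d.2, m * d.1).
have w1 : `|w.1| < e1 /\ `|w.1| < e / 4.
  rewrite /w /= normrM normrN (gtr0_norm m0); split; last first.
    by apply: le_lt_trans x02; apply: ler_piMl.
  by apply: lt_le_trans me; rewrite ltr_pM2l //; apply: lt_trans x02 _; lra.
have w2 : `|w.2| < e1 /\ `|w.2| < e / 4.
  rewrite /w /= normrM (gtr0_norm m0); split; last first.
    by apply: le_lt_trans x01; apply: ler_piMl.
  by apply: lt_le_trans me; rewrite ltr_pM2l //; apply: lt_trans x01 _; lra.
pose dd := (- 2 * d.1 + w.1, - 2 * d.2 + w.2).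
have box t : 0 <= t <= 1 -> `|x0.1 + t * dd.1 - v.1| < e /\ `|x0.2 + t * dd.2 - v.2| < e.
  move=> /andP[t0 t1].
  have e_1 : x0.1 + t * dd.1 - v.1 = (1 - 2 * t) * d.1 + t * w.1 by rewrite /dd /d /=; ring.
  have e_2 : x0.2 + t * dd.2 - v.2 = (1 - 2 * t) * d.2 + t * w.2 by rewrite /dd /d /=; ring.
  have n1 : `|1 - 2 * t| <= 1 by rewrite ler_norml; apply/andP; split; lra.
  have tn : `|t| <= 1 by rewrite ger0_norm.
  have aux (p q : R) : `|p| < e / 4 -> `|q| < e / 4 -> `|(1 - 2 * t) * p + t * q| < e.
    move=> h1 h2; apply: le_lt_trans (ler_normD _ _) _; rewrite !normrM.
    have := ler_pM (normr_ge0 _) (normr_ge0 _) n1 (ltW h1); have := ler_pM (normr_ge0 _) (normr_ge0 _) tn (ltW h2); lra.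
  by rewrite e_1 e_2; split; apply: aux => //; [exact: w1.2|exact: w2.2].
have cC := compact_closed2 (cpT C TC).1; have cC' := compact_closed2 (cpT C' TC').1.
have C'y : C' (x0.1 + dd.1, x0.2 + dd.2).
  have /box : 0 <= (1 : R) <= 1 by rewrite ler01 lexx.
  rewrite !mul1r => -[b1 b2]; case: (nb (x0.1 + dd.1, x0.2 + dd.2) b1 b2) => // Cy; exfalso.
  have [] : (d.1 - w.1, d.2 - w.2) = 0.
    apply: exv => /=.
      apply: he1; rewrite /d /=.
        by rewrite (_ : _ - x0.1 = - w.1) ?normrN; [exact: w1.1|rewrite /w /d /=; ring].
      by rewrite (_ : _ - x0.2 = - w.2) ?normrN; [exact: w2.1|rewrite /w /d /=; ring].
    by move: Cy; congr C; rewrite /dd /d /=; congr (_, _); ring.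
  rewrite /w /= => h1 h2.
  have h3 : d.1 = - m * d.2 by move: h1; rewrite /d /=; lra.
  have h4 : d.2 = m * d.1 by move: h2; rewrite /d /=; lra.
  move: dn0; rewrite !expr2 {1}h3 {3}h4; rewrite (_ : _ + _ = 0) ?ltxx //; ring.
have [t [t01 Ct C't]] := segment_crossing cC cC' (interior_subset Cx0) C'y (fun t h => nb (x0.1 + t * dd.1, x0.2 + t * dd.2) (box t h).1 (box t h).2).
pose f := (x0.1 + t * dd.1 - v.1, x0.2 + t * dd.2 - v.2).
have vf1 : v.1 + f.1 = x0.1 + t * dd.1 by rewrite /f /=; ring.
have vf2 : v.2 + f.2 = x0.2 + t * dd.2 by rewrite /f /=; ring.
have nC : ~ C (v.1 - f.1, v.2 - f.2).
  move=> h; have /exv/(_ h) : C (v.1 + f.1, v.2 + f.2) by rewrite vf1 vf2.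
  move=> [f1 f2].
  have g1 : (1 - 2 * t) * d.1 - t * m * d.2 = 0 by rewrite -[RHS]f1 /dd /w /d /=; ring.
  have g2 : (1 - 2 * t) * d.2 + t * m * d.1 = 0 by rewrite -[RHS]f2 /dd /w /d /=; ring.
  have g3 : (t * m) * (d.1 ^+ 2 + d.2 ^+ 2) = 0.
    have -> : (t * m) * (d.1 ^+ 2 + d.2 ^+ 2) = d.1 * ((1 - 2 * t) * d.2 + t * m * d.1) - d.2 * ((1 - 2 * t) * d.1 - t * m * d.2) by ring.
    by rewrite g1 g2 !mulr0 subr0.
  have t0 : t = 0.
    by move/eqP: g3; rewrite !mulf_eq0 (gt_eqF dn0) (gt_eqF m0) !orbF => /eqP.
  move: g1 g2; rewrite t0 mulr0 subr0 !mul0r !mul1r subr0 addr0 => d1 d2.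
  by move: dn0; rewrite d1 d2 expr0n addr0 ltxx.
have [e2 e20 he2] := closed_compl_box cC nC.
have bt : `|f.1| < e /\ `|f.2| < e by exact: box t t01.
(* The reflection [v - f] is outside [C]. Moved by [ep * d] it stays outside [C] and near [v], hence
   in [C'], and its midpoint with [v + f] is [v + (ep / 2) d], which is interior to [C]. *)
pose ep := Num.min (e2 / e) (Num.min ((e - `|f.1|) / e) (Num.min ((e - `|f.2|) / e) 1)).
have p1 : 0 < e - `|f.1| by rewrite subr_gt0; exact: bt.1.
have p2 : 0 < e - `|f.2| by rewrite subr_gt0; exact: bt.2.
have ep0 : 0 < ep by rewrite !lt_min ltr01 !divr_gt0.
have ep1 : ep <= 1 by rewrite !ge_min lexx !orbT.
have epe2 : ep * e <= e2 by rewrite -ler_pdivlMr // !ge_min lexx ?orbT.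
have epf1 : ep * e <= e - `|f.1| by rewrite -ler_pdivlMr // !ge_min lexx ?orbT.
have epf2 : ep * e <= e - `|f.2| by rewrite -ler_pdivlMr // !ge_min lexx ?orbT.
have epd (p : R) : `|p| < e / 4 -> `|ep * p| < ep * e.
  by move=> h; rewrite normrM (gtr0_norm ep0) ltr_pM2l //; lra.
have C'q : C' (v.1 - f.1 + ep * d.1, v.2 - f.2 + ep * d.2).
  have q1 (a b c : R) : a - b + c - a = - b + c by ring.
  have q2 (a b c : R) : a - b + c - (a - b) = c by ring.
  have [] // := nb (v.1 - f.1 + ep * d.1, v.2 - f.2 + ep * d.2).
  - rewrite [X in `|X|]q1; apply: le_lt_trans (ler_normD _ _) _; rewrite normrN.
    by have := epd d.1 x01; clear -epf1; lra.
  - rewrite [X in `|X|]q1; apply: le_lt_trans (ler_normD _ _) _; rewrite normrN.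
    by have := epd d.2 x02; clear -epf2; lra.
  move=> Cq; exfalso; apply: he2 Cq.
    by rewrite [X in `|X|]q2; have := epd d.1 x01; clear -epe2; lra.
  by rewrite [X in `|X|]q2; have := epd d.2 x02; clear -epe2; lra.
have h2 : 0 <= (1 / 2 : R) <= 1 by apply/andP; split; clear; lra.
have C'm := convexP (cT C' TC') C't C'q h2.
apply/esym; apply: (cell_interior_eq ctT TC' TC C'm).
have h3 : 0 <= 1 - ep / 2 < 1 by apply/andP; split; clear -ep0 ep1; lra.
have := interior_convex (cT C TC) Cx0 Cv h3; congr (C° _).
by congr (_, _) => /=; rewrite -?vf1 -?vf2 /d /=; field.
Qed.

(** * Counting extreme points with a generic linear function *)

Definition slope_fun (R : realType) (t : R) (z : R * R) : R := z.1 + t * z.2.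

(** [s] is a sign that selects one of the two rays from [v] along the level line of
    [slope_fun t]. *)
Definition side (R : realType) (t s : R) (C : set (R * R)) (v : R * R) : Prop :=
  exists2 u, 0 < u & C° (v.1 - t * (s * u), v.2 + s * u).

(* [m] tells a minimum from a maximum. *)
Definition extremal (R : realType) (t : R) (m : bool) (C : set (R * R)) (v : R * R) : Prop :=
  C v /\ forall z, C z -> if m then slope_fun t v <= slope_fun t z else slope_fun t z <= slope_fun t v.

(** A segment from an interior point to [x] or to [y] crosses the level line of [v] at an interior
    point, which differs from [v] because [v] is not interior. *)
Lemma side_exists (R : realType) (t : R) (C : set (R * R)) x y v : convex_set C -> C° !=set0 ->
  ~ C° v -> C x -> C y -> slope_fun t x < slope_fun t v -> slope_fun t v < slope_fun t y ->
  side t 1 C v \/ side t (-1) C v.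
Proof.
move=> cC [z Cz] nv Cx Cy xv vy.
have [w Cw we] : exists2 w, C° w & slope_fun t w = slope_fun t v.
  have aux q : C q -> slope_fun t q != slope_fun t z ->
     0 <= (slope_fun t v - slope_fun t z) / (slope_fun t q - slope_fun t z) < 1 ->
     exists2 w, C° w & slope_fun t w = slope_fun t v.
    move=> Cq qz h; exists (z.1 + (slope_fun t v - slope_fun t z) / (slope_fun t q - slope_fun t z) * (q.1 - z.1),
       z.2 + (slope_fun t v - slope_fun t z) / (slope_fun t q - slope_fun t z) * (q.2 - z.2)).
      exact: interior_convex.
    have qz' : slope_fun t q - slope_fun t z != 0 by rewrite subr_eq0.
    have E (a : R) : slope_fun t (z.1 + a * (q.1 - z.1), z.2 + a * (q.2 - z.2)) =
       slope_fun t z + a * (slope_fun t q - slope_fun t z) by rewrite /slope_fun /=; ring.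
    by rewrite E divfK // addrC subrK.
  have [zv|vz] := leP (slope_fun t z) (slope_fun t v).
    apply: (aux y) => //; first by rewrite gt_eqF //; lra.
    by rewrite ltr_pdivrMr ?ltr_pdivlMr ?divr_ge0 //; lra.
  apply: (aux x) => //; first by rewrite lt_eqF //; lra.
  rewrite -[X in 0 <= X < _]mulrNN -invrN !opprB.
  by rewrite ltr_pdivrMr ?divr_ge0 //; lra.
have w1 : w.1 = v.1 - t * (w.2 - v.2) by move: we; rewrite /slope_fun; lra.
have [lt|gt|eqw] := ltgtP w.2 v.2.
- right; exists (v.2 - w.2); first by rewrite subr_gt0.
  by move: Cw; congr (C° _); rewrite [LHS]surjective_pairing w1; congr (_, _); ring.
- left; exists (w.2 - v.2); first by rewrite subr_gt0.
  by move: Cw; congr (C° _); rewrite [LHS]surjective_pairing w1; congr (_, _); ring.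
exfalso; apply: nv; rewrite [v]surjective_pairing.
by move: Cw; rewrite [w]surjective_pairing w1 eqw subrr mulr0 subr0.
Qed.

(** By convexity the interior points on the ray can be pulled towards [v], to a point common to both
    interiors. So each of the two rays belongs to at most one cell at [v]. *)
Lemma side_unique (R : realType) (T : set (set (R * R))) (t s : R) C D v : convex_tiling T ->
  T C -> T D -> C v -> D v -> side t s C v -> side t s D v -> C = D.
Proof.
move=> [tT cT] TC TD Cv Dv [a a0 Ca] [b b0 Db].
have shrink E u u' : convex_set E -> E v -> 0 < u' -> u' <= u -> E° (v.1 - t * (s * u), v.2 + s * u) ->
    E° (v.1 - t * (s * u'), v.2 + s * u').
  move=> cE Ev u0 uu Eu; have u1 : 0 < u by exact: lt_le_trans uu.
  have h : 0 <= 1 - u' / u < 1.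
    by rewrite subr_ge0 ler_pdivrMr // mul1r uu ltrBlDr ltrDl divr_gt0.
  have := interior_convex cE Eu Ev h; congr (E° _); congr (_, _) => /=; field; rewrite gt_eqF //.
have m0 : 0 < Num.min a b by rewrite lt_min a0.
apply: (tiling_eq tT TC TD (z := (v.1 - t * (s * Num.min a b), v.2 + s * Num.min a b))).
  by apply: shrink Ca => //; [exact: cT|rewrite ge_min lexx].
by apply: shrink Db => //; [exact: cT|rewrite ge_min lexx orbT].
Qed.

Lemma not_extremal_side (R : realType) (t : R) (C : set (R * R)) v : convex_set C -> C° !=set0 ->
  ~ C° v -> C v -> (forall m, ~ extremal t m C v) -> side t 1 C v \/ side t (-1) C v.
Proof.
move=> cC C0 nv Cv H.
have [x Cx xv] : exists2 x, C x & slope_fun t x < slope_fun t v.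
  apply: contrapT => h; apply: (H true); split=> // z Cz; rewrite leNgt; apply/negP => zv.
  by apply: h; exists z.
have [y Cy yv] : exists2 y, C y & slope_fun t v < slope_fun t y.
  apply: contrapT => h; apply: (H false); split=> // z Cz; rewrite leNgt; apply/negP => zv.
  by apply: h; exists z.
exact: side_exists Cx Cy xv yv.
Qed.

(** Otherwise every cell at [v] would occupy one of the two rays of the level line. At most two
    cells would then meet at [v], which [extreme_third_cell] excludes. *)
Lemma extremal_cell (R : realType) (T : set (set (R * R))) r1 r2 (t : R) C v :
  convex_tiling T -> bounded_cells T r1 r2 -> T C -> extreme C v ->
  exists D m, T D /\ extremal t m D v.
Proof.
move=> ctT bT TC ev; have [tT cT] := ctT; have [_ cpT _ _] := tT.
apply: contrapT => H.
have sideT D : T D -> D v -> side t 1 D v \/ side t (-1) D v.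
  move=> TD Dv; apply: not_extremal_side => //; [exact: cT|exact: (cpT D TD).2| |].
    move=> nv; have CD := cell_interior_eq ctT TC TD ev.1 nv.
    by have [_] := extreme_boundary ev; rewrite CD.
  by move=> m em; apply: H; exists D, m.
have uniq D E s : T D -> T E -> D v -> E v -> side t s D v -> side t s E v -> D = E.
  by move=> TD TE Dv Ev sD sE; exact: (side_unique ctT TD TE Dv Ev sD sE).
have Cv := ev.1.
have [[C' [TC' C'v C'C]]|no] := pselect (exists C', [/\ T C', C' v & C' <> C]); last first.
  apply: (extreme_third_cell ctT bT TC TC ev) => // D TD Dv; left.
  by apply: contrapT => DC; apply: no; exists D.
apply: (extreme_third_cell ctT bT TC TC' ev) => // D TD Dv.
case: (sideT C TC Cv) (sideT C' TC' C'v) (sideT D TD Dv) => sC [|] sC' [|] sD;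
 try (by left; exact: (uniq _ _ _ TD TC Dv Cv sD sC)); try (by right; exact: (uniq _ _ _ TD TC' Dv C'v sD sC'));
 by exfalso; apply: C'C; exact: (uniq _ _ _ TC' TC C'v Cv sC' sC).
Qed.

(** The points of [C] with the extremal value form a segment. Its ends, found as lexicographic
    maxima for opposite tie-breaks, are extreme points with equal value and therefore coincide. *)
Lemma extremal_unique (R : realType) (t : R) m (C : set (R * R)) v v' : compact C ->
  (forall p q, extreme C p -> extreme C q -> slope_fun t p = slope_fun t q -> p = q) ->
  extremal t m C v -> extremal t m C v' -> v = v'.
Proof.
move=> cpC inj [Cv mv] [Cv' mv'].
pose s : R := if m then -1 else 1.
have s2 : s * s = 1 by rewrite /s; case: m {mv mv' s} => //; rewrite ?mulrNN mulr1.
have C0 : C !=set0 by exists v.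
have mx z : C z -> s * z.1 + s * t * z.2 <= s * v.1 + s * t * v.2.
  by move=> Cz; have := mv z Cz; rewrite /slope_fun /s; case: (m); lra.
have vv' : s * v.1 + s * t * v.2 = s * v'.1 + s * t * v'.2.
  by have := mv _ Cv'; have := mv' _ Cv; rewrite /slope_fun /s; case: (m); lra.
have [p Cp pm] := lex_max s (s * t) (- t) 1 cpC C0.
have [q Cq qm] := lex_max s (s * t) t (-1) cpC C0.
have s0 : s != 0 by apply: contraTneq isT => h; move/eqP: s2; rewrite h mul0r eq_sym oner_eq0.
have tn : 0 < 1 + t ^+ 2 by rewrite ltr_pwDl // sqr_ge0.
have ep : extreme C p.
  apply: lex_max_extreme pm => //; rewrite (_ : _ - _ = s * (1 + t ^+ 2)); last by ring.
  by rewrite mulf_neq0 // gt_eqF.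
have eq' : extreme C q.
  apply: lex_max_extreme qm => //; rewrite (_ : _ - _ = - (s * (1 + t ^+ 2))); last by ring.
  by rewrite oppr_eq0 mulf_neq0 // gt_eqF.
have top w : s * w.1 + s * t * w.2 = s * v.1 + s * t * v.2 -> C w ->
   [/\ s * w.1 + s * t * w.2 = s * p.1 + s * t * p.2, - t * w.1 + 1 * w.2 <= - t * p.1 + 1 * p.2,
    s * w.1 + s * t * w.2 = s * q.1 + s * t * q.2 & t * w.1 + -1 * w.2 <= t * q.1 + -1 * q.2].
  move=> wv Cw; have := mx p Cp; have := mx q Cq; rewrite -wv => h1 h2.
  by have [h|[h h']] := pm w Cw; have [k|[k k']] := qm w Cw; (try lra); split.
have [a1 a2 a3 a4] := top v erefl Cv.
have [b1 b2 b3 b4] := top v' (esym vv') Cv'.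
have pq : p = q.
  apply: inj => //; rewrite /slope_fun; apply: (mulfI s0); rewrite !mulrDr !mulrA -a1 -a3 //.
rewrite -pq in a4 b4.
have d1 : s * ((v.1 - v'.1) + t * (v.2 - v'.2)) = 0 by lra.
have {}d1 : (v.1 - v'.1) + t * (v.2 - v'.2) = 0 by move/eqP: d1; rewrite mulf_eq0 (negbTE s0) => /eqP.
have d2 : - t * (v.1 - v'.1) + (v.2 - v'.2) = 0 by lra.
have e2 : (1 + t ^+ 2) * (v.2 - v'.2) = 0.
  have -> : (1 + t ^+ 2) * (v.2 - v'.2) = (- t * (v.1 - v'.1) + (v.2 - v'.2)) + t * ((v.1 - v'.1) + t * (v.2 - v'.2)) by ring.
  by rewrite d1 d2 mulr0 addr0.
move/eqP: e2; rewrite mulf_eq0 (gt_eqF tn) => /eqP e2.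
rewrite [v]surjective_pairing [v']surjective_pairing; congr (_, _); last by lra.
by move: d1; rewrite e2 mulr0 addr0; lra.
Qed.

(** Distinct points can share a value only if [- t] is one of the finitely many ratios
    [(p.1 - q.1) / (p.2 - q.2)], and [t] exceeds all of them in absolute value. *)
Lemma generic_slope (R : realType) (F : set (R * R)) : finite_set F ->
  exists t : R, forall p q, F p -> F q -> slope_fun t p = slope_fun t q -> p = q.
Proof.
move=> fF; pose S := enum_fset (fset_set F).
pose c (p q : R * R) := `|(p.1 - q.1) / (p.2 - q.2)|.
pose t := 1 + \sum_(p <- S) \sum_(q <- S) c p q.
exists t => p q Fp Fq e.
have pS : p \in S by rewrite /S in_fset_set //; exact/mem_set.
have qS : q \in S by rewrite /S in_fset_set //; exact/mem_set.
have ct : c p q < t.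
  rewrite /t -[X in X < _]add0r ltr_leD //.
  apply: (@le_trans _ _ (\sum_(q <- S) c p q)).
    by rewrite (big_rem q) //= lerDl sumr_ge0 // => i _; exact: normr_ge0.
  rewrite [leRHS](big_rem p) //= lerDl sumr_ge0 // => i _; apply: sumr_ge0 => j _; exact: normr_ge0.
have [e2|n2] := eqVneq (p.2 - q.2) 0.
  rewrite [p]surjective_pairing [q]surjective_pairing; congr (_, _); last by lra.
  by move: e; rewrite /slope_fun (_ : p.2 = q.2); lra.
exfalso; move: ct; rewrite /c (_ : _ / _ = - t); last first.
  by apply: (mulIf n2); rewrite divfK //; move: e; rewrite /slope_fun; lra.
rewrite normrN ltNge ler_norm //.
Qed.

Lemma size_le_code (A B : eqType) (r : A -> B -> Prop) (s : seq A) (l : seq B) : uniq s ->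
  (forall x, x \in s -> exists2 y, y \in l & r x y) ->
  (forall x x' y, x \in s -> x' \in s -> r x y -> r x' y -> x = x') -> (size s <= size l)%N.
Proof.
elim: s l => //= x s IH l /andP[xs us] ex inj.
have [y yl rxy] := ex x (mem_head _ _).
have pl := perm_to_rem yl; rewrite (perm_size pl) /= ltnS; apply: IH => // [x' x's|x1 x2 y' h1 h2].
  have [|y' y'l rx'y'] := ex x'; first by rewrite inE x's orbT.
  exists y' => //; move: y'l; rewrite (perm_mem pl) inE => /orP[/eqP e|//].
  by move: xs; rewrite (inj x x' y) ?x's ?mem_head ?inE ?x's ?orbT // -e.
by apply: inj; rewrite inE ?h1 ?h2 orbT.
Qed.

Lemma finite_cells_in (R : realType) (T : set (set (R * R))) r1 r2 rho :
  tiling T -> bounded_cells T r1 r2 -> 0 <= rho -> finite_set (cells_in T rho).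
Proof.
move=> tT bT rho0; apply: sub_finite_set (locally_finite tT bT rho0) => C [TC Cd]; split=> //.
have [_ cpT _ _] := tT; have [z /interior_subset Cz] := (cpT C TC).2.
by exists z => //; exact: Cd.
Qed.

Lemma mem_fset_set (T : choiceType) (A : set T) (x : T) : finite_set A -> (x \in enum_fset (fset_set A)) = (x \in A).
Proof. by move=> fA; rewrite -(in_fset_set fA). Qed.

(* Each extreme point [v] of a cell [C] is coded either by [C] itself, if [v] is
   where the generic linear function is least or greatest on [C], or else by a
   cell on which it is extremal at [v] and the side of [v] on which [C] lies. *)
Lemma euler_count (R : realType) (T : set (set (R * R))) r1 r2 rho :
  convex_tiling T -> bounded_cells T r1 r2 -> 0 <= rho ->
  (\sum_(C <- enum_fset (fset_set (cells_in T rho))) size (enum_fset (fset_set (extreme C))) <=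
   2 * size (enum_fset (fset_set (cells_in T rho))) +
   4 * size (enum_fset (fset_set (cells_in T (rho + (r2 + r2))))))%N.
Proof.
move=> ctT bT rho0; have [tT cT] := ctT; have [_ r20 _] := bT; have [_ cpT _ _] := tT.
have rho1 : 0 <= rho + (r2 + r2) by rewrite !addr_ge0 // ltW.
have fA := finite_cells_in tT bT rho0; have fB := finite_cells_in tT bT rho1.
set A := cells_in T rho in fA *; set B := cells_in T _ in fB *.
have AB C : A C -> B C.
  move=> [TC Cd]; split=> // z /Cd; rewrite /euclidean_disk /= => h; apply: le_trans h _.
  by rewrite ler_sqr ?nnegrE // lerDl addr_ge0 // ltW.
have fE C : T C -> finite_set (extreme C) by exact: finite_extreme ctT bT.
have [t tP] : exists t, forall p q, (\bigcup_(C in B) extreme C) p -> (\bigcup_(C in B) extreme C) q ->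
    slope_fun t p = slope_fun t q -> p = q.
  by apply: generic_slope; apply: bigcup_finite => // C [TC _]; exact: fE.
have injB C : B C -> forall p q, extreme C p -> extreme C q -> slope_fun t p = slope_fun t q -> p = q.
  by move=> BC p q ep eq'; apply: tP; exists C.
set a := enum_fset (fset_set A); set b := enum_fset (fset_set B).
have ua : uniq a by exact: fset_uniq.
have ub : uniq b by exact: fset_uniq.
pose e (C : set (R * R)) : seq (R * R) := enum_fset (fset_set (extreme C)).
pose P := [seq (C, v) | C <- a, v <- e C].
have -> : (\sum_(C <- a) size (enum_fset (fset_set (extreme C))))%N = size P.
  by rewrite size_allpairs_dep sumnE big_map.
pose code := ((set (R * R) * bool) + (set (R * R) * (bool * bool)))%type.
pose l : seq code := [seq inl (C, m) | C <- a, m <- [:: true; false]] ++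
  [seq inr (D, ms) | D <- b, ms <- [:: (true, true); (true, false); (false, true); (false, false)]].
have -> : (2 * size a + 4 * size b)%N = size l by rewrite size_cat !size_allpairs /= ![(_ * size _)%N]mulnC.
pose r (x : set (R * R) * (R * R)) (c : code) := match c with
  | inl (C, m) => x.1 = C /\ extremal t m x.1 x.2
  | inr (D, ms) => [/\ B D, extremal t ms.1 D x.2 & side t (if ms.2 then 1 else -1) x.1 x.2]
  end.
have memP C v : ((C, v) \in P) -> A C /\ extreme C v.
  move=> /allpairsPdep[C' [v' [Ca ve [-> ->]]]].
  have AC : A C' by apply/set_mem; rewrite -mem_fset_set.
  split=> //; apply/set_mem; rewrite -mem_fset_set //; exact/fE/AC.1.
apply: (@size_le_code _ _ r).
- apply: allpairs_uniq_dep => //; first by move=> C _; exact: fset_uniq.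
  by move=> [C v] [C' v'] _ _ /= [-> ->].
- move=> [C v] /memP[AC ev]; have TC := AC.1.
  have aC : C \in a by rewrite mem_fset_set //; exact/mem_set.
  have [[m em]|nm] := pselect (exists m, extremal t m C v).
    exists (inl (C, m)); last by split.
    by rewrite mem_cat; apply/orP; left; apply/allpairsP; exists (C, m); split=> //; case: (m); rewrite !inE.
  have [_ nv] := extreme_boundary ev.
  have sd := not_extremal_side (cT C TC) (cpT C TC).2 nv ev.1 (fun m h => nm (ex_intro _ m h)).
  have [D [m [TD eD]]] := extremal_cell t ctT bT TC ev.
  (* [D] contains [v] but may leave the disk of radius [rho], by at most its diameter; hence the
     larger disk. *)
  have BD : B D.
    split=> // z Dz; apply: disk_trans (AC.2 _ ev.1) (cell_diam bT TD eD.1 Dz) => //.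
    by rewrite addr_ge0 // ltW.
  have bD : D \in b by rewrite mem_fset_set //; exact/mem_set.
  have inl' s : (inr (D, (m, s)) : code) \in l.
    by rewrite mem_cat; apply/orP; right; apply/allpairsP; exists (D, (m, s)); split=> //; case: (m); case: (s); rewrite !inE.
  by case: sd => sd; [exists (inr (D, (m, true)))|exists (inr (D, (m, false)))].
move=> [C v] [C' v'] [[D m]|[D [m s]]] /memP[AC ev] /memP[AC' ev'] /=.
  move=> [<- e1] [CC' e2]; rewrite CC' in e2; congr (_, _) => //.
  exact: (extremal_unique (cpT C AC.1).1 (injB C (AB C AC)) e1 e2).
move=> [BD e1 s1] [_ e2 s2].
have vv' : v = v' by exact: (extremal_unique (cpT D BD.1).1 (injB D BD) e1 e2).
rewrite -vv' in ev' s2 *; congr (_, _).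
exact: (side_unique ctT AC.1 AC'.1 ev.1 ev'.1 s1 s2).
Qed.

Lemma extreme_seq (R : realType) (C : set (R * R)) : finite_set (extreme C) ->
  forall x, extreme C x <-> x \in enum_fset (fset_set (extreme C)).
Proof.
by move=> fC x; rewrite mem_fset_set //; split=> [h|/set_mem//]; exact/mem_set.
Qed.

Lemma measurable_cell (R : realType) (C : set (R * R)) : compact C -> convex_set C -> C° !=set0 ->
  finite_set (extreme C) -> measurable (C : set (plane R)).
Proof.
move=> cpC cC C0 fC.
have [v [n2 vn vo ve ev]] := extreme_order cpC cC C0 (fset_uniq _) (extreme_seq fC).
by have [] := extreme_area cpC cC C0 (And3 n2 vn vo) ve ev.
Qed.

Lemma fsum_cst (R : realType) (I : choiceType) (A : set I) (c : R) : finite_set A ->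
  (\sum_(C \in A) c%:E = (c * (size (enum_fset (fset_set A)))%:R)%:E)%E.
Proof.
move=> fA; rewrite fsbig_finite //= sumEFin; congr _%:E.
by rewrite big_const_seq count_predT iter_addr_0 mulr_natr.
Qed.

Lemma sum_affine (R : realType) (I : Type) (s : seq I) (m : I -> R) (a b c : R) :
  \sum_(i <- s) (a + b * (m i - c)) =
  a * (size s)%:R + b * (\sum_(i <- s) m i - c * (size s)%:R).
Proof.
elim: s => [|i s IH]; first by rewrite !big_nil /=; ring.
by rewrite !big_cons IH /= -natr1; ring.
Qed.

Section CellCount.
Variables (R : realType) (T : set (set (R * R))) (r1 r2 : R).
Hypotheses (ctT : convex_tiling T) (bT : bounded_cells T r1 r2) (aT : unit_area_cells T).

Let N rho : R := (size (enum_fset (fset_set (cells_in T rho))))%:R.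

Let mT C : T C -> measurable (C : set (plane R)).
Proof.
move=> TC; have [tT cT] := ctT; have [_ cpT _ _] := tT; have [cpC C0] := cpT C TC.
by apply: measurable_cell => //; [exact: cT|exact: finite_extreme ctT bT TC].
Qed.

Lemma card_cells_ge (kappa rho : R) :
  (forall r, 0 < r -> area (euclidean_disk 0 r) = (kappa * r ^+ 2)%:E) -> r2 + r2 < rho ->
  kappa * (rho - (r2 + r2)) ^+ 2 <= N rho.
Proof.
move=> kP rd; have [_ r20 _] := bT; have rho0 : 0 <= rho by lra.
have [tT cT] := ctT; have [_ cpT cov _] := tT.
have fA := finite_cells_in tT bT rho0.
have d0 : 0 < rho - (r2 + r2) by rewrite subr_gt0.
have := @content_sub_fsum _ _ _ (product_measure1 (@lebesgue_measure R) (@lebesgue_measure R))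
  _ (cells_in T rho) (euclidean_disk 0 (rho - (r2 + r2))) id fA.
move=> /(_ (fun C h => mT h.1) (measurable_disk _ _)) h.
rewrite -lee_fin -kP //; apply: le_trans (h _) _; last first.
  rewrite (eq_fsbigr (fun=> 1%:E)); first by rewrite fsum_cst // mul1r.
  by move=> C /set_mem[TC _]; exact: aT.
move=> z zd; have [C TC Cz] : (\bigcup_(C in T) C) z by rewrite cov.
exists C => //; split=> // y Cy.
rewrite -[rho](subrK (r2 + r2)); apply: disk_trans zd (cell_diam bT TC Cz Cy); first exact: ltW.
by rewrite addr_ge0 // ltW.
Qed.

(** Only the interiors of cells are disjoint, so each cell is shrunk by a factor [u < 1] towards an
    interior point. The copies are disjoint, have area [u ^ 2], and stay in the disk; then [u] tends
    to 1. *)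
Lemma card_cells_le (kappa rho : R) :
  (forall r, 0 < r -> area (euclidean_disk 0 r) = (kappa * r ^+ 2)%:E) -> 0 < rho ->
  N rho <= kappa * rho ^+ 2.
Proof.
move=> kP rho0; have [tT cT] := ctT; have [_ cpT cov tr] := tT.
have fA := finite_cells_in tT bT (ltW rho0).
have /choice[z zP] : forall C : set (R * R), exists z, T C -> C° z.
  by move=> C; have [TC|nTC] := pselect (T C); [have [z ?] := (cpT C TC).2; exists z|exists 0].
have key u : 0 < u < 1 -> N rho * u ^+ 2 <= kappa * rho ^+ 2.
  move=> /andP[u0 u1].
  pose S C : set (plane R) := [set x | C (u^-1 * x.1 + 0 * x.2 + ((1 - u^-1) * (z C).1),
     0 * x.1 + u^-1 * x.2 + ((1 - u^-1) * (z C).2))].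
  have D0 : u^-1 * u^-1 - 0 * 0 != 0 by rewrite mul0r subr0 mulf_neq0 // invr_eq0 gt_eqF.
  have mS C : T C -> measurable (S C).
    move=> TC; have [mf _] := scales_area_affine ((1 - u^-1) * (z C).1) ((1 - u^-1) * (z C).2) D0.
    by rewrite -[X in measurable X]setTI; apply: mf => //; exact: mT.
  have aS C : T C -> area (S C) = (u ^+ 2)%:E.
    move=> TC; have := area_affine ((1 - u^-1) * (z C).1) ((1 - u^-1) * (z C).2) D0 (mT TC).
    rewrite (aT TC) -/(S C) mul0r subr0 ger0_norm ?mulr_ge0 ?invr_ge0 ?(ltW u0) // => h.
    rewrite -[LHS]mule1 -(_ : ((u^-1 * u^-1) * u ^+ 2)%:E = 1%E); last by congr _%:E; field; rewrite gt_eqF.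
    by rewrite EFinM muleA h mul1e.
  have SC C x : T C -> S C x -> C° x.
    move=> TC Cx; have h : 0 <= u < 1 by rewrite ltW.
    have := interior_convex (cT C TC) (zP C TC) Cx h; congr (C° _).
    by rewrite [RHS]surjective_pairing; congr (_, _) => /=; field; rewrite gt_eqF.
  have trS : trivIset (cells_in T rho) S.
    move=> C D [TC _] [TD _] [x [Cx Dx]]; apply: tr => //; exists x.
    by split; [exact: SC TC Cx|exact: SC TD Dx].
  have := @measure_fin_bigcup _ _ _ (product_measure1 (@lebesgue_measure R) (@lebesgue_measure R))
    _ (cells_in T rho) S fA trS (fun C h => mS C h.1).
  rewrite -[X in X = _]/(area _) (eq_fsbigr (fun=> (u ^+ 2)%:E)); last first.
    by move=> C /set_mem[TC _]; exact: aS.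
  rewrite fsum_cst // mulrC => h.
  rewrite -lee_fin -kP // -h; apply: le_area.
  - by apply: fin_bigcup_measurable => // C [TC _]; exact: mS.
  - exact: measurable_disk.
  by move=> x [C [TC Cd] Sx]; apply: Cd; apply: interior_subset; exact: SC TC Sx.
rewrite leNgt; apply/negP => lt.
have hh : 0 < (1 / 2 : R) < 1 by apply/andP; split; lra.
have k0 : 0 <= kappa * rho ^+ 2.
  by apply: le_trans (key _ hh); rewrite mulr_ge0 ?ler0n ?sqr_ge0.
have N0 : 0 < N rho by exact: le_lt_trans lt.
(* Since [(1 - d) ^ 2 >= 1 - 2 * d], shrinking by [1 - d] costs at most [2 * N rho * d], half of the
   supposed excess. *)
pose d := (N rho - kappa * rho ^+ 2) / (4 * N rho).
have d0 : 0 < d by rewrite divr_gt0 ?subr_gt0 ?mulr_gt0.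
have dE : N rho * d = (N rho - kappa * rho ^+ 2) / 4 by rewrite /d; field; rewrite gt_eqF.
have d1 : d < 1 by rewrite /d ltr_pdivrMr ?mulr_gt0 // mul1r; lra.
have := @key (1 - d) _; rewrite (_ : 0 < 1 - d < 1); last by apply/andP; split; lra.
move=> /(_ isT); have := sqr_ge0 d; move: dE N0 lt; move: (N rho) (kappa * rho ^+ 2) => n K dE n0 lt d2 h.
have : 0 <= n * d ^+ 2 by rewrite mulr_ge0 // ltW.
move: h; rewrite !expr2; nra.
Qed.

(* Euler's formula gives at most [6 + o(1)] extreme points per cell on average. *)
Lemma lower_P1_ge (M : set (R * R)) (alpha beta : R) : beta <= 0 ->
  (forall C, T C -> ((alpha + beta * ((size (enum_fset (fset_set (extreme C))))%:R - 6))%:E <= perim M C)%E) ->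
  (alpha%:E <= lower_P1 M T)%E.
Proof.
move=> beta0 HP; have [tT cT] := ctT; have [r10 r20 _] := bT.
have [kappa kap0 kP] := area_disk R.
pose d := r2 + r2; have d0 : 0 < d by rewrite addr_gt0.
apply/lee_subgt0Pr => e e0; rewrite /lower_P1 limf_einfE.
(* Beyond [3 * d] one has [(rho - d) ^ 2 >= 4 / 9 * rho ^ 2]. The cells in the rim then cost at most
   [16 * (9 / 4) * d * (- beta) / rho] per cell, which the second term brings below [e]. *)
pose rho0 := 3 * d + 36 * d * (- beta) / e.
have rho0_ge : 3 * d <= rho0 by rewrite lerDl divr_ge0 ?(ltW e0) // mulr_ge0 ?oppr_ge0 // mulr_ge0 // ltW.
apply: (@le_trans _ _ (ereal_inf [set mean_perim M T x | x in [set x | rho0 < x]])); last first.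
  apply: ereal_sup_ubound; exists [set x | rho0 < x] => //.
  by exists rho0; split=> //; exact: num_real.
apply: le_ereal_inf_tmp => _ [rho /= rho_gt <-].
have rho3 : 3 * d < rho by exact: le_lt_trans rho_gt.
have rhod : d < rho by lra.
have rho00 : 0 <= rho by lra.
have fA := finite_cells_in tT bT rho00.
have NL := card_cells_ge kP rhod.
have NU : N (rho + d) <= kappa * (rho + d) ^+ 2 by apply: card_cells_le => //; lra.
have N0 : 0 < N rho by apply: lt_le_trans NL; rewrite mulr_gt0 // exprn_gt0 // subr_gt0.
have euler := euler_count ctT bT rho00.
rewrite -(ler_nat R) natrD !natrM -/(N rho) -/(N (rho + d)) natr_sum in euler.
rewrite /mean_perim -[X in X%:E^-1%E]/(N rho) inver gt_eqF // lee_pdivlMr //.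
pose m (C : set (R * R)) : R := (size (enum_fset (fset_set (extreme C))))%:R.
apply: (@le_trans _ _ (\sum_(C \in cells_in T rho) (alpha + beta * (m C - 6))%:E)%E); last first.
  by apply: lee_fsum => // C [TC _]; exact: HP.
rewrite fsbig_finite //= sumEFin -EFinB -EFinM lee_fin sum_affine -/(N rho).
move: euler; set S := \sum_(_ <- _) _; rewrite -[X in _ <= _ + _ * (X - _)]/S.
have b0 : 0 <= - beta by rewrite oppr_ge0.
have rb : 36 * d * (- beta) <= e * rho.
  rewrite -ler_pdivrMl // mulrC; apply: le_trans (ltW rho_gt); rewrite /rho0 lerDr; apply: mulr_ge0; [by []|exact: ltW].
rewrite -/d in NL NU *.
move: N0 NL NU; move: (N rho) (N (rho + d)) => n n' n0 NL NU Sle.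
have q0 : 0 < (rho - d) ^+ 2 by rewrite exprn_gt0 // subr_gt0.
have h1 : n' * (rho - d) ^+ 2 <= n * (rho + d) ^+ 2.
  apply: (@le_trans _ _ (kappa * (rho + d) ^+ 2 * (rho - d) ^+ 2)); first by rewrite ler_pM2r.
  by rewrite mulrAC ler_wpM2r // sqr_ge0.
have h2 : (n' - n) * (rho - d) ^+ 2 <= 4 * rho * d * n by move: h1; rewrite !expr2; lra.
have h3 : 4 * (- beta) * ((n' - n) * (rho - d) ^+ 2) <= 4 * (- beta) * (4 * rho * d * n).
  by apply: ler_wpM2l => //; rewrite mulr_ge0.
have h4 : 4 * (- beta) * (4 * rho * d * n) <= 4 / 9 * rho * (e * rho) * n.
  have -> : 4 * (- beta) * (4 * rho * d * n) = 4 / 9 * rho * (36 * d * (- beta)) * n by field.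
  by apply: ler_wpM2r; [exact: ltW|apply: ler_wpM2l => //; rewrite mulr_ge0].
have h5 : 4 / 9 * rho ^+ 2 <= (rho - d) ^+ 2 by rewrite !expr2; nra.
have h6 : 4 / 9 * rho * (e * rho) * n <= e * n * (rho - d) ^+ 2.
  have -> : 4 / 9 * rho * (e * rho) * n = e * n * (4 / 9 * rho ^+ 2) by ring.
  by apply: ler_wpM2l => //; rewrite mulr_ge0 // ltW.
have h7 : 4 * (- beta) * (n' - n) <= e * n.
  by rewrite -(ler_pM2r q0) -mulrA; lra.
have h8 : - beta * S <= - beta * (2 * n + 4 * n') by apply: ler_wpM2l.
lra.
Qed.
End CellCount.

(** * The hexagonal tiling *)

Lemma convex_hull_sub (R : realType) n (v : 'I_n -> R * R) i : convex_hull v (v i).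
Proof.
exists (fun j => (j == i)%:R); split.
- by move=> j; rewrite ler0n.
- by rewrite (bigD1 i) //= eqxx big1 ?addr0 // => j /negbTE ->.
by rewrite (bigD1 i) //= eqxx scale1r big1 ?addr0 // => j /negbTE ->; rewrite scale0r.
Qed.

Lemma convex_hull_convex (R : realType) n (v : 'I_n -> R * R) : convex_set (convex_hull v).
Proof.
apply: convex_setP => x y t [w [w0 w1 ->]] [u [u0 u1 ->]] /andP[t0 t1].
exists (fun i => w i + t * (u i - w i)); split.
- move=> i; have -> : w i + t * (u i - w i) = (1 - t) * w i + t * u i by ring.
  by rewrite addr_ge0 // mulr_ge0 // subr_ge0.
- by rewrite big_split /= -mulr_sumr big_split /= sumrN w1 u1 subrr mulr0 addr0.
set S := \sum_i w i *: v i; set U := \sum_i u i *: v i.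
transitivity (S + t *: (U - S)); first by [].
rewrite /S /U -sumrB scaler_sumr -big_split; apply: eq_bigr => i _ /=.
by rewrite scalerDl -scalerBl scalerA.
Qed.

Lemma crossDr (R : realType) (a x y : R * R) : cross a (x + y) = cross a x + cross a y.
Proof. by rewrite /cross /=; ring. Qed.

Lemma crossBr (R : realType) (a x y : R * R) : cross a (x - y) = cross a x - cross a y.
Proof. by rewrite /cross /=; ring. Qed.

Lemma crossC (R : realType) (a b : R * R) : cross b a = - cross a b.
Proof. by rewrite /cross; ring. Qed.

Lemma crossvv (R : realType) (a : R * R) : cross a a = 0.
Proof. by rewrite /cross; ring. Qed.

Section Hexagon.
Variables (R : realType) (a b c : R * R).
Let p := cross a b.
Let q := cross a c.
Let r := cross b c.
Hypotheses (p0 : 0 < p) (q0 : 0 < q) (r0 : 0 <= r).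

(** The zonogon with edge vectors [a], [b], [c], counterclockwise from the origin. With [r = 0] the
    edges [b] and [c] are parallel and it degenerates to a parallelogram, as happens for [k = 2]. *)
Definition hexagon_vertex (i : 'I_6) : R * R :=
  nth 0 [:: 0; a; a + b; a + b + c; b + c; c] i.

(** The same hexagon as the intersection of the strips between opposite sides. In this form
    membership and lattice translation are linear in the cross products. *)
Definition hexagon_strips : set (R * R) :=
  [set x | [/\ 0 <= cross a x <= p + q, - p <= cross b x <= r & - (q + r) <= cross c x <= 0]].


Lemma cross_dependency x : r * cross a x - q * cross b x + p * cross c x = 0.
Proof. by rewrite /p /q /r /cross; ring. Qed.

Let vtx i : convex_hull hexagon_vertex (nth 0 [:: 0; a; a + b; a + b + c; b + c; c] (i : 'I_6)).
Proof. exact: (convex_hull_sub hexagon_vertex i). Qed.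

Let hull_strips : convex_hull hexagon_vertex `<=` hexagon_strips.
Proof.
have p0' := p0; have q0' := q0; have r0' := r0.
have bound d m : (forall i, cross d (hexagon_vertex i) <= m) ->
   forall x, convex_hull hexagon_vertex x -> cross d x <= m.
  move=> H x hx; have -> : cross d x = - d.2 * x.1 + d.1 * x.2 by rewrite /cross; ring.
  apply: convex_hull_le hx => i; apply: le_trans (H i).
  by rewrite /cross le_eqVlt; apply/orP; left; apply/eqP; ring.
have nbound d m : (forall i, m <= cross d (hexagon_vertex i)) ->
   forall x, convex_hull hexagon_vertex x -> m <= cross d x.
  move=> H x hx; have := @bound (- d) (- m) _ x hx.
  have E y : cross (- d) y = - cross d y by rewrite /cross /=; ring.
  by rewrite E lerN2; apply => i; rewrite E lerN2.
have ba : cross b a = - p by rewrite crossC.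
have ca : cross c a = - q by rewrite crossC.
have cb : cross c b = - r by rewrite crossC.
have z d : cross d 0 = 0 by rewrite /cross /=; ring.
move=> x hx; split; apply/andP; split.
- by apply: nbound hx => -[[|[|[|[|[|[|m]]]]]] Hm] //; rewrite /hexagon_vertex /= ?crossDr ?crossvv ?z -/p -/q; lra.
- by apply: bound hx => -[[|[|[|[|[|[|m]]]]]] Hm] //; rewrite /hexagon_vertex /= ?crossDr ?crossvv ?z -/p -/q; lra.
- by apply: nbound hx => -[[|[|[|[|[|[|m]]]]]] Hm] //; rewrite /hexagon_vertex /= ?crossDr ?crossvv ?z ?ba -/r; lra.
- by apply: bound hx => -[[|[|[|[|[|[|m]]]]]] Hm] //; rewrite /hexagon_vertex /= ?crossDr ?crossvv ?z ?ba -/r; lra.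
- by apply: nbound hx => -[[|[|[|[|[|[|m]]]]]] Hm] //; rewrite /hexagon_vertex /= ?crossDr ?crossvv ?z ?ca ?cb; lra.
by apply: bound hx => -[[|[|[|[|[|[|m]]]]]] Hm] //; rewrite /hexagon_vertex /= ?crossDr ?crossvv ?z ?ca ?cb; lra.
Qed.

(** The three parallelograms of the dissection meet at [b]. By the relation [q b = r a + p c] the
    line of [b] meets the segments from [a] to [c] and from [a + b] to [b + c], and [b] lies between
    the origin and the first point or between the two points. *)
Let hull_b : convex_hull hexagon_vertex b.
Proof.
have p0' := p0; have q0' := q0; have r0' := r0.
have [h0 ha hab habc hbc] := And5 (vtx (@Ordinal 6 0 isT)) (vtx (@Ordinal 6 1 isT))
  (vtx (@Ordinal 6 2 isT)) (vtx (@Ordinal 6 3 isT)) (vtx (@Ordinal 6 4 isT)).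
have hc := vtx (@Ordinal 6 5 isT); have cH : convex_set (convex_hull hexagon_vertex) by exact: convex_hull_convex.
rewrite /= in h0 ha hab habc hbc hc.
have pr0 : 0 < r + p by lra.
have qb : [/\ q * b.1 = r * a.1 + p * c.1 & q * b.2 = r * a.2 + p * c.2].
  by rewrite /p /q /r /cross; split; ring.
have h : 0 <= p / (r + p) <= 1 by rewrite divr_ge0 ?(ltW p0) ?(ltW pr0) // ler_pdivrMr // mul1r; lra.
have w1 := convexP cH ha hc h; have w2 := convexP cH hab hbc h.
have e1 : (a.1 + p / (r + p) * (c.1 - a.1), a.2 + p / (r + p) * (c.2 - a.2)) =
   (q / (r + p) * b.1, q / (r + p) * b.2).
  by congr (_, _); rewrite [RHS]mulrAC; [rewrite qb.1|rewrite qb.2]; field; rewrite gt_eqF.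
have e2 : ((a + b).1 + p / (r + p) * ((b + c).1 - (a + b).1), (a + b).2 + p / (r + p) * ((b + c).2 - (a + b).2)) =
   ((1 + q / (r + p)) * b.1, (1 + q / (r + p)) * b.2).
  have f1 := congr1 fst e1; have f2 := congr1 snd e1; rewrite /= in f1 f2.
  by congr (_, _); rewrite [RHS]mulrDl; [rewrite -f1|rewrite -f2] => /=; ring.
rewrite e1 in w1; rewrite e2 in w2.
have [qs|sq] := leP (r + p) q.
  have h1 : 0 <= (r + p) / q <= 1 by rewrite divr_ge0 ?(ltW q0) ?(ltW pr0) // ler_pdivrMr // mul1r.
  have := convexP cH h0 w1 h1; congr (convex_hull _ _).
  by rewrite [RHS]surjective_pairing /=; congr (_, _); field; rewrite !gt_eqF.
have h1 : 0 <= 1 - q / (r + p) <= 1.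
  have : 0 <= q / (r + p) by rewrite divr_ge0 ?(ltW q0) ?(ltW pr0).
  have : q / (r + p) <= 1 by rewrite ler_pdivrMr // mul1r ltW.
  by move=> *; apply/andP; split; lra.
have := convexP cH w1 w2 h1; congr (convex_hull _ _).
by rewrite [RHS]surjective_pairing /=; congr (_, _); ring.
Qed.

Lemma parallelogram_sub (K : set (R * R)) o d e : convex_set K -> K o -> K (o + d) -> K (o + e) -> K (o + d + e) ->
  parallelogram o d e `<=` K.
Proof.
move=> cK Ko Kd Ke Kde z [s [t [s1 t1 ->]]].
have := convexP cK (convexP cK Ko Kd s1) (convexP cK Ke Kde s1) t1; congr K.
by congr (_, _) => /=; ring.
Qed.

Let par_hull : [/\ parallelogram 0 a b `<=` convex_hull hexagon_vertex,
  parallelogram b a c `<=` convex_hull hexagon_vertex & parallelogram 0 b c `<=` convex_hull hexagon_vertex].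
Proof.
have [h0 ha hab habc hbc] := And5 (vtx (@Ordinal 6 0 isT)) (vtx (@Ordinal 6 1 isT))
  (vtx (@Ordinal 6 2 isT)) (vtx (@Ordinal 6 3 isT)) (vtx (@Ordinal 6 4 isT)).
have hc := vtx (@Ordinal 6 5 isT); have cH : convex_set (convex_hull hexagon_vertex) by exact: convex_hull_convex.
rewrite /= in h0 ha hab habc hbc hc.
have hb := hull_b.
by split; apply: parallelogram_sub; rewrite ?add0r ?(addrC b a).
Qed.

(** The usual dissection of a zonogon into parallelograms, here meeting at [b]. The signs of the
    cross products with [b] and [c], compared with the strip bounds, select the piece; the third one
    vanishes with [r]. *)
Lemma hexagon_strips_cover x : hexagon_strips x ->
  [\/ parallelogram 0 a b x, parallelogram b a c x | 0 < r /\ parallelogram 0 b c x].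
Proof.
have p0' := p0; have q0' := q0; have r0' := r0.
move=> [/andP[A0 A1] /andP[B0 B1] /andP[C0 C1]]; have dep := cross_dependency x.
have par o d e : 0 < cross d e -> 0 <= cross d (x - o) <= cross d e -> - cross d e <= cross e (x - o) <= 0 -> parallelogram o d e x.
  move=> D0 /andP[h1 h2] /andP[h3 h4].
  exists (- cross e (x - o) / cross d e), (cross d (x - o) / cross d e); split.
  - by rewrite divr_ge0 ?oppr_ge0 ?(ltW D0) // ler_pdivrMr // mul1r lerNl.
  - by rewrite divr_ge0 ?(ltW D0) // ler_pdivrMr // mul1r.
  by rewrite [LHS]surjective_pairing; congr (_, _); rewrite /cross in D0 *; field; rewrite gt_eqF.
have [Bp|Bn] := ltP 0 (cross b x).
  have rp : 0 < r by exact: lt_le_trans B1.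
  have [Cr|Cr] := leP (- r) (cross c x).
    by apply: Or33; split=> //; apply: par; rewrite ?subr0 // ?(ltW Bp) ?B1 ?Cr.
  have [Ap|Ap] := leP p (cross a x); last first.
    have h1 : 0 <= r * (p - cross a x) by rewrite mulr_ge0 // subr_ge0 ltW.
    have h2 : 0 < p * (- r - cross c x) by rewrite mulr_gt0 // subr_gt0.
    have h3 : 0 < q * cross b x by rewrite mulr_gt0.
    by exfalso; lra.
  apply: Or32; apply: par => //; rewrite crossBr -/p -/q; first by apply/andP; split; lra.
  by rewrite (crossC b c) -/r; apply/andP; split; lra.
have [Ap|Ap] := leP (cross a x) p.
  by apply: Or31; apply: par; rewrite ?subr0 // ?A0 ?Ap ?B0 ?Bn.
have [Cr|Cr] := leP (cross c x) (- r); last first.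
  have h1 : 0 <= r * (cross a x - p) by rewrite mulr_ge0 // subr_ge0 ltW.
  have h2 : 0 < p * (cross c x - - r) by rewrite mulr_gt0 // subr_gt0.
  have h3 : 0 <= q * (- cross b x) by rewrite mulr_ge0 ?oppr_ge0 // ltW.
  by exfalso; lra.
apply: Or32; apply: par => //; rewrite crossBr -/p -/q; first by apply/andP; split; lra.
by rewrite (crossC b c) -/r; apply/andP; split; lra.
Qed.

Lemma hexagon_stripsE : convex_hull hexagon_vertex = hexagon_strips.
Proof.
have [h1 h2 h3] := par_hull.
by apply/seteqP; split=> [|x /hexagon_strips_cover[/h1|/h2|[_ /h3]]].
Qed.

End Hexagon.

Lemma open_parallelogram_cross (R : realType) (o d e x : R * R) : 0 < cross d e ->
  open_parallelogram o d e x -> 0 < cross d (x - o) < cross d e /\ - cross d e < cross e (x - o) < 0.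
Proof.
move=> D0 [s [t [/andP[s0 s1] /andP[t0 t1] ->]]].
have -> : cross d ((o.1 + s * d.1 + t * e.1, o.2 + s * d.2 + t * e.2) - o) = t * cross d e.
  by rewrite /cross /=; ring.
have -> : cross e ((o.1 + s * d.1 + t * e.1, o.2 + s * d.2 + t * e.2) - o) = - (s * cross d e).
  by rewrite /cross /=; ring.
rewrite ltrN2 oppr_lt0 !mulr_gt0 //= gtr_pMl //; split=> //.
by rewrite andbT gtr_pMl.
Qed.

Lemma closed_cross (R : realType) (d : R * R) (l u : R) : closed [set x : R * R | l <= cross d x <= u].
Proof.
have -> : [set x : R * R | l <= cross d x <= u] =
    (fun x : R * R => - d.2 * x.1 + d.1 * x.2) @^-1` `[l, u]%classic.
  by apply/seteqP; split=> x /=; rewrite in_itv /= /cross mulNr [in X in X -> _]addrC // addrC.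
by apply: closed_comp => [x _|]; [exact: continuous_linear2|exact: itv_closed].
Qed.

Lemma measurable_cross (R : realType) (d : R * R) (l u : R) :
  measurable ([set x : R * R | l <= cross d x <= u] : set (plane R)).
Proof.
have m1 : measurable [set x : plane R | 0 <= - d.2 * x.1 + d.1 * x.2 + - l].
  by apply: measurable_le_fun; exact: measurable_affine.
have m2 : measurable [set x : plane R | 0 <= d.2 * x.1 + - d.1 * x.2 + u].
  by apply: measurable_le_fun; exact: measurable_affine.
have -> : ([set x : R * R | l <= cross d x <= u] : set (plane R)) =
   [set x : plane R | 0 <= - d.2 * x.1 + d.1 * x.2 + - l] `&` [set x : plane R | 0 <= d.2 * x.1 + - d.1 * x.2 + u].
  apply/seteqP; split=> x /=; rewrite /cross.
    by move=> /andP[? ?]; split; lra.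
  by move=> [? ?]; apply/andP; split; lra.
exact: measurableI.
Qed.

Lemma interior_cross (R : realType) (K : set (R * R)) (d z : R * R) (l u : R) : d != 0 ->
  (forall x, K x -> l <= cross d x <= u) -> K° z -> l < cross d z < u.
Proof.
move=> d0 H /interior_box[e e0 he].
have n0 : 0 < d.1 ^+ 2 + d.2 ^+ 2.
  rewrite lt_neqAle eq_sym addr_ge0 ?sqr_ge0 // andbT paddr_eq0 ?sqr_ge0 // !sqrf_eq0.
  by apply: contra d0 => /andP[/eqP h1 /eqP h2]; apply/eqP; rewrite [d]surjective_pairing h1 h2.
pose m := `|d.1| + `|d.2| + 1.
have m0 : 0 < m by rewrite ltr_wpDl // addr_ge0.
have em : 0 < e / m by rewrite divr_gt0.
have small (x : R) : `|x| < m -> `|e / m * x| < e.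
  by move=> h; rewrite normrM (gtr0_norm em) mulrAC ltr_pdivrMr // ltr_pM2l.
have s1 : `|d.1| < m by rewrite /m; have := normr_ge0 d.2; lra.
have s2 : `|d.2| < m by rewrite /m; have := normr_ge0 d.1; lra.
have k1 : K (z.1 - e / m * d.2, z.2 + e / m * d.1).
  by apply: he => /=; [rewrite addrAC subrr add0r normrN; exact: small|rewrite addrAC subrr add0r; exact: small].
have k2 : K (z.1 + e / m * d.2, z.2 - e / m * d.1).
  by apply: he => /=; [rewrite addrAC subrr add0r; exact: small|rewrite addrAC subrr add0r normrN; exact: small].
have pos : 0 < e / m * (d.1 ^+ 2 + d.2 ^+ 2) by rewrite mulr_gt0.
have /andP[_ h1] := H _ k1; have /andP[h2 _] := H _ k2.
have E1 : cross d (z.1 - e / m * d.2, z.2 + e / m * d.1) = cross d z + e / m * (d.1 ^+ 2 + d.2 ^+ 2).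
  by rewrite /cross /=; ring.
have E2 : cross d (z.1 + e / m * d.2, z.2 - e / m * d.1) = cross d z - e / m * (d.1 ^+ 2 + d.2 ^+ 2).
  by rewrite /cross /=; ring.
by rewrite E1 in h1; rewrite E2 in h2; apply/andP; split; lra.
Qed.

Section HexagonArea.
Variables (R : realType) (a b c : R * R).
Let p := cross a b.
Let q := cross a c.
Let r := cross b c.
Hypotheses (p0 : 0 < p) (q0 : 0 < q) (r0 : 0 <= r).
Let K := hexagon_strips a b c.

Let KE : K = [set x : R * R | 0 <= cross a x <= p + q] `&` [set x : R * R | - p <= cross b x <= r]
   `&` [set x : R * R | - (q + r) <= cross c x <= 0].
Proof. by apply/seteqP; split=> x; [case|case=> -[]]. Qed.

Lemma measurable_hexagon : measurable (K : set (plane R)).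
Proof. by rewrite KE; apply: measurableI; [apply: measurableI|]; exact: measurable_cross. Qed.

Lemma compact_hexagon : compact K.
Proof.
pose L (u v : R) := (q + r) / q * `|u| + (p + q) / q * `|v|.
have p0' := p0; have q0' := q0; have r0' := r0.
apply: (@subclosed_compact _ _ (`[- L a.1 c.1, L a.1 c.1]%classic `*` `[- L a.2 c.2, L a.2 c.2]%classic)).
- by rewrite KE; apply: closedI; [apply: closedI|]; exact: closed_cross.
- by apply: compact_setX; exact: segment_compact.
move=> x [/andP[A0 A1] _ /andP[C0 C1]]; rewrite -/p -/q -/r in A1 C0.
have aux (u v w : R) : w = (- cross c x / q) * u + (cross a x / q) * v -> - L u v <= w <= L u v.
  move=> ->; rewrite -ler_norml; apply: le_trans (ler_normD _ _) _; rewrite !normrM normfV normrN (gtr0_norm q0).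
  apply: lerD; apply: ler_wpM2r => //; rewrite ler_pM2r ?invr_gt0 //.
    by rewrite ler0_norm //; lra.
  by rewrite ger0_norm.
have qn : a.1 * c.2 - a.2 * c.1 != 0 by rewrite -/(cross a c) gt_eqF.
by split=> /=; rewrite in_itv /=; apply: aux; rewrite /q /cross; field.
Qed.

(** The closed parallelograms of the dissection cover the hexagon, and the open ones are disjoint
    inside it with the same areas. *)
Lemma area_hexagon : area K = (p + q + r)%:E.
Proof.
have p0' := p0; have q0' := q0; have r0' := r0.
pose mu : {measure set (plane R) -> \bar R} := product_measure1 (@lebesgue_measure R) (@lebesgue_measure R).
have [m1 a1] := area_parallelogram 0 p0; have [n1 b1] := area_open_parallelogram 0 p0.
have [m2 a2] := area_parallelogram b q0; have [n2 b2] := area_open_parallelogram b q0.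
have dep := cross_dependency a b c.
have cb : cross c b = - r by rewrite crossC.
have o1 x : open_parallelogram 0 a b x -> [/\ K x, cross a x < p & cross b x < 0].
  move=> /(open_parallelogram_cross p0); rewrite !subr0 -/p => -[/andP[h1 h2] /andP[h3 h4]]; split=> //.
  have d := dep x; have h5 : 0 <= r * (p - cross a x) by rewrite mulr_ge0 // subr_ge0 ltW.
  have h6 : 0 <= q * (p + cross b x) by rewrite mulr_ge0 ?(ltW q0) //; lra.
  have h7 : 0 <= r * cross a x by rewrite mulr_ge0 // ltW.
  have h8 : 0 <= q * - cross b x by rewrite mulr_ge0 ?(ltW q0) // oppr_ge0 ltW.
  split; rewrite -/p -/q -/r; apply/andP; split; (try lra); rewrite -(ler_pM2l p0); rewrite -/p -/q -/r in d; lra.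
have o2 x : open_parallelogram b a c x -> [/\ K x, p < cross a x & cross c x < - r].
  move=> /(open_parallelogram_cross q0); rewrite !crossBr -/p -/q cb => -[/andP[h1 h2] /andP[h3 h4]]; split=> //; try lra.
  have d := dep x.
  have h5 : 0 <= r * (p + q - cross a x) by rewrite mulr_ge0 //; lra.
  have h6 : 0 <= p * (q + r + cross c x) by rewrite mulr_ge0 ?(ltW p0) //; lra.
  have h7 : 0 <= r * (cross a x - p) by rewrite mulr_ge0 //; lra.
  have h8 : 0 <= p * (- r - cross c x) by rewrite mulr_ge0 ?(ltW p0) //; lra.
  split; rewrite -/p -/q -/r; apply/andP; split; (try lra); rewrite -(ler_pM2l q0); rewrite -/p -/q -/r in d; lra.
have mK := measurable_hexagon.
have dis12 : open_parallelogram 0 a b `&` open_parallelogram b a c = set0.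
  by apply/seteqP; split=> x // [/o1[_ h _] /o2[_ h' _]]; have := lt_trans h h'; rewrite ltxx.
apply/eqP; rewrite eq_le; apply/andP; split.
  have [rp|rn] := ltP 0 r.
    have [m3 a3] := area_parallelogram 0 rp.
    have m12 := measurableU _ _ m1 m2.
    apply: (@le_trans _ _ (mu (parallelogram 0 a b `|` parallelogram b a c `|` parallelogram 0 b c))).
      apply: le_area => //; first exact: measurableU.
      by move=> x /(hexagon_strips_cover p0 q0 r0)[?|?|[_ ?]]; [left; left|left; right|right].
    apply: le_trans (measureU2 _ m12 m3) _; rewrite [X in (_ + X)%E]a3 [leRHS]EFinD leeD2r //.
    by apply: le_trans (measureU2 _ m1 m2) _; rewrite [X in (X + _)%E]a1 [X in (_ + X)%E]a2 -EFinD.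
  apply: (@le_trans _ _ (mu (parallelogram 0 a b `|` parallelogram b a c))).
    apply: le_area => //; first exact: measurableU.
    move=> x /(hexagon_strips_cover p0 q0 r0)[?|?|[rp _]]; [by left|by right|].
    by move: rn; rewrite leNgt -/r rp.
  apply: le_trans (measureU2 _ m1 m2) _; rewrite [X in (X + _)%E]a1 [X in (_ + X)%E]a2 -EFinD lee_fin.
  by rewrite lerDl.
have U12 : mu (open_parallelogram 0 a b `|` open_parallelogram b a c) = (p + q)%:E.
  by rewrite measureU // [X in (X + _)%E]b1 [X in (_ + X)%E]b2 -EFinD.
have m12 := measurableU _ _ n1 n2.
have [rp|rn] := ltP 0 r; last first.
  have -> : r = 0 by apply/eqP; rewrite eq_le rn.
  by rewrite addr0 -U12; apply: le_area => // x [/o1[]|/o2[]].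
have [n3 b3] := area_open_parallelogram 0 rp.
have o3 x : open_parallelogram 0 b c x -> [/\ K x, 0 < cross b x & - r < cross c x].
  move=> /(open_parallelogram_cross rp); rewrite !subr0 -/r => -[/andP[h1 h2] /andP[h3 h4]]; split=> //.
  have d := dep x; have h5 : 0 <= q * (r - cross b x) by rewrite mulr_ge0 ?(ltW q0) // subr_ge0 ltW.
  have h6 : 0 <= q * cross b x by rewrite mulr_ge0 ?(ltW q0) // ltW.
  have h7 : 0 <= p * - cross c x by rewrite mulr_ge0 ?(ltW p0) // oppr_ge0 ltW.
  have h8 : 0 <= p * (r + cross c x) by rewrite mulr_ge0 ?(ltW p0) //; lra.
  split; rewrite -/p -/q -/r; apply/andP; split; (try lra); rewrite -(ler_pM2l rp); rewrite -/p -/q -/r in d; lra.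
rewrite EFinD -U12 -b3 -measureU //; last first.
  apply/seteqP; split=> x // [[/o1[_ _ h]|/o2[_ _ h]] /o3[_ h1 h2]].
    by have := lt_trans h h1; rewrite ltxx.
  by have := lt_trans h h2; rewrite ltxx.
apply: le_area => //; first exact: measurableU.
by move=> x [[/o1[]|/o2[]]|/o3[]].
Qed.

End HexagonArea.

Definition translate (R : realType) (t : R * R) (K : set (R * R)) : set (R * R) :=
  [set t + x | x in K].

Lemma translateP (R : realType) (t : R * R) (K : set (R * R)) y : translate t K y <-> K (y - t).
Proof.
split=> [[x Kx <-]|Ky]; first by rewrite addrC addrA addNr add0r.
by exists (y - t) => //; rewrite addrC subrK.
Qed.

Lemma interior_translate (R : realType) (t : R * R) (K : set (R * R)) y :
  (translate t K)° y <-> K° (y - t).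
Proof.
split=> /interior_box[e e0 he]; apply/interior_box; exists e => // z z1 z2.
  have -> : z = z + t - t by rewrite addrK.
  apply/translateP; apply: he => /=.
    by rewrite (_ : _ - _ = z.1 - (y - t).1) //=; ring.
  by rewrite (_ : _ - _ = z.2 - (y - t).2) //=; ring.
apply/translateP; apply: he => /=.
  by rewrite (_ : _ - _ = z.1 - y.1) //; ring.
by rewrite (_ : _ - _ = z.2 - y.2) //; ring.
Qed.

Lemma compact_translate (R : realType) (t : R * R) (K : set (R * R)) :
  compact K -> compact (translate t K).
Proof.
move=> cK; apply: continuous_compact cK; apply: continuous_subspaceT => x.
by apply: (@cvgD _ (R * R)%type); [exact: cvg_cst|exact: cvg_id].
Qed.

Lemma convex_translate (R : realType) (t : R * R) (K : set (R * R)) :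
  convex_set K -> convex_set (translate t K).
Proof.
move=> cK; apply: convex_setP => x y s /translateP Kx /translateP Ky s01; apply/translateP.
by have := convexP cK Kx Ky s01; congr K; congr (_, _) => /=; ring.
Qed.

Lemma area_translate (R : realType) (t : R * R) (K : set (R * R)) :
  measurable (K : set (plane R)) -> area (translate t K) = area K.
Proof.
move=> mK; have D0 : 1 * 1 - 0 * 0 != 0 :> R by rewrite mul0r subr0 mulr1 oner_neq0.
rewrite -(area_affine (- t.1) (- t.2) D0 mK) mul0r subr0 mulr1 normr1 mule1; congr (area _).
have E (y : R * R) : (1 * y.1 + 0 * y.2 - t.1, 0 * y.1 + 1 * y.2 - t.2) = y - t.
  by rewrite [RHS]surjective_pairing; congr (_, _) => /=; ring.
by apply/seteqP; split=> y; rewrite /= E => /translateP.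
Qed.

Lemma boundary_compact (R : realType) (K : set (R * R)) : compact K ->
  forall x, boundary K x <-> K x /\ ~ K° x.
Proof.
by move=> /compact_closed2 cK x; rewrite /boundary -(closure_id K).1.
Qed.

Lemma perim_translate_le (R : realType) (M K : set (R * R)) (t : R * R) : compact K ->
  (perim M (translate t K) <= perim M K)%E.
Proof.
move=> cK; apply: le_ereal_sup => _ [n [v [[vi vo vn] vb ->]]].
exists n, (fun i => v i - t); split; last by congr _%:E; apply: eq_bigr => i _; congr (M_norm M _); rewrite opprB addrA subrK.
- have E i j l : orient (v i - t) (v j - t) (v l - t) = orient (v i) (v j) (v l).
    by rewrite /orient /=; ring.
  split; first by move=> i j /addIr/vi.
    by move=> i j l ij jl; rewrite E; exact: vo.
  by have [i [j [l h]]] := vn; exists i, j, l; rewrite E.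
move=> i; apply/(boundary_compact cK).
have /(boundary_compact (compact_translate (t := t) cK))[h1 h2] := vb i.
by split; [exact/translateP|move=> h; apply: h2; exact/interior_translate].
Qed.

Lemma translateK (R : realType) (t : R * R) (K : set (R * R)) : translate (- t) (translate t K) = K.
Proof.
apply/seteqP; split=> x; first by move=> /translateP/translateP; rewrite opprK addrK.
by move=> Kx; apply/translateP/translateP; rewrite opprK addrK.
Qed.

Lemma perim_translate (R : realType) (M K : set (R * R)) (t : R * R) : compact K ->
  perim M (translate t K) = perim M K.
Proof.
move=> cK; apply/eqP; rewrite eq_le perim_translate_le //=.
rewrite -{1}(translateK t K); apply: perim_translate_le; exact: compact_translate.
Qed.

(** The strip conditions for the point [s (a + b) + t (b + c)], expanded in cross products. *)
Definition hexagon_point (R : realType) (p q r s t : R) : Prop :=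
  [/\ 0 <= s * p + t * (p + q) <= p + q, - p <= - (s * p) + t * r <= r &
      - (q + r) <= - (s * (q + r)) - t * r <= 0].

(** Beyond the diagonal [s + t = 1] the smallest of the ratios [(s + t - 1) / q], [(1 - s) / r],
    [(1 - t) / p] decides which of the three hexagons contains the point. The comparisons are
    cross-multiplied since [r] may be zero. *)
Lemma hexagon_point_cover (R : realType) (p q r s t : R) : 0 < p -> 0 < q -> 0 <= r ->
  0 <= s < 1 -> 0 <= t < 1 ->
  [\/ hexagon_point p q r s t, hexagon_point p q r (s - 1) t | hexagon_point p q r s (t - 1)].
Proof.
move=> p0 q0 r0 /andP[s0 s1] /andP[t0 t1].
have sp0 : 0 <= s * p by rewrite mulr_ge0 // ltW.
have tp0 : 0 <= t * p by rewrite mulr_ge0 // ltW.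
have sq0 : 0 <= s * q by rewrite mulr_ge0 // ltW.
have tq0 : 0 <= t * q by rewrite mulr_ge0 // ltW.
have sr0 : 0 <= s * r by rewrite mulr_ge0.
have tr0 : 0 <= t * r by rewrite mulr_ge0.
have sp1 : 0 <= (1 - s) * p by rewrite mulr_ge0 ?subr_ge0 // ltW.
have tp1 : 0 <= (1 - t) * p by rewrite mulr_ge0 ?subr_ge0 // ltW.
have sq1 : 0 <= (1 - s) * q by rewrite mulr_ge0 ?subr_ge0 // ltW.
have tq1 : 0 <= (1 - t) * q by rewrite mulr_ge0 ?subr_ge0 // ltW.
have sr1 : 0 <= (1 - s) * r by rewrite mulr_ge0 ?subr_ge0 // ltW.
have tr1 : 0 <= (1 - t) * r by rewrite mulr_ge0 ?subr_ge0 // ltW.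
have [st|st] := leP (s + t) 1.
  have st1 : 0 <= 1 - s - t by lra.
  have h1 := mulr_ge0 st1 (ltW p0); have h2 := mulr_ge0 st1 (ltW q0); have h3 := mulr_ge0 st1 r0.
  by apply: Or31; split; apply/andP; split; lra.
have w0 : 0 < s + t - 1 by lra.
have h1 := mulr_ge0 (ltW w0) (ltW p0); have h2 := mulr_ge0 (ltW w0) (ltW q0); have h3 := mulr_ge0 (ltW w0) r0.
have P1 : (s + t - 1) * p <= (1 - t) * q -> (s + t - 1) * r <= (1 - s) * q -> hexagon_point p q r s t.
  by move=> h4 h5; split; apply/andP; split; lra.
have P2 : (1 - s) * q <= (s + t - 1) * r -> (1 - s) * p <= (1 - t) * r -> hexagon_point p q r (s - 1) t.
  by move=> h4 h5; split; apply/andP; split; lra.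
have P3 : (1 - t) * q <= (s + t - 1) * p -> (1 - t) * r <= (1 - s) * p -> hexagon_point p q r s (t - 1).
  by move=> h4 h5; split; apply/andP; split; lra.
move: P1 P2 P3; set w := s + t - 1; set sg := 1 - s; set ta := 1 - t => P1 P2 P3.
have [c1|c1] := leP (w * p) (ta * q).
  have [c2|c2] := leP (w * r) (sg * q); first by apply: Or31; exact: P1.
  apply: Or32; apply: P2; first exact: ltW.
  rewrite -(ler_pM2r q0); have e1 := ler_wpM2r r0 c1; have e2 := ler_wpM2r (ltW p0) (ltW c2); lra.
have [c3|c3] := leP (ta * r) (sg * p); first by apply: Or33; apply: P3 => //; exact: ltW.
apply: Or32; apply: P2; last exact: ltW.
rewrite -(ler_pM2r p0); have e1 := ler_wpM2r (ltW q0) (ltW c3); have e2 := ler_wpM2r r0 (ltW c1); lra.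
Qed.

(** The bounds say that the strips of two translates overlap. Signs decide which one fails: the
    first when [m] and [n] have equal signs or [m = 0], the second when their signs differ, the
    third when [n = 0]. *)
Lemma hexagon_lattice_eq0 (R : realType) (p q r : R) (m n : int) : 0 < p -> 0 < q -> 0 <= r ->
  `|m%:~R * p + n%:~R * (p + q)| < p + q -> `|- (m%:~R * p) + n%:~R * r| < p + r ->
  `|- (m%:~R * (q + r)) - n%:~R * r| < q + r -> m = 0 /\ n = 0.
Proof.
move=> p0 q0 r0; rewrite !ltr_norml => /andP[a1 a2] /andP[b1 b2] /andP[c1 c2].
have ge1 (z : int) : 0 < z -> 1 <= z%:~R :> R by move=> z0; rewrite ler1z -gtz0_ge1.
have le1 (z : int) : z < 0 -> z%:~R <= -1 :> R.
  by move=> z0; rewrite -lerN2 opprK -mulrNz; apply: ge1; rewrite oppr_gt0.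
have pq : 0 < p + q by lra. have qr : 0 < q + r by lra.
have mulge (x y : R) : 1 <= x -> 0 <= y -> y <= x * y by move=> x1 y0; rewrite ler_peMl.
have mulle (x y : R) : x <= -1 -> 0 <= y -> x * y <= - y.
  by move=> x1 y0; rewrite -mulN1r ler_wpM2r.
have [m0|m0|m0] := ltgtP m 0; have [n0|n0|n0] := ltgtP n 0; try by [].
- by exfalso; have := mulle _ _ (le1 _ n0) (ltW pq); have := mulle _ _ (le1 _ m0) (ltW p0); lra.
- by exfalso; have := mulge _ _ (ge1 _ n0) r0; have := mulle _ _ (le1 _ m0) (ltW p0); lra.
- by exfalso; move: c2; rewrite n0 mul0r subr0; have := mulle _ _ (le1 _ m0) (ltW qr); lra.
- by exfalso; have := mulle _ _ (le1 _ n0) r0; have := mulge _ _ (ge1 _ m0) (ltW p0); lra.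
- by exfalso; have := mulge _ _ (ge1 _ n0) (ltW pq); have := mulge _ _ (ge1 _ m0) (ltW p0); lra.
- by exfalso; move: c1; rewrite n0 mul0r subr0; have := mulge _ _ (ge1 _ m0) (ltW qr); lra.
- by exfalso; move: a1; rewrite m0 mul0r add0r; have := mulle _ _ (le1 _ n0) (ltW pq); lra.
by exfalso; move: a2; rewrite m0 mul0r add0r; have := mulge _ _ (ge1 _ n0) (ltW pq); lra.
Qed.

Lemma compact_disk (R : realType) (K : set (R * R)) : compact K -> K !=set0 ->
  exists2 L, 0 < L & K `<=` euclidean_disk 0 L.
Proof.
move=> cK K0.
have bd (a b : R) : exists m, forall z, K z -> a * z.1 + b * z.2 <= m.
  have [v _ H] := lex_max a b 0 0 cK K0; exists (a * v.1 + b * v.2) => z /H[/ltW//|[-> _]//].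
have [m1 h1] := bd 1 0; have [m2 h2] := bd (-1) 0; have [m3 h3] := bd 0 1; have [m4 h4] := bd 0 (-1).
pose L := `|m1| + `|m2| + `|m3| + `|m4| + 1.
have n1 := ler_norm m1; have n2 := ler_norm m2; have n3 := ler_norm m3; have n4 := ler_norm m4.
have p1 := normr_ge0 m1; have p2 := normr_ge0 m2; have p3 := normr_ge0 m3; have p4 := normr_ge0 m4.
have L0 : 0 < L by rewrite /L; lra.
exists (L + L); first by rewrite addr_gt0.
move=> z Kz; have := h1 z Kz; have := h2 z Kz; have := h3 z Kz; have := h4 z Kz => g4 g3 g2 g1.
have b1 : `|z.1| <= `|L| by rewrite (gtr0_norm L0) ler_norml /L; apply/andP; split; lra.
have b2 : `|z.2| <= `|L| by rewrite (gtr0_norm L0) ler_norml /L; apply/andP; split; lra.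
have sq (x : R) : `|x| <= `|L| -> x ^+ 2 <= L ^+ 2.
  by move=> h; rewrite -[x ^+ 2]real_normK ?num_real // -[L ^+ 2]real_normK ?num_real // ler_sqr ?nnegrE.
rewrite /euclidean_disk /= !subr0.
by have := sqr_ge0 L; have := sq _ b1; have := sq _ b2; rewrite !expr2; lra.
Qed.

Lemma orient_cross (R : realType) (x y z : R * R) :
  orient x y z = cross x y + cross y z + cross z x.
Proof. by rewrite /orient /cross; ring. Qed.

Lemma crossDl (R : realType) (x y z : R * R) : cross (x + y) z = cross x z + cross y z.
Proof. by rewrite /cross /=; ring. Qed.

Lemma cross0l (R : realType) (x : R * R) : cross 0 x = 0.
Proof. by rewrite /cross /=; ring. Qed.

Lemma cross0r (R : realType) (x : R * R) : cross x 0 = 0.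
Proof. by rewrite /cross /=; ring. Qed.

Lemma cross_decomp (R : realType) (x u v : R * R) : cross u v != 0 ->
  x = (cross x v / cross u v) *: u + (cross u x / cross u v) *: v.
Proof.
by rewrite /cross => D0; rewrite [LHS]surjective_pairing [RHS]surjective_pairing;
  congr (_, _); rewrite /= /GRing.scale /=; field.
Qed.

(** The lists are the values of [cross a] and [- cross c] at the six vertices; together they tell
    the vertices apart even when [r = 0]. *)
Lemma hexagon_table_inj (R : realType) (p q r : R) i j : 0 < p -> 0 < q -> 0 <= r ->
  (i < 6)%N -> (j < 6)%N ->
  nth 0 [:: 0; 0; p; p + q; p + q; q] i = nth 0 [:: 0; 0; p; p + q; p + q; q] j ->
  nth 0 [:: 0; q; q + r; q + r; r; 0] i = nth 0 [:: 0; q; q + r; q + r; r; 0] j -> i = j.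
Proof.
move=> p0 q0 r0; case: i => [|[|[|[|[|[|i]]]]]] //; case: j => [|[|[|[|[|[|j]]]]]] //=;
  clear -p0 q0 r0; move=> _ _ e1 e2; exfalso; lra.
Qed.

Section HexagonTiling.
Variables (R : realType) (a b c : R * R).
Let p := cross a b.
Let q := cross a c.
Let r := cross b c.
Hypotheses (p0 : 0 < p) (q0 : 0 < q) (r0 : 0 <= r).
Let K := convex_hull (hexagon_vertex a b c).

Definition hexagon_lattice (m n : int) : R * R := m%:~R *: (a + b) + n%:~R *: (b + c).

Definition hexagon_cells : set (set (R * R)) :=
  [set C | exists m n, C = translate (hexagon_lattice m n) K].

Let ba : cross b a = - p. Proof. exact: crossC. Qed.
Let ca : cross c a = - q. Proof. exact: crossC. Qed.
Let cb : cross c b = - r. Proof. exact: crossC. Qed.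

Lemma convex_polygon_hexagon : convex_polygon (hexagon_vertex a b c).
Proof.
have p0' := p0; have q0' := q0; have r0' := r0.
split.
- move=> i j e.
  have A (l : 'I_6) : nth 0 [:: 0; 0; p; p + q; p + q; q] l = cross a (hexagon_vertex a b c l).
    by case: l => [[|[|[|[|[|[|l]]]]]] Hl] //=; rewrite /hexagon_vertex /= ?(crossDr, crossvv, cross0r) ?add0r.
  have C (l : 'I_6) : nth 0 [:: 0; q; q + r; q + r; r; 0] l = - cross c (hexagon_vertex a b c l).
    by case: l => [[|[|[|[|[|[|l]]]]]] Hl] //=;
      rewrite /hexagon_vertex /= ?(crossDr, crossvv, cross0r) ?ca ?cb ?addr0 ?opprD ?opprK ?oppr0.
  apply/val_inj/(hexagon_table_inj p0 q0 r0 (ltn_ord i) (ltn_ord j)); first by rewrite !A e.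
  by rewrite !C e.
- move=> i j l; rewrite orient_cross /hexagon_vertex.
  case: i => [[|[|[|[|[|[|i]]]]]] Hi] //; case: j => [[|[|[|[|[|[|j]]]]]] Hj] //;
  case: l => [[|[|[|[|[|[|l]]]]]] Hl] //= _ _;
    rewrite ?(crossDr, crossDl, crossvv, cross0r, cross0l) ?ba ?ca ?cb -/p -/q -/r; lra.
exists (@Ordinal 6 0 isT), (@Ordinal 6 1 isT), (@Ordinal 6 2 isT).
rewrite orient_cross /hexagon_vertex /= ?(crossDr, crossDl, crossvv, cross0r, cross0l).
by rewrite ?ba -/p; apply/eqP; lra.
Qed.

Let KE : K = hexagon_strips a b c.
Proof. exact: hexagon_stripsE. Qed.

Lemma convex_hexagon : convex_set K. Proof. exact: convex_hull_convex. Qed.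

Lemma interior_hexagon : K° !=set0.
Proof.
have V i := convex_hull_sub (hexagon_vertex a b c) i.
have o0 : 0 < orient 0 a (a + b).
  by rewrite orient_cross ?(crossDr, crossDl, crossvv, cross0r, cross0l) -/p; have := p0; lra.
exists (((0 : R * R).1 + a.1 + (a + b).1) / 3, ((0 : R * R).2 + a.2 + (a + b).2) / 3).
apply: (interiorS _ (triangle_interior o0)); apply: triangle_sub o0; first exact: convex_hexagon.
- exact: (V (@Ordinal 6 0 isT)).
- exact: (V (@Ordinal 6 1 isT)).
exact: (V (@Ordinal 6 2 isT)).
Qed.

Let cK : compact K. Proof. by rewrite KE; exact: compact_hexagon. Qed.

Lemma hexagon_cells_interior m n z : (translate (hexagon_lattice m n) K)° z ->
  [/\ 0 < cross a (z - hexagon_lattice m n) < p + q, - p < cross b (z - hexagon_lattice m n) < r &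
   - (q + r) < cross c (z - hexagon_lattice m n) < 0].
Proof.
have p0' := p0; have q0' := q0.
move=> /interior_translate h.
have [an bn cn] : [/\ a != 0, b != 0 & c != 0].
  split; apply: contraTneq isT => e; [have := p0'|have := p0'|have := q0'];
    by rewrite ?/p ?/q e ?cross0l ?cross0r ltxx.
by split; [apply: (interior_cross an _ h)|apply: (interior_cross bn _ h)|apply: (interior_cross cn _ h)];
  move=> x; rewrite KE => -[].
Qed.

Lemma tiling_hexagon : tiling hexagon_cells.
Proof.
have p0' := p0; have q0' := q0; have r0' := r0.
have crossZ (x y : R * R) (s : R) : cross x (s *: y) = s * cross x y.
  by rewrite /cross /= /GRing.scale /=; ring.
split.
- have -> : hexagon_cells = [set translate (hexagon_lattice x.1 x.2) K | x in [set: int * int]].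
    by apply/seteqP; split=> C; [move=> [m [n ->]]; exists (m, n)|move=> [[m n] _ <-]; exists m, n].
  by apply: card_le_trans (card_image_le _ _) _; exact: countableP.
- move=> C [m [n ->]]; split; first exact: compact_translate.
  have [z Kz] := interior_hexagon; exists (z + hexagon_lattice m n).
  by apply/interior_translate; rewrite addrK.
- apply/seteqP; split=> // x _.
  have DE : cross (a + b) (b + c) = p + q + r by rewrite crossDl !crossDr crossvv -/p -/q -/r; ring.
  have D0 : cross (a + b) (b + c) != 0 by rewrite DE gt_eqF //; lra.
  have := cross_decomp x D0; set s := _ / _; set t := _ / _ => xE.
  pose s' := s - (Num.floor s)%:~R; pose t' := t - (Num.floor t)%:~R.
  have fl (y : R) : 0 <= y - (Num.floor y)%:~R < 1.
    by have /andP[h1 h2] := floor_itv y; rewrite intrD in h2; apply/andP; split; lra.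
  have cell m n : hexagon_point p q r (s - m%:~R) (t - n%:~R) -> (\bigcup_(C in hexagon_cells) C) x.
    move=> [h1 h2 h3]; exists (translate (hexagon_lattice m n) K); first by exists m, n.
    apply/translateP; rewrite KE.
    have -> : x - hexagon_lattice m n = (s - m%:~R) *: (a + b) + (t - n%:~R) *: (b + c).
      by rewrite /hexagon_lattice {1}xE !scalerBl opprD addrACA.
    move: h1 h2 h3; rewrite /hexagon_strips /= !crossDr !crossZ !crossDr !crossvv ba ca cb -/p -/q -/r.
    by move=> /andP[? ?] /andP[? ?] /andP[? ?]; split; apply/andP; split; lra.
  case: (hexagon_point_cover p0 q0 r0 (fl s) (fl t)) => h.
  + exact: cell h.
  + by apply: (cell (Num.floor s + 1) (Num.floor t)); rewrite intrD opprD addrA.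
  by apply: (cell (Num.floor s) (Num.floor t + 1)); rewrite intrD opprD addrA.
move=> C D [m [n ->]] [m' [n' ->]] [z [/hexagon_cells_interior z1 /hexagon_cells_interior z2]].
have [A B E] := z1; have [A' B' E'] := z2.
have X d : cross d (z - hexagon_lattice m' n') - cross d (z - hexagon_lattice m n) =
    (m - m')%:~R * cross d (a + b) + (n - n')%:~R * cross d (b + c).
  by rewrite /hexagon_lattice !crossBr !crossDr !crossZ !crossDr !intrD !mulrNz; ring.
have [] := @hexagon_lattice_eq0 R p q r (m - m') (n - n') p0 q0 r0.
- rewrite [X in `|X|](_ : _ = cross a (z - hexagon_lattice m' n') - cross a (z - hexagon_lattice m n)); last first.
    by rewrite X !crossDr crossvv -/p -/q add0r.
  by move: A A' => /andP[? ?] /andP[? ?]; rewrite ltr_norml; apply/andP; split; lra.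
- rewrite [X in `|X|](_ : _ = cross b (z - hexagon_lattice m' n') - cross b (z - hexagon_lattice m n)); last first.
    by rewrite X !crossDr crossvv -/r ba addr0 add0r mulrN.
  by move: B B' => /andP[? ?] /andP[? ?]; rewrite ltr_norml; apply/andP; split; lra.
- rewrite [X in `|X|](_ : _ = cross c (z - hexagon_lattice m' n') - cross c (z - hexagon_lattice m n)); last first.
    by rewrite X !crossDr crossvv ca cb addr0; ring.
  by move: E E' => /andP[? ?] /andP[? ?]; rewrite ltr_norml; apply/andP; split; lra.
by move=> /subr0_eq -> /subr0_eq ->.
Qed.

Lemma hexagonal_hexagon_cells : hexagonal_tiling hexagon_cells.
Proof.
split; first exact: tiling_hexagon.
exists (hexagon_vertex a b c); split; first exact: convex_polygon_hexagon.
  exists (2^-1 *: (a + b + c)); rewrite -/K KE => x.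
  have -> : 2^-1 *: (a + b + c) + 2^-1 *: (a + b + c) = a + b + c.
    by rewrite -scalerDl (_ : 2^-1 + 2^-1 = 1 :> R) ?scale1r //; lra.
  rewrite /hexagon_strips /= !crossBr !crossDr !crossvv ba ca cb -/p -/q -/r.
  by move=> [/andP[? ?] /andP[? ?] /andP[? ?]]; split; apply/andP; split; lra.
by move=> C [m [n ->]]; exists (hexagon_lattice m n).
Qed.

Lemma convex_tiling_hexagon : convex_tiling hexagon_cells.
Proof.
split; first exact: tiling_hexagon.
by move=> C [m [n ->]]; apply: convex_translate; exact: convex_hexagon.
Qed.

Lemma bounded_hexagon_cells : exists r1 r2, bounded_cells hexagon_cells r1 r2.
Proof.
have [z Kz] := interior_hexagon.
have K0 : K !=set0 by exists z; exact: interior_subset.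
have [L L0 KL] := compact_disk cK K0.
have /interior_box[e e0 he] := Kz.
exists (e / 2), L; split=> //; first by rewrite divr_gt0.
move=> C [m [n ->]]; split.
  exists (z + hexagon_lattice m n) => x xd; apply/translateP; apply: he.
    have [h _] := disk_coord (ltW (divr_gt0 e0 (ltr0n _ 2 : 0 < 2%:R))) xd.
    by rewrite (_ : _ - _ = x.1 - (z + hexagon_lattice m n).1) /=; [lra|ring].
  have [_ h] := disk_coord (ltW (divr_gt0 e0 (ltr0n _ 2 : 0 < 2%:R))) xd.
  by rewrite (_ : _ - _ = x.2 - (z + hexagon_lattice m n).2) /=; [lra|ring].
exists (hexagon_lattice m n) => x /translateP/KL.
by rewrite /euclidean_disk /= !subr0.
Qed.

Lemma area_hexagon_cells C : hexagon_cells C -> area C = (p + q + r)%:E.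
Proof.
move=> [m [n ->]]; rewrite area_translate KE; first exact: area_hexagon.
exact: measurable_hexagon.
Qed.

Lemma perim_hexagon_cells M C : hexagon_cells C -> perim M C = perim M K.
Proof. by move=> [m [n ->]]; exact: perim_translate. Qed.

End HexagonTiling.

(** * Upper bound for the perimeter of the hexagon *)

Definition alternates (R : realType) (g : nat -> R) i j k l : Prop :=
  [/\ g i < g j, g k < g j, g i < g l & g k < g l].

(* A closed sequence without alternation rises once from its minimum to its
   maximum and falls once back. *)
Lemma closed_variation_le (R : realType) (g : nat -> R) n (lo hi : R) : g n = g 0%N -> (0 < n)%N ->
  (forall i j k l, (i < j)%N -> (j < k)%N -> (k < l)%N -> (l < n)%N ->
     ~ alternates g i j k l /\ ~ alternates (fun i => - g i) i j k l) ->
  (forall i, (i < n)%N -> lo <= g i <= hi) ->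
  \sum_(0 <= i < n) `|g i.+1 - g i| <= 2 * (hi - lo).
Proof.
move=> gn n0 H B.
pose a := [arg min_(i < Ordinal n0) g i]%O; pose b := [arg max_(i > Ordinal n0) g i]%O.
have amin i : (i < n)%N -> g a <= g i.
  by rewrite /a; case: Order.TotalTheory.arg_minP => //= j _ h i_n; exact: (h (Ordinal i_n) isT).
have bmax i : (i < n)%N -> g i <= g b.
  by rewrite /b; case: Order.TotalTheory.arg_maxP => //= j _ h i_n; exact: (h (Ordinal i_n) isT).
move: (nat_of_ord a) (nat_of_ord b) (ltn_ord a) (ltn_ord b) amin bmax => {a b}.
suff main (h : nat -> R) (a b : nat) : h n = h 0%N -> (forall i j k l, (i < j)%N -> (j < k)%N -> (k < l)%N -> (l < n)%N ->
     ~ alternates h i j k l /\ ~ alternates (fun i => - h i) i j k l) ->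
   (a < b)%N -> (b < n)%N -> (forall i, (i < n)%N -> h a <= h i) -> (forall i, (i < n)%N -> h i <= h b) ->
   \sum_(0 <= i < n) `|h i.+1 - h i| = 2 * (h b - h a).
  move=> a b an bn amin bmax; have /andP[la ua] := B a an; have /andP[lb ub] := B b bn.
  have [ab|ba|ab] := ltngtP a b.
  - by rewrite (main g a b) //; lra.
  - have := @main (fun i => - g i) b a; rewrite /= gn => /(_ erefl) m.
    rewrite (eq_bigr (fun i => `|- g i.+1 - - g i|)); last by move=> i _; rewrite -[RHS]normrN; congr `|_|; ring.
    rewrite m //; first by lra.
    + move=> i j k l ij jk kl ln; have [h1 h2] := H i j k l ij jk kl ln; split=> // h3.
      by apply: h1; move: h3; rewrite /alternates !opprK.
    + by move=> i i_n; rewrite lerN2 bmax.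
    by move=> i i_n; rewrite lerN2 amin.
  rewrite big_nat big1 ?mulr_ge0 ?subr_ge0 //; first by lra.
  move=> i /andP[_ i_n].
  have eqa j : (j < n)%N -> g j = g a by move=> jn; apply/le_anti; rewrite amin // andbT ab bmax.
  have [j1|] := ltnP i.+1 n; first by rewrite !eqa // subrr normr0.
  rewrite leq_eqVlt ltnS [X in _ || X]leqNgt i_n orbF => /eqP <-.
  by rewrite gn !eqa // subrr normr0.
move=> hn {}H ab bn amin bmax {g gn B}.
have an : (a < n)%N by exact: ltn_trans bn.
have up i : (a <= i)%N -> (i < b)%N -> h i <= h i.+1.
  rewrite leq_eqVlt => /orP[/eqP <- _|ai]; first by apply: amin; exact: leq_ltn_trans bn.
  rewrite leq_eqVlt => /orP[/eqP e|ib]; first by rewrite e; apply: bmax; apply: ltn_trans bn; rewrite -e.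
  rewrite leNgt; apply/negP => lt.
  have [w _] := H a i i.+1 b ai (leqnn _) ib bn; apply: w.
  have i1 := amin i.+1 (ltn_trans ib bn); have i2 := bmax i (ltn_trans (ltnW ib : (i < b)%N) bn).
  by split; lra.
have down1 i : (b <= i)%N -> (i.+1 < n)%N -> h i.+1 <= h i.
  rewrite leq_eqVlt => /orP[/eqP <-|bi] i_n; first exact: bmax.
  rewrite leNgt; apply/negP => lt.
  have [w _] := H a b i i.+1 ab bi (leqnn _) i_n; apply: w.
  have i1 := amin i (ltnW i_n); have i2 := bmax i.+1 i_n.
  by split; lra.
have down i : (b <= i)%N -> (i < n)%N -> h i.+1 <= h i.
  move=> bi i_n; have [i1|] := ltnP i.+1 n; first exact: down1.
  rewrite leq_eqVlt ltnS [X in _ || X]leqNgt i_n orbF => /eqP en; rewrite -en hn.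
  have [a_0|a0] := posnP a; first by rewrite -{1}a_0; exact: amin.
  move: bi; rewrite leq_eqVlt => /orP[/eqP <-|bi]; first exact: bmax.
  rewrite leNgt; apply/negP => lt.
  have [_ w] := H 0%N a b i a0 ab bi i_n; apply: w.
  have j1 := amin i i_n; have j2 := bmax 0%N n0.
  by split; rewrite ltrN2; lra.
have fall i : (i < a)%N -> h i.+1 <= h i.
  rewrite leq_eqVlt => /orP[/eqP e|ia]; first by rewrite e; apply: amin; apply: ltn_trans an; rewrite -e.
  rewrite leNgt; apply/negP => lt.
  have [w _] := H i i.+1 a b (leqnn _) ia ab bn; apply: w.
  have j1 := amin i (ltn_trans (ltnW ia : (i < a)%N) an); have j2 := bmax i.+1 (ltn_trans ia an).
  by split; lra.
rewrite (big_cat_nat (n := b)) //=; last exact: ltnW.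
rewrite (big_cat_nat (n := a) _ (ltnW ab)) //=.
have -> : \sum_(0 <= i < a) `|h i.+1 - h i| = h 0%N - h a.
  rewrite big_nat (eq_bigr (fun i => - (h i.+1 - h i))); last first.
    by move=> i /andP[_ ia]; rewrite ler0_norm // subr_le0; exact: fall.
  by rewrite -big_nat sumrN telescope_sumr // opprB.
have -> : \sum_(a <= i < b) `|h i.+1 - h i| = h b - h a.
  rewrite big_nat (eq_bigr (fun i => h i.+1 - h i)); last first.
    by move=> i /andP[ai ib]; rewrite ger0_norm // subr_ge0; exact: up.
  by rewrite -big_nat telescope_sumr // ltnW.
have -> : \sum_(b <= i < n) `|h i.+1 - h i| = h b - h 0%N.
  rewrite big_nat (eq_bigr (fun i => - (h i.+1 - h i))); last first.
    by move=> i /andP[bi i_n]; rewrite ler0_norm // subr_le0; exact: down.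
  by rewrite -big_nat sumrN telescope_sumr ?hn ?opprB // ltnW.
ring.
Qed.

Lemma orient_dependency (R : realType) (d w x y z : R * R) :
  orient x y z * cross d w - orient w y z * cross d x + orient w x z * cross d y - orient w x y * cross d z = 0.
Proof. by rewrite /orient /cross; ring. Qed.

Lemma orient_add (R : realType) (w x y z : R * R) :
  orient w x y + orient w y z = orient w x z + orient x y z.
Proof. by rewrite /orient; ring. Qed.

(** The path from [x] through [y] to [z] turns back at [y] on a single line, so a point to the left
    of both steps lies on that line. *)
Lemma orient_valley (R : realType) (d m x y z : R * R) : 0 <= orient m x y -> 0 <= orient m y z ->
  orient x y z = 0 -> cross d y < cross d x -> cross d y < cross d z ->
  orient m x y = 0 /\ orient m y z = 0.
Proof.
move=> h1 h2 h3 yx yz; have := orient_dependency d m x y z; have := orient_add m x y z.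
rewrite h3 addr0 => <-; rewrite mul0r sub0r.
move: (orient m x y) (orient m y z) h1 h2 => s t s0 t0 e.
have e1 : t * (cross d x - cross d y) + s * (cross d z - cross d y) = 0 by lra.
have k1 : 0 <= t * (cross d x - cross d y) by rewrite mulr_ge0 // subr_ge0 ltW.
have k2 : 0 <= s * (cross d z - cross d y) by rewrite mulr_ge0 // subr_ge0 ltW.
have /eqP : s * (cross d z - cross d y) = 0 by lra.
have /eqP : t * (cross d x - cross d y) = 0 by lra.
by rewrite !mulf_eq0 !subr_eq0 (gt_eqF yx) (gt_eqF yz) !orbF => /eqP -> /eqP ->.
Qed.

(** At the crossing of the diagonals the linear function is at most the larger of its values at [i],
    [k] and at least the smaller of those at [j], [l], so the alternation is impossible for a proper
    quadrilateral. Straight angles leave the case of collinear vertices, which would force the whole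
    polygon onto a line. *)
Lemma convex_polygon_unimodal (R : realType) n (v : 'I_n -> R * R) (d : R * R) (i j k l : 'I_n) :
  convex_polygon v -> (i < j)%N -> (j < k)%N -> (k < l)%N ->
  ~ [/\ cross d (v i) < cross d (v j), cross d (v k) < cross d (v j),
        cross d (v i) < cross d (v l) & cross d (v k) < cross d (v l)].
Proof.
move=> [_ vo [i1 [i2 [i3 vn]]]] ij jk kl [h1 h2 h3 h4].
have jl := ltn_trans jk kl; have ik := ltn_trans ij jk.
have o1 := vo _ _ _ ij jk; have o2 := vo _ _ _ ik kl; have o3 := vo _ _ _ ij jl; have o4 := vo _ _ _ jk kl.
have dep := orient_dependency d (v i) (v j) (v k) (v l); have add := orient_add (v i) (v j) (v k) (v l).
have [z1 z3 z4] : [/\ orient (v i) (v j) (v k) = 0, orient (v i) (v j) (v l) = 0 & orient (v j) (v k) (v l) = 0].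
  move: dep add o1 o2 o3 o4 h1 h2 h3 h4.
  move: (orient (v i) (v j) (v k)) (orient (v i) (v k) (v l)) (orient (v i) (v j) (v l)) (orient (v j) (v k) (v l)) => o1 o2 o3 o4.
  move: (cross d (v i)) (cross d (v j)) (cross d (v k)) (cross d (v l)) => f1 f2 f3 f4 dep add p1 p2 p3 p4 h1 h2 h3 h4.
  pose m0 := Num.max f1 f3; pose m1 := Num.min f2 f4.
  have m01 : m0 < m1 by rewrite /m0 /m1 gt_max !lt_min h1 h2 h3 h4.
  have u1 : o4 * f1 <= o4 * m0 by rewrite ler_wpM2l // /m0 le_max lexx.
  have u2 : o3 * f3 <= o3 * m0 by rewrite ler_wpM2l // /m0 le_max lexx orbT.
  have u3 : o2 * m1 <= o2 * f2 by rewrite ler_wpM2l // /m1 ge_min lexx.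
  have u4 : o1 * m1 <= o1 * f4 by rewrite ler_wpM2l // /m1 ge_min lexx orbT.
  have u5 : (o1 + o2) * (m1 - m0) <= 0 by rewrite {1}(_ : (o1 + o2) * (m1 - m0) = (o1 + o2) * m1 - (o3 + o4) * m0); [lra|rewrite -add; ring].
  have u6 : o1 + o2 <= 0 by rewrite -(pmulr_lle0 _ (_ : 0 < m1 - m0)) // subr_gt0.
  by split; lra.
(* Wherever [m] stands in the order, it is to the left of both steps of some turning path among the
   four points, so [orient_valley] applies. *)
have off m : orient (v i) (v j) (v m) = 0.
  apply/eqP/negPn/negP => nz.
  have mi : m != i by apply: contraNneq nz => ->; rewrite orient_id2.
  have mj : m != j by apply: contraNneq nz => ->; rewrite orient_id3.
  have ml : m != l by apply: contraNneq nz => ->; rewrite z3.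
  have QRS : 0 <= orient (v m) (v j) (v k) -> 0 <= orient (v m) (v k) (v l) -> False.
    move=> k1 k2; have [e1 _] := orient_valley k1 k2 z4 h2 h4.
    have := orient_dependency d (v i) (v j) (v k) (v m); have := orient_add (v i) (v j) (v k) (v m).
    have e1' : orient (v j) (v k) (v m) = 0 by rewrite orient_cyclic.
    rewrite z1 e1' add0r addr0 => ->; rewrite !mul0r sub0r subr0 => e2.
    have /eqP : orient (v i) (v j) (v m) * (cross d (v k) - cross d (v j)) = 0 by lra.
    by rewrite mulf_eq0 (negbTE nz) subr_eq0 (lt_eqF h2).
  have [mj'|] := ltnP m j.
    by apply: QRS; apply: vo => //; exact: ltn_trans jk.
  rewrite leq_eqVlt => /orP[/eqP e|jm]; first by move: mj; rewrite (_ : m = j) ?eqxx //; apply/val_inj.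
  have [ml'|] := ltnP m l.
    have k1 : 0 <= orient (v m) (v l) (v i) by rewrite orient_cyclic; apply: vo => //; exact: ltn_trans jm.
    have k2 : 0 <= orient (v m) (v i) (v j) by rewrite -orient_cyclic; apply: vo.
    have z3' : orient (v l) (v i) (v j) = 0 by rewrite -orient_cyclic.
    have [_ e1] := orient_valley k1 k2 z3' h3 h1.
    by move: nz; rewrite orient_cyclic e1 eqxx.
  rewrite leq_eqVlt => /orP[/eqP e|lm]; first by move: ml; rewrite (_ : m = l) ?eqxx //; apply/val_inj.
  by apply: QRS; rewrite -orient_cyclic; apply: vo => //; exact: ltn_trans lm.
move/eqP: vn; apply; apply: (mulIf (_ : cross d (v j) - cross d (v i) != 0)); first by rewrite subr_eq0 gt_eqF.
rewrite mul0r.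
have -> : orient (v i1) (v i2) (v i3) * (cross d (v j) - cross d (v i)) =
  orient (v i) (v j) (v i1) * (cross d (v i3) - cross d (v i2)) +
  orient (v i) (v j) (v i2) * (cross d (v i1) - cross d (v i3)) +
  orient (v i) (v j) (v i3) * (cross d (v i2) - cross d (v i1)) by rewrite /orient /cross; ring.
by rewrite !off !mul0r !addr0.
Qed.

Lemma convex_polygon_variation (R : realType) n (v : 'I_n -> R * R) (d : R * R) (lo hi : R) :
  convex_polygon v -> (forall i, lo <= cross d (v i) <= hi) ->
  \sum_(i < n) `|cross d (v (ordS i) - v i)| <= 2 * (hi - lo).
Proof.
move=> pv B; have [_ _ [i0 _]] := pv.
case: n v pv B i0 => [v _ _ []//|n] v pv B i0.
pose g (i : nat) := cross d (v (inord (i %% n.+1))).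
have -> : \sum_(i < n.+1) `|cross d (v (ordS i) - v i)| = \sum_(0 <= i < n.+1) `|g i.+1 - g i|.
  rewrite big_mkord; apply: eq_bigr => i _; rewrite crossBr /g.
  by congr `|cross d (v _) - cross d (v _)|; apply/val_inj; rewrite /= inordK ?ltn_pmod // modn_small.
apply: closed_variation_le => //.
- by rewrite /g modnn mod0n.
- have small (i : nat) : (i < n.+1)%N -> g i = cross d (v (inord i)) by move=> h; rewrite /g modn_small.
  move=> i j k l ij jk kl ln; have kn := ltn_trans kl ln; have jn := ltn_trans jk kn; have i_n := ltn_trans ij jn.
  have U e := @convex_polygon_unimodal R n.+1 v e (inord i) (inord j) (inord k) (inord l) pv.
  rewrite !inordK // in U.
  rewrite /alternates !small //; split; first exact: (U d).
  have E x : - cross d x = cross (- d) x by rewrite /cross /=; ring.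
  by rewrite !E; exact: (U (- d)).
by move=> i _; exact: B.
Qed.

Lemma M_norm_comb (R : realType) (M : set (R * R)) (x y z : R * R) (s t : R) : convex_set M -> M 0 ->
  M y -> M z -> 0 <= s -> 0 <= t -> x = s *: y + t *: z -> M_norm M x <= s + t.
Proof.
move=> cM M0 My Mz s0 t0 ->.
have [st|st] := eqVneq (s + t) 0.
  have -> : s = 0 by lra.
  have -> : t = 0 by lra.
  by apply: (M_norm_le (y := 0)); rewrite ?addr0 // !scale0r addr0.
have st0 : 0 < s + t by rewrite lt_neqAle eq_sym st addr_ge0.
have h : 0 <= t / (s + t) <= 1 by rewrite (divr_ge0 t0 (ltW st0)) ler_pdivrMr // mul1r lerDr.
apply: (M_norm_le _ (convexP cM My Mz h)); first exact: ltW.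
by rewrite [LHS]surjective_pairing [RHS]surjective_pairing; congr (_, _); rewrite /= /GRing.scale /=; field.
Qed.

Section HexagonPerimeter.
Variables (R : realType) (M : set (R * R)) (a b c ya yb yc : R * R) (La Lb Lc kap : R).
Let p := cross a b.
Let q := cross a c.
Let r := cross b c.
Hypotheses (p0 : 0 < p) (q0 : 0 < q) (r0 : 0 <= r).
Hypotheses (cM : convex_set M) (sM : o_symmetric M) (M0 : M 0).
Hypotheses (Mya : M ya) (Myb : M yb) (Myc : M yc).
Hypotheses (aE : a = La *: ya) (bE : b = Lb *: yb) (cE : c = Lc *: yc).
Hypotheses (LaE : La = kap * (p + q)) (LbE : Lb = kap * (p + r)) (LcE : Lc = kap * (q + r)).
Hypothesis (kap0 : 0 <= kap).

(** The right-hand side is the norm whose unit disk is the hexagon with vertices [ya], [yb], [yc]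
    and their negatives: it is linear on the sectors bounded by the lines of [a], [b], [c], and the
    hypotheses on [La], [Lb], [Lc] make it 1 at those points. M contains this hexagon, so [x] is
    resolved along the two sides of its sector. *)
Lemma M_norm_hexagon_le (x : R * R) :
  M_norm M x <= kap * (`|cross a x| + `|cross b x| + `|cross c x|).
Proof.
have p0' := p0; have q0' := q0; have r0' := r0; have k0' := kap0.
have [La0 Lb0 Lc0] : [/\ 0 <= La, 0 <= Lb & 0 <= Lc].
  by rewrite LaE LbE LcE; split; rewrite mulr_ge0 //; lra.
have dep z := cross_dependency a b c z; rewrite -/p -/q -/r in dep.
suff main z : 0 <= cross a z -> exists y1 y2 s t, [/\ M y1 /\ M y2, 0 <= s, 0 <= t, z = s *: y1 + t *: y2 &
    s + t = kap * (`|cross a z| + `|cross b z| + `|cross c z|)].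
  have [ax|ax] := leP 0 (cross a x).
    by have [y1 [y2 [s [t [[My1 My2] s0 t0 xE <-]]]]] := main x ax; exact: M_norm_comb xE.
  have N d : cross d (- x) = - cross d x by rewrite /cross /=; ring.
  have [|y1 [y2 [s [t [[My1 My2] s0 t0 xE]]]]] := main (- x); first by rewrite N oppr_ge0 ltW.
  rewrite !N !normrN => <-; apply: (M_norm_comb cM M0 (sM My1) (sM My2) s0 t0).
  by rewrite !scalerN -opprD -xE opprK.
move=> A0; have := dep z; set A := cross a z in A0 *; set B := cross b z; set C := cross c z => depz.
have pn : a.1 * b.2 - a.2 * b.1 != 0 by rewrite -/(cross a b) gt_eqF.
have qn : a.1 * c.2 - a.2 * c.1 != 0 by rewrite -/(cross a c) gt_eqF.
have [C0|C0] := leP 0 C.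
  exists yc, (- ya), (A / q * Lc), (C / q * La).
  have zE : z = (A / q) *: c - (C / q) *: a.
    by rewrite [LHS]surjective_pairing [RHS]surjective_pairing; congr (_, _); rewrite /= /GRing.scale /= /A /C /q /cross; field.
  split; [by split=> //; exact: sM|by rewrite mulr_ge0 // divr_ge0 // ltW|by rewrite mulr_ge0 // divr_ge0 // ltW| |].
    by rewrite [LHS]zE scalerN -!scalerA -cE -aE.
  have BE : B = (A * r + C * p) / q by apply: (mulIf (lt0r_neq0 q0)); rewrite divfK ?gt_eqF //; lra.
  have B0 : 0 <= B by rewrite BE divr_ge0 ?(ltW q0) // addr_ge0 // mulr_ge0 // ltW.
  rewrite (ger0_norm A0) (ger0_norm C0) (ger0_norm B0) LcE LaE BE; field; rewrite gt_eqF //.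
have [B0|B0] := leP B 0.
  exists ya, yb, (- B / p * La), (A / p * Lb).
  have zE : z = (- B / p) *: a + (A / p) *: b.
    by rewrite [LHS]surjective_pairing [RHS]surjective_pairing; congr (_, _); rewrite /= /GRing.scale /= /A /B /p /cross; field.
  split; [by []|by rewrite mulr_ge0 // divr_ge0 ?oppr_ge0 // ltW|by rewrite mulr_ge0 // divr_ge0 // ltW| |].
    by rewrite [LHS]zE -!scalerA -aE -bE.
  have CE : C = (q * B - r * A) / p by apply: (mulIf (lt0r_neq0 p0)); rewrite divfK ?gt_eqF //; lra.
  rewrite (ger0_norm A0) (ltr0_norm C0) (ler0_norm B0) LaE LbE CE; field; rewrite gt_eqF //.
have rp : 0 < r.
  rewrite lt_neqAle r0 andbT; apply/eqP => re.
  have : 0 < q * B by rewrite mulr_gt0.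
  have : 0 < p * - C by rewrite mulr_gt0 // oppr_gt0.
  by move: depz; rewrite -re; lra.
have rn : b.1 * c.2 - b.2 * c.1 != 0 by rewrite -/(cross b c) gt_eqF.
exists yb, yc, (- C / r * Lb), (B / r * Lc).
have zE : z = (- C / r) *: b + (B / r) *: c.
  by rewrite [LHS]surjective_pairing [RHS]surjective_pairing; congr (_, _); rewrite /= /GRing.scale /= /C /B /r /cross; field.
split; [by []|by rewrite mulr_ge0 // divr_ge0 ?oppr_ge0 // ltW|by rewrite mulr_ge0 // divr_ge0 // ltW| |].
  by rewrite [LHS]zE -!scalerA -bE -cE.
have AE : A = (q * B - p * C) / r by apply: (mulIf (lt0r_neq0 rp)); rewrite divfK ?gt_eqF //; lra.
rewrite (ger0_norm A0) (ltr0_norm C0) (gtr0_norm B0) LbE LcE AE; field; rewrite gt_eqF //.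
Qed.

Lemma perim_hexagon_le :
  (perim M (convex_hull (hexagon_vertex a b c)) <= (4 * kap * (p + q + r))%:E)%E.
Proof.
have p0' := p0; have q0' := q0; have r0' := r0.
have cK : compact (hexagon_strips a b c) by exact: compact_hexagon.
rewrite hexagon_stripsE //; apply: ge_ereal_sup => _ [n [v [pv vb ->]]]; rewrite lee_fin.
have vK i : hexagon_strips a b c (v i) by have /(boundary_compact cK)[] := vb i.
apply: (@le_trans _ _ (\sum_(i < n) (kap * (`|cross a (v (ordS i) - v i)| + `|cross b (v (ordS i) - v i)| + `|cross c (v (ordS i) - v i)|)))).
  by apply: ler_sum => i _; exact: M_norm_hexagon_le.
rewrite -mulr_sumr !big_split /=.
have wa := convex_polygon_variation (d := a) (lo := 0) (hi := p + q) pv (fun i => let: And3 h _ _ := vK i in h).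
have wb := convex_polygon_variation (d := b) (lo := - p) (hi := r) pv (fun i => let: And3 _ h _ := vK i in h).
have wc := convex_polygon_variation (d := c) (lo := - (q + r)) (hi := 0) pv (fun i => let: And3 _ _ h := vK i in h).
have -> : 4 * kap * (p + q + r) = kap * (4 * (p + q + r)) by ring.
by apply: ler_wpM2l => //; lra.
Qed.

End HexagonPerimeter.

(** * The extremal hexagon *)

Lemma tan_complementary (R : realType) (x y z : R) : cos x != 0 -> cos y != 0 -> cos z != 0 ->
  x + y + z = pi / 2 -> tan x * tan y + tan y * tan z + tan z * tan x = 1.
Proof.
move=> cx cy cz h; have := cos_pihalf R; rewrite -h !(cosD, sinD) /tan => e.
apply: (mulIf (mulf_neq0 (mulf_neq0 cx cy) cz)); rewrite mul1r.
transitivity (sin x * sin y * cos z + cos x * sin y * sin z + sin x * cos y * sin z); last by lra.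
by field; rewrite cx cy cz.
Qed.

Lemma sin_double_tan (R : realType) (x : R) : cos x != 0 ->
  (1 + tan x ^+ 2) * sin (2 * x) = 2 * tan x.
Proof.
move=> cx; have -> : 2 * x = x + x by ring.
have e : 1 + tan x ^+ 2 = (cos x ^+ 2 + sin x ^+ 2) / cos x ^+ 2 by rewrite /tan; field.
by rewrite e cos2Dsin2 sinD /tan; field.
Qed.

Lemma cross_polar (R : realType) (l m x y : R) :
  cross (l *: (cos x, sin x)) (m *: (cos y, sin y)) = l * m * sin (y - x).
Proof. by rewrite sinB /cross /= /GRing.scale /=; ring. Qed.

Lemma regular_hull_vertex (R : realType) (k : nat) (r theta : R) (j : nat) : (j < 2 * k)%N ->
  regular_hull k r theta (r *: (cos (theta + pi / k%:R * j%:R), sin (theta + pi / k%:R * j%:R))).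
Proof.
move=> jk; have k0 : (0 < k)%N by case: k jk => //; rewrite muln0.
have := convex_hull_sub (fun j : 'I_(2 * k) => (r * cos (theta + 2 * pi * j%:R / (2 * k)%:R),
     r * sin (theta + 2 * pi * j%:R / (2 * k)%:R))) (Ordinal jk).
rewrite /= -/(regular_hull k r theta) (_ : 2 * pi * j%:R / (2 * k)%:R = pi / k%:R * j%:R) //.
by rewrite natrM; move: (pi : R) => p; field; rewrite pnatr_eq0 -lt0n.
Qed.

(** The hexagon is homothetic to one circumscribed about a circle, with edges towards vertices of M
    and turning angles as equal as multiples of [s] allow. Its edges are thus proportional to sums
    of tangents of adjacent half-angles, the equality case of Minkowski's inequality. *)
Lemma hexagon_exists (R : realType) (k : nat) (r theta : R) (M := regular_hull k r theta) :
  (1 < k)%N -> 0 < r -> convex_set M -> o_symmetric M -> M 0 ->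
  exists a b c : R * R, [/\ 0 < cross a b, 0 < cross a c, 0 <= cross b c,
    cross a b + cross a c + cross b c = 1 &
    (perim M (convex_hull (hexagon_vertex a b c)) <= (2 / r * Num.sqrt (hexagon_area R k))%:E)%E].
Proof.
move=> k1 r0 cM sM M0; have k0 := ltnW k1; have pi0 := pi_gt0 R.
have kR : 0 < k%:R :> R by rewrite ltr0n.
pose j := (k %/ 3)%N; pose m := (k %% 3)%N.
have m3 : (m < 3)%N by rewrite ltn_mod.
have kE : k = (j * 3 + m)%N by exact: divn_eq.
(* The half turn is split into three numbers of steps differing by at most one. The smallest is
   [g2], so that only [cross b c] vanishes when [k = 2]. *)
pose g1 := (j + (0 < m))%N; pose g2 := j; pose g3 := (j + (1 < m))%N.
have [[gk g1p g3p g1k g2k] g3k] : [/\ g1 + g2 + g3 = k, 0 < g1, 0 < g3, g1 < k & g2 < k]%N /\ (g3 < k)%N.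
  rewrite /g1 /g2 /g3; move: m3 kE k1; clear; move: m j => [|[|[|//]]] j _ -> h; split; [split| |split| |split|]; lia.
pose s : R := pi / k%:R.
have s0 : 0 < s by rewrite divr_gt0.
have sk : s * k%:R = pi by rewrite divfK // gt_eqF.
pose x (g : nat) : R := s * g%:R / 2; pose t g := tan (x g).
have x0 i : 0 <= x i by rewrite /x divr_ge0 // (mulr_ge0 (ltW s0)).
have xpi i : (i < k)%N -> x i < pi / 2.
  by move=> gk'; rewrite /x ltr_pM2r ?invr_gt0 // -sk ltr_pM2l // ltr_nat.
have cx i : (i < k)%N -> 0 < cos (x i).
  by move=> gk'; apply: cos_gt0_itv; rewrite x0 /= xpi.
have sx i : (i < k)%N -> 0 <= sin (x i).
  by move=> gk'; apply: sin_ge0_pi; rewrite x0 /=; have := xpi i gk'; lra.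
have sx0 i : (0 < i)%N -> (i < k)%N -> 0 < sin (x i).
  move=> g0 gk'; apply: sin_gt0_pi; apply/andP; split; last by have := xpi i gk'; lra.
  by rewrite /x divr_gt0 // (mulr_gt0 s0) // ltr0n.
have t1 : 0 < t g1 by rewrite /t /tan divr_gt0 ?sx0 ?cx.
have t2 : 0 <= t g2 by rewrite /t /tan divr_ge0 ?sx // ltW // cx.
have t3 : 0 < t g3 by rewrite /t /tan divr_gt0 ?sx0 ?cx.
have gsum : g1%:R + g2%:R + g3%:R = k%:R :> R by rewrite -!natrD gk.
have compl : t g1 * t g2 + t g2 * t g3 + t g3 * t g1 = 1.
  apply: tan_complementary; rewrite ?gt_eqF ?cx //.
  by rewrite /x -!mulrDl -!mulrDr gsum sk.
have TE : hexagon_area R k = 2 * (t g1 + t g2 + t g3).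
  rewrite /hexagon_area -/m -/j /t /x /g1 /g2 /g3; move: m3.
  by case: (m) => [|[|[|//]]] _; rewrite ?addn0 ?addn1 -/s /=; ring.
pose c6 := Num.sqrt (hexagon_area R k).
have T0 : 0 < hexagon_area R k by rewrite TE; lra.
have c60 : 0 < c6 by rewrite sqrtr_gt0.
have c6E : c6 ^+ 2 = hexagon_area R k by rewrite sqr_sqrtr // ltW.
pose u (g : nat) : R * R := (cos (theta + s * g%:R), sin (theta + s * g%:R)).
(* By [compl], [(t g1 + t g2) * (t g1 + t g3) = 1 + t g1 ^ 2], and likewise for the others. Each
   cross product thus reduces to twice one tangent over [c6 ^ 2], and the factor [c6^-1] normalizes
   the area to 1. *)
pose a := (c6^-1 * (t g3 + t g1)) *: u 0%N.
pose b := (c6^-1 * (t g1 + t g2)) *: u g1.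
pose c := (c6^-1 * (t g2 + t g3)) *: u (g1 + g2)%N.
have sin2 : forall i, (i < k)%N -> (1 + t i ^+ 2) * sin (s * i%:R) = 2 * t i.
  move=> i gk'; have -> : s * i%:R = 2 * x i by rewrite /x; field.
  by apply: sin_double_tan; rewrite gt_eqF // cx.
have pE : cross a b = c6 ^- 2 * (2 * t g1).
  rewrite cross_polar (_ : theta + _ - _ = s * g1%:R); last by rewrite mulr0 addr0; ring.
  rewrite -sin2 // -exprVn -compl; ring.
have rE : cross b c = c6 ^- 2 * (2 * t g2).
  rewrite cross_polar (_ : theta + _ - _ = s * g2%:R); last by rewrite natrD; ring.
  rewrite -sin2 // -exprVn -compl; ring.
have qE : cross a c = c6 ^- 2 * (2 * t g3).
  rewrite cross_polar (_ : sin _ = sin (s * g3%:R)); last first.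
    rewrite (_ : theta + _ - _ = pi - s * g3%:R); first by rewrite sinB sinpi cospi mul0r sub0r mulN1r opprK.
    by rewrite -sk -gsum natrD mulr0 addr0; ring.
  rewrite -sin2 // -exprVn -compl; ring.
have v0 : 0 < c6 ^- 2 by rewrite invr_gt0 exprn_gt0.
have p0 : 0 < cross a b by rewrite pE (mulr_gt0 v0) // mulr_gt0.
have q0 : 0 < cross a c by rewrite qE (mulr_gt0 v0) // mulr_gt0.
have rr0 : 0 <= cross b c by rewrite rE (mulr_ge0 (ltW v0)) // mulr_ge0.
have sum1 : cross a b + cross a c + cross b c = 1.
  rewrite pE qE rE -!mulrDr; apply: (mulfI (lt0r_neq0 (exprn_gt0 2 c60))).
  by rewrite mulVKf ?gt_eqF ?exprn_gt0 // c6E TE mulr1; ring.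
have Mv : forall i, (i < k)%N -> M (r *: u i).
  by move=> i gk'; apply: regular_hull_vertex; rewrite mul2n -addnn; exact: ltn_addr.
have g12 : (g1 + g2 < k)%N by rewrite -gk -[X in (X < _)%N]addn0 ltn_add2l.
exists a, b, c; split=> //.
pose kap := c6 / (2 * r).
have vE (l : R) (i : nat) : l *: u i = (l / r) *: (r *: u i) by rewrite scalerA divfK ?gt_eqF.
have := @perim_hexagon_le R M a b c (r *: u 0%N) (r *: u g1) (r *: u (g1 + g2)%N)
  (c6^-1 * (t g3 + t g1) / r) (c6^-1 * (t g1 + t g2) / r) (c6^-1 * (t g2 + t g3) / r) kap p0 q0 rr0 cM sM M0
  (Mv _ k0) (Mv _ g1k) (Mv _ g12) (vE _ _) (vE _ _) (vE _ _).
rewrite sum1 mulr1 (_ : 4 * kap = 2 / r * c6); last by rewrite /kap; field; rewrite gt_eqF.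
apply; rewrite ?pE ?qE ?rE ?/kap; try (by field; rewrite !gt_eqF).
by rewrite divr_ge0 ?mulr_ge0 ?(ltW c60) // ltW.
Qed.

Lemma hexagon_area2 (R : realType) : Num.sqrt (hexagon_area R 2) = 2.
Proof.
rewrite /hexagon_area /= (_ : 2 %% 3 = 2)%N // (_ : 2 %/ 3 = 0)%N // mulr0 mul0r tan0 mulr0 add0r mulr1.
rewrite (_ : pi / 2 / 2 = pi / 4); last by move: (pi : R) => p; field.
by rewrite tan_piquarter mulr1 (_ : 2 * 2 = 2 ^+ 2) ?sqrtr_sqr ?ger0_norm // expr2.
Qed.

Lemma cell_bound (R : realType) (k : nat) : (2 <= k)%N -> k <> 4 -> k <> 5 -> k <> 7 ->
  exists2 sl : R, sl <= 0 &
  forall (r theta : R) (M := regular_hull k r theta) (C : set (R * R)) (s : seq (R * R)),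
  0 < r -> M° 0 -> compact C -> convex_set C -> C° !=set0 -> area C = 1%E ->
  uniq s -> (forall x, extreme C x <-> x \in s) ->
  ((2 / r * (Num.sqrt (hexagon_area R k) + sl * ((size s)%:R - 6)))%:E <= perim M C)%E.
Proof.
rewrite leq_eqVlt => /orP[/eqP <- _ _ _|k3 k4 k5 k7]; last exact: cell_perim.
exists 0 => // r theta M C s r0 M0 cpC cC C0 aC us es.
by rewrite mul0r addr0 hexagon_area2; exact: square_cell_perim us es.
Qed.

(** * Comparison of the mean perimeters *)

Lemma limf_eventually_cst (R : realType) (f : R -> \bar R) (c : \bar R) (x0 : R) :
  (forall x, x0 < x -> f x = c) -> limf_einf f (pinfty_nbhs R) = c.
Proof.
move=> H; rewrite limf_einfE; apply/eqP; rewrite eq_le; apply/andP; split.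
  apply: ge_ereal_sup => _ [V [m [_ mV]] <-]; apply: ereal_inf_lbound.
  exists (Num.max m x0 + 1); first by apply: mV; rewrite ltr_pwDr // le_max lexx.
  by apply: H; rewrite ltr_pwDr // le_max lexx orbT.
apply: (@le_trans _ _ (ereal_inf [set f x | x in [set x | x0 < x]])).
  by apply: le_ereal_inf_tmp => _ [x /= /H <- <-].
apply: ereal_sup_ubound; exists [set x | x0 < x] => //.
by exists x0; split=> //; exact: num_real.
Qed.

Lemma limf_esup_eventually_cst (R : realType) (f : R -> \bar R) (c : \bar R) (x0 : R) :
  (forall x, x0 < x -> f x = c) -> limf_esup f (pinfty_nbhs R) = c.
Proof.
move=> H; apply: oppe_inj; rewrite -limf_einfN.
by apply: limf_eventually_cst (x0) _ => x /H /= ->.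
Qed.

Theorem theorem3p2 (R : realType) (k : nat) (M : set (R * R)) :
  (2 <= k)%N ->
  convex_disk M -> o_symmetric M ->
  regular_polygon (2 * k) M ->
  k <> 4 -> k <> 5 -> k <> 7 ->
  honeycomb_property M.
Proof.
move=> k2 cdM sM [r [theta [r0 ME]]] k4 k5 k7.
have {ME} : M = regular_hull k r theta by [].
move=> ME; subst M; set M := regular_hull k r theta in cdM sM *.
have M0 := o_symmetric_interior cdM sM; have [_ cM _] := cdM.
have [sl sl0 cb] := cell_bound R k2 k4 k5 k7.
pose alpha := 2 / r * Num.sqrt (hexagon_area R k).
have bound (C : set (R * R)) : compact C -> convex_set C -> C° !=set0 -> area C = 1%E -> finite_set (extreme C) ->
    ((alpha + 2 / r * sl * ((size (enum_fset (fset_set (extreme C))))%:R - 6))%:E <= perim M C)%E.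
  move=> cpC cC C0 aC fC; rewrite -mulrA -mulrDr.
  by apply: cb => //; [exact: fset_uniq|exact: extreme_seq].
have [a [b [c [p0 q0 rr0 sum1 perimK]]]] := hexagon_exists k2 r0 cM sM (interior_subset M0).
set K := convex_hull _ in perimK; pose T := hexagon_cells a b c.
have ctT : convex_tiling T by exact: convex_tiling_hexagon.
have [r1 [r2 bT]] : exists r1 r2, bounded_cells T r1 r2 by exact: bounded_hexagon_cells.
have uT : unit_area_cells T by move=> C TC; rewrite (area_hexagon_cells p0 q0 rr0 TC) sum1.
have pT C : T C -> perim M C = perim M K by exact: perim_hexagon_cells.
(* The cell bound applied to a hexagon and [perimK] enclose the perimeter between reals, so the mean
   over finitely many equal terms can be computed in [R]. *)
have [e eE] : exists e, perim M K = e%:E.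
  have TK : T (translate (hexagon_lattice a b c 0 0) K) by exists 0, 0.
  have [tT cT] := ctT; have [_ cpT _ _] := tT; have [cpK K0] := cpT _ TK.
  have := bound _ cpK (cT _ TK) K0 (uT _ TK) (finite_extreme ctT bT TK).
  rewrite pT // => lo; exists (fine (perim M K)); rewrite fineK //.
  by apply: fin_real; rewrite (lt_le_trans (ltNyr _) lo) (le_lt_trans perimK (ltry _)).
have [kappa kappa0 kP] := area_disk R.
have mean x : r2 + r2 < x -> mean_perim M T x = perim M K.
  move=> rx; have [_ r20 _] := bT; have x0 : 0 <= x by lra.
  have fA := finite_cells_in ctT.1 bT x0.
  have N0 : 0 < (size (enum_fset (fset_set (cells_in T x))))%:R :> R.
    apply: lt_le_trans (card_cells_ge ctT bT uT kP rx).
    by rewrite mulr_gt0 // exprn_gt0 // subr_gt0.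
  rewrite /mean_perim (eq_fsbigr (fun=> e%:E)); last by move=> C /set_mem[TC _]; rewrite pT.
  by rewrite fsum_cst // inver gt_eqF // -EFinM mulfK ?gt_eqF // eE.
exists T, (perim M K); split=> //; first exact: hexagonal_hexagon_cells.
  split; first exact: limf_eventually_cst mean.
  exact: limf_esup_eventually_cst mean.
move=> T' ctT' [s1 [s2 [s10 s12 nT']]] uT'; apply: le_trans perimK _.
have bT' : bounded_cells T' s1 s2 by split=> //; exact: lt_trans s12.
apply: (lower_P1_ge ctT' bT' uT' (beta := 2 / r * sl)) => [|C TC].
  by rewrite pmulr_rle0 // divr_gt0.
have [tT' cT'] := ctT'; have [_ cpT' _ _] := tT'; have [cpC C0] := cpT' C TC.
by apply: bound => //; [exact: cT'|exact: uT'|exact: finite_extreme ctT' bT' TC].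
Qed.
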